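(* Suppose the function $L(z)=\sum_{m\ge1}a_m m^{-z}$, with real coefficients $a_m$, satisfies: (A) $L$ extends to an analytic function on $\mathbb C$; (B) $L$ satisfies a functional equation $\Lambda(z)=\Lambda(1-z)$, where $$\Lambda(z):=N^{z/2}\prod_{j=1}^{J}\Gamma_{\mathbb R}(z+\mu_j)\prod_{k=1}^{K}\Gamma_{\mathbb C}(z+\eta_k)\,L(z),$$ $\Gamma_{\mathbb R}(s)=\pi^{-s/2}\Gamma(s/2)$ and $\Gamma_{\mathbb C}(s)=2(2\pi)^{-s}\Gamma(s)$; (C) $L$ is polynomially bounded in $\operatorname{Im}z$ as $|z|\to\infty$: for $y$ sufficiently large, $|L(x+iy)|\le C|y|^a$ for some positive constants $C$ and $a$. Let $F(z)=\Lambda(1/2+z)$, let $\chi$ be the characteristic function of $\{|\operatorname{Re}z|<1\}$, let $$\mathcal H_0(z)=\frac{1}{\sqrt{2\pi|\phi_\lambda''(1)|}}\,\frac{2}{1-z^2},$$ and let $\delta>0$ be fixed and sufficiently small. Then, as $n\to\infty$ with $\lambda=\lambda(n)$, the Taylor polynomials of $F$ satisfy $$T_{2n-2}(F;\lambda z)=T_{2n-1}(F;\lambda z)=\begin{cases}F(\lambda z)\left[\chi(z)-\dfrac{e^{n\phi_\lambda(z)}}{\sqrt n}\bigl(\mathcal H_0(z)+\mathcal E(z)\bigr)\right], & z\in\mathbb C\setminus B_\delta,\\[3mm] F(\lambda z)\left[\dfrac12\operatorname{erfc}\bigl(i\sqrt n\,w(z)\bigr)-\dfrac{e^{n\phi_\lambda(z)}}{\sqrt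 n}\,\mathcal E(z)\right], & z\in B_\delta,\end{cases}$$ where the residual error function $\mathcal E$ (depending on $n$) is bounded, analytic in $\mathbb C\setminus\bigl((\partial\mathcal S_1\setminus B_\delta)\cup\partial B_\delta\bigr)$, and satisfies $$\mathcal E(z)=\begin{cases}\mathcal O(n^{-1}), & z\in\mathbb C\setminus B_\delta,\\ \mathcal H_0(z)+\dfrac{1}{2i\sqrt\pi\,w(z)}+\mathcal O(n^{-1}), & z\in B_\delta.\end{cases}$$
   Context: $T_m(F;z)$ denotes the degree-$m$ Taylor (Maclaurin) polynomial of $F$ at $0$, and $T_m(F;\lambda z)$ is its value at $\lambda z$. By the functional equation $F(-z)=F(z)$. Scaling: for all sufficiently large $n$, $\lambda=\lambda(n)$ is the unique $\lambda>1/2$ with $2-\frac{\lambda}{n}\frac{F'(\lambda)}{F(\lambda)}=0$. Phase: $\phi_\lambda(z)=2\log z+\frac1n\log\frac{F(\lambda)}{F(\lambda z)}$, so that $e^{n\phi_\lambda(z)}=\frac{z^{2n}F(\lambda)}{F(\lambda z)}$; the branch is chosen real on $(1,\infty)$ with $\phi_\lambda(z)=\phi_\lambda(-z)$, so $\phi_\lambda(\pm1)=0$, and the choice of $\lambda$ gives $\phi_\lambda'(\pm1)=0$. At zeros of $F(\lambda z)$ the product $F(\lambda z)e^{n\phi_\lambda(z)}$ is understood as $z^{2n}F(\lambda)$. $\mathcal S_1=\{z:|\operatorname{Re}z|<1\}$. Local map: near $z=1$, $w=w(z)$ is the conformal map defined by $w^2=\phi_\lambda(z)$ and $w(z)=-i\sqrt{-\phi_\lambda''(1)/2}\,(z-1)[1+\mathcal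 O(z-1)]$ (so that it maps $\partial\mathcal S_1$ locally to a nearly horizontal contour oriented left to right); near $z=-1$ it is defined by $w(z)=w(-z)$. For small $\delta>0$, $B_{\pm1,\delta}$ is the neighborhood of $\pm1$ mapped conformally by $w$ onto $\{|w|<\delta\}$, and $B_\delta=B_{1,\delta}\cup B_{-1,\delta}$. $\operatorname{erfc}(s)=\frac{2}{\sqrt\pi}\int_s^\infty e^{-t^2}\,dt$.
   Formalization: Λ is additionally assumed entire: (A)–(C) allow gamma factors with shifts of negative real part whose poles survive in Λ (e.g. a weight-3 form with η=−1), and then the Taylor asymptotics fail; (C) is assumed only on each vertical strip, which is more general. *)

(* Defs.v *)
From Stdlib Require Export Reals Arith.
From Coquelicot Require Export Coquelicot.
Local Open Scope R_scope.
Local Open Scope C_scope.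

Definition Cexp (z : C) : C :=
  (exp (Re z) * cos (Im z), exp (Re z) * sin (Im z))%R.

(* x ^ z for a positive real base x *)
Definition Rcpow (x : R) (z : C) : C := Cexp (z * ln x).

Definition holomorphic_on (U : C -> Prop) (f : C -> C) : Prop :=
  forall z : C, U z -> ex_derive f z.

Definition entire (f : C -> C) : Prop := holomorphic_on (fun _ => True) f.

Definition frontier (A : C -> Prop) (z : C) : Prop :=
  forall eps : R, (0 < eps)%R ->
    (exists u : C, A u /\ (Cmod (u - z) < eps)%R) /\
    (exists u : C, ~ A u /\ (Cmod (u - z) < eps)%R).

Fixpoint Cprod (f : nat -> C) (n : nat) : C :=
  match n with
  | O => 1
  | S k => Cprod f k * f k
  end.

(** Gamma function, by Gauss's limit
    n! n^z / (z (z+1) ... (z+n)), valid off the poles 0, -1, -2, ... *)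

Definition gauss_gamma (z : C) (n : nat) : C :=
  INR (fact n) * Rcpow (INR n) z / Cprod (fun k => z + INR k) (S n).

Definition Cgamma (z : C) : C :=
  (real (Lim_seq (fun n => Re (gauss_gamma z n))),
   real (Lim_seq (fun n => Im (gauss_gamma z n)))).

Definition gamma_pole (z : C) : Prop := exists k : nat, z = - INR k.

Definition GammaR (s : C) : C := Rcpow PI (- s / 2) * Cgamma (s / 2).

Definition GammaC (s : C) : C := 2 * Rcpow (2 * PI) (- s) * Cgamma s.

Definition dirichlet_series (a : nat -> R) (L : C -> C) : Prop :=
  exists sigma : R, forall z : C, (sigma < Re z)%R ->
    is_series (fun k : nat => a (S k) * Rcpow (INR (S k)) (- z)) (L z).

(* [Lam] is the entire function given by
   N^(z/2) prod_j GammaR (z + mu_j) prod_k GammaC (z + eta_k) L(z).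
   [Cgamma] has no meaning at its poles, so the formula is imposed at the
   other points only; by continuity this determines [Lam] everywhere. *)
Definition completed (N : R) (J K : nat) (mu eta : nat -> C)
    (L Lam : C -> C) : Prop :=
  entire Lam /\
  forall z : C,
    (forall j : nat, (j < J)%nat -> ~ gamma_pole ((z + mu j) / 2)) ->
    (forall k : nat, (k < K)%nat -> ~ gamma_pole (z + eta k)) ->
    Lam z = Rcpow N (z / 2) * Cprod (fun j => GammaR (z + mu j)) J
            * Cprod (fun k => GammaC (z + eta k)) K * L z.

(* The constants may depend on the strip: for a gamma factor of positive
   degree no single exponent works for all Re z, by the functional equation. *)
Definition polynomially_bounded (L : C -> C) : Prop :=
  forall x1 x2 : R, exists M a Y : R,
    (0 < M)%R /\ (0 < a)%R /\ (0 < Y)%R /\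
    forall x y : R, (x1 <= x <= x2)%R -> (Y <= y)%R ->
      (Cmod (L (x, y)) <= M * Rpower (Rabs y) a)%R.

Fixpoint C_derive_n (f : C -> C) (k : nat) : C -> C :=
  match k with
  | O => f
  | S j => C_derive (C_derive_n f j)
  end.

Definition taylor_poly (m : nat) (F : C -> C) (z : C) : C :=
  sum_n (G := C_AbelianMonoid)
    (fun k => C_derive_n F k 0 / INR (fact k) * z ^ k) m.

Definition scaling_eq (F : C -> C) (n : nat) (lam : R) : Prop :=
  2 - lam / INR n * (C_derive F lam / F lam) = 0.

Definition is_scaling (F : C -> C) (n : nat) (lam : R) : Prop :=
  ((1 / 2 < lam)%R /\ scaling_eq F n lam) /\
  forall lam' : R, (1 / 2 < lam')%R -> scaling_eq F n lam' -> lam' = lam.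

(* The part of the right half-plane lying to the right of all the zeros of
   s |-> F (lam s): an open half-plane (or empty), hence a domain for an
   analytic branch of log (F (lam) / F (lam z)). *)
Definition right_of_zeros (F : C -> C) (lam : R) (z : C) : Prop :=
  (0 < Re z)%R /\
  exists r : R, (r < Re z)%R /\
    forall s : C, (r < Re s)%R -> F (lam * s) <> 0.

(* phi = 2 log z + (1/n) log (F (lam) / F (lam z)).  The last two conditions
   select the branch of the logarithm; on [right_of_zeros] and its mirror
   image it is unique.  Elsewhere phi is any (possibly discontinuous) choice
   of logarithm: only exp (n phi) is used there. *)
Definition is_phase (F : C -> C) (n : nat) (lam : R) (phi : C -> C) : Prop :=
  holomorphic_on (right_of_zeros F lam) phi /\
  (forall z : C, z <> 0 -> F (lam * z) <> 0 ->
     Cexp (INR n * phi z) = z ^ (2 * n) * F lam / F (lam * z)) /\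
  (forall x : R, (1 < x)%R -> Im (phi x) = 0%R) /\
  (forall z : C, phi z = phi (- z)).

(* The product F (lam z) exp (n phi (z)), extended to the zeros of F (lam z)
   and to z = 0. *)
Definition F_exp_phase (F : C -> C) (n : nat) (lam : R) (z : C) : C :=
  z ^ (2 * n) * F lam.

Lemma F_exp_phaseE (F : C -> C) (n : nat) (lam : R) (phi : C -> C) (z : C) :
  is_phase F n lam phi -> z <> 0 -> F (lam * z) <> 0 ->
  F_exp_phase F n lam z = F (lam * z) * Cexp (INR n * phi z).
Proof.
intros (_ & h & _) hz hF; unfold F_exp_phase.
rewrite (h z hz hF); field; exact hF.
Qed.

Definition S1 (z : C) : Prop := (Rabs (Re z) < 1)%R.

Definition chi (z : C) : C := if Rlt_dec (Rabs (Re z)) 1 then 1 else 0.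

Definition phi2 (phi : C -> C) : C := C_derive (C_derive phi) 1.

(* w is the local map, with B the neighbourhood of 1 that it maps
   conformally onto |w| < delta.  The number phi''(1) is real. *)
Definition is_local_map (F : C -> C) (lam : R) (phi : C -> C) (delta : R)
    (w : C -> C) (B : C -> Prop) : Prop :=
  open B /\ B 1 /\ (forall z : C, B z -> right_of_zeros F lam z) /\
  holomorphic_on B w /\
  (forall z z' : C, B z -> B z' -> w z = w z' -> z = z') /\
  (forall u : C, (Cmod u < delta)%R <-> exists z : C, B z /\ w z = u) /\
  (forall z : C, B z -> w z ^ 2 = phi z) /\
  (exists M eps : R, (0 < eps)%R /\
     forall z : C, (Cmod (z - 1) < eps)%R ->
       exists r : C, (Cmod r <= M * Cmod (z - 1))%R /\
         w z = - Ci * sqrt (- Re (phi2 phi) / 2) * (z - 1) * (1 + r)) /\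
  (forall z : C, B (- z) -> w z = w (- z)).

Definition B_both (B : C -> Prop) (z : C) : Prop := B z \/ B (- z).

(* The integral from s to infinity is taken along the horizontal ray. *)
Definition Cerfc (s : C) : C :=
  2 / sqrt PI *
  RInt_gen (V := C_R_CompleteNormedModule)
    (fun t : R => Cexp (- (s + t) ^ 2)) (at_point 0) (Rbar_locally p_infty).

Definition H0 (phi : C -> C) (z : C) : C :=
  1 / sqrt (2 * PI * Cmod (phi2 phi)) * (2 / (1 - z ^ 2)).

(* Main.v *)
(** Applying Cauchy's formula to [F (lam s)] on a tall rectangle whose vertical sides pass close to 1 and -1 gives
[F (lam z) chi z - T (lam z) = z^(2n) F (lam) / (2 pi i)] times the boundary integral of [exp (-n phi (s)) / (s - z)].
By evenness the two vertical sides fold into one, with kernel [2 s / (s^2 - z^2)].  Stirling's formula for the gamma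
factors shows that [F' / F] varies slowly to the right of the zeros of [F]; with the scaling equation this makes [phi']
uniformly close to [2 / z - 2] near 1, so that 1 is a nondegenerate saddle point.  Away from it the integrand decays
exponentially, because [|F (s)|] is at most a constant times [|F (Re s)|] far to the right while [|s|^(2n)] grows along
verticals; the saddle contributes [H0 + O(1/n)] by Laplace's method.  In the disc around 1 the error term is analytic
across the line [Re z = 1].  On the boundary of a slightly larger square the outer estimate and the expansion of [erfc]
at infinity show that it differs by [O(1/n)] from the regular function [H0 + 1 / (2 i sqrt(pi) w)], and Cauchy's formula
carries this bound inside. *)
Require Import Defs.
From Stdlib Require Import Lra Lia Classical ClassicalEpsilon Wf_nat Ranalysis5.
Local Open Scope R_scope.

(** * Complex differentiation *)

(** The phase and the scaling change with [n], so the bounds need constants fixed before [n]: the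
    data at level [n] enter through [near_sigma], and the constants depend only on [delta] (or [c0])
    and on the growth constant [K0]. The error term is obtained by solving the two formulas for it,
    so the formulas hold by construction and the work lies in the bounds. No location of zeros is
    assumed: that [F] has none far to the right follows from the leading Dirichlet coefficient and
    the zero-free gamma function; that [F' / F] is real far out on the axis follows from the reality
    of the phase beyond 1; that [lam n] tends to infinity follows from the uniqueness of the
    scaling. Without gamma factors [F' / F] only tends to a constant; were it not positive, [F]
    would be bounded in a half-plane, hence constant, against the scaling equation. The vertical
    line runs along Re s = 1 - eta or 1 + eta, whichever keeps [z] at distance at least eta, even
    for Re z = 1. *)

Lemma Cmod_sub_sym (a b : C) : Cmod (a - b) = Cmod (b - a).
Proof. rewrite <- Cmod_opp. f_equal. ring. Qed.

Lemma Cmod_sub_triangle (a b c : C) : Cmod (a - c) <= Cmod (a - b) + Cmod (b - c).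
Proof. replace (a - c)%C with ((a - b) + (b - c))%C by ring. apply Cmod_triangle. Qed.

Lemma Cmod_sub_ge (a b : C) : Cmod a - Cmod b <= Cmod (a - b).
Proof.
  assert (h := Cmod_triangle (a - b) b).
  replace (a - b + b)%C with a in h by ring. lra.
Qed.

Lemma Cmod_sub_le (a b : C) : Cmod (a - b) <= Cmod a + Cmod b.
Proof. unfold Cminus. rewrite <- (Cmod_opp b). apply Cmod_triangle. Qed.

Lemma im_le_Cmod (c : C) : Rabs (Im c) <= Cmod c.
Proof. eapply Rle_trans; [apply Rmax_r | apply Rmax_Cmod]. Qed.

Lemma Cmod_le_re_im (z : C) : Cmod z <= Rabs (Re z) + Rabs (Im z).
Proof.
  unfold Cmod. rewrite <- (sqrt_Rsqr (Rabs (Re z) + Rabs (Im z))).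
  2: { generalize (Rabs_pos (Re z)) (Rabs_pos (Im z)); lra. }
  apply sqrt_le_1_alt. unfold Re, Im, Rsqr.
  generalize (Rabs_pos (fst z)) (Rabs_pos (snd z)).
  rewrite <- (pow2_abs (fst z)), <- (pow2_abs (snd z)). nra.
Qed.

Lemma C_eta (z : C) : z = (Re z, Im z).
Proof. now destruct z. Qed.

Lemma Re_plus (a b : C) : Re (a + b) = Re a + Re b. Proof. reflexivity. Qed.
Lemma Im_plus (a b : C) : Im (a + b) = Im a + Im b. Proof. reflexivity. Qed.
Lemma Re_opp (a : C) : Re (- a) = - Re a. Proof. reflexivity. Qed.
Lemma Im_opp (a : C) : Im (- a) = - Im a. Proof. reflexivity. Qed.
Lemma Re_minus (a b : C) : Re (a - b) = Re a - Re b. Proof. reflexivity. Qed.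
Lemma Im_minus (a b : C) : Im (a - b) = Im a - Im b. Proof. reflexivity. Qed.
Lemma Re_mult (a b : C) : Re (a * b) = Re a * Re b - Im a * Im b. Proof. reflexivity. Qed.
Lemma Im_mult (a b : C) : Im (a * b) = Re a * Im b + Im a * Re b. Proof. reflexivity. Qed.
Lemma Re_RtoC (x : R) : Re x = x. Proof. reflexivity. Qed.
Lemma Im_RtoC (x : R) : Im x = 0. Proof. reflexivity. Qed.
Lemma Re_pair (x y : R) : Re (x, y) = x. Proof. reflexivity. Qed.
Lemma Im_pair (x y : R) : Im (x, y) = y. Proof. reflexivity. Qed.
Lemma Re_Ci : Re Ci = 0. Proof. reflexivity. Qed.
Lemma Im_Ci : Im Ci = 1. Proof. reflexivity. Qed.

Ltac reim := repeat progress rewrite ?Re_plus, ?Im_plus, ?Re_opp, ?Im_opp, ?Re_minus, ?Im_minus,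
  ?Re_mult, ?Im_mult, ?Re_RtoC, ?Im_RtoC, ?Re_pair, ?Im_pair, ?Re_Ci, ?Im_Ci.
Lemma C_ext (a b : C) : Re a = Re b -> Im a = Im b -> a = b.
Proof. destruct a, b; unfold Re, Im; simpl; congruence. Qed.

Lemma Cmod_pos_neq (z : C) : 0 < Cmod z -> z <> 0%C.
Proof. apply Cmod_gt_0. Qed.

Lemma Csub_neq_0 (a b : C) : a <> b -> (a - b)%C <> 0%C.
Proof. intros h e. apply h. replace a with ((a - b) + b)%C by ring. rewrite e; ring. Qed.

Lemma RtoC_neq_0 (x : R) : x <> 0 -> RtoC x <> 0%C.
Proof. intros h e. apply h. now apply (f_equal Re) in e. Qed.

Lemma Cmod_RtoC_pos (x : R) : 0 <= x -> Cmod x = x.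
Proof. intros. rewrite Cmod_R. now apply Rabs_pos_eq. Qed.

(** The filter comes from the product uniform structure, whose balls are squares; the equivalence of
    norms turns it into discs for [Cmod]. *)
Lemma locally_C (z : C) (P : C -> Prop) :
  locally z P <-> exists d : R, 0 < d /\ forall s : C, Cmod (s - z) < d -> P s.
Proof.
  split.
  - intros h. apply (locally_norm_le_locally (K := C_AbsRing) (V := C_NormedModule)) in h.
    destruct h as [d h]. exists d. split; [apply cond_pos|]. intros s hs. apply h.
    red. exact hs.
  - intros (d & hd & h). apply (locally_le_locally_norm (K := C_AbsRing) (V := C_NormedModule)).
    exists (mkposreal d hd). intros s hs. apply h. exact hs.
Qed.

(** The same carrier also has the uniform structure of an absolute ring, and complex derivatives
    take their domain filter there. Both filters thus get the same description by discs. *)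
Lemma locally_C_AbsRing (z : C) (P : C -> Prop) :
  locally (T := AbsRing_UniformSpace C_AbsRing) z P <->
  exists d : R, 0 < d /\ forall s : C, Cmod (s - z) < d -> P s.
Proof.
  split.
  - intros [d h]. exists d. split; [apply cond_pos|]. intros s hs. apply h. exact hs.
  - intros (d & hd & h). exists (mkposreal d hd). intros s hs. apply h. exact hs.
Qed.

Lemma is_derive_C (f : C -> C) (z l : C) :
  is_derive f z l <->
  forall eps : R, 0 < eps -> exists d : R, 0 < d /\
    forall s : C, Cmod (s - z) < d ->
      Cmod (f s - f z - (s - z) * l) <= eps * Cmod (s - z).
Proof.
  split.
  - intros [_ h] eps heps.
    specialize (h z (fun P h => h) (mkposreal eps heps)). simpl in h.
    apply locally_C_AbsRing in h. destruct h as (d & hd & h). exists d; split; [exact hd|].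
    intros s hs. exact (h s hs).
  - intros h. split; [apply is_linear_scal_l|].
    intros x hx. apply (is_filter_lim_locally_unique (K := C_AbsRing) (V := AbsRing_NormedModule C_AbsRing)) in hx. subst x.
    intros eps. apply locally_C_AbsRing. destruct (h eps (cond_pos eps)) as (d & hd & h').
    exists d; split; [exact hd|]. exact h'.
Qed.

(** The codomain can be read as [C_NormedModule] or as the module of the ring [C] over itself. The
    rules for products and compositions are stated for the second reading, so they are imported
    through this equivalence. *)
Lemma is_derive_C_AbsRing (f : C -> C) (z l : C) :
  is_derive (V := AbsRing_NormedModule C_AbsRing) f z l <-> is_derive f z l.
Proof.
  split; intros [_ h].
  - split; [apply (is_linear_scal_l (K := C_AbsRing) (V := C_NormedModule))|]. exact h.
  - split; [apply (is_linear_scal_l (K := C_AbsRing) (V := AbsRing_NormedModule C_AbsRing))|]. exact h.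
Qed.

Lemma continuous_C (f : C -> C) (z : C) :
  continuous f z <->
  forall eps : R, 0 < eps -> exists d : R, 0 < d /\
    forall s : C, Cmod (s - z) < d -> Cmod (f s - f z) < eps.
Proof.
  split.
  - intros h eps heps.
    specialize (h (fun y => Cmod (y - f z) < eps)).
    apply locally_C in h; [exact h|].
    apply locally_C. exists eps. tauto.
  - intros h P hP. apply locally_C in hP. destruct hP as (e & he & hP).
    apply locally_C. destruct (h e he) as (d & hd & h'). exists d; split; [exact hd|].
    intros s hs. apply hP, h', hs.
Qed.

Lemma continuous_R_C (f : R -> C) (x : R) :
  continuous f x <->
  forall eps : R, 0 < eps -> exists d : R, 0 < d /\
    forall t : R, Rabs (t - x) < d -> Cmod (f t - f x) < eps.
Proof.
  split.
  - intros h eps heps.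
    specialize (h (fun y => Cmod (y - f x) < eps)).
    destruct h as [d h].
    { apply locally_C. exists eps. tauto. }
    exists d; split; [apply cond_pos|]. intros t ht. exact (h t ht).
  - intros h P hP. apply locally_C in hP. destruct hP as (e & he & hP).
    destruct (h e he) as (d & hd & h'). exists (mkposreal d hd).
    intros s hs. apply hP, h'. exact hs.
Qed.

Lemma continuous_R_C_pair (f : R -> C) (x : R) :
  continuous (fun t => Re (f t)) x -> continuous (fun t => Im (f t)) x -> continuous f x.
Proof.
  intros h1 h2. apply continuous_R_C. intros eps heps.
  assert (he : 0 < eps / 2) by lra.
  destruct (proj1 (filterlim_locally _ _) h1 (mkposreal _ he)) as [d1 k1].
  destruct (proj1 (filterlim_locally _ _) h2 (mkposreal _ he)) as [d2 k2].
  exists (Rmin d1 d2). split; [apply Rmin_pos; apply cond_pos|]. intros t ht.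
  assert (a1 : Rabs (Re (f t) - Re (f x)) < eps / 2).
  { apply k1. eapply Rlt_le_trans; [exact ht | apply Rmin_l]. }
  assert (a2 : Rabs (Im (f t) - Im (f x)) < eps / 2).
  { apply k2. eapply Rlt_le_trans; [exact ht | apply Rmin_r]. }
  eapply Rle_lt_trans; [apply Cmod_le_re_im|]. reim. lra.
Qed.

Lemma is_derive_continuous_C (f : C -> C) (z l : C) : is_derive f z l -> continuous f z.
Proof.
  intros h P hP.
  assert (h' := ex_derive_continuous (K := C_AbsRing) (V := C_NormedModule) f z (ex_intro _ l h) P hP).
  apply locally_C. now apply locally_C_AbsRing in h'.
Qed.

Lemma ex_derive_continuous_C (f : C -> C) (z : C) : ex_derive f z -> continuous f z.
Proof. intros [l h]. exact (is_derive_continuous_C _ _ _ h). Qed.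

Lemma is_derive_const_C (a z : C) : is_derive (fun _ : C => a) z (0 : C)%C.
Proof. apply (is_derive_const (K := C_AbsRing) (V := C_NormedModule)). Qed.

Lemma is_derive_id_C (z : C) : is_derive (fun s : C => s) z (1 : C)%C.
Proof. apply is_derive_C_AbsRing, (is_derive_id (K := C_AbsRing)). Qed.

Lemma is_derive_plus_C (f g : C -> C) (z df dg : C) :
  is_derive f z df -> is_derive g z dg -> is_derive (fun s => f s + g s)%C z (df + dg)%C.
Proof. apply (is_derive_plus (K := C_AbsRing) (V := C_NormedModule)). Qed.

Lemma is_derive_opp_C (f : C -> C) (z df : C) :
  is_derive f z df -> is_derive (fun s => - f s)%C z (- df)%C.
Proof. apply (is_derive_opp (K := C_AbsRing) (V := C_NormedModule)). Qed.

Lemma is_derive_minus_C (f g : C -> C) (z df dg : C) :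
  is_derive f z df -> is_derive g z dg -> is_derive (fun s => f s - g s)%C z (df - dg)%C.
Proof. apply (is_derive_minus (K := C_AbsRing) (V := C_NormedModule)). Qed.

Lemma is_derive_mult_C (f g : C -> C) (z df dg : C) :
  is_derive f z df -> is_derive g z dg ->
  is_derive (fun s => f s * g s)%C z (df * g z + f z * dg)%C.
Proof.
  intros h1 h2. apply is_derive_C_AbsRing in h1. apply is_derive_C_AbsRing in h2.
  apply is_derive_C_AbsRing.
  apply (is_derive_mult (K := C_AbsRing) f g z df dg h1 h2). exact Cmult_comm.
Qed.

Lemma is_derive_comp_C (f g : C -> C) (z df dg : C) :
  is_derive f (g z) df -> is_derive g z dg -> is_derive (fun s => f (g s)) z (dg * df)%C.
Proof.
  intros h1 h2. apply is_derive_C_AbsRing in h2.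
  exact (is_derive_comp (K := C_AbsRing) (V := C_NormedModule) f g z df dg h1 h2).
Qed.

Lemma is_derive_ext_val (f : C -> C) (z l l' : C) : is_derive f z l -> l = l' -> is_derive f z l'.
Proof. now intros h <-. Qed.

Lemma is_derive_locally_ext (f g : C -> C) (z l : C) (d : R) : 0 < d ->
  (forall s : C, Cmod (s - z) < d -> f s = g s) -> is_derive f z l -> is_derive g z l.
Proof.
  intros hd he. apply (is_derive_ext_loc (K := C_AbsRing) (V := C_NormedModule)).
  apply locally_C_AbsRing. now exists d.
Qed.

Lemma ex_derive_locally_ext (f g : C -> C) (z : C) (d : R) : 0 < d ->
  (forall s : C, Cmod (s - z) < d -> f s = g s) -> ex_derive f z -> ex_derive g z.
Proof. intros hd he [l h]. exists l. now apply (is_derive_locally_ext f g z l d). Qed.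

Lemma is_derive_Cinv (z : C) : z <> 0%C -> is_derive Cinv z (- / (z * z))%C.
Proof.
  intros hz. apply is_derive_C. intros eps heps.
  set (m := Cmod z). assert (hm : 0 < m) by (now apply Cmod_gt_0).
  exists (Rmin (m / 2) (eps * m ^ 3 / 2)).
  assert (hp : 0 < eps * m ^ 3 / 2).
  { apply Rmult_lt_0_compat; [|lra]. apply Rmult_lt_0_compat; [lra|]. now apply pow_lt. }
  split; [apply Rmin_pos; lra|].
  intros s hs.
  assert (h1 : Cmod (s - z) < m / 2) by (eapply Rlt_le_trans; [exact hs | apply Rmin_l]).
  assert (h2 : Cmod (s - z) < eps * m ^ 3 / 2) by (eapply Rlt_le_trans; [exact hs | apply Rmin_r]).
  assert (h3 : m / 2 < Cmod s).
  { assert (h := Cmod_sub_ge z s). rewrite Cmod_sub_sym in h. fold m in h. lra. }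
  assert (hs0 : s <> 0%C) by (apply Cmod_pos_neq; lra).
  replace (/ s - / z - (s - z) * - / (z * z))%C with ((s - z) * ((s - z) / (s * (z * z))))%C
    by (field; tauto).
  rewrite Cmod_mult, (Rmult_comm eps). apply Rmult_le_compat_l; [apply Cmod_ge_0|].
  rewrite Cmod_div. 2: { apply Cmult_neq_0; [exact hs0|]. now apply Cmult_neq_0. }
  rewrite !Cmod_mult. fold m.
  assert (hq : 0 < Cmod s * (m * m)) by (apply Rmult_lt_0_compat; [lra|nra]).
  apply Rmult_le_reg_r with (1 := hq). unfold Rdiv. rewrite Rmult_assoc, Rinv_l, Rmult_1_r by lra.
  assert (eps * (m / 2 * (m * m)) <= eps * (Cmod s * (m * m))).
  { apply Rmult_le_compat_l; [lra|]. apply Rmult_le_compat_r; nra. }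
  simpl in h2. lra.
Qed.

Lemma is_derive_inv_C (f : C -> C) (z df : C) : f z <> 0%C ->
  is_derive f z df -> is_derive (fun s => / f s)%C z (- df / (f z * f z))%C.
Proof.
  intros hz h.
  eapply is_derive_ext_val. { apply (is_derive_comp_C Cinv f); [now apply is_derive_Cinv | exact h]. }
  field. exact hz.
Qed.

Lemma is_derive_div_C (f g : C -> C) (z df dg : C) : g z <> 0%C ->
  is_derive f z df -> is_derive g z dg ->
  is_derive (fun s => f s / g s)%C z ((df * g z - f z * dg) / (g z * g z))%C.
Proof.
  intros hz h1 h2.
  eapply is_derive_ext_val. { exact (is_derive_mult_C f (fun s => / g s)%C _ _ _ h1 (is_derive_inv_C g z dg hz h2)). }
  cbv beta. field. exact hz.
Qed.

Lemma is_derive_pow_C (f : C -> C) (n : nat) (z df : C) :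
  is_derive f z df -> is_derive (fun s => f s ^ n)%C z (INR n * f z ^ (n - 1) * df)%C.
Proof.
  intros h. induction n as [|n IH].
  - eapply is_derive_ext_val; [exact (is_derive_const_C 1 z)|]. simpl. ring.
  - apply (is_derive_ext (K := C_AbsRing) (V := C_NormedModule) (fun s => f s * f s ^ n)%C).
    { intros t; now rewrite Cpow_S. }
    eapply is_derive_ext_val; [apply is_derive_mult_C; [exact h | exact IH]|].
    rewrite S_INR, RtoC_plus. destruct n as [|n].
    + simpl. ring.
    + replace (S (S n) - 1)%nat with (S n) by lia. replace (S n - 1)%nat with n by lia.
      rewrite Cpow_S. ring.
Qed.

Lemma ex_derive_const_C (a z : C) : ex_derive (fun _ : C => a) z.
Proof. eexists; apply is_derive_const_C. Qed.
Lemma ex_derive_id_C (z : C) : ex_derive (fun s : C => s) z.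
Proof. eexists; apply is_derive_id_C. Qed.
Lemma ex_derive_plus_C (f g : C -> C) (z : C) :
  ex_derive f z -> ex_derive g z -> ex_derive (fun s => f s + g s)%C z.
Proof. intros [a h] [b h']; eexists; apply is_derive_plus_C; eassumption. Qed.
Lemma ex_derive_minus_C (f g : C -> C) (z : C) :
  ex_derive f z -> ex_derive g z -> ex_derive (fun s => f s - g s)%C z.
Proof. intros [a h] [b h']; eexists; apply is_derive_minus_C; eassumption. Qed.
Lemma ex_derive_opp_C (f : C -> C) (z : C) : ex_derive f z -> ex_derive (fun s => - f s)%C z.
Proof. intros [a h]; eexists; apply is_derive_opp_C; eassumption. Qed.
Lemma ex_derive_mult_C (f g : C -> C) (z : C) :
  ex_derive f z -> ex_derive g z -> ex_derive (fun s => f s * g s)%C z.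
Proof. intros [a h] [b h']; eexists; apply is_derive_mult_C; eassumption. Qed.
Lemma ex_derive_div_C (f g : C -> C) (z : C) : g z <> 0%C ->
  ex_derive f z -> ex_derive g z -> ex_derive (fun s => f s / g s)%C z.
Proof. intros h0 [a h] [b h']; eexists; apply is_derive_div_C; eassumption. Qed.
Lemma ex_derive_pow_C (f : C -> C) (n : nat) (z : C) :
  ex_derive f z -> ex_derive (fun s => f s ^ n)%C z.
Proof. intros [a h]; eexists; apply is_derive_pow_C; eassumption. Qed.
Lemma ex_derive_comp_C (f g : C -> C) (z : C) :
  ex_derive f (g z) -> ex_derive g z -> ex_derive (fun s => f (g s)) z.
Proof. intros [a h] [b h']; eexists; apply is_derive_comp_C; eassumption. Qed.

Lemma C_derive_is (f : C -> C) (z : C) : ex_derive f z -> is_derive f z (C_derive f z).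
Proof. apply C_derive_correct. exact 0%C. Qed.

Lemma is_derive_R_C (g : R -> C) (x : R) (l : C) :
  is_derive (V := C_R_NormedModule) g x l <->
  forall eps : R, 0 < eps -> exists d : R, 0 < d /\
    forall t : R, Rabs (t - x) < d ->
      Cmod (g t - g x - RtoC (t - x) * l) <= eps * Rabs (t - x).
Proof.
  assert (hs : forall t : R, scal (V := C_R_NormedModule) t l = (RtoC t * l)%C).
  { intros t. destruct l as [a b]. apply C_ext; unfold scal; simpl; unfold prod_scal, scal; simpl;
    unfold mult; simpl; ring. }
  split.
  - intros [_ h] eps heps.
    specialize (h x (fun P h => h) (mkposreal eps heps)). simpl in h.
    destruct h as [d h]. exists d; split; [apply cond_pos|].
    intros t ht. specialize (h t ht). rewrite hs in h. rewrite (Cmod_norm (g t - g x - _)). exact h.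
  - intros h. split; [apply is_linear_scal_l|].
    intros y hy. apply (is_filter_lim_locally_unique (K := R_AbsRing) (V := AbsRing_NormedModule R_AbsRing)) in hy. subst y.
    intros eps. destruct (h eps (cond_pos eps)) as (d & hd & h').
    exists (mkposreal d hd). intros t ht. rewrite hs. specialize (h' t ht).
    rewrite (Cmod_norm (g t - g x - _)) in h'. exact h'.
Qed.

(** The chain rule between the two base fields: a complex derivative composed with a real path. It
    is what lets primitives be integrated along segments. *)
Lemma is_derive_path (f : C -> C) (g : R -> C) (x : R) (l dg : C) :
  is_derive f (g x) l -> is_derive (V := C_R_NormedModule) g x dg ->
  is_derive (V := C_R_NormedModule) (fun t => f (g t)) x (l * dg)%C.
Proof.
  intros hf hg. apply is_derive_R_C. intros eps heps.
  set (A := Cmod dg + 1). assert (hA : 1 <= A) by (unfold A; generalize (Cmod_ge_0 dg); lra).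
  set (e1 := eps / (2 * A)). assert (he1 : 0 < e1) by (apply Rdiv_lt_0_compat; lra).
  destruct (proj1 (is_derive_C _ _ _) hf e1 he1) as (d1 & hd1 & k1).
  set (B := Cmod l + 1). assert (hB : 1 <= B) by (unfold B; generalize (Cmod_ge_0 l); lra).
  set (e2 := Rmin 1 (eps / (2 * B))).
  assert (he2 : 0 < e2) by (apply Rmin_pos; [lra | apply Rdiv_lt_0_compat; lra]).
  destruct (proj1 (is_derive_R_C _ _ _) hg e2 he2) as (d2 & hd2 & k2).
  exists (Rmin d2 (d1 / A)). split; [apply Rmin_pos; [lra | apply Rdiv_lt_0_compat; lra]|].
  intros t ht.
  assert (ht2 : Rabs (t - x) < d2) by (eapply Rlt_le_trans; [exact ht | apply Rmin_l]).
  assert (ht1 : Rabs (t - x) < d1 / A) by (eapply Rlt_le_trans; [exact ht | apply Rmin_r]).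
  specialize (k2 t ht2).
  assert (hE2 : e2 <= 1) by apply Rmin_l.
  assert (hE2' : e2 <= eps / (2 * B)) by apply Rmin_r.
  assert (hp := Rabs_pos (t - x)).
  assert (hg1 : Cmod (g t - g x) <= A * Rabs (t - x)).
  { replace (g t - g x)%C with ((g t - g x - RtoC (t - x) * dg) + RtoC (t - x) * dg)%C by ring.
    eapply Rle_trans; [apply Cmod_triangle|]. rewrite Cmod_mult, Cmod_R. unfold A. nra. }
  assert (hg2 : Cmod (g t - g x) < d1).
  { eapply Rle_lt_trans; [exact hg1|]. apply Rmult_lt_compat_l with (r := A) in ht1; [|lra].
    replace (A * (d1 / A)) with d1 in ht1 by (field; lra). lra. }
  specialize (k1 (g t) hg2).
  replace (f (g t) - f (g x) - RtoC (t - x) * (l * dg))%C with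
    ((f (g t) - f (g x) - (g t - g x) * l) + (g t - g x - RtoC (t - x) * dg) * l)%C by ring.
  eapply Rle_trans; [apply Cmod_triangle|]. rewrite Cmod_mult.
  assert (a1 : e1 * Cmod (g t - g x) <= eps / 2 * Rabs (t - x)).
  { replace (eps / 2) with (e1 * A) by (unfold e1; field; lra). rewrite Rmult_assoc.
    apply Rmult_le_compat_l; lra. }
  assert (a2 : Cmod (g t - g x - RtoC (t - x) * dg) * Cmod l <= eps / 2 * Rabs (t - x)).
  { apply Rle_trans with (e2 * Rabs (t - x) * B).
    - apply Rmult_le_compat; [apply Cmod_ge_0 | apply Cmod_ge_0 | exact k2 | unfold B; lra].
    - apply Rle_trans with (eps / (2 * B) * Rabs (t - x) * B).
      + apply Rmult_le_compat_r; [lra|]. apply Rmult_le_compat_r; lra.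
      + right. field. lra. }
  lra.
Qed.

Lemma is_derive_R_C_pair (u v : R -> R) (x du dv : R) :
  is_derive u x du -> is_derive v x dv ->
  is_derive (V := C_R_NormedModule) (fun t => (u t, v t) : C) x (du, dv).
Proof.
  intros hu hv. apply is_derive_R_C. intros eps heps.
  assert (he : 0 < eps / 2) by lra.
  assert (k : forall w dw, is_derive w x dw -> exists d : R, 0 < d /\ forall t, Rabs (t - x) < d ->
    Rabs (w t - w x - (t - x) * dw) <= eps / 2 * Rabs (t - x)).
  { intros w dw [_ h]. specialize (h x (fun P h => h) (mkposreal _ he)). destruct h as [d h].
    exists d; split; [apply cond_pos|]. exact h. }
  destruct (k u du hu) as (d1 & hd1 & k1). destruct (k v dv hv) as (d2 & hd2 & k2).
  exists (Rmin d1 d2). split; [now apply Rmin_pos|]. intros t ht.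
  assert (b1 := k1 t (Rlt_le_trans _ _ _ ht (Rmin_l _ _))).
  assert (b2 := k2 t (Rlt_le_trans _ _ _ ht (Rmin_r _ _))).
  eapply Rle_trans; [apply Cmod_le_re_im|]. reim.
  rewrite !Rmult_0_l, Rminus_0_r, Rplus_0_r. lra.
Qed.

(** * The complex exponential *)

(** The lower bound is convexity. For the upper one, convexity at - x gives exp x (1 - x) <= 1, and
    (1 + x + 2 x^2) (1 - x) = 1 + x^2 (1 - 2 x) >= 1. *)
Lemma exp_le_quad (x : R) : Rabs x <= 1 / 2 -> Rabs (exp x - 1 - x) <= 2 * x ^ 2.
Proof.
  intros h. apply Rabs_le_between in h.
  assert (h1 := exp_ineq1_le x). assert (h2 := exp_ineq1_le (- x)).
  rewrite exp_Ropp in h2.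
  assert (hp := exp_pos x).
  assert (h3 : exp x * (1 + - x) <= 1).
  { apply Rmult_le_compat_l with (r := exp x) in h2; [|lra]. rewrite Rinv_r in h2; lra. }
  apply Rabs_le. split; [nra|].
  assert (exp x <= 1 + x + 2 * x ^ 2); [|lra].
  apply Rmult_le_reg_r with (1 + - x); [lra|]. nra.
Qed.

Lemma cos_sub_1_bound (y : R) : Rabs (cos y - 1) <= y ^ 2 / 2.
Proof.
  replace y with (2 * (y / 2)) at 1 by field. rewrite cos_2a_sin.
  assert (h : Rabs (sin (y / 2)) <= Rabs (y / 2)).
  { assert (k : forall u, 0 <= u -> Rabs (sin u) <= u).
    { intros u hu. destruct (Rle_lt_dec u 1) as [h|h].
      - assert (hpi := PI2_1). rewrite Rabs_pos_eq.
        + destruct hu as [hu|<-]; [left; now apply sin_lt_x | rewrite sin_0; lra].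
        + apply sin_ge_0; lra.
      - destruct (SIN_bound u). apply Rabs_le; lra. }
    destruct (Rle_lt_dec 0 (y / 2)) as [h|h].
    - rewrite (Rabs_pos_eq (y / 2)) by lra. now apply k.
    - rewrite <- Rabs_Ropp, <- sin_neg, (Rabs_left (y / 2)) by lra. apply k; lra. }
  replace (1 - 2 * sin (y / 2) * sin (y / 2) - 1) with (- (2 * (sin (y / 2)) ^ 2)) by ring.
  rewrite Rabs_Ropp, Rabs_pos_eq by nra.
  rewrite <- (pow2_abs (sin _)).
  assert (hh := Rabs_pos (sin (y / 2))).
  assert (h2 : Rabs (sin (y / 2)) ^ 2 <= Rabs (y / 2) ^ 2) by (apply pow_incr; lra).
  rewrite (pow2_abs (y / 2)) in h2. lra.
Qed.

Lemma sin_sub_bound (y : R) : Rabs (sin y - y) <= Rabs y * (y ^ 2 / 2).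
Proof.
  destruct (MVT_gen (fun t => sin t - t) 0 y (fun t => cos t - 1)) as (c & hc & he).
  - intros x _. auto_derive; [trivial|ring].
  - intros x _. apply continuity_pt_filterlim.
    apply (ex_derive_continuous (fun t => sin t - t)). auto_derive; trivial.
  - rewrite sin_0 in he. replace (sin y - y) with ((cos c - 1) * (y - 0)) by lra.
    rewrite Rabs_mult, Rminus_0_r, Rmult_comm. apply Rmult_le_compat_l; [apply Rabs_pos|].
    eapply Rle_trans; [apply cos_sub_1_bound|].
    assert (c ^ 2 <= y ^ 2); [|lra].
    destruct (Rle_lt_dec 0 y).
    + rewrite Rmin_left, Rmax_right in hc by lra. nra.
    + rewrite Rmin_right, Rmax_left in hc by lra. nra.
Qed.

Lemma Cexp_0 : Cexp 0 = 1%C.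
Proof. unfold Cexp. rewrite Re_RtoC, Im_RtoC, exp_0, cos_0, sin_0. apply C_ext; reim; ring. Qed.

Lemma Cexp_plus (a b : C) : Cexp (a + b) = (Cexp a * Cexp b)%C.
Proof.
  unfold Cexp. reim. rewrite exp_plus, cos_plus, sin_plus. apply C_ext; reim; ring.
Qed.

Lemma Cmod_Cexp (z : C) : Cmod (Cexp z) = exp (Re z).
Proof.
  unfold Cexp, Cmod. simpl fst. simpl snd.
  replace ((exp (Re z) * cos (Im z)) ^ 2 + (exp (Re z) * sin (Im z)) ^ 2) with (Rsqr (exp (Re z))).
  - apply sqrt_Rsqr. left; apply exp_pos.
  - assert (h := sin2_cos2 (Im z)). unfold Rsqr in *.
    replace (exp (Re z) * exp (Re z)) with
      (exp (Re z) * exp (Re z) * (sin (Im z) * sin (Im z) + cos (Im z) * cos (Im z))) by (rewrite h; ring).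
    ring.
Qed.

Lemma Cexp_neq_0 (z : C) : Cexp z <> 0%C.
Proof. apply Cmod_pos_neq. rewrite Cmod_Cexp. apply exp_pos. Qed.

Lemma Cexp_opp (z : C) : Cexp (- z) = (/ Cexp z)%C.
Proof.
  assert (h : (Cexp (- z) * Cexp z = 1)%C).
  { rewrite <- Cexp_plus, <- Cexp_0. f_equal. ring. }
  assert (h0 := Cexp_neq_0 z).
  replace (Cexp (- z)) with (Cexp (- z) * Cexp z / Cexp z)%C by (field; exact h0).
  rewrite h. field. exact h0.
Qed.

Lemma Cexp_minus (a b : C) : Cexp (a - b) = (Cexp a / Cexp b)%C.
Proof. unfold Cminus. now rewrite Cexp_plus, Cexp_opp. Qed.

Lemma Cexp_RtoC (x : R) : Cexp x = RtoC (exp x).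
Proof. unfold Cexp. rewrite Re_RtoC, Im_RtoC, cos_0, sin_0. apply C_ext; reim; ring. Qed.

Lemma Cexp_quad (h : C) : Cmod h <= 1 / 2 -> Cmod (Cexp h - 1 - h) <= 4 * Cmod h ^ 2.
Proof.
  intros hh. set (x := Re h). set (y := Im h).
  assert (hx : Rabs x <= 1 / 2) by (eapply Rle_trans; [apply re_le_Cmod | exact hh]).
  assert (hy : Rabs y <= 1 / 2) by (eapply Rle_trans; [apply im_le_Cmod | exact hh]).
  eapply Rle_trans; [apply Cmod_le_re_im|].
  rewrite Cmod2_alt. fold x y. unfold Cexp. reim. fold x y.
  clearbody x y.
  assert (e1 := exp_le_quad x hx). assert (c1 := cos_sub_1_bound y). assert (s1 := sin_sub_bound y).
  assert (hexp : exp x <= 2).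
  { apply Rabs_le_between in e1. apply Rabs_le_between in hx. nra. }
  assert (hp := exp_pos x).
  replace (exp x * cos y - 1 - x) with (exp x * (cos y - 1) + (exp x - 1 - x)) by ring.
  replace (exp x * sin y - 0 - y) with (exp x * (sin y - y) + ((exp x - 1 - x) + x) * y) by ring.
  assert (a1 : Rabs (exp x * (cos y - 1) + (exp x - 1 - x)) <= y ^ 2 + 2 * x ^ 2).
  { eapply Rle_trans; [apply Rabs_triang|]. rewrite Rabs_mult, (Rabs_pos_eq (exp x)) by lra.
    assert (hc := Rabs_pos (cos y - 1)). nra. }
  assert (a2 : Rabs (exp x * (sin y - y) + ((exp x - 1 - x) + x) * y) <= y ^ 2 + 2 * Rabs x * Rabs y).
  { eapply Rle_trans; [apply Rabs_triang|]. rewrite !Rabs_mult, (Rabs_pos_eq (exp x)) by lra.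
    assert (hs := Rabs_pos (sin y - y)). assert (hy0 := Rabs_pos y). assert (hx0 := Rabs_pos x).
    assert (b : Rabs (exp x - 1 - x + x) <= 2 * Rabs x).
    { eapply Rle_trans; [apply Rabs_triang|]. rewrite <- (pow2_abs x) in e1. nra. }
    assert (b2 : exp x * Rabs (sin y - y) <= y ^ 2).
    { apply Rle_trans with (2 * (Rabs y * (y ^ 2 / 2))); [nra|]. nra. }
    assert (b3 : Rabs (exp x - 1 - x + x) * Rabs y <= 2 * Rabs x * Rabs y)
      by (apply Rmult_le_compat_r; lra).
    lra. }
  assert (2 * Rabs x * Rabs y <= x ^ 2 + y ^ 2).
  { assert (hsq := pow2_ge_0 (Rabs x - Rabs y)). rewrite <- (pow2_abs x), <- (pow2_abs y). lra. }
  generalize (pow2_ge_0 x) (pow2_ge_0 y). lra.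
Qed.

Lemma is_derive_Cexp (z : C) : is_derive Cexp z (Cexp z).
Proof.
  apply is_derive_C. intros eps heps.
  set (A := 4 * exp (Re z)). assert (hA : 0 < A) by (unfold A; generalize (exp_pos (Re z)); lra).
  exists (Rmin (1 / 2) (eps / A)). split; [apply Rmin_pos; [lra | now apply Rdiv_lt_0_compat]|].
  intros s hs.
  assert (h1 : Cmod (s - z) <= 1 / 2) by (left; eapply Rlt_le_trans; [exact hs | apply Rmin_l]).
  assert (h2 : Cmod (s - z) < eps / A) by (eapply Rlt_le_trans; [exact hs | apply Rmin_r]).
  replace (Cexp s - Cexp z - (s - z) * Cexp z)%C with (Cexp z * (Cexp (s - z) - 1 - (s - z)))%C.
  2: { rewrite Cexp_minus. field. apply Cexp_neq_0. }
  rewrite Cmod_mult, Cmod_Cexp.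
  apply Rle_trans with (exp (Re z) * (4 * Cmod (s - z) ^ 2)).
  { apply Rmult_le_compat_l; [left; apply exp_pos | now apply Cexp_quad]. }
  replace (exp (Re z) * (4 * Cmod (s - z) ^ 2)) with (A * Cmod (s - z) * Cmod (s - z)) by (unfold A; ring).
  apply Rmult_le_compat_r; [apply Cmod_ge_0|].
  apply Rmult_lt_compat_l with (r := A) in h2; [|lra].
  replace (A * (eps / A)) with eps in h2 by (field; lra). lra.
Qed.

Lemma ex_derive_Cexp (z : C) : ex_derive Cexp z.
Proof. eexists; apply is_derive_Cexp. Qed.

(** * Integrals over rectangles *)

Notation CRInt := (RInt (V := C_R_CompleteNormedModule)).
Notation is_CRInt := (is_RInt (V := C_R_NormedModule)).
Notation ex_CRInt := (ex_RInt (V := C_R_NormedModule)).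

Lemma ex_RInt_C (f : R -> C) (a b : R) :
  (forall t, Rmin a b <= t <= Rmax a b -> continuous f t) ->
  ex_CRInt f a b.
Proof. intros h. apply (ex_RInt_continuous (V := C_R_CompleteNormedModule)). exact h. Qed.

Lemma CRInt_correct (f : R -> C) (a b : R) :
  ex_CRInt f a b ->
  is_CRInt f a b (CRInt f a b).
Proof. apply (RInt_correct (V := C_R_CompleteNormedModule)). Qed.

Lemma CRInt_unique (f : R -> C) (a b : R) (l : C) :
  is_CRInt f a b l -> CRInt f a b = l.
Proof. apply (is_RInt_unique (V := C_R_CompleteNormedModule)). Qed.

Lemma is_RInt_C_pair (f : R -> C) (a b : R) (l : C) :
  is_CRInt f a b l <->
  is_RInt (fun t => Re (f t)) a b (Re l) /\ is_RInt (fun t => Im (f t)) a b (Im l).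
Proof.
  split.
  - intros h. split.
    + exact (is_RInt_fct_extend_fst (U := R_NormedModule) (V := R_NormedModule) f a b l h).
    + exact (is_RInt_fct_extend_snd (U := R_NormedModule) (V := R_NormedModule) f a b l h).
  - intros [h1 h2]. rewrite (C_eta l).
    exact (is_RInt_fct_extend_pair (U := R_NormedModule) (V := R_NormedModule) f a b _ _ h1 h2).
Qed.

Lemma is_RInt_C_scal (c : C) (f : R -> C) (a b : R) (l : C) :
  is_CRInt f a b l ->
  is_CRInt (fun t => c * f t)%C a b (c * l)%C.
Proof.
  intros h. apply is_RInt_C_pair in h. destruct h as [h1 h2]. apply is_RInt_C_pair. split.
  - exact (is_RInt_minus _ _ _ _ _ _ (is_RInt_scal _ _ _ (Re c) _ h1) (is_RInt_scal _ _ _ (Im c) _ h2)).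
  - exact (is_RInt_plus _ _ _ _ _ _ (is_RInt_scal _ _ _ (Re c) _ h2) (is_RInt_scal _ _ _ (Im c) _ h1)).
Qed.

Lemma CRInt_scal (c : C) (f : R -> C) (a b : R) :
  ex_CRInt f a b ->
  CRInt (fun t => c * f t)%C a b = (c * CRInt f a b)%C.
Proof. intros h. apply CRInt_unique, is_RInt_C_scal, CRInt_correct, h. Qed.

Lemma ex_RInt_C_scal (c : C) (f : R -> C) (a b : R) :
  ex_CRInt f a b ->
  ex_CRInt (fun t => c * f t)%C a b.
Proof. intros [l h]. eexists. apply is_RInt_C_scal, h. Qed.

Lemma CRInt_plus (f g : R -> C) (a b : R) :
  ex_CRInt f a b -> ex_CRInt g a b ->
  CRInt (fun t => f t + g t)%C a b = (CRInt f a b + CRInt g a b)%C.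
Proof. apply (RInt_plus (V := C_R_CompleteNormedModule)). Qed.

Lemma CRInt_minus (f g : R -> C) (a b : R) :
  ex_CRInt f a b -> ex_CRInt g a b ->
  CRInt (fun t => f t - g t)%C a b = (CRInt f a b - CRInt g a b)%C.
Proof. apply (RInt_minus (V := C_R_CompleteNormedModule)). Qed.

Lemma CRInt_ext (f g : R -> C) (a b : R) :
  (forall t, Rmin a b < t < Rmax a b -> f t = g t) -> CRInt f a b = CRInt g a b.
Proof. apply (RInt_ext (V := C_R_CompleteNormedModule)). Qed.

Lemma CRInt_bound (f : R -> C) (g : R -> R) (a b : R) : a <= b ->
  ex_CRInt f a b -> ex_RInt g a b ->
  (forall t, a <= t <= b -> Cmod (f t) <= g t) ->
  Cmod (CRInt f a b) <= RInt g a b.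
Proof.
  intros hab hf hg h. rewrite Cmod_norm.
  apply (norm_RInt_le (V := C_R_NormedModule) f g a b (CRInt f a b) (RInt g a b)); trivial.
  - intros x hx. assert (k := h x hx). rewrite Cmod_norm in k. exact k.
  - now apply CRInt_correct.
  - apply (RInt_correct (V := R_CompleteNormedModule) g a b hg).
Qed.

Lemma CRInt_bound_const (f : R -> C) (M a b : R) : a <= b ->
  ex_CRInt f a b ->
  (forall t, a <= t <= b -> Cmod (f t) <= M) ->
  Cmod (CRInt f a b) <= M * (b - a).
Proof.
  intros hab hf h.
  replace (M * (b - a)) with (RInt (fun _ => M) a b).
  - apply CRInt_bound; trivial. apply ex_RInt_const.
  - rewrite RInt_const. apply Rmult_comm.
Qed.

Lemma is_RInt_C_derive (G f : R -> C) (a b : R) :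
  (forall t, Rmin a b <= t <= Rmax a b -> is_derive (V := C_R_NormedModule) G t (f t)) ->
  (forall t, Rmin a b <= t <= Rmax a b -> continuous f t) ->
  is_CRInt f a b (G b - G a)%C.
Proof. apply (is_RInt_derive (V := C_R_CompleteNormedModule)). Qed.

Definition IntH (f : C -> C) (y a b : R) : C := CRInt (fun x => f (x, y)) a b.
Definition IntV (f : C -> C) (x a b : R) : C := CRInt (fun y => f (x, y)) a b.

(* The integral over the boundary of the rectangle, counterclockwise. *)
Definition RectInt (f : C -> C) (x1 x2 y1 y2 : R) : C :=
  (IntH f y1 x1 x2 + Ci * IntV f x2 y1 y2 - IntH f y2 x1 x2 - Ci * IntV f x1 y1 y2)%C.

Definition in_rect (x1 x2 y1 y2 : R) (z : C) : Prop :=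
  x1 <= Re z <= x2 /\ y1 <= Im z <= y2.

Definition on_bd (x1 x2 y1 y2 : R) (z : C) : Prop :=
  in_rect x1 x2 y1 y2 z /\ (Re z = x1 \/ Re z = x2 \/ Im z = y1 \/ Im z = y2).

Lemma Cmod_pair_eq_y (a b y : R) : Cmod ((a, y) - (b, y)) = Rabs (a - b).
Proof.
  replace ((a, y) - (b, y))%C with (RtoC (a - b)); [apply Cmod_R|].
  apply C_ext; reim; ring.
Qed.

Lemma Cmod_pair_eq_x (a b x : R) : Cmod ((x, a) - (x, b)) = Rabs (a - b).
Proof.
  replace ((x, a) - (x, b))%C with (Ci * RtoC (a - b))%C.
  - rewrite Cmod_mult, Cmod_Ci, Cmod_R; ring.
  - apply C_ext; reim; ring.
Qed.

Lemma continuous_H (f : C -> C) (x y : R) :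
  continuous f (x, y) -> continuous (fun t => f (t, y)) x.
Proof.
  intros h. apply continuous_R_C. intros eps heps.
  destruct (proj1 (continuous_C _ _) h eps heps) as (d & hd & k).
  exists d; split; [exact hd|]. intros t ht. apply k. now rewrite Cmod_pair_eq_y.
Qed.

Lemma continuous_V (f : C -> C) (x y : R) :
  continuous f (x, y) -> continuous (fun t => f (x, t)) y.
Proof.
  intros h. apply continuous_R_C. intros eps heps.
  destruct (proj1 (continuous_C _ _) h eps heps) as (d & hd & k).
  exists d; split; [exact hd|]. intros t ht. apply k. now rewrite Cmod_pair_eq_x.
Qed.

Lemma ex_IntH (f : C -> C) (y a b : R) :
  (forall x, Rmin a b <= x <= Rmax a b -> continuous f (x, y)) ->
  ex_CRInt (fun x => f (x, y)) a b.
Proof. intros h. apply ex_RInt_C. intros t ht. apply continuous_H, h, ht. Qed.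

Lemma ex_IntV (f : C -> C) (x a b : R) :
  (forall y, Rmin a b <= y <= Rmax a b -> continuous f (x, y)) ->
  ex_CRInt (fun y => f (x, y)) a b.
Proof. intros h. apply ex_RInt_C. intros t ht. apply continuous_V, h, ht. Qed.

Lemma IntH_Chasles (f : C -> C) (y a m b : R) : a <= m <= b ->
  (forall x, a <= x <= b -> continuous f (x, y)) ->
  IntH f y a b = (IntH f y a m + IntH f y m b)%C.
Proof.
  intros hm h. symmetry. apply (RInt_Chasles (V := C_R_CompleteNormedModule)); apply ex_IntH;
  intros x hx; apply h; rewrite Rmin_left, Rmax_right in hx by lra; lra.
Qed.

Lemma IntV_Chasles (f : C -> C) (x a m b : R) : a <= m <= b ->
  (forall y, a <= y <= b -> continuous f (x, y)) ->
  IntV f x a b = (IntV f x a m + IntV f x m b)%C.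
Proof.
  intros hm h. symmetry. apply (RInt_Chasles (V := C_R_CompleteNormedModule)); apply ex_IntV;
  intros y hy; apply h; rewrite Rmin_left, Rmax_right in hy by lra; lra.
Qed.

Lemma IntH_bound (f : C -> C) (y a b M : R) : a <= b ->
  (forall x, a <= x <= b -> continuous f (x, y)) ->
  (forall x, a <= x <= b -> Cmod (f (x, y)) <= M) -> Cmod (IntH f y a b) <= M * (b - a).
Proof.
  intros hab hc hM. apply CRInt_bound_const; trivial.
  apply ex_IntH. intros x; rewrite Rmin_left, Rmax_right by lra; apply hc.
Qed.

Lemma IntV_bound (f : C -> C) (x a b M : R) : a <= b ->
  (forall y, a <= y <= b -> continuous f (x, y)) ->
  (forall y, a <= y <= b -> Cmod (f (x, y)) <= M) -> Cmod (IntV f x a b) <= M * (b - a).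
Proof.
  intros hab hc hM. apply CRInt_bound_const; trivial.
  apply ex_IntV. intros y; rewrite Rmin_left, Rmax_right by lra; apply hc.
Qed.

Lemma RectInt_split_x (f : C -> C) (x1 xm x2 y1 y2 : R) : x1 <= xm <= x2 ->
  (forall x, x1 <= x <= x2 -> continuous f (x, y1)) ->
  (forall x, x1 <= x <= x2 -> continuous f (x, y2)) ->
  RectInt f x1 x2 y1 y2 = (RectInt f x1 xm y1 y2 + RectInt f xm x2 y1 y2)%C.
Proof.
  intros h h1 h2. unfold RectInt.
  rewrite (IntH_Chasles f y1 x1 xm x2), (IntH_Chasles f y2 x1 xm x2) by trivial. ring.
Qed.

Lemma RectInt_split_y (f : C -> C) (x1 x2 y1 ym y2 : R) : y1 <= ym <= y2 ->
  (forall y, y1 <= y <= y2 -> continuous f (x1, y)) ->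
  (forall y, y1 <= y <= y2 -> continuous f (x2, y)) ->
  RectInt f x1 x2 y1 y2 = (RectInt f x1 x2 y1 ym + RectInt f x1 x2 ym y2)%C.
Proof.
  intros h h1 h2. unfold RectInt.
  rewrite (IntV_Chasles f x1 y1 ym y2), (IntV_Chasles f x2 y1 ym y2) by trivial. ring.
Qed.

Section RectIntBoundary.
Variables (x1 x2 y1 y2 : R).
Hypothesis (hx : x1 <= x2) (hy : y1 <= y2).

Lemma bd_b (x : R) : x1 <= x <= x2 -> on_bd x1 x2 y1 y2 (x, y1).
Proof. intros h. split; [split; simpl; lra | simpl; tauto]. Qed.
Lemma bd_t (x : R) : x1 <= x <= x2 -> on_bd x1 x2 y1 y2 (x, y2).
Proof. intros h. split; [split; simpl; lra | simpl; tauto]. Qed.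
Lemma bd_l (y : R) : y1 <= y <= y2 -> on_bd x1 x2 y1 y2 (x1, y).
Proof. intros h. split; [split; simpl; lra | simpl; tauto]. Qed.
Lemma bd_r (y : R) : y1 <= y <= y2 -> on_bd x1 x2 y1 y2 (x2, y).
Proof. intros h. split; [split; simpl; lra | simpl; tauto]. Qed.

Lemma ex_bd (f : C -> C) :
  (forall z, on_bd x1 x2 y1 y2 z -> continuous f z) ->
  ex_CRInt (fun x => f (x, y1)) x1 x2 /\
  ex_CRInt (fun x => f (x, y2)) x1 x2 /\
  ex_CRInt (fun y => f (x1, y)) y1 y2 /\
  ex_CRInt (fun y => f (x2, y)) y1 y2.
Proof.
  intros h. split; [|split; [|split]].
  - apply ex_IntH. intros t; rewrite Rmin_left, Rmax_right by lra. intros ht; apply h, bd_b, ht.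
  - apply ex_IntH. intros t; rewrite Rmin_left, Rmax_right by lra. intros ht; apply h, bd_t, ht.
  - apply ex_IntV. intros t; rewrite Rmin_left, Rmax_right by lra. intros ht; apply h, bd_l, ht.
  - apply ex_IntV. intros t; rewrite Rmin_left, Rmax_right by lra. intros ht; apply h, bd_r, ht.
Qed.

Lemma RectInt_ext (f g : C -> C) :
  (forall z, on_bd x1 x2 y1 y2 z -> f z = g z) -> RectInt f x1 x2 y1 y2 = RectInt g x1 x2 y1 y2.
Proof.
  intros h. unfold RectInt, IntH, IntV.
  rewrite (CRInt_ext (fun x => f (x, y1)) (fun x => g (x, y1))),
    (CRInt_ext (fun x => f (x, y2)) (fun x => g (x, y2))),
    (CRInt_ext (fun y => f (x1, y)) (fun y => g (x1, y))),
    (CRInt_ext (fun y => f (x2, y)) (fun y => g (x2, y))); trivial;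
  intros t; rewrite Rmin_left, Rmax_right by lra; intros ht; apply h;
  first [apply bd_b; lra | apply bd_t; lra | apply bd_l; lra | apply bd_r; lra].
Qed.

Lemma RectInt_plus (f g : C -> C) :
  (forall z, on_bd x1 x2 y1 y2 z -> continuous f z) ->
  (forall z, on_bd x1 x2 y1 y2 z -> continuous g z) ->
  RectInt (fun z => f z + g z)%C x1 x2 y1 y2 = (RectInt f x1 x2 y1 y2 + RectInt g x1 x2 y1 y2)%C.
Proof.
  intros h k. destruct (ex_bd f h) as (a & b & c & d). destruct (ex_bd g k) as (a' & b' & c' & d').
  unfold RectInt, IntH, IntV. rewrite !CRInt_plus by trivial. ring.
Qed.

Lemma RectInt_minus (f g : C -> C) :
  (forall z, on_bd x1 x2 y1 y2 z -> continuous f z) ->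
  (forall z, on_bd x1 x2 y1 y2 z -> continuous g z) ->
  RectInt (fun z => f z - g z)%C x1 x2 y1 y2 = (RectInt f x1 x2 y1 y2 - RectInt g x1 x2 y1 y2)%C.
Proof.
  intros h k. destruct (ex_bd f h) as (a & b & c & d). destruct (ex_bd g k) as (a' & b' & c' & d').
  unfold RectInt, IntH, IntV. rewrite !CRInt_minus by trivial. ring.
Qed.

Lemma RectInt_scal (k : C) (f : C -> C) :
  (forall z, on_bd x1 x2 y1 y2 z -> continuous f z) ->
  RectInt (fun z => k * f z)%C x1 x2 y1 y2 = (k * RectInt f x1 x2 y1 y2)%C.
Proof.
  intros h. destruct (ex_bd f h) as (a & b & c & d).
  unfold RectInt, IntH, IntV. rewrite !CRInt_scal by trivial. ring.
Qed.

Lemma RectInt_bound (f : C -> C) (M : R) :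
  (forall z, on_bd x1 x2 y1 y2 z -> continuous f z) ->
  (forall z, on_bd x1 x2 y1 y2 z -> Cmod (f z) <= M) ->
  Cmod (RectInt f x1 x2 y1 y2) <= 2 * M * ((x2 - x1) + (y2 - y1)).
Proof.
  intros hc hM. unfold RectInt.
  assert (b1 : Cmod (IntH f y1 x1 x2) <= M * (x2 - x1))
    by (apply IntH_bound; auto using bd_b).
  assert (b2 : Cmod (IntH f y2 x1 x2) <= M * (x2 - x1))
    by (apply IntH_bound; auto using bd_t).
  assert (b3 : Cmod (IntV f x1 y1 y2) <= M * (y2 - y1))
    by (apply IntV_bound; auto using bd_l).
  assert (b4 : Cmod (IntV f x2 y1 y2) <= M * (y2 - y1))
    by (apply IntV_bound; auto using bd_r).
  eapply Rle_trans; [apply Cmod_sub_le|].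
  eapply Rle_trans; [apply Rplus_le_compat_r, Cmod_sub_le|].
  eapply Rle_trans; [apply Rplus_le_compat_r, Rplus_le_compat_r, Cmod_triangle|].
  rewrite !Cmod_mult, Cmod_Ci. lra.
Qed.

Lemma RectInt_primitive (f G : C -> C) :
  (forall z, on_bd x1 x2 y1 y2 z -> continuous f z) ->
  (forall z, on_bd x1 x2 y1 y2 z -> is_derive G z (f z)) ->
  RectInt f x1 x2 y1 y2 = 0%C.
Proof.
  intros hc hd.
  assert (pH : forall x y, is_derive (V := C_R_NormedModule) (fun t => (t, y) : C) x (1, 0)).
  { intros x y. apply is_derive_R_C_pair; auto_derive; trivial. }
  assert (pV : forall x y, is_derive (V := C_R_NormedModule) (fun t => (x, t) : C) y (0, 1)).
  { intros x y. apply is_derive_R_C_pair; auto_derive; trivial. }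
  assert (H : forall y, (forall x, x1 <= x <= x2 -> on_bd x1 x2 y1 y2 (x, y)) ->
    IntH f y x1 x2 = (G (x2, y) - G (x1, y))%C).
  { intros y hb. apply CRInt_unique.
    apply (is_RInt_C_derive (fun t => G (t, y)) (fun t => f (t, y))); rewrite Rmin_left, Rmax_right by lra.
    - intros t ht. replace (f (t, y)) with (f (t, y) * (1, 0))%C by (apply C_ext; reim; ring).
      apply (is_derive_path G (fun t => (t, y))); [apply hd, hb, ht | apply pH].
    - intros t ht. apply continuous_H; auto. }
  assert (V : forall x, (forall y, y1 <= y <= y2 -> on_bd x1 x2 y1 y2 (x, y)) ->
    (Ci * IntV f x y1 y2 = G (x, y2) - G (x, y1))%C).
  { intros x hb. unfold IntV. rewrite <- CRInt_scal.
    2: { apply ex_IntV. intros y; rewrite Rmin_left, Rmax_right by lra; auto. }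
    apply CRInt_unique.
    apply (is_RInt_C_derive (fun t => G (x, t)) (fun t => Ci * f (x, t))%C); rewrite Rmin_left, Rmax_right by lra.
    - intros t ht. rewrite Cmult_comm. apply (is_derive_path G (fun t => (x, t))); [apply hd, hb, ht | apply pV].
    - intros t ht. apply (continuous_V (fun z => Ci * f z)%C). apply continuous_C. intros e he.
      destruct (proj1 (continuous_C _ _) (hc _ (hb _ ht)) e he) as (d & hd' & k).
      exists d; split; [exact hd'|]. intros s hs. specialize (k s hs).
      replace (Ci * f s - Ci * f (x, t))%C with (Ci * (f s - f (x, t)))%C by ring.
      rewrite Cmod_mult, Cmod_Ci. lra. }
  unfold RectInt. rewrite !H, !V by auto using bd_b, bd_t, bd_l, bd_r. ring.
Qed.
End RectIntBoundary.

(** * Goursat's theorem *)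

Definition hol_rect (f : C -> C) (x1 x2 y1 y2 : R) : Prop :=
  forall z, in_rect x1 x2 y1 y2 z -> ex_derive f z.

Lemma hol_rect_cont (f : C -> C) (x1 x2 y1 y2 : R) : hol_rect f x1 x2 y1 y2 ->
  forall x y, x1 <= x <= x2 -> y1 <= y <= y2 -> continuous f (x, y).
Proof. intros h x y hx hy. apply ex_derive_continuous_C, h. split; assumption. Qed.

Section Goursat.
Variables (f : C -> C) (x0 y0 w h : R).
Hypothesis (hw : 0 <= w) (hh : 0 <= h).
Hypothesis hol : hol_rect f x0 (x0 + w) y0 (y0 + h).

(* Goursat's bisection: among the four quarters one carries at least a quarter of the integral. *)
Let Q (k : nat) (p : R * R) : C :=
  RectInt f (fst p) (fst p + w / 2 ^ k) (snd p) (snd p + h / 2 ^ k).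

Let next (k : nat) (p : R * R) : R * R :=
  let a := w / 2 ^ S k in let b := h / 2 ^ S k in
  let big q := Rle_dec (Cmod (Q k p) / 4) (Cmod (Q (S k) q)) in
  if big p then p
  else if big (fst p + a, snd p) then (fst p + a, snd p)
  else if big (fst p, snd p + b) then (fst p, snd p + b)
  else (fst p + a, snd p + b).

Fixpoint goursat_corner (k : nat) : R * R :=
  match k with O => (x0, y0) | S j => next j (goursat_corner j) end.

Let half (k : nat) (v : R) : v / 2 ^ k = v / 2 ^ S k + v / 2 ^ S k.
Proof. simpl. field. apply pow_nonzero. lra. Qed.

Let half_pos (k : nat) (v : R) : 0 <= v -> 0 <= v / 2 ^ k.
Proof. intros hv. apply Rdiv_le_0_compat; [exact hv|]. apply pow_lt; lra. Qed.

Lemma goursat_next_choice (k : nat) (p : R * R) :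
  (fst (next k p) = fst p \/ fst (next k p) = fst p + w / 2 ^ S k) /\
  (snd (next k p) = snd p \/ snd (next k p) = snd p + h / 2 ^ S k).
Proof.
  unfold next. cbv zeta.
  destruct (Rle_dec _ _); [simpl; tauto|]. destruct (Rle_dec _ _); [simpl; tauto|].
  destruct (Rle_dec _ _); simpl; tauto.
Qed.

Lemma goursat_in (k : nat) :
  x0 <= fst (goursat_corner k) /\ fst (goursat_corner k) + w / 2 ^ k <= x0 + w /\
  y0 <= snd (goursat_corner k) /\ snd (goursat_corner k) + h / 2 ^ k <= y0 + h.
Proof.
  induction k as [|k IH].
  - simpl. lra.
  - simpl goursat_corner. destruct (goursat_next_choice k (goursat_corner k)) as [[-> | ->] [-> | ->]];
    rewrite (half k w), (half k h) in IH;
    generalize (half_pos (S k) w hw) (half_pos (S k) h hh); lra.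
Qed.

Lemma goursat_big (k : nat) :
  Cmod (Q k (goursat_corner k)) / 4 <= Cmod (Q (S k) (goursat_corner (S k))).
Proof.
  destruct (goursat_in k) as (i1 & i2 & i3 & i4).
  simpl goursat_corner. set (p := goursat_corner k) in *.
  set (a := w / 2 ^ S k). set (b := h / 2 ^ S k).
  assert (ha : 0 <= a) by now apply half_pos. assert (hb : 0 <= b) by now apply half_pos.
  assert (ew : w / 2 ^ k = a + a) by apply half. assert (eh : h / 2 ^ k = b + b) by apply half.
  assert (e : Q k p = (Q (S k) p + Q (S k) ((fst p + a)%R, snd p) + Q (S k) (fst p, (snd p + b)%R)
    + Q (S k) ((fst p + a)%R, (snd p + b)%R))%C).
  { unfold Q. simpl fst. simpl snd. rewrite ew, eh. fold a b. rewrite ew in i2. rewrite eh in i4.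
    assert (hc : forall x y, fst p <= x <= fst p + (a + a) -> snd p <= y <= snd p + (b + b) ->
      continuous f (x, y)).
    { intros x y hx hy. apply (hol_rect_cont _ _ _ _ _ hol); lra. }
    rewrite (RectInt_split_x f (fst p) (fst p + a) (fst p + (a + a)));
      try (intros; try apply hc; lra).
    rewrite (RectInt_split_y f (fst p) (fst p + a) (snd p) (snd p + b) (snd p + (b + b)));
      try (intros; try apply hc; lra).
    rewrite (RectInt_split_y f (fst p + a) (fst p + (a + a)) (snd p) (snd p + b) (snd p + (b + b)));
      try (intros; try apply hc; lra).
    replace (fst p + (a + a)) with (fst p + a + a) by ring.
    replace (snd p + (b + b)) with (snd p + b + b) by ring. ring. }
  unfold next. fold a b.
  repeat destruct (Rle_dec _ _); try assumption.
  apply Rnot_le_lt in n, n0, n1.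
  assert (t : Cmod (Q k p) <= Cmod (Q (S k) p) + Cmod (Q (S k) (fst p + a, snd p))
    + Cmod (Q (S k) (fst p, snd p + b)) + Cmod (Q (S k) (fst p + a, snd p + b))).
  { rewrite e at 1. eapply Rle_trans; [apply Cmod_triangle|]. apply Rplus_le_compat_r.
    eapply Rle_trans; [apply Cmod_triangle|]. apply Rplus_le_compat_r. apply Cmod_triangle. }
  lra.
Qed.

Lemma goursat_big0 (k : nat) :
  Cmod (RectInt f x0 (x0 + w) y0 (y0 + h)) / 4 ^ k <= Cmod (Q k (goursat_corner k)).
Proof.
  induction k as [|k IH].
  - unfold Q. simpl. rewrite !Rdiv_1_r. lra.
  - assert (b := goursat_big k).
    replace (Cmod (RectInt f x0 (x0 + w) y0 (y0 + h)) / 4 ^ S k) with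
      (Cmod (RectInt f x0 (x0 + w) y0 (y0 + h)) / 4 ^ k / 4).
    + lra.
    + simpl. field. apply pow_nonzero; lra.
Qed.

Lemma goursat_mono (j k : nat) : (j <= k)%nat ->
  fst (goursat_corner j) <= fst (goursat_corner k) /\
  fst (goursat_corner k) + w / 2 ^ k <= fst (goursat_corner j) + w / 2 ^ j /\
  snd (goursat_corner j) <= snd (goursat_corner k) /\
  snd (goursat_corner k) + h / 2 ^ k <= snd (goursat_corner j) + h / 2 ^ j.
Proof.
  induction 1 as [|k hk IH]; [lra|].
  simpl goursat_corner. destruct (goursat_next_choice k (goursat_corner k)) as [[-> | ->] [-> | ->]];
  rewrite (half k w), (half k h) in IH;
  generalize (half_pos (S k) w hw) (half_pos (S k) h hh); lra.
Qed.

Lemma goursat_point : exists p : C, forall k,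
  in_rect (fst (goursat_corner k)) (fst (goursat_corner k) + w / 2 ^ k)
    (snd (goursat_corner k)) (snd (goursat_corner k) + h / 2 ^ k) p.
Proof.
  assert (L : forall u : nat -> R, forall v : nat -> R,
    (forall j k, (j <= k)%nat -> u j <= u k /\ v k <= v j) -> (forall k, u k <= v k) ->
    exists l, forall k, u k <= l <= v k).
  { intros u v hm huv. destruct (completeness (fun x => exists k, x = u k)) as [l [h1 h2]].
    - exists (v O). intros x [k ->]. eapply Rle_trans; [apply huv|]. apply (hm O k); lia.
    - now exists (u O), O.
    - exists l. intros k. split.
      + apply h1. now exists k.
      + apply h2. intros x [j ->].
        apply Rle_trans with (u (Nat.max j k)); [apply hm; lia|].
        apply Rle_trans with (v (Nat.max j k)); [apply huv | apply hm; lia]. }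
  destruct (L (fun k => fst (goursat_corner k)) (fun k => fst (goursat_corner k) + w / 2 ^ k)) as [X hX].
  { intros j k hjk. destruct (goursat_mono j k hjk). tauto. }
  { intros k. generalize (half_pos k w hw). lra. }
  destruct (L (fun k => snd (goursat_corner k)) (fun k => snd (goursat_corner k) + h / 2 ^ k)) as [Y hY].
  { intros j k hjk. destruct (goursat_mono j k hjk). tauto. }
  { intros k. generalize (half_pos k h hh). lra. }
  exists (X, Y). intros k. split; [apply hX | apply hY].
Qed.

Lemma goursat_rect_aux : RectInt f x0 (x0 + w) y0 (y0 + h) = 0%C.
Proof.
  apply NNPP. intros hne. apply Cmod_gt_0 in hne.
  set (I0 := Cmod (RectInt f x0 (x0 + w) y0 (y0 + h))) in *.
  destruct goursat_point as [p hp].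
  assert (hp0 : ex_derive f p). { apply hol. specialize (hp O). simpl in hp. now rewrite !Rdiv_1_r in hp. }
  destruct hp0 as [l hl].
  (* [e] is chosen so that the linear approximation with error [e] bounds the integral over the k-th
     rectangle by 2 e (w + h)^2 / 4^k, which is below I0 / 4^k; the bisection keeps at least I0 /
     4^k there. *)
  set (D := (w + h) * (w + h) + 1). assert (hD : 1 <= D) by (unfold D; nra).
  set (e := I0 / (4 * D)). assert (he : 0 < e) by (apply Rdiv_lt_0_compat; lra).
  destruct (proj1 (is_derive_C _ _ _) hl e he) as (d & hd & k0).
  assert (hk : exists k : nat, (w + h) / 2 ^ k < d).
  { destruct (pow_lt_1_zero (1 / 2)) with (y := d / (w + h + 1)) as [k hk].
    - rewrite Rabs_pos_eq; lra.
    - apply Rdiv_lt_0_compat; lra.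
    - exists k. specialize (hk k (le_n k)). rewrite Rabs_pos_eq in hk by (apply pow_le; lra).
      unfold Rdiv at 1. rewrite <- pow_inv. replace (/ 2) with (1 / 2) by lra.
      assert (hq : 0 < (1 / 2) ^ k) by (apply pow_lt; lra).
      apply Rmult_lt_compat_l with (r := w + h + 1) in hk; [|lra].
      replace ((w + h + 1) * (d / (w + h + 1))) with d in hk by (field; lra). nra. }
  destruct hk as [k hk].
  destruct (hp k) as [px py]. set (c := goursat_corner k) in *.
  destruct (goursat_in k) as (i1 & i2 & i3 & i4). fold c in i1, i2, i3, i4.
  assert (b0 := goursat_big0 k). fold c in b0. unfold Q in b0. fold I0 in b0.
  set (a := w / 2 ^ k) in *. set (b := h / 2 ^ k) in *.
  assert (ha : 0 <= a) by now apply half_pos. assert (hb : 0 <= b) by now apply half_pos.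
  assert (hab : a + b = (w + h) / 2 ^ k) by (unfold a, b; field; apply pow_nonzero; lra).
  set (A := fun s : C => (f p + (s - p) * l)%C).
  assert (dA : forall z, is_derive A z l).
  { intros z. unfold A. eapply is_derive_ext_val.
    - apply is_derive_plus_C; [apply is_derive_const_C|].
      apply is_derive_mult_C; [|apply is_derive_const_C].
      apply is_derive_minus_C; [apply is_derive_id_C | apply is_derive_const_C].
    - cbv beta. ring. }
  assert (cf : forall z, on_bd (fst c) (fst c + a) (snd c) (snd c + b) z -> continuous f z).
  { intros z [[zx zy] _]. apply ex_derive_continuous_C, hol. split; lra. }
  assert (cA : forall z, continuous A z) by (intros z; eapply is_derive_continuous_C, dA).
  assert (e1 : RectInt f (fst c) (fst c + a) (snd c) (snd c + b) =
               RectInt (fun s => f s - A s)%C (fst c) (fst c + a) (snd c) (snd c + b)).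
  { rewrite RectInt_minus; [|lra|lra|exact cf|intros z _; apply cA].
    rewrite (RectInt_primitive (fst c) (fst c + a) (snd c) (snd c + b)) with (f := A)
      (G := (fun s => f p * s + (s * s / 2 - p * s) * l)%C); [ring|lra|lra|intros z _; apply cA|].
    intros z _. eapply is_derive_ext_val.
    - apply is_derive_plus_C.
      + apply is_derive_mult_C; [apply is_derive_const_C | apply is_derive_id_C].
      + apply is_derive_mult_C; [|apply is_derive_const_C].
        apply is_derive_minus_C.
        * apply is_derive_div_C; [apply RtoC_neq_0; lra | | apply is_derive_const_C].
          apply is_derive_mult_C; apply is_derive_id_C.
        * apply is_derive_mult_C; [apply is_derive_const_C | apply is_derive_id_C].
    - unfold A. cbv beta. field. }
  rewrite e1 in b0.
  assert (bb : Cmod (RectInt (fun s => f s - A s)%C (fst c) (fst c + a) (snd c) (snd c + b)) <=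
    2 * (e * (a + b)) * ((fst c + a - fst c) + (snd c + b - snd c))).
  { apply RectInt_bound; try lra.
    - intros z hz. apply continuous_C. intros eps heps.
      assert (c1 := proj1 (continuous_C _ _) (cf z hz) (eps / 2) ltac:(lra)).
      assert (c2 := proj1 (continuous_C _ _) (cA z) (eps / 2) ltac:(lra)).
      destruct c1 as (d1 & hd1 & c1). destruct c2 as (d2 & hd2 & c2).
      exists (Rmin d1 d2). split; [now apply Rmin_pos|]. intros s hs.
      specialize (c1 s (Rlt_le_trans _ _ _ hs (Rmin_l _ _))).
      specialize (c2 s (Rlt_le_trans _ _ _ hs (Rmin_r _ _))).
      replace (f s - A s - (f z - A z))%C with ((f s - f z) - (A s - A z))%C by ring.
      eapply Rle_lt_trans; [apply Cmod_sub_le|]. lra.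
    - intros z [[zx zy] _]. unfold A.
      assert (hzp : Cmod (z - p) <= a + b).
      { eapply Rle_trans; [apply Cmod_le_re_im|]. reim.
        apply Rplus_le_compat; apply Rabs_le; lra. }
      replace (f z - (f p + (z - p) * l))%C with (f z - f p - (z - p) * l)%C by ring.
      eapply Rle_trans; [apply k0; lra|]. apply Rmult_le_compat_l; lra. }
  assert (hlt : 2 * (e * (a + b)) * (a + b) < I0 / 4 ^ k).
  { rewrite hab. replace (4 ^ k) with (2 ^ k * 2 ^ k) by (rewrite <- Rpow_mult_distr; f_equal; ring).
    assert (h2 : 0 < 2 ^ k) by (apply pow_lt; lra).
    replace (2 * (e * ((w + h) / 2 ^ k)) * ((w + h) / 2 ^ k)) with
      (2 * e * ((w + h) * (w + h)) / (2 ^ k * 2 ^ k)) by (field; lra).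
    apply Rmult_lt_compat_r; [apply Rinv_0_lt_compat; nra|].
    assert (he2 : e * D = I0 / 4) by (unfold e; field; lra). unfold D in he2. nra. }
  lra.
Qed.
End Goursat.

Theorem goursat_rect (f : C -> C) (x1 x2 y1 y2 : R) : x1 <= x2 -> y1 <= y2 ->
  hol_rect f x1 x2 y1 y2 -> RectInt f x1 x2 y1 y2 = 0%C.
Proof.
  intros hx hy hol. assert (k := goursat_rect_aux f x1 y1 (x2 - x1) (y2 - y1)).
  replace (x1 + (x2 - x1)) with x2 in k by ring. replace (y1 + (y2 - y1)) with y2 in k by ring.
  apply k; trivial; lra.
Qed.

(** * Cauchy's formula and its derivatives *)

Definition in_open_rect (x1 x2 y1 y2 : R) (z : C) : Prop :=
  x1 < Re z < x2 /\ y1 < Im z < y2.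

(** Two vertical and two horizontal cuts leave [z] in the central square only; the other four pieces
    vanish by Goursat. *)
Lemma RectInt_shrink (f : C -> C) (x1 x2 y1 y2 : R) (z : C) (e : R) : 0 < e ->
  x1 <= Re z - e -> Re z + e <= x2 -> y1 <= Im z - e -> Im z + e <= y2 ->
  (forall s, in_rect x1 x2 y1 y2 s -> s <> z -> ex_derive f s) ->
  RectInt f x1 x2 y1 y2 = RectInt f (Re z - e) (Re z + e) (Im z - e) (Im z + e).
Proof.
  intros he h1 h2 h3 h4 hol. destruct z as [a b]. simpl in *.
  assert (hc : forall x y, x1 <= x <= x2 -> y1 <= y <= y2 -> (x <> a \/ y <> b) -> continuous f (x, y)).
  { intros x y hx hy hne. apply ex_derive_continuous_C, hol; [split; assumption|].
    intros e0. injection e0. tauto. }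
  rewrite (RectInt_split_x f x1 (a - e) x2); try lra; try (intros x hx; apply hc; lra).
  rewrite (RectInt_split_x f (a - e) (a + e) x2); try lra; try (intros x hx; apply hc; lra).
  rewrite (RectInt_split_y f (a - e) (a + e) y1 (b - e) y2); try lra; try (intros y hy; apply hc; lra).
  rewrite (RectInt_split_y f (a - e) (a + e) (b - e) (b + e) y2); try lra; try (intros y hy; apply hc; lra).
  rewrite (goursat_rect f x1 (a - e)), (goursat_rect f (a + e) x2),
    (goursat_rect f (a - e) (a + e) y1), (goursat_rect f (a - e) (a + e) (b + e)); try lra.
  - ring.
  - intros s [sx sy]. apply hol; [split; lra|]. intros ->; simpl in *; lra.
  - intros s [sx sy]. apply hol; [split; lra|]. intros ->; simpl in *; lra.
  - intros s [sx sy]. apply hol; [split; lra|]. intros ->; simpl in *; lra.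
  - intros s [sx sy]. apply hol; [split; lra|]. intros ->; simpl in *; lra.
Qed.

Lemma square_dist (z s : C) (e : R) : 0 < e ->
  on_bd (Re z - e) (Re z + e) (Im z - e) (Im z + e) s -> e <= Cmod (s - z).
Proof.
  intros he [_ h].
  assert (h1 := re_le_Cmod (s - z)). assert (h2 := im_le_Cmod (s - z)).
  rewrite Re_minus in h1. rewrite Im_minus in h2.
  destruct h as [h|[h|[h|h]]]; rewrite h in *.
  - replace (Re z - e - Re z) with (- e) in h1 by ring. rewrite Rabs_Ropp, Rabs_pos_eq in h1; lra.
  - replace (Re z + e - Re z) with e in h1 by ring. rewrite Rabs_pos_eq in h1; lra.
  - replace (Im z - e - Im z) with (- e) in h2 by ring. rewrite Rabs_Ropp, Rabs_pos_eq in h2; lra.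
  - replace (Im z + e - Im z) with e in h2 by ring. rewrite Rabs_pos_eq in h2; lra.
Qed.

Lemma RectInt_inv_square (z : C) (e : R) : 0 < e ->
  RectInt (fun s => / (s - z))%C (Re z - e) (Re z + e) (Im z - e) (Im z + e) = (2 * PI * Ci)%C.
Proof.
  intros he. destruct z as [a b]. simpl Re. simpl Im.
  (* Each side reduces to the same integral, up to the sign [sg]: the logarithmic real part cancels
     by symmetry and the arctangent runs from - PI / 4 to PI / 4. So every side contributes i PI / 2
     to the oriented total. *)
  assert (K : forall (sg : R) (c : R), sg = 1 \/ sg = -1 ->
    CRInt (fun t => ((t - c) / ((t - c) ^ 2 + e ^ 2), sg * (e / ((t - c) ^ 2 + e ^ 2))) : C) (c - e) (c + e)
    = (0, sg * (PI / 2))).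
  { intros sg c _.
    assert (hpos : forall t, 0 < (t - c) ^ 2 + e ^ 2) by (intros t; generalize (pow2_ge_0 (t - c)) (pow_lt e 2 he); lra).
    assert (i := is_RInt_C_derive
      (fun t => (1 / 2 * ln ((t - c) ^ 2 + e ^ 2), sg * atan ((t - c) / e)) : C)
      (fun t => ((t - c) / ((t - c) ^ 2 + e ^ 2), sg * (e / ((t - c) ^ 2 + e ^ 2))) : C) (c - e) (c + e)).
    lapply i; [clear i; intros i; lapply i; [clear i; intros i; rewrite (CRInt_unique _ _ _ _ i)|]|].
    - unfold Cminus, Cplus, Copp. simpl.
      replace (c + e - c) with e by ring. replace (c - e - c) with (- e) by ring.
      replace (- e / e) with (Ropp 1) by (field; lra). replace (e / e) with 1 by (field; lra).
      rewrite atan_opp, atan_1. replace (- e * (- e * 1)) with (e * (e * 1)) by ring.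
      f_equal; field.
    - intros t _. specialize (hpos t). apply continuous_R_C_pair; simpl.
      + apply (ex_derive_continuous (fun t => (t - c) / ((t - c) * ((t - c) * 1) + e * (e * 1)))).
        auto_derive. simpl in hpos. lra.
      + apply (ex_derive_continuous (fun t => sg * (e / ((t - c) * ((t - c) * 1) + e * (e * 1))))).
        auto_derive. simpl in hpos. lra.
    - intros t _. specialize (hpos t). apply is_derive_R_C_pair.
      + auto_derive; [simpl in hpos; lra|]. field. simpl in hpos. lra.
      + auto_derive; [trivial|]. field. simpl in hpos. split; [|lra].
        replace ((t - c) ^ 2) with ((t - c) * ((t - c) * 1)) by ring. lra. }
  assert (hne : forall x y, (x <> a \/ y <> b) -> ((x, y) - (a, b))%C <> 0%C).
  { intros x y h e0. injection e0. intros. destruct h; lra. }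
  assert (hpos : forall t c : R, (t - c) ^ 2 + e ^ 2 <> 0) by (intros t c; generalize (pow2_ge_0 (t - c)) (pow_lt e 2 he); lra).
  assert (hc : forall x y, (x <> a \/ y <> b) -> continuous (fun s => / (s - (a, b)))%C (x, y)).
  { intros x y h. eapply is_derive_continuous_C. apply is_derive_inv_C; [now apply hne|].
    apply is_derive_minus_C; [apply is_derive_id_C | apply is_derive_const_C]. }
  unfold RectInt.
  assert (B : IntH (fun s => / (s - (a, b)))%C (b - e) (a - e) (a + e) = (0, 1 * (PI / 2))).
  { rewrite <- (K 1 a) by tauto. apply CRInt_ext. intros t _.
    assert (hp := hpos t a). unfold Cinv, Cminus, Cplus, Copp. simpl in *. f_equal; field; nra. }
  assert (T : IntH (fun s => / (s - (a, b)))%C (b + e) (a - e) (a + e) = (0, -1 * (PI / 2))).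
  { rewrite <- (K (-1) a) by tauto. apply CRInt_ext. intros t _.
    assert (hp := hpos t a). unfold Cinv, Cminus, Cplus, Copp. simpl in *. f_equal; field; nra. }
  assert (Rr : (Ci * IntV (fun s => / (s - (a, b)))%C (a + e) (b - e) (b + e))%C = (0, 1 * (PI / 2))).
  { unfold IntV. rewrite <- CRInt_scal.
    2: { apply (ex_IntV (fun s => / (s - (a, b)))%C). intros y _. apply hc. left; lra. }
    rewrite <- (K 1 b) by tauto. apply CRInt_ext. intros t _.
    assert (hp := hpos t b). unfold Cinv, Cminus, Cplus, Copp, Ci, Cmult. simpl in *. f_equal; field; nra. }
  assert (Ll : (Ci * IntV (fun s => / (s - (a, b)))%C (a - e) (b - e) (b + e))%C = (0, -1 * (PI / 2))).
  { unfold IntV. rewrite <- CRInt_scal.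
    2: { apply (ex_IntV (fun s => / (s - (a, b)))%C). intros y _. apply hc. left; lra. }
    rewrite <- (K (-1) b) by tauto. apply CRInt_ext. intros t _.
    assert (hp := hpos t b). unfold Cinv, Cminus, Cplus, Copp, Ci, Cmult. simpl in *. f_equal; field; nra. }
  rewrite B, T, Rr, Ll. apply C_ext; reim; field.
Qed.

Lemma rect_room (x1 x2 y1 y2 : R) (z : C) : in_open_rect x1 x2 y1 y2 z ->
  exists e : R, 0 < e /\ x1 <= Re z - e /\ Re z + e <= x2 /\ y1 <= Im z - e /\ Im z + e <= y2.
Proof.
  intros [[a b] [c d]].
  exists (Rmin (Rmin (Re z - x1) (x2 - Re z)) (Rmin (Im z - y1) (y2 - Im z))).
  set (m1 := Rmin (Re z - x1) (x2 - Re z)). set (m2 := Rmin (Im z - y1) (y2 - Im z)).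
  assert (h1 : m1 <= Re z - x1) by apply Rmin_l. assert (h2 : m1 <= x2 - Re z) by apply Rmin_r.
  assert (h3 : m2 <= Im z - y1) by apply Rmin_l. assert (h4 : m2 <= y2 - Im z) by apply Rmin_r.
  assert (h5 := Rmin_l m1 m2). assert (h6 := Rmin_r m1 m2).
  assert (0 < m1) by (apply Rmin_pos; lra). assert (0 < m2) by (apply Rmin_pos; lra).
  repeat split; try lra. now apply Rmin_pos.
Qed.

Theorem cauchy_formula (f : C -> C) (x1 x2 y1 y2 : R) (z : C) :
  in_open_rect x1 x2 y1 y2 z -> hol_rect f x1 x2 y1 y2 ->
  RectInt (fun s => f s / (s - z))%C x1 x2 y1 y2 = (2 * PI * Ci * f z)%C.
Proof.
  intros hz hol. destruct (rect_room _ _ _ _ _ hz) as (e0 & he0 & r1 & r2 & r3 & r4).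
  assert (hd : ex_derive f z) by (apply hol; destruct hz; split; lra).
  destruct hd as [l hl].
  destruct (proj1 (is_derive_C _ _ _) hl 1 Rlt_0_1) as (d & hd & k).
  (* On a small square the quotient (f s - f z) / (s - z) is at most |l| + 1, and the perimeter is 8
     e; 16 leaves room for the crude constant. *)
  set (K := 16 * (Cmod l + 1)). assert (hK : 0 < K) by (unfold K; generalize (Cmod_ge_0 l); lra).
  set (I := RectInt (fun s => f s / (s - z))%C x1 x2 y1 y2).
  assert (key : forall e, 0 < e -> e <= e0 -> e < d / 2 -> Cmod (I - 2 * PI * Ci * f z) <= K * e).
  { intros e he hee hed.
    assert (dz : forall s, s <> z -> ex_derive (fun s => / (s - z))%C s).
    { intros s hs. eexists. apply is_derive_inv_C; [now apply Csub_neq_0|].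
      apply is_derive_minus_C; [apply is_derive_id_C | apply is_derive_const_C]. }
    unfold I. rewrite (RectInt_shrink _ x1 x2 y1 y2 z e); try lra.
    2: { intros s hs hsz. apply ex_derive_mult_C; [now apply hol | now apply dz]. }
    rewrite <- (RectInt_inv_square z e he).
    assert (hsq : forall s, on_bd (Re z - e) (Re z + e) (Im z - e) (Im z + e) s ->
      s <> z /\ in_rect x1 x2 y1 y2 s /\ Cmod (s - z) <= 2 * e).
    { intros s hs. assert (hdist := square_dist z s e he hs). destruct hs as [[sx sy] _]. repeat split; try lra.
      - intros ->. unfold Cminus in hdist. rewrite Cplus_opp_r, Cmod_0 in hdist. lra.
      - eapply Rle_trans; [apply Cmod_le_re_im|]. reim.
        replace (2 * e) with (e + e) by ring. apply Rplus_le_compat; apply Rabs_le; lra. }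
    rewrite <- Cmult_comm, <- RectInt_scal; try lra.
    2: { intros s hs. apply ex_derive_continuous_C, dz, hsq, hs. }
    rewrite <- RectInt_minus; try lra.
    2: { intros s hs. apply ex_derive_continuous_C, ex_derive_mult_C; [apply hol, hsq, hs | apply dz, hsq, hs]. }
    2: { intros s hs. apply ex_derive_continuous_C, ex_derive_mult_C; [apply ex_derive_const_C | apply dz, hsq, hs]. }
    eapply Rle_trans.
    - apply RectInt_bound with (M := Cmod l + 1); [lra|lra| |].
      + intros s hs. apply ex_derive_continuous_C, ex_derive_minus_C; apply ex_derive_mult_C.
        * apply hol, hsq, hs.
        * apply dz, hsq, hs.
        * apply ex_derive_const_C.
        * apply dz, hsq, hs.
      + intros s hs. destruct (hsq s hs) as (h1 & h2 & h3).
        specialize (k s ltac:(lra)).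
        replace (f s / (s - z) - f z * / (s - z))%C with ((f s - f z) / (s - z))%C
          by (field; now apply Csub_neq_0).
        rewrite Cmod_div by now apply Csub_neq_0.
        assert (hp : 0 < Cmod (s - z)) by now apply Cmod_gt_0, Csub_neq_0.
        apply Rmult_le_reg_r with (1 := hp). unfold Rdiv. rewrite Rmult_assoc, Rinv_l, Rmult_1_r by lra.
        replace (f s - f z)%C with ((f s - f z - (s - z) * l) + (s - z) * l)%C by ring.
        eapply Rle_trans; [apply Cmod_triangle|]. rewrite Cmod_mult. lra.
    - assert (hp : 0 < (Cmod l + 1) * e) by (apply Rmult_lt_0_compat; unfold K in hK; lra).
      unfold K. lra. }
  assert (hz0 : Cmod (I - 2 * PI * Ci * f z) = 0).
  { apply Rle_antisym; [|apply Cmod_ge_0]. apply Rnot_lt_le. intros hpos.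
    set (v := Cmod (I - 2 * PI * Ci * f z)) in *.
    set (e := Rmin (Rmin e0 (d / 4)) (v / (2 * K))).
    assert (hq : 0 < v / (2 * K)) by (apply Rdiv_lt_0_compat; lra).
    assert (he : 0 < e) by (apply Rmin_pos; [apply Rmin_pos; lra | lra]).
    assert (a1 : e <= Rmin e0 (d / 4)) by apply Rmin_l. assert (a2 : e <= v / (2 * K)) by apply Rmin_r.
    assert (a3 := Rmin_l e0 (d / 4)). assert (a4 := Rmin_r e0 (d / 4)).
    specialize (key e he ltac:(lra) ltac:(lra)).
    assert (K * e <= K * (v / (2 * K))) by (apply Rmult_le_compat_l; lra).
    replace (K * (v / (2 * K))) with (v / 2) in H by (field; lra). lra. }
  apply Cmod_eq_0 in hz0.
  replace I with ((I - 2 * PI * Ci * f z) + 2 * PI * Ci * f z)%C by ring. rewrite hz0. ring.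
Qed.

Lemma two_pi_i_neq_0 : (2 * PI * Ci)%C <> 0%C.
Proof. intros h. apply (f_equal Im) in h. revert h. reim. generalize PI_RGT_0. intros. lra. Qed.

Lemma PIC_neq_0 : RtoC PI <> 0%C.
Proof. apply RtoC_neq_0, PI_neq0. Qed.

Lemma Ci_neq_0 : Ci <> 0%C.
Proof. intros h. apply (f_equal Im) in h. revert h. reim. lra. Qed.

Lemma Cmod_two_pi_i : Cmod (2 * PI * Ci) = 2 * PI.
Proof.
  generalize PI_RGT_0. intros hpi.
  rewrite !Cmod_mult, Cmod_Ci, !Cmod_RtoC_pos by lra. ring.
Qed.

Lemma in_open_rect_not_bd (x1 x2 y1 y2 : R) (z s : C) :
  in_open_rect x1 x2 y1 y2 z -> on_bd x1 x2 y1 y2 s -> s <> z.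
Proof. intros [a b] [_ h] ->. lra. Qed.

Lemma in_open_rect_dist (x1 x2 y1 y2 : R) (z : C) : in_open_rect x1 x2 y1 y2 z ->
  exists d : R, 0 < d /\ (forall s, Cmod (s - z) < d -> in_open_rect x1 x2 y1 y2 s) /\
    (forall s, on_bd x1 x2 y1 y2 s -> d <= Cmod (s - z)).
Proof.
  intros hz. destruct (rect_room _ _ _ _ _ hz) as (e & he & h1 & h2 & h3 & h4).
  exists e. split; [exact he|]. split.
  - intros s hs. assert (a := re_le_Cmod (s - z)). assert (b := im_le_Cmod (s - z)).
    rewrite Re_minus in a. rewrite Im_minus in b.
    assert (a' := Rle_lt_trans _ _ _ a hs). assert (b' := Rle_lt_trans _ _ _ b hs).
    apply Rabs_lt_between in a', b'. split; lra.
  - intros s [[sx sy] hb].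
    assert (a := re_le_Cmod (s - z)). assert (b := im_le_Cmod (s - z)).
    rewrite Re_minus in a. rewrite Im_minus in b.
    assert (a1 := Rle_abs (Re s - Re z)). assert (a2 := Rle_abs (- (Re s - Re z))). rewrite Rabs_Ropp in a2.
    assert (b1 := Rle_abs (Im s - Im z)). assert (b2 := Rle_abs (- (Im s - Im z))). rewrite Rabs_Ropp in b2.
    lra.
Qed.

Lemma bounded_H (f : C -> C) (y a b : R) :
  (forall x, a <= x <= b -> continuous f (x, y)) ->
  exists M : R, forall x, a <= x <= b -> Cmod (f (x, y)) <= M.
Proof.
  intros h. destruct (bounded_continuity (V := C_R_NormedModule) (fun x => f (x, y)) a b) as [M hM].
  - intros x hx. apply continuous_H, h, hx.
  - exists M. intros x hx. left. rewrite Cmod_norm. exact (hM x hx).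
Qed.

Lemma bounded_V (f : C -> C) (x a b : R) :
  (forall y, a <= y <= b -> continuous f (x, y)) ->
  exists M : R, forall y, a <= y <= b -> Cmod (f (x, y)) <= M.
Proof.
  intros h. destruct (bounded_continuity (V := C_R_NormedModule) (fun y => f (x, y)) a b) as [M hM].
  - intros y hy. apply continuous_V, h, hy.
  - exists M. intros y hy. left. rewrite Cmod_norm. exact (hM y hy).
Qed.

Lemma bounded_bd (f : C -> C) (x1 x2 y1 y2 : R) : x1 <= x2 -> y1 <= y2 ->
  (forall z, on_bd x1 x2 y1 y2 z -> continuous f z) ->
  exists M : R, 0 <= M /\ forall z, on_bd x1 x2 y1 y2 z -> Cmod (f z) <= M.
Proof.
  intros hx hy h.
  destruct (bounded_H f y1 x1 x2) as [M1 b1]; [intros; apply h, bd_b; trivial|].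
  destruct (bounded_H f y2 x1 x2) as [M2 b2]; [intros; apply h, bd_t; trivial|].
  destruct (bounded_V f x1 y1 y2) as [M3 b3]; [intros; apply h, bd_l; trivial|].
  destruct (bounded_V f x2 y1 y2) as [M4 b4]; [intros; apply h, bd_r; trivial|].
  exists (Rabs M1 + Rabs M2 + Rabs M3 + Rabs M4).
  assert (p1 := Rabs_pos M1). assert (p2 := Rabs_pos M2). assert (p3 := Rabs_pos M3). assert (p4 := Rabs_pos M4).
  assert (q1 := Rle_abs M1). assert (q2 := Rle_abs M2). assert (q3 := Rle_abs M3). assert (q4 := Rle_abs M4).
  split; [lra|].
  intros [x y] [[zx zy] hb]. simpl in *.
  destruct hb as [->|[->|[->| ->]]].
  - specialize (b3 y zy). lra.
  - specialize (b4 y zy). lra.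
  - specialize (b1 x zx). lra.
  - specialize (b2 x zx). lra.
Qed.

Lemma Csub_eq_0 (a b : C) : (a - b = 0)%C -> a = b.
Proof. intros h. replace a with ((a - b) + b)%C by ring. rewrite h. ring. Qed.

(** Meant for p = 1 / (s - z), q = 1 / (s - w), u = w - z, where the hypothesis is the resolvent
    identity. Induction on the power gives a second-order expansion uniform in [s], without any
    division. *)
Lemma kernel_taylor (D : R) (m : nat) : 0 <= D -> exists K : R, 0 <= K /\
  forall p q u : C, Cmod p <= D -> Cmod q <= D -> (q - p = u * p * q)%C ->
    Cmod (q ^ m - p ^ m - INR m * u * p ^ (S m)) <= K * Cmod u ^ 2.
Proof.
  intros hD. induction m as [|m (K & hK & IH)].
  - exists 0. split; [lra|]. intros p q u _ _ _.
    simpl. replace (1 - 1 - 0 * u * (p * 1))%C with (RtoC 0) by ring. rewrite Cmod_0. lra.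
  - assert (hDm : 0 <= D ^ (S (S m))) by (now apply pow_le).
    exists (D * K + (1 + INR m) * (D ^ (S (S m)) * D)).
    assert (hm := pos_INR m).
    split. { assert (0 <= D * K) by nra. assert (0 <= D ^ (S (S m)) * D) by nra. nra. }
    intros p q u hp hq he. specialize (IH p q u hp hq he).
    replace (q ^ S m - p ^ S m - INR (S m) * u * p ^ (S (S m)))%C with
      (q * (q ^ m - p ^ m - INR m * u * p ^ (S m)) + (1 + INR m) * (u * u) * (p ^ (S (S m)) * q))%C.
    2: { rewrite S_INR, RtoC_plus, !Cpow_S.
      assert (hX : (q - p - u * p * q = 0)%C) by (rewrite he; ring).
      symmetry. apply Csub_eq_0.
      transitivity ((q - p - u * p * q) * (p ^ m * (1 + (INR m + 1) * (u * p))))%C; [ring|].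
      rewrite hX. ring. }
    eapply Rle_trans; [apply Cmod_triangle|].
    rewrite !Cmod_mult.
    replace (Cmod (1 + INR m)) with (1 + INR m) by (rewrite <- RtoC_plus, Cmod_RtoC_pos; lra).
    rewrite Cmod_pow.
    assert (hp2 : Cmod p ^ S (S m) <= D ^ S (S m)) by (apply pow_incr; split; [apply Cmod_ge_0 | exact hp]).
    assert (hu := Cmod_ge_0 u). assert (hq0 := Cmod_ge_0 q).
    assert (a1 : Cmod q * Cmod (q ^ m - p ^ m - INR m * u * p ^ (S m)) <= D * (K * Cmod u ^ 2)).
    { apply Rmult_le_compat; auto; apply Cmod_ge_0. }
    assert (a2 : (1 + INR m) * (Cmod u * Cmod u) * (Cmod p ^ S (S m) * Cmod q) <=
       (1 + INR m) * (Cmod u * Cmod u) * (D ^ S (S m) * D)).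
    { apply Rmult_le_compat_l; [apply Rmult_le_pos; nra|].
      apply Rmult_le_compat; auto. apply pow_le, Cmod_ge_0. }
    lra.
Qed.

Lemma ex_derive_kernel (k : nat) (z s : C) : s <> z -> ex_derive (fun s => / (s - z) ^ k)%C s.
Proof.
  intros h. eexists. apply is_derive_inv_C.
  - apply Cpow_nz, Csub_neq_0, h.
  - apply is_derive_pow_C, is_derive_minus_C; [apply is_derive_id_C | apply is_derive_const_C].
Qed.

Lemma continuous_C_mult (f g : C -> C) (z : C) :
  continuous f z -> continuous g z -> continuous (fun s => f s * g s)%C z.
Proof.
  intros hf hg. apply continuous_C. intros e he.
  set (A := Cmod (f z) + 1). set (B := Cmod (g z) + 1).
  assert (hA : 1 <= A) by (unfold A; generalize (Cmod_ge_0 (f z)); lra).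
  assert (hB : 1 <= B) by (unfold B; generalize (Cmod_ge_0 (g z)); lra).
  destruct (proj1 (continuous_C _ _) hf (Rmin 1 (e / (2 * B)))) as (d1 & hd1 & k1).
  { apply Rmin_pos; [lra | apply Rdiv_lt_0_compat; lra]. }
  destruct (proj1 (continuous_C _ _) hg (e / (2 * A))) as (d2 & hd2 & k2).
  { apply Rdiv_lt_0_compat; lra. }
  exists (Rmin d1 d2). split; [now apply Rmin_pos|]. intros s hs.
  specialize (k1 s (Rlt_le_trans _ _ _ hs (Rmin_l _ _))).
  specialize (k2 s (Rlt_le_trans _ _ _ hs (Rmin_r _ _))).
  assert (l1 := Rlt_le_trans _ _ _ k1 (Rmin_l _ _)). assert (l2 := Rlt_le_trans _ _ _ k1 (Rmin_r _ _)).
  replace (f s * g s - f z * g z)%C with (f s * (g s - g z) + (f s - f z) * g z)%C by ring.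
  eapply Rle_lt_trans; [apply Cmod_triangle|]. rewrite !Cmod_mult.
  assert (hfs : Cmod (f s) <= A).
  { replace (f s) with ((f s - f z) + f z)%C by ring. eapply Rle_trans; [apply Cmod_triangle|]. unfold A. lra. }
  assert (a1 : Cmod (f s) * Cmod (g s - g z) <= A * Cmod (g s - g z)).
  { apply Rmult_le_compat_r; [apply Cmod_ge_0 | exact hfs]. }
  assert (a2 : A * Cmod (g s - g z) < e / 2).
  { apply Rmult_lt_compat_l with (r := A) in k2; [|lra].
    replace (A * (e / (2 * A))) with (e / 2) in k2 by (field; lra). exact k2. }
  assert (a3 : Cmod (f s - f z) * Cmod (g z) <= e / 2).
  { apply Rle_trans with (e / (2 * B) * B).
    - apply Rmult_le_compat; [apply Cmod_ge_0 | apply Cmod_ge_0 | left; exact l2 | unfold B; lra].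
    - right; field; lra. }
  lra.
Qed.

(** Differentiation under the integral sign: the uniform second-order remainder of [kernel_taylor]
    replaces any exchange of limits, and only continuity of [f] on the boundary enters. *)
Lemma is_derive_RectInt_kernel (f : C -> C) (x1 x2 y1 y2 : R) (k : nat) (z : C) :
  in_open_rect x1 x2 y1 y2 z ->
  (forall s, on_bd x1 x2 y1 y2 s -> continuous f s) ->
  is_derive (fun z => RectInt (fun s => f s * / (s - z) ^ k)%C x1 x2 y1 y2) z
    (INR k * RectInt (fun s => f s * / (s - z) ^ (S k))%C x1 x2 y1 y2)%C.
Proof.
  intros hz hc. destruct (in_open_rect_dist _ _ _ _ _ hz) as (d & hd & hin & hdist).
  assert (hx : x1 <= x2) by (destruct hz; lra). assert (hy : y1 <= y2) by (destruct hz; lra).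
  destruct (bounded_bd f x1 x2 y1 y2 hx hy hc) as (M & hM & bM).
  destruct (kernel_taylor (2 / d) k) as (K & hK & bK); [apply Rdiv_le_0_compat; lra|].
  set (P := 2 * (M * K) * ((x2 - x1) + (y2 - y1)) + 1).
  assert (hP : 0 < P). { unfold P. assert (0 <= M * K) by nra. nra. }
  apply is_derive_C. intros eps heps.
  exists (Rmin (d / 2) (eps / P)). split; [apply Rmin_pos; [lra | now apply Rdiv_lt_0_compat]|].
  intros w hw.
  assert (hw1 := Rlt_le_trans _ _ _ hw (Rmin_l _ _)). assert (hw2 := Rlt_le_trans _ _ _ hw (Rmin_r _ _)).
  assert (hwin : in_open_rect x1 x2 y1 y2 w) by (apply hin; lra).
  assert (cz : forall j s, on_bd x1 x2 y1 y2 s -> continuous (fun s => f s * / (s - z) ^ j)%C s).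
  { intros j s hs. apply continuous_C_mult; [now apply hc|].
    apply ex_derive_continuous_C, ex_derive_kernel. eapply in_open_rect_not_bd; eauto. }
  assert (cw : forall j s, on_bd x1 x2 y1 y2 s -> continuous (fun s => f s * / (s - w) ^ j)%C s).
  { intros j s hs. apply continuous_C_mult; [now apply hc|].
    apply ex_derive_continuous_C, ex_derive_kernel. eapply in_open_rect_not_bd; eauto. }
  assert (cs : forall s, on_bd x1 x2 y1 y2 s ->
    continuous (fun s => ((w - z) * INR k) * (f s * / (s - z) ^ (S k)))%C s).
  { intros s hs. apply (continuous_C_mult (fun _ => ((w - z) * INR k)%C)); [|now apply cz].
    apply ex_derive_continuous_C, ex_derive_const_C. }
  replace ((w - z) * (INR k * RectInt (fun s => f s * / (s - z) ^ (S k)) x1 x2 y1 y2))%C with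
    (RectInt (fun s => ((w - z) * INR k) * (f s * / (s - z) ^ (S k))) x1 x2 y1 y2)%C.
  2: { rewrite RectInt_scal; auto. ring. }
  rewrite <- RectInt_minus; auto.
  assert (c2 : forall s, on_bd x1 x2 y1 y2 s ->
    continuous (fun s => f s * / (s - w) ^ k - f s * / (s - z) ^ k)%C s).
  { intros s hs. apply (continuous_minus (V := C_R_NormedModule) (U := C_UniformSpace)); [now apply cw | now apply cz]. }
  rewrite <- RectInt_minus; auto.
  eapply Rle_trans.
  - apply RectInt_bound with (M := M * (K * Cmod (w - z) ^ 2)); auto.
    + intros s hs. apply (continuous_minus (V := C_R_NormedModule) (U := C_UniformSpace)); auto.
    + intros s hs.
      assert (hs1 : (s - z)%C <> 0%C) by (apply Csub_neq_0; eapply in_open_rect_not_bd; eauto).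
      assert (hs2 : (s - w)%C <> 0%C) by (apply Csub_neq_0; eapply in_open_rect_not_bd; eauto).
      assert (hds := hdist s hs).
      replace (f s * / (s - w) ^ k - f s * / (s - z) ^ k - ((w - z) * INR k) * (f s * / (s - z) ^ (S k)))%C
        with (f s * ((/ (s - w)) ^ k - (/ (s - z)) ^ k - INR k * (w - z) * (/ (s - z)) ^ (S k)))%C.
      2: { rewrite !Cpow_inv by assumption. ring. }
      rewrite Cmod_mult. apply Rmult_le_compat; try apply Cmod_ge_0; [now apply bM|].
      apply bK.
      * rewrite Cmod_inv by assumption. apply Rle_trans with (/ d).
        -- apply Rinv_le_contravar; lra.
        -- unfold Rdiv. assert (0 < / d) by (now apply Rinv_0_lt_compat). lra.
      * rewrite Cmod_inv by assumption. replace (2 / d) with (/ (d / 2)) by (field; lra).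
        apply Rinv_le_contravar; [lra|].
        assert (t := Cmod_sub_triangle s w z). lra.
      * field. split; assumption.
  - assert (hp := Cmod_ge_0 (w - z)).
    replace (2 * (M * (K * Cmod (w - z) ^ 2)) * (x2 - x1 + (y2 - y1))) with
      ((P - 1) * Cmod (w - z) * Cmod (w - z)) by (unfold P; ring).
    apply Rmult_le_compat_r; [lra|].
    apply Rmult_lt_compat_l with (r := P) in hw2; [|lra].
    replace (P * (eps / P)) with eps in hw2 by (field; lra). nra.
Qed.

(** The formula and the differentiability are proved together: [C_derive] of order k + 1 can be
    computed at [z] only once the formula of order k is known in a neighbourhood of [z]. *)
Lemma cauchy_derivatives (f : C -> C) (x1 x2 y1 y2 : R) (k : nat) :
  hol_rect f x1 x2 y1 y2 -> forall z, in_open_rect x1 x2 y1 y2 z ->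
  (2 * PI * Ci * C_derive_n f k z = INR (fact k) * RectInt (fun s => f s * / (s - z) ^ (S k))%C x1 x2 y1 y2)%C /\
  ex_derive (C_derive_n f k) z.
Proof.
  intros hol.
  assert (hc : forall s, on_bd x1 x2 y1 y2 s -> continuous f s).
  { intros s [hs _]. apply ex_derive_continuous_C, hol, hs. }
  assert (hder : forall j z, in_open_rect x1 x2 y1 y2 z ->
    (forall w, in_open_rect x1 x2 y1 y2 w -> (2 * PI * Ci * C_derive_n f j w =
       INR (fact j) * RectInt (fun s => f s * / (s - w) ^ (S j))%C x1 x2 y1 y2)%C) ->
    is_derive (C_derive_n f j) z (/ (2 * PI * Ci) * INR (fact j) *
      (INR (S j) * RectInt (fun s => f s * / (s - z) ^ (S (S j)))%C x1 x2 y1 y2))%C).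
  { intros j z hz IH. destruct (in_open_rect_dist _ _ _ _ _ hz) as (d & hd & hin & _).
    apply (is_derive_locally_ext (fun w => (/ (2 * PI * Ci) * INR (fact j)) *
      RectInt (fun s => f s * / (s - w) ^ (S j))%C x1 x2 y1 y2)%C _ _ _ d hd).
    - intros w hw. rewrite <- Cmult_assoc, <- IH by (now apply hin).
      field. repeat split; auto using PIC_neq_0, Ci_neq_0.
    - eapply is_derive_ext_val.
      + apply is_derive_mult_C; [apply is_derive_const_C | apply is_derive_RectInt_kernel; assumption].
      + cbv beta. ring. }
  induction k as [|k IH]; intros z hz.
  - assert (e : forall w, in_open_rect x1 x2 y1 y2 w -> (2 * PI * Ci * C_derive_n f 0 w =
      INR (fact 0) * RectInt (fun s => f s * / (s - w) ^ 1)%C x1 x2 y1 y2)%C).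
    { intros w hw. simpl C_derive_n. rewrite <- (cauchy_formula f x1 x2 y1 y2 w hw hol).
      rewrite Cmult_1_l. apply RectInt_ext; [destruct hw; lra | destruct hw; lra|].
      intros s hs. rewrite Cpow_1_r. reflexivity. }
    split; [now apply e|]. eexists. now apply hder.
  - assert (e : forall w, in_open_rect x1 x2 y1 y2 w -> (2 * PI * Ci * C_derive_n f (S k) w =
      INR (fact (S k)) * RectInt (fun s => f s * / (s - w) ^ (S (S k)))%C x1 x2 y1 y2)%C).
    { intros w hw. simpl C_derive_n.
      rewrite (is_C_derive_unique _ _ _ (hder k w hw (fun v hv => proj1 (IH v hv)))).
      rewrite fact_simpl, mult_INR, RtoC_mult. field.
      repeat split; auto using PIC_neq_0, Ci_neq_0. }
    split; [now apply e|]. eexists. now apply hder.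
Qed.

(** * Taylor remainders *)

Definition taylor_at (f : C -> C) (p : C) (m : nat) (z : C) : C :=
  sum_n (G := C_AbelianMonoid) (fun k => C_derive_n f k p / INR (fact k) * (z - p) ^ k)%C m.

Section TaylorRI.
Variables (f : C -> C) (x1 x2 y1 y2 : R) (p : C).
Hypothesis (hol : hol_rect f x1 x2 y1 y2) (hp : in_open_rect x1 x2 y1 y2 p).

Let hx : x1 <= x2. Proof. destruct hp; lra. Qed.
Let hy : y1 <= y2. Proof. destruct hp; lra. Qed.
Let dp (s : C) : on_bd x1 x2 y1 y2 s -> (s - p)%C <> 0%C.
Proof. intros hs. apply Csub_neq_0. eapply in_open_rect_not_bd; eauto. Qed.
Let df (s : C) : on_bd x1 x2 y1 y2 s -> ex_derive f s.
Proof. intros [hs _]. now apply hol. Qed.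

(** The Cauchy integrals of the coefficients add up to a geometric sum under the integral. The point
    [z] only has to avoid the boundary, so the same identity serves inside and outside. *)
Lemma taylor_RectInt (m : nat) (z : C) : (forall s, on_bd x1 x2 y1 y2 s -> s <> z) ->
  (2 * PI * Ci * taylor_at f p m z =
   RectInt (fun s => f s * ((1 - ((z - p) / (s - p)) ^ (S m)) / (s - z))) x1 x2 y1 y2)%C.
Proof.
  intros hz.
  assert (coef : forall k, (2 * PI * Ci * (C_derive_n f k p / INR (fact k) * (z - p) ^ k) =
    RectInt (fun s => (z - p) ^ k * (f s * / (s - p) ^ (S k))) x1 x2 y1 y2)%C).
  { intros k. rewrite RectInt_scal; auto.
    2: { intros s hs. apply ex_derive_continuous_C, ex_derive_mult_C; [now apply df|].
         apply ex_derive_kernel. intros ->. apply (dp p hs). ring. }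
    destruct (cauchy_derivatives f x1 x2 y1 y2 k hol p hp) as [e _].
    assert (hf : RtoC (INR (fact k)) <> 0%C) by apply RtoC_neq_0, INR_fact_neq_0.
    replace (2 * PI * Ci * (C_derive_n f k p / INR (fact k) * (z - p) ^ k))%C with
      ((2 * PI * Ci * C_derive_n f k p) / INR (fact k) * (z - p) ^ k)%C by (field; exact hf).
    rewrite e. field. exact hf. }
  assert (cont : forall k s, on_bd x1 x2 y1 y2 s ->
     ex_derive (fun s => f s * ((1 - ((z - p) / (s - p)) ^ (S k)) / (s - z)))%C s).
  { intros k s hs. apply ex_derive_mult_C; [now apply df|].
    apply ex_derive_div_C; [apply Csub_neq_0; now apply hz| |].
    - apply ex_derive_minus_C; [apply ex_derive_const_C|].
      apply ex_derive_pow_C, ex_derive_div_C; [now apply dp | apply ex_derive_const_C|].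
      apply ex_derive_minus_C; [apply ex_derive_id_C | apply ex_derive_const_C].
    - apply ex_derive_minus_C; [apply ex_derive_id_C | apply ex_derive_const_C]. }
  unfold taylor_at. induction m as [|m IH].
  - rewrite sum_O, coef. apply RectInt_ext; auto. intros s hs.
    assert (h1 := dp s hs). assert (h2 := Csub_neq_0 _ _ (hz s hs)).
    rewrite !Cpow_1_r. simpl. field. split; assumption.
  - rewrite sum_Sn. change plus with Cplus.
    rewrite Cmult_plus_distr_l, IH, coef, <- RectInt_plus; [| exact hx | exact hy | |].
    + apply RectInt_ext; auto. intros s hs.
      assert (h1 := dp s hs). assert (h2 := Csub_neq_0 _ _ (hz s hs)).
      unfold Cdiv. rewrite !Cpow_mult_l, !Cpow_inv, !(Cpow_S _ (S m)) by assumption.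
      assert (h3 := Cpow_nz _ (S m) h1).
      field. repeat split; assumption.
    + intros s hs. apply ex_derive_continuous_C. exact (cont m s hs).
    + intros s hs. apply ex_derive_continuous_C, ex_derive_mult_C; [apply ex_derive_const_C|].
      apply ex_derive_mult_C; [now apply df|].
      apply ex_derive_kernel. intros ->. apply (dp p hs). ring.
Qed.

Lemma taylor_RectInt_split (m : nat) (z : C) : (forall s, on_bd x1 x2 y1 y2 s -> s <> z) ->
  (2 * PI * Ci * taylor_at f p m z = RectInt (fun s => f s / (s - z)) x1 x2 y1 y2
   - (z - p) ^ (S m) * RectInt (fun s => f s / ((s - p) ^ (S m) * (s - z))) x1 x2 y1 y2)%C.
Proof.
  intros hz. rewrite taylor_RectInt by assumption.
  assert (c1 : forall s, on_bd x1 x2 y1 y2 s -> ex_derive (fun s => f s / (s - z))%C s).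
  { intros s hs. apply ex_derive_div_C; [apply Csub_neq_0; now apply hz | now apply df|].
    apply ex_derive_minus_C; [apply ex_derive_id_C | apply ex_derive_const_C]. }
  assert (c2 : forall s, on_bd x1 x2 y1 y2 s -> ex_derive (fun s => f s / ((s - p) ^ (S m) * (s - z)))%C s).
  { intros s hs. apply ex_derive_div_C; [|now apply df|].
    - apply Cmult_neq_0; [apply Cpow_nz; now apply dp | apply Csub_neq_0; now apply hz].
    - apply ex_derive_mult_C; [apply ex_derive_pow_C|];
      (apply ex_derive_minus_C; [apply ex_derive_id_C | apply ex_derive_const_C]). }
  rewrite <- RectInt_scal; auto.
  2: { intros s hs. now apply ex_derive_continuous_C, c2. }
  rewrite <- RectInt_minus; [| exact hx | exact hy | |].
  - apply RectInt_ext; auto. intros s hs.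
    assert (h1 := dp s hs). assert (h2 := Csub_neq_0 _ _ (hz s hs)).
    unfold Cdiv. rewrite !Cpow_mult_l, !Cpow_inv by assumption.
    assert (h3 := Cpow_nz _ (S m) h1). field. split; assumption.
  - intros s hs. now apply ex_derive_continuous_C, c1.
  - intros s hs. apply ex_derive_continuous_C, ex_derive_mult_C; [apply ex_derive_const_C | now apply c2].
Qed.

Lemma taylor_remainder_in (m : nat) (z : C) : in_open_rect x1 x2 y1 y2 z ->
  (2 * PI * Ci * (f z - taylor_at f p m z) =
   (z - p) ^ (S m) * RectInt (fun s => f s / ((s - p) ^ (S m) * (s - z))) x1 x2 y1 y2)%C.
Proof.
  intros hz.
  assert (e := taylor_RectInt_split m z (fun s hs => in_open_rect_not_bd _ _ _ _ _ _ hz hs)).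
  rewrite (cauchy_formula f x1 x2 y1 y2 z hz hol) in e.
  replace (2 * PI * Ci * (f z - taylor_at f p m z))%C with
    (2 * PI * Ci * f z - 2 * PI * Ci * taylor_at f p m z)%C by ring.
  rewrite e. ring.
Qed.

(** For [z] outside, the Cauchy integral of [f] vanishes by Goursat, so the integral that gave f - T
    inside now gives - T. The two cases together produce the characteristic function [chi]. *)
Lemma taylor_remainder_out (m : nat) (z : C) : ~ in_rect x1 x2 y1 y2 z ->
  (2 * PI * Ci * (- taylor_at f p m z) =
   (z - p) ^ (S m) * RectInt (fun s => f s / ((s - p) ^ (S m) * (s - z))) x1 x2 y1 y2)%C.
Proof.
  intros hz.
  assert (hz' : forall s, in_rect x1 x2 y1 y2 s -> s <> z) by (intros s hs ->; contradiction).
  assert (e := taylor_RectInt_split m z (fun s hs => hz' s (proj1 hs))).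
  rewrite goursat_rect in e; auto.
  - replace (2 * PI * Ci * - taylor_at f p m z)%C with (- (2 * PI * Ci * taylor_at f p m z))%C by ring.
    rewrite e. ring.
  - intros s hs. apply ex_derive_div_C; [apply Csub_neq_0; now apply hz' | now apply hol|].
    apply ex_derive_minus_C; [apply ex_derive_id_C | apply ex_derive_const_C].
Qed.
End TaylorRI.

Definition hol_square (f : C -> C) (p : C) (r : R) : Prop :=
  hol_rect f (Re p - r) (Re p + r) (Im p - r) (Im p + r).

Lemma center_in_square (p : C) (r : R) : 0 < r ->
  in_open_rect (Re p - r) (Re p + r) (Im p - r) (Im p + r) p.
Proof. intros; split; lra. Qed.

Lemma disk_in_square (p z : C) (r : R) : Cmod (z - p) < r ->
  in_open_rect (Re p - r) (Re p + r) (Im p - r) (Im p + r) z.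
Proof.
  intros h. assert (a := re_le_Cmod (z - p)). assert (b := im_le_Cmod (z - p)).
  rewrite Re_minus in a. rewrite Im_minus in b.
  assert (a' := Rle_lt_trans _ _ _ a h). assert (b' := Rle_lt_trans _ _ _ b h).
  apply Rabs_lt_between in a', b'. split; lra.
Qed.

(** The restriction to half the radius keeps |s - z| >= r / 2 on the square of perimeter 8 r; the
    bound 16 obtained for 2 PI times the remainder becomes 4 through 2 PI >= 4. *)
Lemma taylor_remainder_bound (f : C -> C) (p : C) (r M : R) (m : nat) (z : C) :
  0 < r -> hol_square f p r ->
  (forall s, on_bd (Re p - r) (Re p + r) (Im p - r) (Im p + r) s -> Cmod (f s) <= M) ->
  Cmod (z - p) <= r / 2 ->
  Cmod (f z - taylor_at f p m z) <= 4 * M * (Cmod (z - p) / r) ^ (S m).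
Proof.
  intros hr hol hM hz.
  assert (hzin := disk_in_square p z r ltac:(lra)).
  assert (e := taylor_remainder_in f _ _ _ _ p hol (center_in_square p r hr) m z hzin).
  assert (hd : forall s, on_bd (Re p - r) (Re p + r) (Im p - r) (Im p + r) s ->
     r <= Cmod (s - p) /\ r / 2 <= Cmod (s - z)).
  { intros s hs. assert (h := square_dist p s r hr hs). split; [exact h|].
    assert (t := Cmod_sub_triangle s z p). lra. }
  assert (hrm : 0 < r ^ S m) by now apply pow_lt.
  assert (hM0 : 0 <= M).
  { eapply Rle_trans; [apply Cmod_ge_0 | apply (hM (Re p + r, Im p))]. split; [split; simpl; lra|]. simpl; tauto. }
  assert (b : Cmod (RectInt (fun s => f s / ((s - p) ^ (S m) * (s - z)))%C (Re p - r) (Re p + r) (Im p - r) (Im p + r))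
    <= 2 * (M / (r ^ S m * (r / 2))) * ((Re p + r - (Re p - r)) + (Im p + r - (Im p - r)))).
  { apply RectInt_bound; try lra.
    - intros s hs. destruct (hd s hs). apply ex_derive_continuous_C, ex_derive_div_C.
      + apply Cmult_neq_0; [apply Cpow_nz|]; apply Cmod_pos_neq; lra.
      + apply hol, hs.
      + apply ex_derive_mult_C; [apply ex_derive_pow_C|];
        (apply ex_derive_minus_C; [apply ex_derive_id_C | apply ex_derive_const_C]).
    - intros s hs. destruct (hd s hs) as [d1 d2].
      rewrite Cmod_div by (apply Cmult_neq_0; [apply Cpow_nz|]; apply Cmod_pos_neq; lra).
      rewrite Cmod_mult, Cmod_pow.
      assert (q : r ^ S m <= Cmod (s - p) ^ S m) by (apply pow_incr; lra).
      apply Rmult_le_compat; [apply Cmod_ge_0 | | now apply hM |].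
      + left. apply Rinv_0_lt_compat, Rmult_lt_0_compat; lra.
      + apply Rinv_le_contravar; [apply Rmult_lt_0_compat; lra|].
        apply Rmult_le_compat; lra. }
  apply (f_equal Cmod) in e. rewrite Cmod_mult, Cmod_two_pi_i, Cmod_mult, Cmod_pow in e.
  unfold Rdiv at 1. rewrite Rpow_mult_distr, pow_inv.
  assert (hz0 : 0 <= Cmod (z - p) ^ S m) by (apply pow_le, Cmod_ge_0).
  assert (hpi := PI2_3_2). unfold PI2 in hpi.
  set (A := Cmod (f z - taylor_at f p m z)) in *. assert (hA : 0 <= A) by apply Cmod_ge_0.
  set (B := Cmod (RectInt _ _ _ _ _)) in *.
  replace (2 * (M / (r ^ S m * (r / 2))) * (Re p + r - (Re p - r) + (Im p + r - (Im p - r)))) with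
    (16 * (M * / r ^ S m)) in b by (field; split; lra).
  assert (c : Cmod (z - p) ^ S m * B <= Cmod (z - p) ^ S m * (16 * (M * / r ^ S m))) by (apply Rmult_le_compat_l; lra).
  rewrite <- e in c.
  assert (4 * A <= 2 * PI * A) by nra. lra.
Qed.

Lemma cauchy_estimate (f : C -> C) (p : C) (r M : R) (k : nat) :
  0 < r -> hol_square f p r ->
  (forall s, on_bd (Re p - r) (Re p + r) (Im p - r) (Im p + r) s -> Cmod (f s) <= M) ->
  Cmod (C_derive_n f k p) <= 4 * INR (fact k) * M / r ^ k.
Proof.
  intros hr hol hM.
  destruct (cauchy_derivatives f _ _ _ _ k hol p (center_in_square p r hr)) as [e _].
  assert (hrm : 0 < r ^ S k) by now apply pow_lt.
  assert (hM0 : 0 <= M).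
  { eapply Rle_trans; [apply Cmod_ge_0 | apply (hM (Re p + r, Im p))]. split; [split; simpl; lra|]. simpl; tauto. }
  assert (b : Cmod (RectInt (fun s => f s * / (s - p) ^ (S k))%C (Re p - r) (Re p + r) (Im p - r) (Im p + r))
    <= 2 * (M * / r ^ S k) * ((Re p + r - (Re p - r)) + (Im p + r - (Im p - r)))).
  { apply RectInt_bound; try lra.
    - intros s hs. assert (d1 := square_dist p s r hr hs).
      apply ex_derive_continuous_C, ex_derive_mult_C; [apply hol, hs|].
      apply ex_derive_kernel. intros ->. unfold Cminus in d1. rewrite Cplus_opp_r, Cmod_0 in d1. lra.
    - intros s hs. assert (d1 := square_dist p s r hr hs).
      rewrite Cmod_mult. rewrite Cmod_inv by (apply Cpow_nz, Cmod_pos_neq; lra). rewrite Cmod_pow.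
      apply Rmult_le_compat; [apply Cmod_ge_0 | | now apply hM |].
      + left. apply Rinv_0_lt_compat, pow_lt; lra.
      + apply Rinv_le_contravar; [lra|]. apply pow_incr; lra. }
  apply (f_equal Cmod) in e. rewrite Cmod_mult, Cmod_two_pi_i, Cmod_mult, Cmod_RtoC_pos in e by apply pos_INR.
  assert (hpi := PI2_3_2). unfold PI2 in hpi.
  set (A := Cmod (C_derive_n f k p)) in *. assert (hA : 0 <= A) by apply Cmod_ge_0.
  set (B := Cmod (RectInt _ _ _ _ _)) in *.
  assert (hk : 0 < r ^ k) by now apply pow_lt.
  replace (2 * (M * / r ^ S k) * (Re p + r - (Re p - r) + (Im p + r - (Im p - r)))) with
    (8 * (M / r ^ k)) in b by (simpl; field; split; lra).
  assert (c : INR (fact k) * B <= INR (fact k) * (8 * (M / r ^ k))) by (apply Rmult_le_compat_l; [apply pos_INR | lra]).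
  rewrite <- e in c. unfold Rdiv in *.
  assert (2 * A <= 2 * PI * A) by nra.
  assert (0 <= INR (fact k) * (M * / r ^ k)).
  { apply Rmult_le_pos; [apply pos_INR|]. apply Rmult_le_pos; [lra|]. left. now apply Rinv_0_lt_compat. }
  nra.
Qed.

(** Library lemmas leave equalities typed in the carrier of some algebraic structure; restating them
    in [R] or [C] lets [ring] and [field] recognise them. *)
Ltac req := cbv beta; match goal with |- ?a = ?b => change (@eq R a b) end.
Ltac ceq := cbv beta; match goal with |- ?a = ?b => change (@eq C a b) end.

Lemma CRInt_swap (f : R -> C) (a b : R) : ex_CRInt f a b ->
  CRInt f b a = (- CRInt f a b)%C.
Proof. intros h. symmetry. apply (opp_RInt_swap (V := C_R_CompleteNormedModule) f a b h). Qed.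

(** * The complementary error function *)

Section Primitive.
Variable f : C -> C.
Hypothesis hol : entire f.

Let cf (z : C) : continuous f z.
Proof. apply ex_derive_continuous_C, hol. exact I. Qed.
Let eH (y a b : R) : ex_CRInt (fun x => f (x, y)) a b.
Proof. apply ex_IntH. intros; apply cf. Qed.
Let eV (x a b : R) : ex_CRInt (fun y => f (x, y)) a b.
Proof. apply ex_IntV. intros; apply cf. Qed.

(** Rectangles with reversed sides are allowed, since the two endpoints of a primitive may lie in
    any relative position; swapping sides only changes the sign. *)
Lemma RectInt_entire (x1 x2 y1 y2 : R) : RectInt f x1 x2 y1 y2 = 0%C.
Proof.
  assert (sx : forall a b c d, RectInt f b a c d = (- RectInt f a b c d)%C).
  { intros a b c d. unfold RectInt, IntH. rewrite (CRInt_swap _ a b) by apply eH.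
    rewrite (CRInt_swap (fun x => f (x, d)) a b) by apply eH. ring. }
  assert (sy : forall a b c d, RectInt f a b d c = (- RectInt f a b c d)%C).
  { intros a b c d. unfold RectInt, IntV. rewrite (CRInt_swap _ c d) by apply eV.
    rewrite (CRInt_swap (fun y => f (a, y)) c d) by apply eV. ring. }
  assert (g : forall a b c d, a <= b -> c <= d -> RectInt f a b c d = 0%C).
  { intros a b c d hab hcd. apply goursat_rect; trivial. intros z _. now apply hol. }
  destruct (Rle_lt_dec x1 x2) as [hx|hx]; destruct (Rle_lt_dec y1 y2) as [hy|hy].
  - now apply g.
  - rewrite sy, g by lra. ring.
  - rewrite sx, g by lra. ring.
  - rewrite sx, sy, g by lra. ring.
Qed.

(** The integral along the L-shaped path from 0, horizontal and then vertical. Its differences are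
    integrals along such paths again, because rectangles contribute nothing. *)
Definition primitive (z : C) : C :=
  (IntH f 0 0 (Re z) + Ci * IntV f (Re z) 0 (Im z))%C.

Lemma primitive_sub (z z' : C) :
  (primitive z' - primitive z = IntH f (Im z) (Re z) (Re z') + Ci * IntV f (Re z') (Im z) (Im z'))%C.
Proof.
  destruct z as [x y]. destruct z' as [x' y']. unfold primitive. simpl Re. simpl Im.
  assert (h := RectInt_entire x x' 0 y). unfold RectInt in h.
  assert (c1 : IntH f 0 0 x' = (IntH f 0 0 x + IntH f 0 x x')%C)
    by (symmetry; apply (RInt_Chasles (V := C_R_CompleteNormedModule)); apply eH).
  assert (c2 : IntV f x' 0 y' = (IntV f x' 0 y + IntV f x' y y')%C)
    by (symmetry; apply (RInt_Chasles (V := C_R_CompleteNormedModule)); apply eV).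
  rewrite c1, c2.
  transitivity (IntH f y x x' + Ci * IntV f x' y y' +
    (IntH f 0 x x' + Ci * IntV f x' 0 y - IntH f y x x' - Ci * IntV f x 0 y))%C; [ring|].
  rewrite h. ring.
Qed.

Lemma CRInt_const (c : C) (a b : R) : CRInt (fun _ => c) a b = (RtoC (b - a) * c)%C.
Proof.
  rewrite (RInt_const (V := C_R_CompleteNormedModule)). destruct c as [u v].
  apply C_ext; unfold scal; simpl; unfold prod_scal, scal; simpl; unfold mult; simpl; ring.
Qed.

Lemma CRInt_bound_abs (g : R -> C) (M a b : R) : ex_CRInt g a b ->
  (forall t, Rmin a b <= t <= Rmax a b -> Cmod (g t) <= M) ->
  Cmod (CRInt g a b) <= Rabs (b - a) * M.
Proof.
  intros hex h. rewrite Cmod_norm.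
  apply (norm_RInt_le_const_abs (V := C_R_NormedModule) g a b); [|now apply CRInt_correct].
  intros t ht. assert (k := h t ht). rewrite Cmod_norm in k. exact k.
Qed.

Lemma is_derive_primitive (z : C) : is_derive primitive z (f z).
Proof.
  apply is_derive_C. intros e he.
  destruct (proj1 (continuous_C _ _) (cf z) (e / 2) ltac:(lra)) as (d & hd & k).
  exists (d / 2). split; [lra|]. intros s hs.
  destruct z as [x y]. destruct s as [x' y'].
  rewrite primitive_sub. simpl Re. simpl Im. set (c := f (x, y)) in *.
  assert (rx := re_le_Cmod ((x', y') - (x, y))). assert (ry := im_le_Cmod ((x', y') - (x, y))).
  revert rx ry. reim. intros rx ry.
  set (D := Cmod ((x', y') - (x, y))) in *.
  assert (near : forall u v, Rabs (u - x) <= Rabs (x' - x) -> Rabs (v - y) <= Rabs (y' - y) ->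
    Cmod (f (u, v) - c) <= e / 2).
  { intros u v hu hv. left. apply k. eapply Rle_lt_trans; [apply Cmod_le_re_im|]. reim. lra. }
  assert (mid : forall a b t, Rmin a b <= t <= Rmax a b -> Rabs (t - a) <= Rabs (b - a)).
  { intros a b t. unfold Rmin, Rmax. destruct (Rle_dec a b); intros ht.
    - rewrite !Rabs_pos_eq; lra.
    - rewrite !Rabs_left1; lra. }
  assert (z0 : Rabs 0 = 0) by apply Rabs_R0.
  replace (IntH f y x x' + Ci * IntV f x' y y' - ((x', y') - (x, y)) * c)%C with
    (CRInt (fun t => f (t, y) - c)%C x x' + Ci * CRInt (fun t => f (x', t) - c)%C y y')%C.
  2: { rewrite (CRInt_minus (fun t => f (t, y)) (fun _ => c)) ; [|apply eH|apply ex_RInt_const].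
       rewrite (CRInt_minus (fun t => f (x', t)) (fun _ => c)) ; [|apply eV|apply ex_RInt_const].
       rewrite !CRInt_const.
       unfold IntH, IntV. replace ((x', y') - (x, y))%C with (RtoC (x' - x) + Ci * RtoC (y' - y))%C.
       - ring.
       - apply C_ext; reim; ring. }
  eapply Rle_trans; [apply Cmod_triangle|]. rewrite Cmod_mult, Cmod_Ci, Rmult_1_l.
  assert (b1 : Cmod (CRInt (fun t => f (t, y) - c)%C x x') <= Rabs (x' - x) * (e / 2)).
  { apply CRInt_bound_abs.
    - apply (ex_RInt_minus (V := C_R_NormedModule)); [apply eH | apply ex_RInt_const].
    - intros t ht. apply near; [now apply mid|]. unfold Rminus at 1. rewrite Rplus_opp_r, z0. apply Rabs_pos. }
  assert (b2 : Cmod (CRInt (fun t => f (x', t) - c)%C y y') <= Rabs (y' - y) * (e / 2)).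
  { apply CRInt_bound_abs.
    - apply (ex_RInt_minus (V := C_R_NormedModule)); [apply eV | apply ex_RInt_const].
    - intros t ht. apply near; [lra | now apply mid]. }
  nra.
Qed.
End Primitive.

Definition gauss_int (x : R) : R := RInt (fun t => exp (- t ^ 2)) 0 x.

Lemma continuous_gauss (t : R) : continuous (fun t => exp (- t ^ 2)) t.
Proof. apply (ex_derive_continuous (fun t => exp (- t ^ 2))). auto_derive. trivial. Qed.

Lemma ex_gauss (a b : R) : ex_RInt (fun t => exp (- t ^ 2)) a b.
Proof. apply (ex_RInt_continuous (V := R_CompleteNormedModule)). intros; apply continuous_gauss. Qed.

Lemma is_derive_gauss_int (x : R) : is_derive gauss_int x (exp (- x ^ 2)).
Proof.
  apply (is_derive_RInt (fun t => exp (- t ^ 2)) gauss_int 0 x).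
  - exists (mkposreal 1 Rlt_0_1). intros y _. apply (RInt_correct (V := R_CompleteNormedModule)), ex_gauss.
  - apply continuous_gauss.
Qed.

(** The auxiliary function of the classical evaluation of the Gauss integral: its derivative is
    opposite to that of [gauss_int] squared, so their sum keeps its value PI / 4 at 0. *)
Definition gauss_aux (x : R) : R := RInt (fun t => exp (- (x ^ 2 * (1 + t ^ 2))) / (1 + t ^ 2)) 0 1.

Lemma one_plus_sqr_pos (t : R) : 0 < 1 + t ^ 2.
Proof. generalize (pow2_ge_0 t); lra. Qed.

Lemma ex_gauss_aux (x : R) : ex_RInt (fun t => exp (- (x ^ 2 * (1 + t ^ 2))) / (1 + t ^ 2)) 0 1.
Proof.
  apply (ex_RInt_continuous (V := R_CompleteNormedModule)). intros t _.
  apply (ex_derive_continuous (fun t => exp (- (x ^ 2 * (1 + t ^ 2))) / (1 + t ^ 2))).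
  auto_derive. generalize (one_plus_sqr_pos t). simpl. lra.
Qed.

Lemma is_derive_gauss_aux (x : R) :
  is_derive gauss_aux x (- 2 * exp (- x ^ 2) * gauss_int x).
Proof.
  assert (D : forall u t, Derive (fun z => exp (- (z ^ 2 * (1 + t ^ 2))) / (1 + t ^ 2)) u
     = - 2 * u * exp (- (u ^ 2 * (1 + t ^ 2)))).
  { intros u t. assert (hp := one_plus_sqr_pos t). apply is_derive_unique. auto_derive; [simpl in hp; lra|].
    simpl in *. field. lra. }
  replace (- 2 * exp (- x ^ 2) * gauss_int x) with
    (RInt (fun t => Derive (fun u => exp (- (u ^ 2 * (1 + t ^ 2))) / (1 + t ^ 2)) x) 0 1).
  - apply is_derive_RInt_param.
    + exists (mkposreal 1 Rlt_0_1). intros y _ t _. assert (hp := one_plus_sqr_pos t).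
      auto_derive. simpl in hp. lra.
    + intros t _. eapply continuity_2d_pt_ext; [intros; symmetry; apply D|].
      apply continuity_2d_pt_filterlim.
      apply (continuous_comp (fun z : R * R => (fst z, snd z)) (fun z : R * R => - 2 * fst z * exp (- (fst z ^ 2 * (1 + snd z ^ 2))))
         (x, t)).
      * eapply continuous_ext; [|apply continuous_id]. now intros [].
      * apply (continuous_mult (U := prod_UniformSpace R_UniformSpace R_UniformSpace) (K := R_AbsRing)
          (fun z : R * R => - 2 * fst z) (fun z : R * R => exp (- (fst z ^ 2 * (1 + snd z ^ 2))))).
        -- apply (continuous_mult (U := prod_UniformSpace R_UniformSpace R_UniformSpace) (K := R_AbsRing)
             (fun _ => - 2) fst); [apply continuous_const | apply continuous_fst].
        -- apply (continuous_comp (fun z : R * R => - (fst z ^ 2 * (1 + snd z ^ 2))) exp).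
           ++ assert (sq : forall p : R * R -> R, (forall z, continuous p z) -> forall z, continuous (fun z => p z ^ 2) z).
              { intros p hp z. apply (continuous_comp p (fun u => u ^ 2)); [apply hp|].
                apply (ex_derive_continuous (fun u => u ^ 2)). auto_derive; trivial. }
              apply (continuous_opp (U := prod_UniformSpace R_UniformSpace R_UniformSpace) (V := R_NormedModule)).
              apply (continuous_mult (U := prod_UniformSpace R_UniformSpace R_UniformSpace) (K := R_AbsRing)
                (fun z : R * R => fst z ^ 2) (fun z => 1 + snd z ^ 2)).
              ** apply sq. intros [a b]; apply continuous_fst.
              ** apply (continuous_plus (U := prod_UniformSpace R_UniformSpace R_UniformSpace) (V := R_NormedModule)
                  (fun _ => 1) (fun z => snd z ^ 2)); [apply continuous_const|].
                 apply sq. intros [a b]; apply continuous_snd.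
           ++ apply (ex_derive_continuous exp). auto_derive; trivial.
    + exists (mkposreal 1 Rlt_0_1). intros y _. apply ex_gauss_aux.
  - rewrite (RInt_ext _ (fun t => - 2 * exp (- x ^ 2) * (x * exp (- (x * t + 0) ^ 2)))).
    + rewrite (RInt_scal (V := R_CompleteNormedModule) (fun t => x * exp (- (x * t + 0) ^ 2))).
      2: { apply (ex_RInt_continuous (V := R_CompleteNormedModule)). intros t _.
           apply (ex_derive_continuous (fun t => x * exp (- (x * t + 0) ^ 2))). auto_derive; trivial. }
      assert (h := RInt_comp_lin (V := R_CompleteNormedModule) (fun t => exp (- t ^ 2)) x 0 0 1 (ex_gauss _ _)).
      unfold scal in *. simpl in *. unfold mult in *. simpl in *. rewrite h. unfold gauss_int.
      now replace (x * 0 + 0) with 0 by ring; replace (x * 1 + 0) with x by ring.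
    + intros t _. rewrite D. replace (- (x ^ 2 * (1 + t ^ 2))) with (- x ^ 2 + - (x * t + 0) ^ 2) by ring.
      rewrite exp_plus. req. ring.
Qed.

Lemma gauss_identity (x : R) : gauss_int x ^ 2 + gauss_aux x = PI / 4.
Proof.
  assert (h0 : gauss_int 0 ^ 2 + gauss_aux 0 = PI / 4).
  { unfold gauss_int. rewrite (RInt_point (V := R_CompleteNormedModule)). unfold gauss_aux.
    rewrite (RInt_ext _ (fun t => / (1 + t ^ 2))).
    - replace (PI / 4) with (atan 1 - atan 0) by (rewrite atan_1, atan_0; ring).
      assert (i := is_RInt_derive (V := R_CompleteNormedModule) atan (fun t => / (1 + t ^ 2)) 0 1).
      rewrite (is_RInt_unique (V := R_CompleteNormedModule) _ _ _ (minus (atan 1) (atan 0)) (i ltac:(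
        intros t _; auto_derive; [trivial | now rewrite Rmult_1_l]) ltac:(
        intros t _; apply (ex_derive_continuous (fun t => / (1 + t ^ 2))); auto_derive;
        generalize (one_plus_sqr_pos t); simpl; lra))).
      unfold zero, minus, plus, opp; simpl. ring.
    - intros t _. replace (- (0 ^ 2 * (1 + t ^ 2))) with 0 by ring. rewrite exp_0.
      req. unfold Rdiv; ring. }
  assert (hd : forall t, is_derive (fun u => gauss_int u ^ 2 + gauss_aux u) t 0).
  { intros t. assert (h1 := is_derive_gauss_int t). assert (h2 := is_derive_gauss_aux t).
    assert (h3 := is_derive_plus (V := R_NormedModule) _ _ _ _ _ (is_derive_pow gauss_int 2 t _ h1) h2).
    evar_last; [exact h3|]. unfold plus; simpl. req. ring. }
  rewrite <- h0. destruct (Rtotal_order x 0) as [h|[->|h]]; trivial.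
  - exact (eq_is_derive (V := R_NormedModule) _ _ _ (fun t _ => hd t) h).
  - exact (eq_sym (eq_is_derive (V := R_NormedModule) _ _ _ (fun t _ => hd t) h)).
Qed.

(** Factor PI / 4 - gauss_int^2 = gauss_aux as a product of sum and difference: the sum is at least
    1 / 2, and [gauss_aux] lies between 0 and exp (- x^2). *)
Lemma gauss_int_bound (x : R) : 0 <= x -> Rabs (gauss_int x - sqrt PI / 2) <= 2 * exp (- x ^ 2).
Proof.
  intros hx.
  assert (hg : 0 <= gauss_int x).
  { apply RInt_ge_0; [exact hx | apply ex_gauss|]. intros t _. left; apply exp_pos. }
  assert (ha : 0 <= gauss_aux x <= exp (- x ^ 2)).
  { split.
    - apply RInt_ge_0; [lra | apply ex_gauss_aux|]. intros t _. left.
      apply Rdiv_lt_0_compat; [apply exp_pos | apply one_plus_sqr_pos].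
    - replace (exp (- x ^ 2)) with (RInt (fun _ => exp (- x ^ 2)) 0 1).
      + apply RInt_le; [lra | apply ex_gauss_aux | apply ex_RInt_const|].
        intros t _. assert (hp := one_plus_sqr_pos t). assert (ht := pow2_ge_0 t).
        apply Rle_trans with (exp (- (x ^ 2 * (1 + t ^ 2)))).
        * apply Rmult_le_reg_r with (1 + t ^ 2); [lra|]. unfold Rdiv. rewrite Rmult_assoc, Rinv_l by lra.
          assert (he := exp_pos (- (x ^ 2 * (1 + t ^ 2)))). nra.
        * assert (h : - (x ^ 2 * (1 + t ^ 2)) <= - x ^ 2).
          { assert (hx2 := pow2_ge_0 x). nra. }
          destruct h as [h| ->]; [left; now apply exp_increasing | lra].
      + rewrite RInt_const. unfold scal; simpl; unfold mult; simpl. ring. }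
  assert (id := gauss_identity x).
  assert (hpi := PI2_3_2). unfold PI2 in hpi.
  assert (hs : sqrt PI * sqrt PI = PI) by (apply sqrt_sqrt; lra).
  assert (hs1 : 1 <= sqrt PI). { rewrite <- sqrt_1. apply sqrt_le_1_alt. lra. }
  set (q := sqrt PI) in *.
  assert (hle : gauss_int x <= q / 2) by nra.
  rewrite Rabs_left1 by lra. nra.
Qed.

Definition gauss_fun (s : C) : C := Cexp (- s ^ 2).
Definition gauss_prim : C -> C := primitive gauss_fun.

Lemma is_derive_gauss_fun (z : C) : is_derive gauss_fun z (- (2 * z) * gauss_fun z)%C.
Proof.
  unfold gauss_fun. eapply is_derive_ext_val.
  - apply (is_derive_comp_C Cexp (fun s => - s ^ 2)%C); [apply is_derive_Cexp|].
    apply is_derive_opp_C, is_derive_pow_C, is_derive_id_C.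
  - simpl. rewrite ?Cpow_1_r. cbv beta. replace (RtoC (1 + 1)) with (RtoC 2) by (f_equal; ring). ring.
Qed.

Lemma gauss_fun_entire : entire gauss_fun.
Proof. intros z _. eexists. apply is_derive_gauss_fun. Qed.

Lemma is_derive_gauss_prim (z : C) : is_derive gauss_prim z (gauss_fun z).
Proof. apply is_derive_primitive, gauss_fun_entire. Qed.

Lemma continuous_gauss_fun (z : C) : continuous gauss_fun z.
Proof. eapply is_derive_continuous_C, is_derive_gauss_fun. Qed.

Lemma is_derive_line (c d : C) (t : R) :
  is_derive (V := C_R_NormedModule) (fun t : R => c + t * d)%C t d.
Proof.
  apply is_derive_R_C. intros e he. exists 1. split; [lra|]. intros u _.
  replace (c + u * d - (c + t * d) - RtoC (u - t) * d)%C with (RtoC 0) by (rewrite RtoC_minus; ring).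
  rewrite Cmod_0. apply Rmult_le_pos; [lra | apply Rabs_pos].
Qed.

Lemma continuous_line (c d : C) (t : R) : continuous (fun t : R => c + t * d)%C t.
Proof.
  apply (ex_derive_continuous (K := R_AbsRing) (V := C_R_NormedModule)). eexists. apply is_derive_line.
Qed.

(** On the ray t s the function gauss_prim (t s) + gauss_prim (- t s) has derivative 0, the
    integrand being even, and it vanishes at t = 0. *)
Lemma gauss_prim_odd (s : C) : (gauss_prim (- s) = - gauss_prim s)%C.
Proof.
  assert (h0 : gauss_prim 0 = 0%C).
  { unfold gauss_prim, primitive, IntH, IntV. simpl. rewrite !(RInt_point (V := C_R_CompleteNormedModule)).
    match goal with |- context [@zero ?G] => change (@zero G) with (RtoC 0) end. ceq. ring. }
  assert (hd : forall t, is_derive (V := C_R_NormedModule)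
     (fun t : R => gauss_prim (0 + t * s) + gauss_prim (0 + t * (- s)))%C t (RtoC 0)).
  { intros t.
    assert (a := is_derive_path gauss_prim (fun t : R => 0 + t * s)%C t _ _ (is_derive_gauss_prim _) (is_derive_line 0 s t)).
    assert (b := is_derive_path gauss_prim (fun t : R => 0 + t * (- s))%C t _ _ (is_derive_gauss_prim _) (is_derive_line 0 (- s) t)).
    assert (c := is_derive_plus (V := C_R_NormedModule) _ _ _ _ _ a b).
    evar_last; [exact c|]. match goal with |- context [@plus ?G] => change (@plus G) with Cplus end.
    ceq.
    unfold gauss_fun. replace (- (0 + t * - s) ^ 2)%C with (- (0 + t * s) ^ 2)%C by (simpl; ring). ring. }
  assert (e := eq_is_derive (V := C_R_NormedModule) _ 0 1 (fun t _ => hd t) Rlt_0_1).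
  cbv beta in e. replace (0 + 0 * s)%C with (RtoC 0) in e by ring. replace (0 + 0 * - s)%C with (RtoC 0) in e by ring.
  replace (0 + 1 * s)%C with s in e by ring. replace (0 + 1 * - s)%C with (- s)%C in e by ring.
  rewrite h0 in e. apply Csub_eq_0.
  transitivity (gauss_prim s + gauss_prim (- s))%C; [ring|]. rewrite <- e. ring.
Qed.

Lemma is_RInt_gauss (s : C) (T : R) :
  is_CRInt (fun t : R => Cexp (- (s + t) ^ 2)) 0 T (gauss_prim (s + T) - gauss_prim s)%C.
Proof.
  assert (e : forall t : R, (s + t = s + t * 1)%C) by (intros; ring).
  assert (h := is_RInt_C_derive (fun t : R => gauss_prim (s + t * 1)%C) (fun t : R => Cexp (- (s + t * 1) ^ 2)) 0 T).
  eapply is_RInt_ext. 2: { evar_last. { apply h.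
    - intros t _. replace (Cexp (- (s + t * 1) ^ 2)) with (gauss_fun (s + t * 1) * 1)%C by (unfold gauss_fun; ring).
      apply (is_derive_path gauss_prim (fun t : R => s + t * 1)%C); [apply is_derive_gauss_prim | apply is_derive_line].
    - intros t _. apply (continuous_comp (fun t : R => s + t * 1)%C gauss_fun).
      + apply continuous_line.
      + apply continuous_gauss_fun. }
    f_equal; [f_equal; ring|]. f_equal. f_equal. ring. }
  intros t _. cbv beta. now rewrite <- e.
Qed.

(** Follow the L-shaped path: the horizontal part is the real Gauss integral, and on the vertical
    part of height [b] the integrand is at most exp (- (a + T)^2) exp (b^2). *)
Lemma gauss_prim_limit (s : C) (e : R) : 0 < e ->
  exists T0 : R, 0 <= T0 /\ forall T, T0 < T -> Cmod (gauss_prim (s + T) - sqrt PI / 2) < e.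
Proof.
  intros he. destruct s as [a b].
  set (K := 2 + Rabs b * exp (b ^ 2)).
  assert (hK : 2 <= K).
  { unfold K. assert (h := Rabs_pos b). assert (h' := exp_pos (b ^ 2)). nra. }
  exists (Rabs a + 1 + K / e).
  assert (ha := Rabs_pos a). assert (hKe : 0 < K / e) by (apply Rdiv_lt_0_compat; lra).
  split; [lra|]. intros T hT.
  assert (hx : 1 + K / e < a + T). { assert (h := Rle_abs (- a)). rewrite Rabs_Ropp in h. lra. }
  assert (hexp : exp (- (a + T) ^ 2) < e / K).
  { rewrite exp_Ropp. replace (e / K) with (/ (K / e)) by (field; lra).
    apply Rinv_lt_contravar.
    - apply Rmult_lt_0_compat; [lra | apply exp_pos].
    - assert (h := exp_ineq1_le ((a + T) ^ 2)). nra. }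
  unfold gauss_prim, primitive. rewrite Re_plus, Im_plus. simpl Re. simpl Im. rewrite Rplus_0_r.
  assert (g : IntH gauss_fun 0 0 (a + T) = RtoC (gauss_int (a + T))).
  { apply CRInt_unique, is_RInt_C_pair. split.
    - eapply is_RInt_ext; [|apply (RInt_correct (V := R_CompleteNormedModule)), ex_gauss].
      intros t _. unfold gauss_fun. replace (- ((t, 0) : C) ^ 2)%C with (RtoC (- t ^ 2)).
      + rewrite Cexp_RtoC. reflexivity.
      + apply C_ext; simpl; reim; simpl; ring.
    - assert (c0 := is_RInt_const (V := R_NormedModule) 0 (a + T) 0).
      replace (Im (RtoC (gauss_int (a + T)))) with (scal (a + T - 0) 0 : R_NormedModule) by (unfold scal; simpl; unfold mult; simpl; ring).
      eapply is_RInt_ext; [|exact c0].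
      intros t _. unfold gauss_fun. replace (- ((t, 0) : C) ^ 2)%C with (RtoC (- t ^ 2)).
      + rewrite Cexp_RtoC. reflexivity.
      + apply C_ext; simpl; reim; simpl; ring. }
  rewrite g.
  replace (gauss_int (a + T) + Ci * IntV gauss_fun (a + T) 0 b - sqrt PI / 2)%C with
    (RtoC (gauss_int (a + T) - sqrt PI / 2) + Ci * IntV gauss_fun (a + T) 0 b)%C.
  2: { rewrite RtoC_minus, RtoC_div by lra. ring. }
  eapply Rle_lt_trans; [apply Cmod_triangle|]. rewrite Cmod_R, Cmod_mult, Cmod_Ci, Rmult_1_l.
  assert (b1 := gauss_int_bound (a + T) ltac:(lra)).
  assert (b2 : Cmod (IntV gauss_fun (a + T) 0 b) <= Rabs (b - 0) * (exp (- (a + T) ^ 2) * exp (b ^ 2))).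
  { apply CRInt_bound_abs.
    - apply ex_IntV. intros; apply continuous_gauss_fun.
    - intros t ht. unfold gauss_fun. rewrite Cmod_Cexp, <- exp_plus.
      assert (h : Re (- (((a + T)%R, t) : C) ^ 2)%C <= - (a + T) ^ 2 + b ^ 2).
      { simpl. reim. simpl. revert ht. unfold Rmin, Rmax. destruct (Rle_dec 0 b); intros ht; nra. }
      destruct h as [h| ->]; [left; now apply exp_increasing | lra]. }
  rewrite Rminus_0_r in b2.
  assert (h : (2 + Rabs b * exp (b ^ 2)) * exp (- (a + T) ^ 2) < e).
  { fold K. apply Rmult_lt_compat_l with (r := K) in hexp; [|lra].
    replace (K * (e / K)) with e in hexp by (field; lra). exact hexp. }
  lra.
Qed.

(** Replaces the improper integral by an entire function; the reflection formula and the analyticity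
    of [Cerfc] are read off from this form. *)
Lemma Cerfc_eq (s : C) : Cerfc s = (1 - 2 / sqrt PI * gauss_prim s)%C.
Proof.
  assert (hpi : RtoC (sqrt PI) <> 0%C).
  { apply RtoC_neq_0. assert (h := sqrt_lt_R0 PI PI_RGT_0). lra. }
  unfold Cerfc.
  rewrite (is_RInt_gen_unique (V := C_R_CompleteNormedModule) _ (sqrt PI / 2 - gauss_prim s)%C).
  - field. exact hpi.
  - intros P hP. apply locally_C in hP. destruct hP as (e & he & hP).
    destruct (gauss_prim_limit s e he) as (T0 & _ & hT).
    exists (fun a => a = 0) (fun b => T0 < b).
    + reflexivity.
    + exists T0. trivial.
    + intros x y -> hy. simpl. exists (gauss_prim (s + y) - gauss_prim s)%C. split; [apply is_RInt_gauss|].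
      apply hP. replace (gauss_prim (s + y) - gauss_prim s - (sqrt PI / 2 - gauss_prim s))%C with
        (gauss_prim (s + y) - sqrt PI / 2)%C by ring. now apply hT.
Qed.

Lemma Cerfc_opp (s : C) : Cerfc (- s) = (2 - Cerfc s)%C.
Proof. rewrite !Cerfc_eq, gauss_prim_odd. ring. Qed.

Lemma ex_derive_Cerfc (s : C) : ex_derive Cerfc s.
Proof.
  apply (ex_derive_locally_ext (fun s => 1 - 2 / sqrt PI * gauss_prim s)%C _ _ 1 Rlt_0_1).
  - intros z _. now rewrite Cerfc_eq.
  - apply ex_derive_minus_C; [apply ex_derive_const_C|].
    apply ex_derive_mult_C; [apply ex_derive_const_C|]. eexists. apply is_derive_gauss_prim.
Qed.

Lemma exp_neg_sqr_le (T : R) : 1 <= T -> T ^ 2 * exp (- T ^ 2) <= 4 / T ^ 2.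
Proof.
  intros hT.
  assert (h := exp_ineq1_le (T ^ 2 / 2)).
  assert (e : exp (T ^ 2) = exp (T ^ 2 / 2) * exp (T ^ 2 / 2)) by (rewrite <- exp_plus; f_equal; field).
  assert (hT2 : 1 <= T ^ 2) by nra.
  assert (h2 : T ^ 2 * T ^ 2 / 4 <= exp (T ^ 2)) by (rewrite e; nra).
  rewrite exp_Ropp.
  apply Rmult_le_reg_r with (exp (T ^ 2) * T ^ 2).
  { apply Rmult_lt_0_compat; [apply exp_pos | lra]. }
  assert (hp := exp_pos (T ^ 2)).
  replace (T ^ 2 * / exp (T ^ 2) * (exp (T ^ 2) * T ^ 2)) with (T ^ 2 * T ^ 2) by (field; lra).
  replace (4 / T ^ 2 * (exp (T ^ 2) * T ^ 2)) with (4 * exp (T ^ 2)) by (field; lra). lra.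
Qed.

Section ErfcAsym.
Variable s : C.
Hypothesis (hs : 0 <= Re s) (hs0 : s <> 0%C).

Let u : C := (/ (2 * s))%C.
Let E (t : C) : C := Cexp (- (2 * s * t) - t ^ 2).
(** Three integrations by parts of exp (- 2 s t) against exp (- t^2) bring in the Hermite
    polynomials 1, 2 t and 4 t^2 - 2, weighted by powers of u = 1 / (2 s). [A] is the resulting
    approximate primitive of [E]; the next Hermite polynomial 8 t^3 - 12 t is what its derivative
    misses, with factor u^3. *)
Let q (t : C) : C := (1 - 2 * u * t + u ^ 2 * (4 * t ^ 2 - 2))%C.
Let A (t : C) : C := (- u * E t * q t)%C.

Let us : (2 * u * s = 1)%C.
Proof. unfold u. field. exact hs0. Qed.

Let dA (t : C) : is_derive A t (E t + u ^ 3 * (E t * (8 * t ^ 3 - 12 * t)))%C.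
Proof.
  assert (dE : is_derive E t ((- (2 * s) - 2 * t) * E t)%C).
  { unfold E. eapply is_derive_ext_val.
    - apply (is_derive_comp_C Cexp (fun t => - (2 * s * t) - t ^ 2)%C); [apply is_derive_Cexp|].
      apply is_derive_minus_C.
      + apply is_derive_opp_C, is_derive_mult_C; [apply is_derive_const_C | apply is_derive_id_C].
      + apply is_derive_pow_C, is_derive_id_C.
    - simpl. ceq. replace (RtoC (1 + 1)) with (RtoC 2) by (f_equal; ring). ring. }
  unfold A. eapply is_derive_ext_val.
  - apply is_derive_mult_C.
    + apply is_derive_mult_C; [apply is_derive_const_C | exact dE].
    + unfold q. apply is_derive_plus_C.
      * apply is_derive_minus_C; [apply is_derive_const_C|].
        apply is_derive_mult_C; [apply is_derive_const_C | apply is_derive_id_C].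
      * apply is_derive_mult_C; [apply is_derive_const_C|].
        apply is_derive_minus_C; [|apply is_derive_const_C].
        apply is_derive_mult_C; [apply is_derive_const_C | apply is_derive_pow_C, is_derive_id_C].
  - simpl. ceq. replace (RtoC (1 + 1)) with (RtoC 2) by (f_equal; ring).
    unfold q. set (e := E t). simpl. apply Csub_eq_0.
    transitivity ((2 * u * s - 1) * (e * (1 - 2 * u * t + u * u * (4 * (t * t) - 2))))%C; [ring|].
    rewrite us. ring.
Qed.

Let line (t : R) : (0 + t * 1 = t)%C. Proof. ring. Qed.

Let contE (t : R) : continuous (fun t : R => E t) t.
Proof.
  assert (h : continuous (fun t : R => E (0 + t * 1)) t).
  { apply (continuous_comp (fun t : R => 0 + t * 1)%C E); [apply continuous_line|].
    apply ex_derive_continuous_C. unfold E. apply ex_derive_comp_C; [apply ex_derive_Cexp|].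
    apply ex_derive_minus_C; [|apply ex_derive_pow_C, ex_derive_id_C].
    apply ex_derive_opp_C, ex_derive_mult_C; [apply ex_derive_const_C | apply ex_derive_id_C]. }
  eapply continuous_ext; [|exact h]. intros x. cbv beta. now rewrite line.
Qed.

Let R3 (t : R) : C := (E t * (8 * t ^ 3 - 12 * t))%C.

Let contR3 (t : R) : continuous R3 t.
Proof.
  assert (h : continuous (fun t : R => (fun z : C => E z * (8 * z ^ 3 - 12 * z)) (0 + t * 1))%C t).
  { apply (continuous_comp (fun t : R => 0 + t * 1)%C (fun z : C => E z * (8 * z ^ 3 - 12 * z))%C); [apply continuous_line|].
    apply ex_derive_continuous_C. apply ex_derive_mult_C.
    - unfold E. apply ex_derive_comp_C; [apply ex_derive_Cexp|].
      apply ex_derive_minus_C; [|apply ex_derive_pow_C, ex_derive_id_C].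
      apply ex_derive_opp_C, ex_derive_mult_C; [apply ex_derive_const_C | apply ex_derive_id_C].
    - apply ex_derive_minus_C; (apply ex_derive_mult_C; [apply ex_derive_const_C|]).
      + apply ex_derive_pow_C, ex_derive_id_C.
      + apply ex_derive_id_C. }
  eapply continuous_ext; [|exact h]. intros x. cbv beta. now rewrite line.
Qed.

Let CE (t : R) : 0 <= t -> Cmod (E t) <= exp (- t ^ 2).
Proof.
  intros ht. unfold E. rewrite Cmod_Cexp.
  assert (h : Re (- (2 * s * t) - t ^ 2)%C <= - t ^ 2).
  { rewrite <- RtoC_pow. reim. assert (0 <= Re s * t) by (apply Rmult_le_pos; assumption). lra. }
  destruct h as [h| ->]; [left; now apply exp_increasing | lra].
Qed.

Let intE (T : R) : CRInt (fun t : R => E t) 0 T = (A T - A 0 - u ^ 3 * CRInt R3 0 T)%C.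
Proof.
  assert (e1 : ex_CRInt (fun t : R => E t) 0 T) by (apply ex_RInt_C; intros; apply contE).
  assert (e2 : ex_CRInt R3 0 T) by (apply ex_RInt_C; intros; apply contR3).
  assert (h : CRInt (fun t : R => E t + u ^ 3 * R3 t)%C 0 T = (A T - A 0)%C).
  { apply CRInt_unique. replace (A T) with (A (0 + T * 1))%C by now rewrite line.
    replace (A 0) with (A (0 + 0 * 1))%C by now rewrite line.
    apply (is_RInt_C_derive (fun t : R => A (0 + t * 1)%C)).
    - intros t _. replace (E t + u ^ 3 * R3 t)%C with ((E (0 + t * 1)%C + u ^ 3 * (E (0 + t * 1)%C * (8 * (0 + t * 1) ^ 3 - 12 * (0 + t * 1)))) * 1)%C.
      + apply (is_derive_path A (fun t : R => 0 + t * 1)%C); [apply dA | apply is_derive_line].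
      + rewrite line. unfold R3. ring.
    - intros t _. apply (continuous_plus (V := C_R_NormedModule) (U := R_UniformSpace)); [apply contE|].
      apply continuous_R_C. intros e he. set (k := Cmod (u ^ 3) + 1).
      assert (hk : 1 <= k) by (unfold k; generalize (Cmod_ge_0 (u ^ 3)); lra).
      destruct (proj1 (continuous_R_C _ _) (contR3 t) (e / k)) as (d & hd & h); [apply Rdiv_lt_0_compat; lra|].
      exists d. split; [exact hd|]. intros x hx. specialize (h x hx).
      replace (u ^ 3 * R3 x - u ^ 3 * R3 t)%C with (u ^ 3 * (R3 x - R3 t))%C by ring.
      rewrite Cmod_mult. apply Rmult_lt_compat_l with (r := k) in h; [|lra].
      replace (k * (e / k)) with e in h by (field; lra).
      assert (h0 := Cmod_ge_0 (R3 x - R3 t)). unfold k in h. nra. }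
  rewrite CRInt_plus, CRInt_scal in h; trivial.
  2: { now apply ex_RInt_C_scal. }
  assert (alg : forall x y z w : C, (x + y * z = w)%C -> x = (w - y * z)%C) by (intros x y z w <-; ring).
  apply alg. exact h.
Qed.

(** The constant is the integral of exp (- t^2) (8 t^3 + 12 t) over the positive half-line, 4 + 6;
    its primitive [G] is explicit. *)
Let boundR3 (T : R) : 0 <= T -> Cmod (CRInt R3 0 T) <= 10.
Proof.
  intros hT.
  set (g := fun t : R => exp (- t ^ 2) * (8 * t ^ 3 + 12 * t)).
  set (G := fun t : R => - exp (- t ^ 2) * (4 * (t ^ 2 + 1) + 6)).
  assert (i : is_RInt g 0 T (minus (G T) (G 0))).
  { apply (is_RInt_derive (V := R_CompleteNormedModule)).
    - intros t _. unfold G, g. auto_derive; [trivial|]. simpl. req. ring.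
    - intros t _. apply (ex_derive_continuous g). unfold g. auto_derive. trivial. }
  assert (b : Cmod (CRInt R3 0 T) <= RInt g 0 T).
  { apply CRInt_bound; trivial.
    - apply ex_RInt_C. intros; apply contR3.
    - eexists; exact i.
    - intros t ht. unfold R3, g. rewrite Cmod_mult. apply Rmult_le_compat; try apply Cmod_ge_0; [apply CE; lra|].
      eapply Rle_trans; [apply Cmod_sub_le|]. rewrite !Cmod_mult, Cmod_pow, !Cmod_RtoC_pos by lra. lra. }
  rewrite (is_RInt_unique (V := R_CompleteNormedModule) _ _ _ _ i) in b.
  eapply Rle_trans; [exact b|]. unfold minus, plus, opp, G; simpl.
  replace (- (0 * (0 * 1))) with 0 by ring. rewrite exp_0.
  assert (h := exp_pos (- (T * (T * 1)))).
  assert (0 <= T * (T * 1)) by nra.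
  assert (0 <= exp (- (T * (T * 1))) * (4 * (T * (T * 1) + 1) + 6)) by (apply Rmult_le_pos; lra).
  lra.
Qed.

Let limA (e : R) : 0 < e -> exists T0, 0 <= T0 /\ forall T, T0 < T -> Cmod (A T) < e.
Proof.
  intros he. set (a := Cmod u). assert (ha : 0 <= a) by apply Cmod_ge_0.
  set (K := a * (1 + 2 * a + 6 * a ^ 2) * 4 + 1).
  assert (hK : 1 <= K). { unfold K. assert (0 <= a * (1 + 2 * a + 6 * a ^ 2)) by (apply Rmult_le_pos; nra). lra. }
  exists (1 + K / e). assert (hKe : 0 < K / e) by (apply Rdiv_lt_0_compat; lra).
  split; [lra|]. intros T hT.
  assert (hq : Cmod (q T) <= (1 + 2 * a + 6 * a ^ 2) * T ^ 2).
  { unfold q. eapply Rle_trans; [apply Cmod_triangle|].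
    eapply Rle_trans; [apply Rplus_le_compat_r, Cmod_sub_le|].
    rewrite !Cmod_mult, Cmod_pow, !Cmod_RtoC_pos by lra. fold a.
    assert (h : Cmod (4 * T ^ 2 - 2) <= 6 * T ^ 2).
    { eapply Rle_trans; [apply Cmod_sub_le|]. rewrite Cmod_mult, Cmod_pow, !Cmod_RtoC_pos by lra. nra. }
    assert (h2 : a ^ 2 * Cmod (4 * T ^ 2 - 2) <= a ^ 2 * (6 * T ^ 2)) by (apply Rmult_le_compat_l; nra).
    assert (1 <= T ^ 2) by nra. assert (T <= T ^ 2) by nra. assert (a * T <= a * T ^ 2) by (apply Rmult_le_compat_l; lra).
    lra. }
  assert (b := exp_neg_sqr_le T ltac:(lra)).
  unfold A. rewrite !Cmod_mult, Cmod_opp. fold a.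
  apply Rle_lt_trans with (a * (exp (- T ^ 2)) * ((1 + 2 * a + 6 * a ^ 2) * T ^ 2)).
  - apply Rmult_le_compat; try apply Cmod_ge_0; [apply Rmult_le_pos; [lra | apply Cmod_ge_0] | |exact hq].
    apply Rmult_le_compat_l; [lra|]. apply CE. lra.
  - replace (a * exp (- T ^ 2) * ((1 + 2 * a + 6 * a ^ 2) * T ^ 2)) with
      (a * (1 + 2 * a + 6 * a ^ 2) * (T ^ 2 * exp (- T ^ 2))) by ring.
    apply Rle_lt_trans with (a * (1 + 2 * a + 6 * a ^ 2) * (4 / T ^ 2)).
    { apply Rmult_le_compat_l; [apply Rmult_le_pos; nra | exact b]. }
    replace (a * (1 + 2 * a + 6 * a ^ 2) * (4 / T ^ 2)) with ((K - 1) / T ^ 2) by (unfold K; field; lra).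
    apply Rmult_lt_reg_r with (T ^ 2); [nra|]. unfold Rdiv. rewrite Rmult_assoc, Rinv_l, Rmult_1_r by nra.
    assert (K < e * T). { apply Rmult_lt_compat_l with (r := e) in hT; [|lra].
      replace (e * (1 + K / e)) with (e + K) in hT by (field; lra). lra. }
    assert (e * T <= e * T ^ 2) by (apply Rmult_le_compat_l; nra). lra.
Qed.

(** In 12 |u|^3, ten come from the remainder integral and two from the boundary value A 0 = - u + 2
    u^3; the contribution of [A] at infinity vanishes. *)
Lemma erfc_asym_aux :
  Cmod (Cexp (s ^ 2) * (sqrt PI / 2 - gauss_prim s) - u) <= 12 * Cmod u ^ 3.
Proof.
  apply Rnot_lt_le. intros hlt.
  set (D := Cmod (Cexp (s ^ 2) * (sqrt PI / 2 - gauss_prim s) - u)) in *.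
  set (e := (D - 12 * Cmod u ^ 3) / 2). assert (he : 0 < e) by (unfold e; lra).
  set (k := exp (Re (s ^ 2)%C)). assert (hk : 0 < k) by apply exp_pos.
  destruct (gauss_prim_limit s (e / k)) as (T1 & hT1 & l1); [now apply Rdiv_lt_0_compat|].
  destruct (limA e he) as (T2 & hT2 & l2).
  set (T := T1 + T2 + 1). specialize (l1 T ltac:(unfold T; lra)). specialize (l2 T ltac:(unfold T; lra)).
  assert (i1 : CRInt (fun t : R => E t) 0 T = (Cexp (s ^ 2) * (gauss_prim (s + T) - gauss_prim s))%C).
  { apply CRInt_unique. eapply is_RInt_ext; [|apply is_RInt_C_scal, is_RInt_gauss].
    intros t _. cbv beta. unfold E. rewrite <- Cexp_plus. f_equal. simpl. ring. }
  rewrite intE in i1.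
  assert (a0 : A 0 = (- u + 2 * u ^ 3)%C).
  { unfold A, E, q. replace (- (2 * s * 0) - 0 ^ 2)%C with (RtoC 0) by (simpl; ring). rewrite Cexp_0. simpl. ring. }
  assert (id : (Cexp (s ^ 2) * (sqrt PI / 2 - gauss_prim s) - u =
     (- Cexp (s ^ 2)) * (gauss_prim (s + T) - sqrt PI / 2) + A T + - (u ^ 3 * (2 + CRInt R3 0 T)))%C).
  { transitivity ((- Cexp (s ^ 2)) * (gauss_prim (s + T) - sqrt PI / 2) +
      Cexp (s ^ 2) * (gauss_prim (s + T) - gauss_prim s) - u)%C; [ring|].
    rewrite <- i1, a0. ring. }
  assert (b : D <= k * Cmod (gauss_prim (s + T) - sqrt PI / 2) + Cmod (A T) + Cmod u ^ 3 * (2 + 10)).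
  { unfold D. rewrite id. eapply Rle_trans; [apply Cmod_triangle|]. rewrite (Cmod_opp (u ^ 3 * _)), Cmod_mult, Cmod_pow.
    apply Rplus_le_compat.
    - eapply Rle_trans; [apply Cmod_triangle|]. rewrite Cmod_mult, Cmod_opp, Cmod_Cexp. fold k. lra.
    - apply Rmult_le_compat_l; [apply pow_le, Cmod_ge_0|]. eapply Rle_trans; [apply Cmod_triangle|].
      rewrite Cmod_RtoC_pos by lra. apply Rplus_le_compat_l, boundR3. unfold T; lra. }
  apply Rmult_lt_compat_l with (r := k) in l1; [|lra].
  replace (k * (e / k)) with e in l1 by (field; lra). unfold e in *. lra.
Qed.
End ErfcAsym.

Lemma erfc_asym (s : C) : 0 <= Re s -> s <> 0%C ->
  Cmod (Cexp (s ^ 2) * Cerfc s - 1 / (sqrt PI * s)) <= 2 / Cmod s ^ 3.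
Proof.
  intros hs hs0. assert (h := erfc_asym_aux s hs hs0).
  assert (hpi := PI2_3_2). unfold PI2 in hpi.
  assert (hq2 : sqrt PI * sqrt PI = PI) by (apply sqrt_sqrt; lra).
  assert (hq : 3 / 2 <= sqrt PI).
  { apply Rsqr_incr_0_var; [|apply sqrt_pos]. unfold Rsqr. rewrite hq2. lra. }
  assert (hqC : RtoC (sqrt PI) <> 0%C) by (apply RtoC_neq_0; lra).
  rewrite Cerfc_eq.
  replace (Cexp (s ^ 2) * (1 - 2 / sqrt PI * gauss_prim s) - 1 / (sqrt PI * s))%C with
    (2 / sqrt PI * (Cexp (s ^ 2) * (sqrt PI / 2 - gauss_prim s) - / (2 * s)))%C.
  2: { field. split; assumption. }
  assert (hc : 0 < Cmod s) by now apply Cmod_gt_0.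
  assert (hc3 : 0 < Cmod s ^ 3) by now apply pow_lt.
  rewrite Cmod_mult, Cmod_div by assumption. rewrite !Cmod_RtoC_pos by lra.
  apply Rle_trans with (2 / sqrt PI * (12 * Cmod (/ (2 * s)) ^ 3)).
  { apply Rmult_le_compat_l; [|exact h]. apply Rdiv_le_0_compat; lra. }
  rewrite Cmod_inv, Cmod_mult, Cmod_RtoC_pos by (try lra; apply Cmult_neq_0; trivial; apply RtoC_neq_0; lra).
  (* With u = 1 / (2 s) the factor 12 becomes 12 / 8, and 3 / sqrt PI <= 2 because sqrt PI >= 3 /
     2. *)
  replace (2 / sqrt PI * (12 * (/ (2 * Cmod s)) ^ 3)) with (3 / sqrt PI * / Cmod s ^ 3) by (field; lra).
  unfold Rdiv. apply Rmult_le_compat_r; [left; now apply Rinv_0_lt_compat|].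
  apply Rmult_le_reg_r with (sqrt PI); [lra|]. rewrite Rmult_assoc, Rinv_l by lra. lra.
Qed.

(** * The gamma function *)

Definition Ccv (u : nat -> C) (l : C) : Prop :=
  forall e : R, 0 < e -> exists N : nat, forall m, (N <= m)%nat -> Cmod (u m - l) < e.

Definition Climit (u : nat -> C) : C :=
  (real (Lim_seq (fun n => Re (u n))), real (Lim_seq (fun n => Im (u n)))).

Lemma Ccv_re (u : nat -> C) (l : C) : Ccv u l -> is_lim_seq (fun n => Re (u n)) (Re l).
Proof.
  intros h. apply is_lim_seq_spec. intros e. destruct (h e (cond_pos e)) as [N hN].
  exists N. intros m hm. eapply Rle_lt_trans; [|exact (hN m hm)]. rewrite <- Re_minus. apply re_le_Cmod.
Qed.

Lemma Ccv_im (u : nat -> C) (l : C) : Ccv u l -> is_lim_seq (fun n => Im (u n)) (Im l).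
Proof.
  intros h. apply is_lim_seq_spec. intros e. destruct (h e (cond_pos e)) as [N hN].
  exists N. intros m hm. eapply Rle_lt_trans; [|exact (hN m hm)]. rewrite <- Im_minus. apply im_le_Cmod.
Qed.

Lemma Ccv_of_re_im (u : nat -> C) (a b : R) :
  is_lim_seq (fun n => Re (u n)) a -> is_lim_seq (fun n => Im (u n)) b -> Ccv u (a, b).
Proof.
  intros h1 h2 e he. apply is_lim_seq_spec in h1. apply is_lim_seq_spec in h2.
  assert (he2 : 0 < e / 2) by lra.
  destruct (h1 (mkposreal _ he2)) as [N1 k1]. destruct (h2 (mkposreal _ he2)) as [N2 k2]. simpl in *.
  exists (N1 + N2)%nat. intros m hm. eapply Rle_lt_trans; [apply Cmod_le_re_im|].
  reim. specialize (k1 m ltac:(lia)). specialize (k2 m ltac:(lia)). lra.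
Qed.

Lemma Climit_unique (u : nat -> C) (l : C) : Ccv u l -> Climit u = l.
Proof.
  intros h. unfold Climit. rewrite (is_lim_seq_unique _ _ (Ccv_re u l h)), (is_lim_seq_unique _ _ (Ccv_im u l h)).
  now destruct l.
Qed.

Lemma Ccv_unique (u : nat -> C) (l l' : C) : Ccv u l -> Ccv u l' -> l = l'.
Proof. intros h h'. now rewrite <- (Climit_unique u l h), <- (Climit_unique u l' h'). Qed.

Lemma Ccv_mult (u v : nat -> C) (a b : C) : Ccv u a -> Ccv v b -> Ccv (fun n => u n * v n)%C (a * b)%C.
Proof.
  intros hu hv e he.
  set (A := Cmod a + 1). set (B := Cmod b + 1).
  assert (hA : 1 <= A) by (unfold A; generalize (Cmod_ge_0 a); lra).
  assert (hB : 1 <= B) by (unfold B; generalize (Cmod_ge_0 b); lra).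
  destruct (hu (Rmin 1 (e / (2 * B)))) as [N1 k1].
  { apply Rmin_pos; [lra | apply Rdiv_lt_0_compat; lra]. }
  destruct (hv (e / (2 * A))) as [N2 k2]. { apply Rdiv_lt_0_compat; lra. }
  exists (N1 + N2)%nat. intros m hm. specialize (k1 m ltac:(lia)). specialize (k2 m ltac:(lia)).
  assert (l1 := Rlt_le_trans _ _ _ k1 (Rmin_l _ _)). assert (l2 := Rlt_le_trans _ _ _ k1 (Rmin_r _ _)).
  replace (u m * v m - a * b)%C with (u m * (v m - b) + (u m - a) * b)%C by ring.
  eapply Rle_lt_trans; [apply Cmod_triangle|]. rewrite !Cmod_mult.
  assert (hfs : Cmod (u m) <= A).
  { replace (u m) with ((u m - a) + a)%C by ring. eapply Rle_trans; [apply Cmod_triangle|]. unfold A. lra. }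
  assert (a1 : Cmod (u m) * Cmod (v m - b) <= A * Cmod (v m - b)).
  { apply Rmult_le_compat_r; [apply Cmod_ge_0 | exact hfs]. }
  assert (a2 : A * Cmod (v m - b) < e / 2).
  { apply Rmult_lt_compat_l with (r := A) in k2; [|lra].
    replace (A * (e / (2 * A))) with (e / 2) in k2 by (field; lra). exact k2. }
  assert (a3 : Cmod (u m - a) * Cmod b <= e / 2).
  { apply Rle_trans with (e / (2 * B) * B).
    - apply Rmult_le_compat; [apply Cmod_ge_0 | apply Cmod_ge_0 | left; exact l2 | unfold B; lra].
    - right; field; lra. }
  lra.
Qed.

Lemma Ccv_plus (u v : nat -> C) (a b : C) : Ccv u a -> Ccv v b -> Ccv (fun n => u n + v n)%C (a + b)%C.
Proof.
  intros hu hv e he. destruct (hu (e / 2)) as [N1 k1]; [lra|]. destruct (hv (e / 2)) as [N2 k2]; [lra|].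
  exists (N1 + N2)%nat. intros m hm. specialize (k1 m ltac:(lia)). specialize (k2 m ltac:(lia)).
  replace (u m + v m - (a + b))%C with ((u m - a) + (v m - b))%C by ring.
  eapply Rle_lt_trans; [apply Cmod_triangle|]. lra.
Qed.

Lemma Ccv_const (a : C) : Ccv (fun _ => a) a.
Proof. intros e he. exists O. intros m _. unfold Cminus. rewrite Cplus_opp_r, Cmod_0. exact he. Qed.

Lemma Ccv_minus (u v : nat -> C) (a b : C) : Ccv u a -> Ccv v b -> Ccv (fun n => u n - v n)%C (a - b)%C.
Proof.
  intros hu hv. replace (a - b)%C with (a + (- (1)) * b)%C by ring.
  assert (h := Ccv_plus _ _ _ _ hu (Ccv_mult _ _ _ _ (Ccv_const (- (1))%C) hv)).
  intros e he. destruct (h e he) as [N k]. exists N. intros m hm. specialize (k m hm).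
  replace (u m - v m)%C with (u m + (- (1)) * v m)%C by ring. exact k.
Qed.

Lemma Ccv_ext (u v : nat -> C) (l : C) (N0 : nat) :
  (forall m, (N0 <= m)%nat -> u m = v m) -> Ccv u l -> Ccv v l.
Proof.
  intros hext h e he. destruct (h e he) as [N k]. exists (N + N0)%nat. intros m hm.
  rewrite <- hext by lia. apply k. lia.
Qed.

Lemma Ccv_Cmod_le (u : nat -> C) (l : C) (B : R) (N0 : nat) :
  (forall m, (N0 <= m)%nat -> Cmod (u m) <= B) -> Ccv u l -> Cmod l <= B.
Proof.
  intros hb h. apply Rnot_lt_le. intros hlt.
  destruct (h (Cmod l - B) ltac:(lra)) as [N k]. specialize (k (N + N0)%nat ltac:(lia)).
  specialize (hb (N + N0)%nat ltac:(lia)).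
  assert (t := Cmod_sub_ge l (u (N + N0)%nat)). rewrite Cmod_sub_sym in t. lra.
Qed.

Lemma Ccv_Cmod_compare (u v : nat -> C) (a b : C) (K : R) : 0 <= K ->
  (forall m, (1 <= m)%nat -> Cmod (u m) <= K * Cmod (v m)) -> Ccv u a -> Ccv v b -> Cmod a <= K * Cmod b.
Proof.
  intros hK hb hu hv. apply Rnot_lt_le. intros hlt.
  set (d := Cmod a - K * Cmod b) in *.
  destruct (hu (d / 2)) as [N1 k1]; [unfold d; lra|].
  destruct (hv (d / (2 * (K + 1)))) as [N2 k2]; [apply Rdiv_lt_0_compat; unfold d; lra|].
  specialize (k1 (N1 + N2 + 1)%nat ltac:(lia)). specialize (k2 (N1 + N2 + 1)%nat ltac:(lia)).
  specialize (hb (N1 + N2 + 1)%nat ltac:(lia)). set (m := (N1 + N2 + 1)%nat) in *.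
  assert (t := Cmod_sub_ge a (u m)). rewrite Cmod_sub_sym in t. assert (t' := Cmod_sub_ge (v m) b).
  assert (K * Cmod (v m - b) <= d / 2).
  { apply Rle_trans with ((K + 1) * Cmod (v m - b)); [generalize (Cmod_ge_0 (v m - b)); nra|].
    apply Rmult_lt_compat_l with (r := K + 1) in k2; [|lra].
    replace ((K + 1) * (d / (2 * (K + 1)))) with (d / 2) in k2 by (field; lra). lra. }
  assert (K * Cmod (v m) <= K * (Cmod b + Cmod (v m - b))) by (apply Rmult_le_compat_l; lra).
  unfold d in *. lra.
Qed.

(** Bounds sums of inverse squares by a telescoping sum. All the convergence arguments below (gamma
    products, digamma sums, Dirichlet tails) rest on it. *)
Lemma inv_sqr_telescope (x : R) : 1 <= x -> / (x ^ 2) <= 2 * (/ x - / (x + 1)).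
Proof.
  intros hx. replace (/ x - / (x + 1)) with (/ (x * (x + 1))) by (field; lra).
  replace (/ x ^ 2) with (2 * / (2 * x ^ 2)) by (field; lra).
  apply Rmult_le_compat_l; [lra|]. apply Rinv_le_contravar; nra.
Qed.

Lemma Ccv_increments (u : nat -> C) (K : R) (m0 : nat) : (1 <= m0)%nat -> 0 <= K ->
  (forall m, (m0 <= m)%nat -> Cmod (u (S m) - u m) <= K / INR m ^ 2) -> exists l, Ccv u l.
Proof.
  intros hm0 hK h.
  assert (hc : forall m k, (m0 <= m)%nat -> Cmod (u (m + k)%nat - u m) <= 2 * K * (/ INR m - / INR (m + k))).
  { intros m k hm. induction k as [|k IH].
    - rewrite Nat.add_0_r. unfold Cminus. rewrite Cplus_opp_r, Cmod_0. lra.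
    - eapply Rle_trans; [apply (Cmod_sub_triangle _ (u (m + k)%nat))|].
      replace (m + S k)%nat with (S (m + k)) by lia.
      specialize (h (m + k)%nat ltac:(lia)).
      assert (h1 : 1 <= INR (m + k)) by (replace 1 with (INR 1) by reflexivity; apply le_INR; lia).
      assert (t := inv_sqr_telescope _ h1). rewrite (S_INR (m + k)).
      assert (K / INR (m + k) ^ 2 <= K * (2 * (/ INR (m + k) - / (INR (m + k) + 1)))).
      { apply Rmult_le_compat_l; assumption. }
      lra. }
  assert (cau : forall g : C -> R, (forall a b, Rabs (g a - g b) <= Cmod (a - b)) ->
    exists l : R, is_lim_seq (fun n => g (u n)) l).
  { intros g hg. apply ex_lim_seq_cauchy_corr. intros e.
    assert (hx : exists N, (m0 <= N)%nat /\ 4 * K / INR N < e).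
    { destruct (nfloor_ex (4 * K / e)) as [n hn].
      { apply Rdiv_le_0_compat; [lra | apply cond_pos]. }
      exists (n + 1 + m0)%nat. split; [lia|].
      assert (hp : 0 < INR (n + 1 + m0)) by (apply lt_0_INR; lia).
      apply Rmult_lt_reg_r with (1 := hp). unfold Rdiv. rewrite Rmult_assoc, Rinv_l, Rmult_1_r by lra.
      assert (he := cond_pos e).
      assert (h2 : 4 * K / e < INR (n + 1 + m0)).
      { rewrite !plus_INR. simpl. assert (hh := pos_INR m0). lra. }
      apply Rmult_lt_compat_l with (r := e) in h2; [|lra].
      replace (e * (4 * K / e)) with (4 * K) in h2 by (field; lra). exact h2. }
    destruct hx as (N & hN & hNe). exists N.
    assert (close : forall n, (N <= n)%nat -> Rabs (g (u n) - g (u N)) < e / 2).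
    { intros n hn. eapply Rle_lt_trans; [apply hg|].
      replace n with (N + (n - N))%nat by lia. eapply Rle_lt_trans; [now apply hc|].
      assert (hp : 0 < INR (N + (n - N))) by (apply lt_0_INR; lia).
      assert (0 < / INR (N + (n - N))) by now apply Rinv_0_lt_compat.
      unfold Rdiv in hNe. nra. }
    intros n m hn hm. replace (g (u n) - g (u m)) with ((g (u n) - g (u N)) - (g (u m) - g (u N))) by ring.
    eapply Rle_lt_trans; [apply Rabs_triang|]. rewrite Rabs_Ropp.
    generalize (close n hn) (close m hm). lra. }
  destruct (cau Re) as [a ha]. { intros x y. rewrite <- Re_minus. apply re_le_Cmod. }
  destruct (cau Im) as [b hb]. { intros x y. rewrite <- Im_minus. apply im_le_Cmod. }
  exists (a, b). now apply Ccv_of_re_im.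
Qed.

(** The quantity |u m| exp (2 K / m) does not increase: a step multiplies |u m| by at most exp (K /
    m^2), which the telescoping bound compensates. *)
Lemma product_bound (u : nat -> C) (K : R) (m0 : nat) : (1 <= m0)%nat -> 0 <= K ->
  (forall m, (m0 <= m)%nat -> Cmod (u (S m) - u m) <= K / INR m ^ 2 * Cmod (u m)) ->
  forall m, (m0 <= m)%nat -> Cmod (u m) <= Cmod (u m0) * exp (2 * K).
Proof.
  intros hm0 hK h.
  assert (hc : forall k, Cmod (u (m0 + k)%nat) * exp (2 * K / INR (m0 + k)) <= Cmod (u m0) * exp (2 * K / INR m0)).
  { induction k as [|k IH].
    - rewrite Nat.add_0_r. lra.
    - eapply Rle_trans; [|exact IH]. replace (m0 + S k)%nat with (S (m0 + k)) by lia.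
      set (m := (m0 + k)%nat) in *. specialize (h m ltac:(unfold m; lia)).
      assert (h1 : 1 <= INR m) by (replace 1 with (INR 1) by reflexivity; apply le_INR; unfold m; lia).
      assert (t := inv_sqr_telescope _ h1). rewrite (S_INR m).
      assert (h2 : Cmod (u (S m)) <= Cmod (u m) * exp (K / INR m ^ 2)).
      { replace (u (S m)) with ((u (S m) - u m) + u m)%C by ring.
        eapply Rle_trans; [apply Cmod_triangle|].
        assert (hexp := exp_ineq1_le (K / INR m ^ 2)). assert (hp := Cmod_ge_0 (u m)). nra. }
      apply Rle_trans with (Cmod (u m) * exp (K / INR m ^ 2) * exp (2 * K / (INR m + 1))).
      { apply Rmult_le_compat_r; [left; apply exp_pos | exact h2]. }
      rewrite Rmult_assoc, <- exp_plus. apply Rmult_le_compat_l; [apply Cmod_ge_0|].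
      assert (h3 : K / INR m ^ 2 + 2 * K / (INR m + 1) <= 2 * K / INR m).
      { assert (K / INR m ^ 2 <= K * (2 * (/ INR m - / (INR m + 1)))) by (apply Rmult_le_compat_l; assumption).
        unfold Rdiv in *. lra. }
      destruct h3 as [h3| ->]; [left; now apply exp_increasing | lra]. }
  intros m hm. specialize (hc (m - m0)%nat). replace (m0 + (m - m0))%nat with m in hc by lia.
  assert (h1 : 1 <= INR m0) by (replace 1 with (INR 1) by reflexivity; apply le_INR; lia).
  assert (h1' : 1 <= INR m) by (replace 1 with (INR 1) by reflexivity; apply le_INR; lia).
  assert (e1 : 1 <= exp (2 * K / INR m)).
  { assert (q := exp_ineq1_le (2 * K / INR m)). assert (0 <= 2 * K / INR m) by (apply Rdiv_le_0_compat; lra). lra. }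
  assert (e2 : exp (2 * K / INR m0) <= exp (2 * K)).
  { assert (hle : 2 * K / INR m0 <= 2 * K).
    { apply Rmult_le_reg_r with (INR m0); [lra|]. unfold Rdiv. rewrite Rmult_assoc, Rinv_l by lra. nra. }
    destruct hle as [hle| ->]; [left; now apply exp_increasing | lra]. }
  assert (p1 := Cmod_ge_0 (u m)). assert (p2 := Cmod_ge_0 (u m0)). nra.
Qed.

Lemma Ccv_product (u : nat -> C) (K : R) (m0 : nat) : (1 <= m0)%nat -> 0 <= K ->
  (forall m, (m0 <= m)%nat -> Cmod (u (S m) - u m) <= K / INR m ^ 2 * Cmod (u m)) -> exists l, Ccv u l.
Proof.
  intros hm0 hK h. assert (b := product_bound u K m0 hm0 hK h).
  set (B := Cmod (u m0) * exp (2 * K)) in *.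
  assert (hB : 0 <= B) by (apply Rmult_le_pos; [apply Cmod_ge_0 | left; apply exp_pos]).
  apply (Ccv_increments u (K * B) m0 hm0); [now apply Rmult_le_pos|].
  intros m hm. eapply Rle_trans; [now apply h|].
  assert (hp : 0 < INR m ^ 2) by (apply pow_lt, lt_0_INR; lia).
  replace (K * B / INR m ^ 2) with (K / INR m ^ 2 * B) by (field; apply not_0_INR; lia).
  apply Rmult_le_compat_l; [apply Rdiv_le_0_compat; lra | now apply b].
Qed.

Lemma Cprod_neq_0 (f : nat -> C) (n : nat) : (forall k, (k < n)%nat -> f k <> 0%C) -> Cprod f n <> 0%C.
Proof.
  induction n as [|n IH]; intros h; simpl.
  - apply RtoC_neq_0. lra.
  - apply Cmult_neq_0; [apply IH; intros; apply h; lia | apply h; lia].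
Qed.

Lemma not_pole_add (z : C) (k : nat) : ~ gamma_pole z -> (z + INR k)%C <> 0%C.
Proof. intros h e. apply h. exists k. apply Csub_eq_0. rewrite <- e. ring. Qed.

Lemma not_pole_Re (z : C) : 0 < Re z -> ~ gamma_pole z.
Proof. intros h [k e]. rewrite e in h. revert h. reim. generalize (pos_INR k). lra. Qed.

Lemma Rcpow_neq_0 (x : R) (z : C) : Rcpow x z <> 0%C.
Proof. apply Cexp_neq_0. Qed.

Lemma Cmod_Rcpow (x : R) (z : C) : Cmod (Rcpow x z) = exp (Re z * ln x).
Proof. unfold Rcpow. rewrite Cmod_Cexp. reim. f_equal. ring. Qed.

Lemma Cprod_add_neq_0 (z : C) (n : nat) : ~ gamma_pole z -> Cprod (fun k => z + INR k)%C n <> 0%C.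
Proof. intros h. apply Cprod_neq_0. intros k _. now apply not_pole_add. Qed.

Lemma gauss_gamma_neq_0 (z : C) (n : nat) : ~ gamma_pole z -> gauss_gamma z n <> 0%C.
Proof.
  intros h. unfold gauss_gamma. apply Cmult_neq_0.
  - apply Cmult_neq_0; [apply RtoC_neq_0, INR_fact_neq_0 | apply Rcpow_neq_0].
  - intros e. assert (h2 := Cprod_add_neq_0 z (S n) h).
    assert (h3 : (Cprod (fun k => z + INR k) (S n) * / Cprod (fun k => z + INR k) (S n) = 1)%C) by (field; exact h2).
    rewrite e in h3. apply (f_equal Re) in h3. revert h3. reim. lra.
Qed.

Lemma ln_step (m : nat) : (1 <= m)%nat ->
  / (INR m + 1) <= ln (INR m + 1) - ln (INR m) <= / INR m.
Proof.
  intros hm. assert (h1 : 1 <= INR m) by (replace 1 with (INR 1) by reflexivity; apply le_INR; lia).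
  assert (L : forall t, 0 < t -> ln t <= t - 1).
  { intros t ht. assert (h := exp_ineq1_le (ln t)). rewrite exp_ln in h by exact ht. lra. }
  rewrite <- ln_div by lra. split.
  - replace (ln ((INR m + 1) / INR m)) with (- ln (INR m / (INR m + 1))).
    + assert (h := L (INR m / (INR m + 1)) ltac:(apply Rdiv_lt_0_compat; lra)).
      replace (INR m / (INR m + 1) - 1) with (- / (INR m + 1)) in h by (field; lra). lra.
    + rewrite <- ln_Rinv by (apply Rdiv_lt_0_compat; lra). f_equal. field. lra.
  - eapply Rle_trans; [apply L; apply Rdiv_lt_0_compat; lra|]. right. field. lra.
Qed.

(** The quotient of consecutive Gauss products. The terms of order 1 / m of numerator and
    denominator agree, so it is 1 + O(1 / m^2), and the product converges. *)
Definition gamma_ratio (z : C) (m : nat) : C :=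
  (Cexp (z * (ln (INR m + 1) - ln (INR m))) / (1 + z / (INR m + 1)))%C.

Lemma gauss_gamma_S (z : C) (m : nat) : (1 <= m)%nat -> ~ gamma_pole z ->
  gauss_gamma z (S m) = (gauss_gamma z m * gamma_ratio z m)%C.
Proof.
  intros hm hz. assert (h1 : 1 <= INR m) by (replace 1 with (INR 1) by reflexivity; apply le_INR; lia).
  unfold gauss_gamma, gamma_ratio.
  assert (e : Rcpow (INR (S m)) z = (Rcpow (INR m) z * Cexp (z * (ln (INR m + 1) - ln (INR m))))%C).
  { unfold Rcpow. rewrite <- Cexp_plus, S_INR. f_equal. ring. }
  rewrite e, fact_simpl, mult_INR, RtoC_mult.
  change (Cprod (fun k => z + INR k)%C (S (S m))) with (Cprod (fun k => z + INR k) (S m) * (z + INR (S m)))%C.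
  rewrite S_INR, RtoC_plus.
  assert (n1 := Cprod_add_neq_0 z (S m) hz). assert (n2 := not_pole_add z (S m) hz).
  rewrite S_INR, RtoC_plus in n2.
  assert (n3 : (INR m + 1)%C <> 0%C) by (rewrite <- RtoC_plus; apply RtoC_neq_0; lra).
  field. repeat split; trivial.
  intros e0. apply n2. rewrite <- e0. ring.
Qed.

Lemma one_plus_div_ge (z : C) (x : R) : 0 < x -> 2 * Cmod z <= x -> 1 / 2 <= Cmod (1 + z / x).
Proof.
  intros hx h. assert (hxC : RtoC x <> 0%C) by (apply RtoC_neq_0; lra).
  assert (t := Cmod_sub_ge 1 (- (z / x))%C).
  replace (1 - - (z / x))%C with (1 + z / x)%C in t by ring.
  rewrite Cmod_1, Cmod_opp, Cmod_div, (Cmod_RtoC_pos x) in t by (try assumption; lra).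
  assert (Cmod z / x <= 1 / 2); [|lra].
  apply Rmult_le_reg_r with x; [lra|]. unfold Rdiv. rewrite Rmult_assoc, Rinv_l by lra. lra.
Qed.

Lemma gamma_ratio_near (z : C) (m : nat) (B : R) : (1 <= m)%nat -> Cmod z <= B -> 2 * B <= INR m ->
  Cmod (gamma_ratio z m - 1) <= 2 * (B + 4 * B ^ 2) / INR m ^ 2.
Proof.
  intros hm hzB hBm. assert (h1 : 1 <= INR m) by (replace 1 with (INR 1) by reflexivity; apply le_INR; lia).
  assert (hz0 := Cmod_ge_0 z).
  destruct (ln_step m hm) as [l1 l2]. set (l := ln (INR m + 1) - ln (INR m)) in *.
  assert (d := one_plus_div_ge z (INR m + 1) ltac:(lra) ltac:(lra)).
  assert (dn : (1 + z / (INR m + 1)%R)%C <> 0%C) by (apply Cmod_pos_neq; lra).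
  unfold gamma_ratio. rewrite <- RtoC_plus, <- RtoC_minus. fold l.
  replace (Cexp (z * l) / (1 + z / (INR m + 1)%R) - 1)%C with
    ((Cexp (z * l) - 1 - z * l + z * (l - / (INR m + 1)%R)) / (1 + z / (INR m + 1)%R))%C.
  2: { field. split; [apply RtoC_neq_0; lra|]. intros e0. apply dn.
       assert (hxC : RtoC (INR m + 1) <> 0%C) by (apply RtoC_neq_0; lra).
       replace (1 + z / (INR m + 1)%R)%C with (((INR m + 1)%R + z) / (INR m + 1)%R)%C by (field; exact hxC).
       rewrite e0. field. exact hxC. }
  rewrite Cmod_div by exact dn.
  assert (hl0 : 0 <= l). { eapply Rle_trans; [|exact l1]. left; apply Rinv_0_lt_compat; lra. }
  assert (hl : Cmod (z * l) <= B / INR m).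
  { rewrite Cmod_mult, Cmod_RtoC_pos by exact hl0. apply Rmult_le_compat; assumption. }
  assert (hBm2 : B / INR m <= 1 / 2).
  { apply Rmult_le_reg_r with (INR m); [lra|]. unfold Rdiv. rewrite Rmult_assoc, Rinv_l by lra. lra. }
  assert (q := Cexp_quad (z * l) ltac:(lra)).
  assert (n1 : Cmod (Cexp (z * l) - 1 - z * l) <= 4 * B ^ 2 / INR m ^ 2).
  { eapply Rle_trans; [exact q|].
    replace (4 * B ^ 2 / INR m ^ 2) with (4 * (B / INR m) ^ 2) by (field; lra).
    apply Rmult_le_compat_l; [lra|]. apply pow_incr. split; [apply Cmod_ge_0 | exact hl]. }
  assert (n2 : Cmod (z * (l - / (INR m + 1)%R)) <= B / INR m ^ 2).
  { rewrite <- RtoC_inv, <- RtoC_minus, Cmod_mult, Cmod_RtoC_pos by lra.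
    apply Rmult_le_compat; try assumption; [lra|].
    apply Rle_trans with (/ INR m - / (INR m + 1)); [lra|].
    replace (/ INR m - / (INR m + 1)) with (/ (INR m * (INR m + 1))) by (field; lra).
    apply Rinv_le_contravar; nra. }
  assert (n3 := Cmod_triangle (Cexp (z * l) - 1 - z * l) (z * (l - / (INR m + 1)%R))).
  set (Nn := Cmod (Cexp (z * l) - 1 - z * l + z * (l - / (INR m + 1)%R))) in *.
  set (Dd := Cmod (1 + z / (INR m + 1)%R)) in *.
  assert (hN : 0 <= Nn) by apply Cmod_ge_0.
  apply Rle_trans with (2 * Nn).
  { apply Rmult_le_reg_r with Dd; [lra|]. unfold Rdiv. rewrite Rmult_assoc, Rinv_l by lra. nra. }
  replace (2 * (B + 4 * B ^ 2) / INR m ^ 2) with (2 * (B / INR m ^ 2 + 4 * B ^ 2 / INR m ^ 2)) by (field; lra).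
  lra.
Qed.

Lemma gauss_gamma_step (z : C) (m : nat) (B : R) : (1 <= m)%nat -> Cmod z <= B -> 2 * B <= INR m ->
  ~ gamma_pole z ->
  Cmod (gauss_gamma z (S m) - gauss_gamma z m) <= 2 * (B + 4 * B ^ 2) / INR m ^ 2 * Cmod (gauss_gamma z m).
Proof.
  intros hm hB hBm hz. rewrite gauss_gamma_S by assumption.
  replace (gauss_gamma z m * gamma_ratio z m - gauss_gamma z m)%C with
    ((gamma_ratio z m - 1) * gauss_gamma z m)%C by ring.
  rewrite Cmod_mult. apply Rmult_le_compat_r; [apply Cmod_ge_0 | now apply gamma_ratio_near].
Qed.

Lemma nat_above (x : R) : exists n : nat, (1 <= n)%nat /\ x <= INR n.
Proof.
  destruct (nfloor_ex (Rabs x)) as [n hn]; [apply Rabs_pos|]. exists (S n). split; [lia|].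
  rewrite S_INR. generalize (Rle_abs x). lra.
Qed.

Lemma gauss_gamma_cv (z : C) : ~ gamma_pole z -> Ccv (gauss_gamma z) (Cgamma z).
Proof.
  intros hz. destruct (nat_above (2 * Cmod z)) as (m0 & h1 & h2).
  destruct (Ccv_product (gauss_gamma z) (2 * (Cmod z + 4 * Cmod z ^ 2)) m0 h1) as [l hl].
  - generalize (Cmod_ge_0 z) (pow2_ge_0 (Cmod z)). lra.
  - intros m hm. apply gauss_gamma_step; trivial; [lia | lra |].
    eapply Rle_trans; [exact h2|]. now apply le_INR.
  - change (Cgamma z) with (Climit (gauss_gamma z)). now rewrite (Climit_unique _ _ hl).
Qed.

(** The reciprocals of the Gauss products satisfy the same kind of step bound, hence converge too.
    The limit of the products times that of the reciprocals is 1. *)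
Lemma Cgamma_neq_0 (z : C) : ~ gamma_pole z -> Cgamma z <> 0%C.
Proof.
  intros hz. set (B := Cmod z). assert (hB : 0 <= B) by apply Cmod_ge_0.
  set (K := 2 * (B + 4 * B ^ 2)). assert (hK : 0 <= K) by (unfold K; nra).
  destruct (nat_above (2 * B + 2 * K + 1)) as (m0 & h1 & h2).
  destruct (Ccv_product (fun m => / gauss_gamma z m)%C (2 * K) m0 h1) as [l hl]; [lra| |].
  - intros m hm. assert (hm1 : (1 <= m)%nat) by lia.
    assert (hI : 2 * B + 2 * K + 1 <= INR m) by (eapply Rle_trans; [exact h2 | now apply le_INR]).
    assert (r := gamma_ratio_near z m B hm1 ltac:(unfold B; lra) ltac:(lra)). fold K in r.
    rewrite gauss_gamma_S by assumption.
    assert (hp : 0 < INR m ^ 2) by nra.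
    assert (hle : K / INR m ^ 2 <= 1 / 2).
    { apply Rmult_le_reg_r with (1 := hp). unfold Rdiv. rewrite Rmult_assoc, Rinv_l by lra. nra. }
    assert (g0 := gauss_gamma_neq_0 z m hz).
    set (q := gamma_ratio z m) in *.
    assert (hq : 1 / 2 <= Cmod q).
    { assert (t := Cmod_sub_ge 1 q). rewrite Cmod_1, Cmod_sub_sym in t.
      assert (t2 := Cmod_sub_ge 1 (1 - q)%C). replace (1 - (1 - q))%C with q in t2 by ring.
      rewrite Cmod_1, Cmod_sub_sym in t2. lra. }
    assert (q0 : q <> 0%C) by (apply Cmod_pos_neq; lra).
    replace (/ (gauss_gamma z m * q) - / gauss_gamma z m)%C with ((1 - q) / q * / gauss_gamma z m)%C
      by (field; split; assumption).
    rewrite Cmod_mult. apply Rmult_le_compat_r; [apply Cmod_ge_0|].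
    rewrite Cmod_div, Cmod_sub_sym by assumption.
    assert (hc := Cmod_ge_0 (q - 1)).
    apply Rle_trans with (2 * Cmod (q - 1)).
    { apply Rmult_le_reg_r with (Cmod q); [lra|]. unfold Rdiv. rewrite Rmult_assoc, Rinv_l by lra. nra. }
    unfold Rdiv in *. lra.
  - intros e. assert (h := Ccv_mult _ _ _ _ (gauss_gamma_cv z hz) hl). rewrite e in h.
    assert (h' : Ccv (fun _ : nat => RtoC 1) (0 * l)%C).
    { eapply (Ccv_ext _ _ _ 1); [|exact h]. intros m _. cbv beta. field. now apply gauss_gamma_neq_0. }
    assert (h3 := Ccv_unique _ _ _ h' (Ccv_const 1)).
    apply (f_equal Re) in h3. revert h3. reim. lra.
Qed.

Lemma Cgamma_succ (z : C) : ~ gamma_pole z -> (Cgamma (z + 1) = z * Cgamma z)%C.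
Proof.
  intros hz.
  assert (hz1 : ~ gamma_pole (z + 1)%C).
  { intros [k e]. apply hz. exists (S k). rewrite S_INR, RtoC_plus. apply Csub_eq_0.
    transitivity (z + 1 - - INR k)%C; [ring|]. rewrite e. ring. }
  assert (id : forall m, (1 <= m)%nat ->
     (gauss_gamma (z + 1) m = gauss_gamma z m * z * (INR m / (z + INR (S m))))%C).
  { intros m hm. assert (h1 : 1 <= INR m) by (replace 1 with (INR 1) by reflexivity; apply le_INR; lia).
    unfold gauss_gamma.
    assert (e : Rcpow (INR m) (z + 1) = (Rcpow (INR m) z * INR m)%C).
    { unfold Rcpow. rewrite Cmult_plus_distr_r, Cexp_plus, Cmult_1_l, Cexp_RtoC, exp_ln by lra. reflexivity. }
    assert (p : forall j, (Cprod (fun k => z + 1 + INR k) j * z = Cprod (fun k => z + INR k) (S j))%C).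
    { induction j as [|j IH]; [simpl; ring|].
      change (Cprod (fun k => z + 1 + INR k)%C (S j)) with (Cprod (fun k => z + 1 + INR k) j * (z + 1 + INR j))%C.
      change (Cprod (fun k => z + INR k)%C (S (S j))) with (Cprod (fun k => z + INR k) (S j) * (z + INR (S j)))%C.
      rewrite <- IH, S_INR, RtoC_plus. ring. }
    assert (p' := p (S m)).
    change (Cprod (fun k => z + INR k)%C (S (S m))) with (Cprod (fun k => z + INR k) (S m) * (z + INR (S m)))%C in p'.
    assert (n1 := Cprod_add_neq_0 z (S m) hz). assert (n2 := not_pole_add z (S m) hz).
    assert (n3 := Cprod_add_neq_0 _ (S m) hz1).
    rewrite e.
    set (P1 := Cprod (fun k => z + 1 + INR k)%C (S m)) in *. set (P0 := Cprod (fun k => z + INR k)%C (S m)) in *.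
    assert (hz0 : z <> 0%C) by (intros e0; apply (not_pole_add z 0 hz); rewrite e0; simpl; ring).
    replace P1 with (P0 * (z + INR (S m)) / z)%C by (rewrite <- p'; field; exact hz0).
    field. repeat split; assumption. }
  assert (lim : Ccv (fun m => INR m / (z + INR (S m)))%C 1).
  { intros e he. set (B := Cmod z + 1). assert (hB : 1 <= B) by (unfold B; generalize (Cmod_ge_0 z); lra).
    destruct (nat_above (2 * B + 2 * B / e)) as (N & hN1 & hN2). exists N. intros m hm.
    assert (hI : 2 * B + 2 * B / e <= INR m) by (eapply Rle_trans; [exact hN2 | now apply le_INR]).
    assert (n2 := not_pole_add z (S m) hz).
    replace (INR m / (z + INR (S m)) - 1)%C with (- (z + 1) / (z + INR (S m)))%C.
    2: { rewrite S_INR, RtoC_plus in *. field. exact n2. }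
    rewrite Cmod_div, Cmod_opp by exact n2.
    assert (h1 : Cmod (z + 1) <= B) by (eapply Rle_trans; [apply Cmod_triangle|]; rewrite Cmod_1; unfold B; lra).
    assert (he2 : 0 < 2 * B / e) by (apply Rdiv_lt_0_compat; lra).
    assert (h2 : INR m / 2 < Cmod (z + INR (S m))).
    { assert (t := Cmod_sub_ge (INR (S m)) (- z)%C). replace (INR (S m) - - z)%C with (z + INR (S m))%C in t by ring.
      rewrite Cmod_RtoC_pos, Cmod_opp, S_INR in t by apply pos_INR.
      assert (hI2 : 2 * B <= INR m) by lra. unfold B in hI2. rewrite S_INR. lra. }
    apply Rmult_lt_reg_r with (Cmod (z + INR (S m))); [lra|].
    unfold Rdiv at 1. rewrite Rmult_assoc, Rinv_l, Rmult_1_r by lra.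
    assert (e * (2 * B + 2 * B / e) <= e * INR m) by (apply Rmult_le_compat_l; lra).
    replace (e * (2 * B + 2 * B / e)) with (e * (2 * B) + 2 * B) in H by (field; lra).
    assert (e * (INR m / 2) < e * Cmod (z + INR (S m))) by (apply Rmult_lt_compat_l; lra).
    assert (0 < e * (2 * B)) by (apply Rmult_lt_0_compat; lra). lra. }
  apply (Ccv_unique (gauss_gamma (z + 1)%C)); [now apply gauss_gamma_cv|].
  assert (h := Ccv_mult _ _ _ _ (Ccv_mult _ _ _ _ (gauss_gamma_cv z hz) (Ccv_const z)) lim).
  replace (Cgamma z * z * 1)%C with (z * Cgamma z)%C in h by ring.
  eapply (Ccv_ext _ _ _ 1); [|exact h]. intros m hm. cbv beta. now rewrite id.
Qed.

Lemma Rle_exp (x y : R) : x <= y -> exp x <= exp y.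
Proof. intros [h| ->]; [left; now apply exp_increasing | lra]. Qed.

Lemma Re_le_Cmod (z : C) : Re z <= Cmod z.
Proof. eapply Rle_trans; [apply Rle_abs | apply re_le_Cmod]. Qed.

Lemma Cmod_gauss_gamma (z : C) (m : nat) : ~ gamma_pole z ->
  Cmod (gauss_gamma z m) = INR (fact m) * exp (Re z * ln (INR m)) / Cmod (Cprod (fun k => z + INR k)%C (S m)).
Proof.
  intros hz. unfold gauss_gamma.
  rewrite Cmod_div by (now apply Cprod_add_neq_0). rewrite Cmod_mult, Cmod_Rcpow, Cmod_RtoC_pos by apply pos_INR.
  reflexivity.
Qed.

(** With x = Re z + k one has |z + k| >= x, while |w + k|^2 <= x^2 + b^2 <= x^2 exp (b^2 / x^2); the
    exponents 1 / x^2 telescope. *)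
Lemma Cprod_shift_le (z w : C) (b : R) (n : nat) : 1 <= Re z -> Re w = Re z -> Rabs (Im w) <= b ->
  Cmod (Cprod (fun k => w + INR k)%C n) <=
  Cmod (Cprod (fun k => z + INR k)%C n) * exp (b ^ 2 * (/ Re z - / (Re z + INR n))).
Proof.
  intros hz hw hb. induction n as [|n IH].
  - simpl. rewrite Cmod_1. replace (b * (b * 1) * (/ Re z - / (Re z + 0))) with 0.
    + rewrite exp_0. lra.
    + rewrite Rplus_0_r. ring.
  - simpl Cprod. rewrite !Cmod_mult.
    set (x := Re z + INR n). assert (hn := pos_INR n). assert (hx : 1 <= x) by (unfold x; lra).
    assert (t := inv_sqr_telescope x hx).
    assert (f1 : x <= Cmod (z + INR n)).
    { eapply Rle_trans; [|apply Re_le_Cmod]. reim. unfold x. lra. }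
    assert (f2 : Cmod (w + INR n) <= x * exp (b ^ 2 * (/ x - / (x + 1)))).
    { apply Rsqr_incr_0_var; [|apply Rmult_le_pos; [lra | left; apply exp_pos]].
      unfold Rsqr. replace (x * exp (b ^ 2 * (/ x - / (x + 1))) * (x * exp (b ^ 2 * (/ x - / (x + 1))))) with
        (x ^ 2 * exp (b ^ 2 * (2 * (/ x - / (x + 1))))).
      2: { replace (b ^ 2 * (2 * (/ x - / (x + 1)))) with (b ^ 2 * (/ x - / (x + 1)) + b ^ 2 * (/ x - / (x + 1))) by ring.
           rewrite exp_plus. ring. }
      replace (Cmod (w + INR n) * Cmod (w + INR n)) with (Cmod (w + INR n) ^ 2) by ring.
      rewrite Cmod2_alt. reim. rewrite Rplus_0_r, hw. fold x.
      assert (hb2 : Im w ^ 2 <= b ^ 2). { rewrite <- pow2_abs. apply pow_incr. split; [apply Rabs_pos | exact hb]. }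
      assert (e := exp_ineq1_le (b ^ 2 * / x ^ 2)).
      assert (e2 : exp (b ^ 2 * / x ^ 2) <= exp (b ^ 2 * (2 * (/ x - / (x + 1))))).
      { apply Rle_exp. apply Rmult_le_compat_l; [apply pow2_ge_0 | exact t]. }
      assert (hx2 : 0 < x ^ 2) by nra.
      apply Rle_trans with (x ^ 2 * (1 + b ^ 2 * / x ^ 2)).
      - replace (x ^ 2 * (1 + b ^ 2 * / x ^ 2)) with (x ^ 2 + b ^ 2) by (field; lra). lra.
      - apply Rmult_le_compat_l; lra. }
    rewrite S_INR. replace (Re z + (INR n + 1)) with (x + 1) by (unfold x; ring).
    replace (exp (b ^ 2 * (/ Re z - / (x + 1)))) with
      (exp (b ^ 2 * (/ Re z - / x)) * exp (b ^ 2 * (/ x - / (x + 1)))) by (rewrite <- exp_plus; f_equal; ring).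
    fold x in IH.
    apply Rle_trans with ((Cmod (Cprod (fun k => z + INR k)%C n) * exp (b ^ 2 * (/ Re z - / x))) *
      (Cmod (z + INR n) * exp (b ^ 2 * (/ x - / (x + 1))))); [|right; ring].
    apply Rmult_le_compat; try apply Cmod_ge_0; [exact IH|].
    eapply Rle_trans; [exact f2|]. apply Rmult_le_compat_r; [left; apply exp_pos | exact f1].
Qed.

Lemma gauss_gamma_mod_le (z w : C) (b : R) (m : nat) : 1 <= Re z -> Re w = Re z -> Rabs (Im w) <= b ->
  Cmod (gauss_gamma z m) <= exp (b ^ 2) * Cmod (gauss_gamma w m).
Proof.
  intros hz hw hb. assert (pz : ~ gamma_pole z) by (apply not_pole_Re; lra).
  assert (pw : ~ gamma_pole w) by (apply not_pole_Re; lra).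
  rewrite !Cmod_gauss_gamma, hw by assumption.
  assert (h := Cprod_shift_le z w b (S m) hz hw hb).
  assert (cz : 0 < Cmod (Cprod (fun k => z + INR k)%C (S m))) by (apply Cmod_gt_0; now apply Cprod_add_neq_0).
  assert (cw : 0 < Cmod (Cprod (fun k => w + INR k)%C (S m))) by (apply Cmod_gt_0; now apply Cprod_add_neq_0).
  set (cZ := Cmod (Cprod (fun k => z + INR k)%C (S m))) in *. set (cW := Cmod (Cprod (fun k => w + INR k)%C (S m))) in *.
  assert (h2 : cW <= cZ * exp (b ^ 2)).
  { eapply Rle_trans; [exact h|]. apply Rmult_le_compat_l; [lra|]. apply Rle_exp.
    assert (h0 : 0 < / (Re z + INR (S m))). { apply Rinv_0_lt_compat. generalize (pos_INR (S m)). lra. }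
    assert (h1 : / Re z <= 1). { rewrite <- Rinv_1. apply Rinv_le_contravar; lra. }
    assert (hb2 := pow2_ge_0 b). nra. }
  assert (hN : 0 < INR (fact m) * exp (Re z * ln (INR m))).
  { apply Rmult_lt_0_compat; [apply lt_0_INR, lt_O_fact | apply exp_pos]. }
  set (A := INR (fact m) * exp (Re z * ln (INR m))) in *.
  apply Rmult_le_reg_r with (cZ * cW); [now apply Rmult_lt_0_compat|].
  replace (A / cZ * (cZ * cW)) with (A * cW) by (field; lra).
  replace (exp (b ^ 2) * (A / cW) * (cZ * cW)) with (A * (cZ * exp (b ^ 2))) by (field; lra).
  apply Rmult_le_compat_l; lra.
Qed.

(** On a vertical line gamma is largest at its real point, up to a constant for other base points.
    The freedom in [w] is needed for complex shifts: at real z the argument k z + u has imaginary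
    part Im u, so it is not real. *)
Lemma Cgamma_mod_le (z w : C) (b : R) : 1 <= Re z -> Re w = Re z -> Rabs (Im w) <= b ->
  Cmod (Cgamma z) <= exp (b ^ 2) * Cmod (Cgamma w).
Proof.
  intros hz hw hb.
  apply (Ccv_Cmod_compare (gauss_gamma z) (gauss_gamma w)).
  - left; apply exp_pos.
  - intros m _. now apply gauss_gamma_mod_le.
  - apply gauss_gamma_cv, not_pole_Re; lra.
  - apply gauss_gamma_cv, not_pole_Re; lra.
Qed.

(** Uniformity in [m] and in [z] over a bounded part of the half-plane is what allows Taylor bounds
    on the Gauss products to pass to the limit. *)
Lemma gauss_gamma_uniform (B : R) : 0 <= B -> exists (M : R) (m0 : nat), 0 <= M /\ (1 <= m0)%nat /\
  forall z m, (m0 <= m)%nat -> 1 / 2 <= Re z -> Cmod z <= B -> Cmod (gauss_gamma z m) <= M.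
Proof.
  intros hB. destruct (nat_above (2 * B)) as (m0 & h1 & h2).
  set (K := 2 * (B + 4 * B ^ 2)). assert (hK : 0 <= K) by (unfold K; nra).
  set (A := INR (fact m0) * exp (B * ln (INR m0)) / (1 / 2) ^ S m0).
  assert (hA : 0 <= A).
  { apply Rdiv_le_0_compat; [|apply pow_lt; lra]. apply Rmult_le_pos; [apply pos_INR | left; apply exp_pos]. }
  exists (A * exp (2 * K)), m0. split; [apply Rmult_le_pos; [exact hA | left; apply exp_pos]|]. split; [exact h1|].
  intros z m hm hz hzB. assert (pz : ~ gamma_pole z) by (apply not_pole_Re; lra).
  eapply Rle_trans.
  - apply (product_bound (gauss_gamma z) K m0 h1 hK); [|exact hm].
    intros j hj. apply gauss_gamma_step; trivial; [lia|]. eapply Rle_trans; [exact h2 | now apply le_INR].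
  - apply Rmult_le_compat_r; [left; apply exp_pos|]. rewrite Cmod_gauss_gamma by exact pz. unfold A.
    assert (c : forall n, (1 / 2) ^ n <= Cmod (Cprod (fun k => z + INR k)%C n)).
    { induction n as [|n IH]; simpl Cprod.
      - rewrite Cmod_1. simpl. lra.
      - rewrite Cmod_mult, <- tech_pow_Rmult, Rmult_comm. apply Rmult_le_compat; [apply pow_le; lra | lra | exact IH|].
        eapply Rle_trans; [|apply Re_le_Cmod]. reim. generalize (pos_INR n). lra. }
    assert (l0 : 0 <= ln (INR m0)).
    { rewrite <- ln_1. apply Rcomplements.ln_le; [lra|]. replace 1 with (INR 1) by reflexivity. now apply le_INR. }
    unfold Rdiv. apply Rmult_le_compat.
    + apply Rmult_le_pos; [apply pos_INR | left; apply exp_pos].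
    + left. apply Rinv_0_lt_compat. apply Cmod_gt_0. now apply Cprod_add_neq_0.
    + apply Rmult_le_compat_l; [apply pos_INR|]. apply Rle_exp, Rmult_le_compat_r; [exact l0|].
      eapply Rle_trans; [apply Re_le_Cmod | exact hzB].
    + apply Rinv_le_contravar; [apply pow_lt; lra | apply (c (S m0))].
Qed.

Fixpoint Csum (f : nat -> C) (n : nat) : C :=
  match n with O => 0%C | S k => (Csum f k + f k)%C end.

(* [psi] is the logarithmic derivative of [Cgamma]. *)
Definition psi_approx (z : C) (m : nat) : C := (ln (INR m) - Csum (fun k => / (z + INR k)) (S m))%C.
Definition psi (z : C) : C := Climit (psi_approx z).

Lemma is_derive_Cprod_add (z : C) (n : nat) : ~ gamma_pole z ->
  is_derive (fun z => Cprod (fun k => z + INR k) n)%C z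
    (Cprod (fun k => z + INR k) n * Csum (fun k => / (z + INR k)) n)%C.
Proof.
  intros hz. induction n as [|n IH].
  - eapply is_derive_ext_val; [exact (is_derive_const_C 1 z)|]. simpl. ring.
  - simpl Cprod. eapply is_derive_ext_val.
    + apply is_derive_mult_C; [exact IH|]. apply is_derive_plus_C; [apply is_derive_id_C | apply is_derive_const_C].
    + simpl Csum. ceq. field. now apply not_pole_add.
Qed.

Lemma is_derive_gauss_gamma (z : C) (m : nat) : ~ gamma_pole z ->
  is_derive (fun z => gauss_gamma z m) z (gauss_gamma z m * psi_approx z m)%C.
Proof.
  intros hz. unfold gauss_gamma. eapply is_derive_ext_val.
  - apply is_derive_div_C; [now apply Cprod_add_neq_0| |now apply is_derive_Cprod_add].
    apply is_derive_mult_C; [apply is_derive_const_C|]. unfold Rcpow.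
    apply (is_derive_comp_C Cexp (fun z => z * ln (INR m))%C); [apply is_derive_Cexp|].
    apply is_derive_mult_C; [apply is_derive_id_C | apply is_derive_const_C].
  - ceq. unfold psi_approx, Rcpow.
    assert (h := Cprod_add_neq_0 z (S m) hz).
    set (P := Cprod _ _) in *. set (S0 := Csum _ _). field. exact h.
Qed.

Lemma psi_cv (z : C) : 0 < Re z -> Ccv (psi_approx z) (psi z).
Proof.
  intros hz. set (B := Cmod z). assert (hB : 0 <= B) by apply Cmod_ge_0.
  destruct (nat_above 1) as (m0 & h1 & h2).
  destruct (Ccv_increments (psi_approx z) (1 + B) 1 (le_n 1)) as [l hl]; [lra| |].
  - intros m hm. assert (hI : 1 <= INR m) by (replace 1 with (INR 1) by reflexivity; now apply le_INR).
    assert (n2 := not_pole_add z (S m) (not_pole_Re z hz)).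
    destruct (ln_step m hm) as [l1 l2].
    assert (hxC : RtoC (INR m + 1) <> 0%C) by (apply RtoC_neq_0; lra).
    replace (psi_approx z (S m) - psi_approx z m)%C with
      (RtoC (ln (INR m + 1) - ln (INR m) - / (INR m + 1)) + z / ((INR m + 1)%R * (z + (INR m + 1)%R)))%C.
    2: { unfold psi_approx. change (Csum (fun k => / (z + INR k))%C (S (S m))) with
           (Csum (fun k => / (z + INR k)) (S m) + / (z + INR (S m)))%C.
         rewrite S_INR in *. rewrite !RtoC_minus, RtoC_inv by lra. set (y := RtoC (INR m + 1)) in *. set (S0 := Csum _ _). field. split; assumption. }
    eapply Rle_trans; [apply Cmod_triangle|].
    rewrite Cmod_RtoC_pos by lra.
    rewrite S_INR in n2.
    rewrite Cmod_div by (apply Cmult_neq_0; assumption). fold B. rewrite Cmod_mult, Cmod_RtoC_pos by lra.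
    assert (f : INR m <= Cmod (z + (INR m + 1)%R)).
    { eapply Rle_trans; [|apply Re_le_Cmod]. reim. lra. }
    assert (g1 : ln (INR m + 1) - ln (INR m) - / (INR m + 1) <= / INR m ^ 2).
    { apply Rle_trans with (/ INR m - / (INR m + 1)); [lra|].
      replace (/ INR m - / (INR m + 1)) with (/ (INR m * (INR m + 1))) by (field; lra).
      apply Rinv_le_contravar; nra. }
    assert (g2 : B / ((INR m + 1) * Cmod (z + (INR m + 1)%R)) <= B * / INR m ^ 2).
    { apply Rmult_le_compat_l; [exact hB|]. apply Rinv_le_contravar; nra. }
    unfold Rdiv at 2. lra.
  - unfold psi. now rewrite (Climit_unique _ _ hl).
Qed.

Lemma is_derive_quadratic (f : C -> C) (z l : C) (K d : R) : 0 < d -> 0 <= K ->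
  (forall w, Cmod (w - z) <= d -> Cmod (f w - f z - (w - z) * l) <= K * Cmod (w - z) ^ 2) ->
  is_derive f z l.
Proof.
  intros hd hK h. apply is_derive_C. intros e he. exists (Rmin d (e / (K + 1))).
  split; [apply Rmin_pos; [exact hd | apply Rdiv_lt_0_compat; lra]|]. intros s hs.
  assert (h1 := Rlt_le_trans _ _ _ hs (Rmin_l _ _)). assert (h2 := Rlt_le_trans _ _ _ hs (Rmin_r _ _)).
  eapply Rle_trans; [apply h; lra|].
  replace (K * Cmod (s - z) ^ 2) with (K * Cmod (s - z) * Cmod (s - z)) by ring.
  apply Rmult_le_compat_r; [apply Cmod_ge_0|].
  apply Rmult_lt_compat_l with (r := K + 1) in h2; [|lra].
  replace ((K + 1) * (e / (K + 1))) with e in h2 by (field; lra).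
  generalize (Cmod_ge_0 (s - z)). nra.
Qed.

Lemma taylor_at_1 (f : C -> C) (p z : C) : taylor_at f p 1 z = (f p + (z - p) * C_derive f p)%C.
Proof.
  unfold taylor_at. rewrite sum_Sn, sum_O. change plus with Cplus. simpl. field.
  all: apply RtoC_neq_0; lra.
Qed.

(** Each Gauss product satisfies a second-order Taylor bound on a square of half-side 1 / 4 with a
    constant independent of [m]. Passing to the limit in the bound itself avoids exchanging limit
    and derivative. *)
Lemma is_derive_Cgamma (z : C) : 1 <= Re z -> is_derive Cgamma z (Cgamma z * psi z)%C.
Proof.
  intros hz. destruct (gauss_gamma_uniform (Cmod z + 1)) as (M & m0 & hM & hm0 & bM).
  { generalize (Cmod_ge_0 z). lra. }
  apply (is_derive_quadratic _ _ _ (4 * M * 16) (1 / 8)); [lra | lra|].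
  intros w hw.
  assert (rw : 0 < Re w).
  { assert (h := re_le_Cmod (w - z)). rewrite Re_minus in h. apply (fun h' => Rle_trans _ _ _ h h') in hw.
    apply Rabs_le_between in hw. lra. }
  apply (Ccv_Cmod_le (fun m => gauss_gamma w m - gauss_gamma z m - (w - z) * (gauss_gamma z m * psi_approx z m))%C _ _ m0).
  - intros m hm.
    assert (pz : ~ gamma_pole z) by (apply not_pole_Re; lra).
    assert (hsq : forall s, in_rect (Re z - 1 / 4) (Re z + 1 / 4) (Im z - 1 / 4) (Im z + 1 / 4) s ->
       1 / 2 <= Re s /\ Cmod s <= Cmod z + 1).
    { intros s [h1 h2]. split; [lra|].
      replace s with ((s - z) + z)%C by ring. eapply Rle_trans; [apply Cmod_triangle|].
      assert (Cmod (s - z) <= 1 / 4 + 1 / 4); [|lra].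
      eapply Rle_trans; [apply Cmod_le_re_im|]. reim. apply Rplus_le_compat; apply Rabs_le; lra. }
    assert (t := taylor_remainder_bound (fun z => gauss_gamma z m) z (1 / 4) M 1 w ltac:(lra)).
    assert (e : C_derive (fun z : C => gauss_gamma z m) z = (gauss_gamma z m * psi_approx z m)%C)
      by exact (is_C_derive_unique _ _ _ (is_derive_gauss_gamma z m pz)).
    rewrite taylor_at_1, e in t.
    replace (gauss_gamma w m - gauss_gamma z m - (w - z) * (gauss_gamma z m * psi_approx z m))%C with
      (gauss_gamma w m - (gauss_gamma z m + (w - z) * (gauss_gamma z m * psi_approx z m)))%C by ring.
    eapply Rle_trans; [apply t|].
    + intros s hs. destruct (hsq s hs). eexists. apply is_derive_gauss_gamma, not_pole_Re. lra.
    + intros s [hs _]. destruct (hsq s hs). now apply bM.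
    + lra.
    + right. field.
  - apply Ccv_minus; [apply Ccv_minus; apply gauss_gamma_cv, not_pole_Re; lra|].
    apply Ccv_mult; [apply Ccv_const|]. apply Ccv_mult; [apply gauss_gamma_cv, not_pole_Re; lra | apply psi_cv; lra].
Qed.

(** The gain 1 / a matters: over distances proportional to the real part, the logarithmic derivative
    of gamma moves by a bounded amount only. *)
Lemma psi_lipschitz (a : R) (z w : C) : 1 <= a -> a <= Re z -> a <= Re w ->
  Cmod (psi z - psi w) <= 2 * Cmod (z - w) / a.
Proof.
  intros ha hz hw.
  apply (Ccv_Cmod_le (fun m => psi_approx z m - psi_approx w m)%C _ _ 0).
  2: { apply Ccv_minus; apply psi_cv; lra. }
  intros m _.
  assert (h : forall n, Cmod (Csum (fun k => / (z + INR k))%C n - Csum (fun k => / (w + INR k))%C n) <=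
    2 * Cmod (z - w) * (/ a - / (a + INR n))).
  { induction n as [|n IH]; simpl Csum.
    - simpl. replace (0 - 0)%C with (RtoC 0) by ring. rewrite Cmod_0, Rplus_0_r. lra.
    - replace (Csum (fun k => / (z + INR k)) n + / (z + INR n) - (Csum (fun k => / (w + INR k)) n + / (w + INR n)))%C
        with ((Csum (fun k => / (z + INR k)) n - Csum (fun k => / (w + INR k)) n) + (/ (z + INR n) - / (w + INR n)))%C by ring.
      eapply Rle_trans; [apply Cmod_triangle|].
      set (x := a + INR n). assert (hn := pos_INR n). assert (hx : 1 <= x) by (unfold x; lra).
      assert (fz : x <= Cmod (z + INR n)). { eapply Rle_trans; [|apply Re_le_Cmod]. reim. unfold x; lra. }
      assert (fw : x <= Cmod (w + INR n)). { eapply Rle_trans; [|apply Re_le_Cmod]. reim. unfold x; lra. }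
      assert (nz : (z + INR n)%C <> 0%C) by (apply Cmod_pos_neq; lra).
      assert (nw : (w + INR n)%C <> 0%C) by (apply Cmod_pos_neq; lra).
      replace (/ (z + INR n) - / (w + INR n))%C with ((w - z) / ((z + INR n) * (w + INR n)))%C
        by (field; split; assumption).
      rewrite Cmod_div by (now apply Cmult_neq_0). rewrite (Cmod_sub_sym w z), Cmod_mult.
      assert (t := inv_sqr_telescope x hx).
      rewrite S_INR. replace (a + (INR n + 1)) with (x + 1) by (unfold x; ring). fold x in IH.
      assert (b : Cmod (z - w) / (Cmod (z + INR n) * Cmod (w + INR n)) <= Cmod (z - w) * (2 * (/ x - / (x + 1)))).
      { apply Rmult_le_compat_l; [apply Cmod_ge_0|]. eapply Rle_trans; [|exact t].
        apply Rinv_le_contravar; nra. }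
      lra. }
  specialize (h (S m)). unfold psi_approx.
  replace (ln (INR m) - Csum (fun k => / (z + INR k)) (S m) - (ln (INR m) - Csum (fun k => / (w + INR k)) (S m)))%C
    with (- (Csum (fun k => / (z + INR k)) (S m) - Csum (fun k => / (w + INR k)) (S m)))%C by ring.
  rewrite Cmod_opp. eapply Rle_trans; [exact h|].
  unfold Rdiv. apply Rmult_le_compat_l; [generalize (Cmod_ge_0 (z - w)); lra|].
  assert (0 < / (a + INR (S m))) by (apply Rinv_0_lt_compat; generalize (pos_INR (S m)); lra). lra.
Qed.

(** Re (1 / (z + k)) is at most 1 / (x + k), and the sum of these is compared with a logarithm. Only
    divergence to infinity will be used. *)
Lemma psi_Re_ge (z : C) : 1 <= Re z -> ln (Re z) - / Re z <= Re (psi z).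
Proof.
  intros hz. set (x := Re z) in *.
  assert (L : forall t, 0 < t -> ln t <= t - 1).
  { intros t ht. assert (h := exp_ineq1_le (ln t)). rewrite exp_ln in h by exact ht. lra. }
  assert (h : forall n, Re (Csum (fun k => / (z + INR k))%C (S n)) <= / x + ln (x + INR n) - ln x).
  { assert (one : forall k, Re (/ (z + INR k))%C <= / (x + INR k)).
    { intros k. assert (hk := pos_INR k). assert (f : x + INR k <= Cmod (z + INR k)).
      { eapply Rle_trans; [|apply Re_le_Cmod]. reim. unfold x; lra. }
      assert (n0 : (z + INR k)%C <> 0%C) by (apply Cmod_pos_neq; lra).
      eapply Rle_trans; [apply Re_le_Cmod|]. rewrite Cmod_inv by exact n0.
      apply Rinv_le_contravar; lra. }
    induction n as [|n IH].
    - change (Csum (fun k => / (z + INR k))%C 1) with (0 + / (z + INR 0))%C.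
      specialize (one O). rewrite Re_plus, Re_RtoC. change (INR 0) with 0 in *. rewrite Rplus_0_r in *. lra.
    - change (Csum (fun k => / (z + INR k))%C (S (S n))) with
        (Csum (fun k => / (z + INR k)) (S n) + / (z + INR (S n)))%C.
      rewrite Re_plus. specialize (one (S n)). rewrite S_INR in *.
      set (y := x + INR n) in *. assert (hn := pos_INR n).
      replace (x + (INR n + 1)) with (y + 1) in * by (unfold y; ring).
      assert (hy : 1 <= y) by (unfold y; lra).
      assert (l := L (y / (y + 1)) ltac:(apply Rdiv_lt_0_compat; lra)).
      rewrite ln_div in l by lra.
      replace (y / (y + 1) - 1) with (- / (y + 1)) in l by (field; lra). lra. }
  apply Rnot_lt_le. intros hlt. set (d := ln x - / x - Re (psi z)) in *.
  destruct (psi_cv z ltac:(fold x; lra) (d / 2)) as [N hN]; [unfold d; lra|].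
  destruct (nat_above (2 * x / d + INR N)) as (m & hm1 & hm2).
  assert (hd : 0 < d) by (unfold d; lra).
  assert (hxd : 0 < 2 * x / d) by (apply Rdiv_lt_0_compat; lra).
  assert (hmN : (N <= m)%nat). { apply INR_le. lra. }
  specialize (hN m hmN). specialize (h m).
  assert (r := Re_le_Cmod (psi_approx z m - psi z)).
  assert (hI : 1 <= INR m) by (replace 1 with (INR 1) by reflexivity; now apply le_INR).
  assert (r2 : Re (psi_approx z m) = ln (INR m) - Re (Csum (fun k => / (z + INR k))%C (S m))) by reflexivity.
  assert (r3 := re_le_Cmod (psi_approx z m - psi z)). rewrite Re_minus in r3.
  assert (r4 := Rle_abs (Re (psi_approx z m) - Re (psi z))).
  assert (l := L ((x + INR m) / INR m) ltac:(apply Rdiv_lt_0_compat; lra)).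
  rewrite ln_div in l by lra. replace ((x + INR m) / INR m - 1) with (x / INR m) in l by (field; lra).
  assert (hx2 : x / INR m <= d / 2).
  { apply Rmult_le_reg_r with (INR m); [lra|]. unfold Rdiv at 1. rewrite Rmult_assoc, Rinv_l, Rmult_1_r by lra.
    assert (h1 : d / 2 * (2 * x / d + INR N) <= d / 2 * INR m) by (apply Rmult_le_compat_l; lra).
    replace (d / 2 * (2 * x / d + INR N)) with (x + d / 2 * INR N) in h1 by (field; lra).
    assert (0 <= d / 2 * INR N) by (apply Rmult_le_pos; [lra | apply pos_INR]). lra. }
  unfold d in *. lra.
Qed.

Lemma Cgamma_bounded (B : R) : exists M : R, 0 <= M /\
  forall z, 1 <= Re z <= B -> Cmod (Cgamma z) <= M.
Proof.
  destruct (gauss_gamma_uniform (Rabs B) (Rabs_pos B)) as (M & m0 & hM & hm0 & bM).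
  exists M. split; [exact hM|]. intros z hz.
  assert (h := Cgamma_mod_le z (RtoC (Re z)) 0 ltac:(lra) eq_refl).
  rewrite Im_RtoC, Rabs_R0 in h. specialize (h ltac:(lra)).
  replace (0 ^ 2) with 0 in h by ring. rewrite exp_0, Rmult_1_l in h.
  eapply Rle_trans; [exact h|].
  apply (Ccv_Cmod_le (gauss_gamma (RtoC (Re z))) _ _ m0).
  - intros m hm. apply bM; trivial; [rewrite Re_RtoC; lra|]. rewrite Cmod_RtoC_pos by lra.
    generalize (Rle_abs B). lra.
  - apply gauss_gamma_cv, not_pole_Re. rewrite Re_RtoC. lra.
Qed.

Lemma not_pole_Im (z : C) : Im z <> 0 -> ~ gamma_pole z.
Proof. intros h [k e]. rewrite e in h. apply h. reim. ring. Qed.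

(** Shift to the right with the functional equation: each step divides by z + j, of modulus at least
    1 because Im z >= 1, so the value on the left is bounded by one on the right. *)
Lemma Cgamma_strip_bounded (X : R) : exists M : R, 0 <= M /\
  forall z, - X <= Re z <= X -> 1 <= Im z -> Cmod (Cgamma z) <= M.
Proof.
  destruct (nat_above (X + 1)) as (k & hk1 & hk2).
  destruct (Cgamma_bounded (X + INR k)) as (M & hM & bM). exists M. split; [exact hM|].
  intros z hz hy.
  assert (h : forall j, Cmod (Cgamma z) <= Cmod (Cgamma (z + INR j))).
  { induction j as [|j IH].
    - simpl. rewrite Cplus_0_r. lra.
    - eapply Rle_trans; [exact IH|]. rewrite S_INR, RtoC_plus, Cplus_assoc.
      rewrite Cgamma_succ. 2: { apply not_pole_Im. reim. lra. }
      rewrite Cmod_mult. assert (hp := Cmod_ge_0 (Cgamma (z + INR j))).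
      assert (h1 : 1 <= Cmod (z + INR j)).
      { eapply Rle_trans; [|apply im_le_Cmod]. reim. rewrite Rplus_0_r. rewrite Rabs_pos_eq; lra. }
      nra. }
  eapply Rle_trans; [apply (h k)|]. apply bM. reim. lra.
Qed.

(** * Logarithmic derivatives of the gamma factors *)

(* [l] is the logarithmic derivative of [f]; its oscillation at distance at most x / 2 from x is bounded, and so small
   compared with its size, which tends to infinity for a gamma factor. *)
Definition slow_log_deriv (f l : C -> C) (D : R) : Prop :=
  exists X K : R, 1 <= X /\ 0 <= K /\
  (forall z : C, X <= Re z ->
     f z <> 0%C /\ is_derive f z (f z * l z)%C /\ Cmod (f z) <= K * Cmod (f (RtoC (Re z)))) /\
  (forall (x : R) (z : C), X <= x -> Cmod (z - x) <= x / 2 -> Cmod (l z - l (RtoC x)) <= D).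

Lemma slow_log_deriv_mult (f g l m : C -> C) (D E : R) : slow_log_deriv f l D -> slow_log_deriv g m E ->
  slow_log_deriv (fun z => f z * g z)%C (fun z => l z + m z)%C (D + E).
Proof.
  intros (X & K & hX & hK & h1 & h2) (X' & K' & hX' & hK' & h1' & h2').
  exists (Rmax X X'), (K * K'). assert (a := Rmax_l X X'). assert (b := Rmax_r X X').
  split; [lra|]. split; [now apply Rmult_le_pos|]. split.
  - intros z hz. destruct (h1 z ltac:(lra)) as (n1 & d1 & b1). destruct (h1' z ltac:(lra)) as (n2 & d2 & b2).
    split; [now apply Cmult_neq_0|]. split.
    + eapply is_derive_ext_val; [apply is_derive_mult_C; eassumption|]. ceq. ring.
    + rewrite !Cmod_mult. replace (K * K' * (Cmod (f (Re z)) * Cmod (g (Re z)))) with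
        ((K * Cmod (f (Re z))) * (K' * Cmod (g (Re z)))) by ring.
      apply Rmult_le_compat; trivial; apply Cmod_ge_0.
  - intros x z hx hz. specialize (h2 x z ltac:(lra) hz). specialize (h2' x z ltac:(lra) hz).
    replace (l z + m z - (l x + m x))%C with ((l z - l x) + (m z - m x))%C by ring.
    eapply Rle_trans; [apply Cmod_triangle|]. lra.
Qed.

Lemma slow_log_deriv_ext (f g l : C -> C) (D : R) (X0 : R) :
  (forall z, X0 <= Re z -> f z = g z) -> slow_log_deriv f l D -> slow_log_deriv g l D.
Proof.
  intros e (X & K & hX & hK & h1 & h2). exists (Rmax X (X0 + 1)), K.
  assert (a := Rmax_l X (X0 + 1)). assert (b := Rmax_r X (X0 + 1)).
  split; [lra|]. split; [exact hK|]. split.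
  - intros z hz. destruct (h1 z ltac:(lra)) as (n1 & d1 & b1). rewrite <- !e by (reim; lra).
    split; [exact n1|]. split; [|exact b1].
    apply (is_derive_locally_ext f g z _ 1 Rlt_0_1); [|exact d1].
    intros s hs. apply e. assert (q := re_le_Cmod (s - z)). rewrite Re_minus in q.
    assert (q' := Rle_lt_trans _ _ _ q hs). apply Rabs_lt_between in q'. lra.
  - intros x z hx. apply h2. lra.
Qed.

Lemma slow_log_deriv_exp (c : C) (r : R) : c <> 0%C -> slow_log_deriv (fun z => c * Cexp (r * z))%C (fun _ => RtoC r) 0.
Proof.
  intros hc. exists 1, 1. split; [lra|]. split; [lra|]. split.
  - intros z _. split; [|split].
    + apply Cmult_neq_0; [exact hc | apply Cexp_neq_0].
    + eapply is_derive_ext_val.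
      * apply is_derive_mult_C; [apply is_derive_const_C|].
        apply (is_derive_comp_C Cexp (fun z => r * z)%C); [apply is_derive_Cexp|].
        apply is_derive_mult_C; [apply is_derive_const_C | apply is_derive_id_C].
      * ceq. ring.
    + rewrite !Cmod_mult, !Cmod_Cexp. reim. right. rewrite Rmult_1_l. f_equal. f_equal. ring.
  - intros x z _ _. unfold Cminus. rewrite Cplus_opp_r, Cmod_0. lra.
Qed.

Lemma slow_log_deriv_gamma (k : R) (u : C) : 0 < k <= 1 ->
  slow_log_deriv (fun z => Cgamma (k * z + u)) (fun z => k * psi (k * z + u))%C 4.
Proof.
  intros hk. set (v := Rabs (Re u)).
  assert (hv := Rabs_pos (Re u)). fold v in hv.
  assert (hu : - v <= Re u). { unfold v. generalize (Rle_abs (- Re u)). rewrite Rabs_Ropp. lra. }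
  (* Beyond this abscissa Re (k z + u) >= k x / 4 >= 1 for all [z] within x / 2 of x. The Lipschitz
     constant 2 / (k x / 4) times the distance k x / 2 is then 4. *)
  exists (4 * (v + 1) / k), (exp (Im u ^ 2)).
  assert (hX : 4 * (v + 1) <= 4 * (v + 1) / k).
  { apply Rmult_le_reg_r with k; [lra|]. replace (4 * (v + 1) / k * k) with (4 * (v + 1)) by (field; lra). nra. }
  split; [lra|]. split; [left; apply exp_pos|].
  assert (kx : forall x, 4 * (v + 1) / k <= x -> 4 * (v + 1) <= k * x).
  { intros x hx. apply Rmult_le_compat_l with (r := k) in hx; [|lra].
    replace (k * (4 * (v + 1) / k)) with (4 * (v + 1)) in hx by (field; lra). exact hx. }
  split.
  - intros z hz. specialize (kx _ hz).
    assert (hr : 1 <= Re (k * z + u)%C) by (reim; lra).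
    split; [|split].
    + apply Cgamma_neq_0, not_pole_Re. lra.
    + eapply is_derive_ext_val.
      * apply (is_derive_comp_C Cgamma (fun z => k * z + u)%C); [now apply is_derive_Cgamma|].
        apply is_derive_plus_C; [|apply is_derive_const_C].
        apply is_derive_mult_C; [apply is_derive_const_C | apply is_derive_id_C].
      * ceq. ring.
    + assert (e : exp (Im u ^ 2) = exp (Rabs (Im u) ^ 2)) by now rewrite pow2_abs. rewrite e.
      apply Cgamma_mod_le; [exact hr | reim; ring |]. reim.
      replace (k * 0 + 0 * Re z + Im u) with (Im u) by ring. lra.
  - intros x z hx hz. specialize (kx x hx).
    assert (hre : x / 2 <= Re z).
    { assert (q := re_le_Cmod (z - x)). rewrite Re_minus, Re_RtoC in q.
      assert (q' := Rle_trans _ _ _ q hz). apply Rabs_le_between in q'. lra. }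
    replace (k * psi (k * z + u) - k * psi (k * x + u))%C with (k * (psi (k * z + u) - psi (k * x + u)))%C by ring.
    rewrite Cmod_mult, Cmod_RtoC_pos by lra.
    assert (p := psi_lipschitz (k * x / 4) (k * z + u) (k * x + u)).
    assert (p1 : 1 <= k * x / 4) by lra.
    assert (p2 : k * x / 4 <= Re (k * z + u)%C). { reim. assert (k * (x / 2) <= k * Re z) by (apply Rmult_le_compat_l; lra). lra. }
    assert (p3 : k * x / 4 <= Re (k * x + u)%C). { reim. lra. }
    specialize (p p1 p2 p3).
    replace (k * z + u - (k * x + u))%C with (k * (z - x))%C in p by ring.
    rewrite Cmod_mult, Cmod_RtoC_pos in p by lra.
    assert (hq : 2 * (k * Cmod (z - x)) / (k * x / 4) <= 4).
    { apply Rmult_le_reg_r with (k * x / 4); [lra|]. replace (2 * (k * Cmod (z - x)) / (k * x / 4) * (k * x / 4)) with (2 * (k * Cmod (z - x))) by (field; nra).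
      assert (k * Cmod (z - x) <= k * (x / 2)) by (apply Rmult_le_compat_l; lra). lra. }
    assert (h0 := Cmod_ge_0 (psi (k * z + u) - psi (k * x + u))). nra.
Qed.

(** A gamma factor satisfies this for every [B], since digamma grows like a logarithm; the
    exponential and Dirichlet factors only for some [B]. *)
Definition eventually_above (l : C -> C) (B : R) : Prop :=
  exists X : R, forall x, X <= x -> B <= Re (l (RtoC x)).

Lemma eventually_above_plus (l m : C -> C) (B E : R) : eventually_above l B -> eventually_above m E -> eventually_above (fun z => l z + m z)%C (B + E).
Proof.
  intros [X h] [X' h']. exists (Rmax X X'). intros x hx. rewrite Re_plus.
  specialize (h x (Rle_trans _ _ _ (Rmax_l _ _) hx)). specialize (h' x (Rle_trans _ _ _ (Rmax_r _ _) hx)). lra.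
Qed.

Lemma eventually_above_gamma (k : R) (u : C) (B : R) : 0 < k <= 1 -> eventually_above (fun z => k * psi (k * z + u))%C B.
Proof.
  intros hk. set (v := Rabs (Re u)).
  assert (hu : - v <= Re u). { unfold v. generalize (Rle_abs (- Re u)). rewrite Rabs_Ropp. lra. }
  set (T := exp (Rabs B / k + 1) + 1).
  exists ((v + T) / k). intros x hx.
  apply Rmult_le_compat_l with (r := k) in hx; [|lra].
  replace (k * ((v + T) / k)) with (v + T) in hx by (field; lra).
  assert (hT := exp_pos (Rabs B / k + 1)).
  assert (hr : T <= Re (k * x + u)%C) by (reim; lra).
  set (w := (k * x + u)%C) in *.
  assert (p := psi_Re_ge w ltac:(unfold T in hr; lra)).
  assert (hl : Rabs B / k + 1 <= ln (Re w)).
  { rewrite <- (ln_exp (Rabs B / k + 1)). apply Rcomplements.ln_le; [exact hT|]. unfold T in hr. lra. }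
  assert (hi : / Re w <= 1). { rewrite <- Rinv_1. apply Rinv_le_contravar; unfold T in hr; lra. }
  rewrite Re_mult, Re_RtoC, Im_RtoC, Rmult_0_l, Rminus_0_r.
  assert (hb : Rabs B / k <= Re (psi w)) by lra.
  apply Rmult_le_compat_l with (r := k) in hb; [|lra].
  replace (k * (Rabs B / k)) with (Rabs B) in hb by (field; lra).
  generalize (Rle_abs B). lra.
Qed.

(** Only the upper part of the strip appears because the bound on [L] is given there; evenness of
    the completed function supplies the lower part. *)
Definition bounded_high (f : C -> C) : Prop :=
  forall X : R, exists M Y : R, 0 <= M /\ forall z, - X <= Re z <= X -> Y <= Im z -> Cmod (f z) <= M.

Lemma bounded_high_mult (f g : C -> C) : bounded_high f -> bounded_high g -> bounded_high (fun z => f z * g z)%C.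
Proof.
  intros h h' X. destruct (h X) as (M & Y & hM & b). destruct (h' X) as (M' & Y' & hM' & b').
  exists (M * M'), (Rmax Y Y'). split; [now apply Rmult_le_pos|]. intros z hz hy. rewrite Cmod_mult.
  apply Rmult_le_compat; try apply Cmod_ge_0.
  - apply b; [exact hz|]. eapply Rle_trans; [apply Rmax_l | exact hy].
  - apply b'; [exact hz|]. eapply Rle_trans; [apply Rmax_r | exact hy].
Qed.

Lemma bounded_high_exp (c : C) (r : R) : bounded_high (fun z => c * Cexp (r * z))%C.
Proof.
  intros X. exists (Cmod c * exp (Rabs r * Rabs X)), 0. split.
  { apply Rmult_le_pos; [apply Cmod_ge_0 | left; apply exp_pos]. }
  intros z hz _. rewrite Cmod_mult, Cmod_Cexp. apply Rmult_le_compat_l; [apply Cmod_ge_0|].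
  apply Rle_exp. reim. rewrite Rmult_0_l, Rminus_0_r.
  eapply Rle_trans; [apply Rle_abs|]. rewrite Rabs_mult. apply Rmult_le_compat_l; [apply Rabs_pos|].
  generalize (Rle_abs X). intros. apply Rabs_le. lra.
Qed.

Lemma bounded_high_gamma (k : R) (u : C) : 0 < k <= 1 -> bounded_high (fun z => Cgamma (k * z + u)).
Proof.
  intros hk X. destruct (Cgamma_strip_bounded (Rabs X + Rabs (Re u))) as (M & hM & b).
  exists M, ((Rabs (Im u) + 1) / k). split; [exact hM|]. intros z hz hy. apply b.
  - reim. rewrite Rmult_0_l, Rminus_0_r.
    assert (a1 := Rle_abs (Re u)). assert (a2 := Rle_abs (- Re u)). rewrite Rabs_Ropp in a2.
    assert (a3 := Rle_abs X). assert (a4 : 0 <= Rabs X) by apply Rabs_pos.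
    assert (hX : Rabs (Re z) <= Rabs X) by (apply Rabs_le; lra).
    assert (hz' := Rle_abs (Re z)). assert (hz2 := Rle_abs (- Re z)). rewrite Rabs_Ropp in hz2.
    assert (hz0 := Rabs_pos (Re z)). nra.
  - reim. rewrite Rmult_0_l, Rplus_0_r.
    apply Rmult_le_compat_l with (r := k) in hy; [|lra].
    replace (k * ((Rabs (Im u) + 1) / k)) with (Rabs (Im u) + 1) in hy by (field; lra).
    generalize (Rle_abs (- Im u)). rewrite Rabs_Ropp. lra.
Qed.

Definition good_factor (f l : C -> C) : Prop := (exists D, 0 <= D /\ slow_log_deriv f l D) /\ bounded_high f.

Lemma good_factor_mult (f g l m : C -> C) : good_factor f l -> good_factor g m ->
  good_factor (fun z => f z * g z)%C (fun z => l z + m z)%C.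
Proof.
  intros [(D & hD & s) b] [(E & hE & t) c]. split; [|now apply bounded_high_mult].
  exists (D + E). split; [lra | now apply slow_log_deriv_mult].
Qed.

Lemma good_factor_ext (f g l : C -> C) : (forall z, f z = g z) -> good_factor f l -> good_factor g l.
Proof.
  intros e [(D & hD & s) b]. split.
  - exists D. split; [exact hD|]. apply (slow_log_deriv_ext f g l D 0); auto.
  - intros X. destruct (b X) as (M & Y & hM & k). exists M, Y. split; [exact hM|].
    intros z. rewrite <- e. apply k.
Qed.

Lemma good_factor_exp (c : C) (r : R) : c <> 0%C -> good_factor (fun z => c * Cexp (r * z))%C (fun _ => RtoC r).
Proof. intros hc. split; [exists 0; split; [lra | now apply slow_log_deriv_exp] | apply bounded_high_exp]. Qed.

Lemma good_factor_gamma (k : R) (u : C) : 0 < k <= 1 ->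
  good_factor (fun z => Cgamma (k * z + u)) (fun z => k * psi (k * z + u))%C.
Proof. intros hk. split; [exists 4; split; [lra | now apply slow_log_deriv_gamma] | now apply bounded_high_gamma]. Qed.

Definition log_deriv_GammaR (u : C) (z : C) : C := (RtoC (- ln PI / 2) + RtoC (1 / 2) * psi (RtoC (1 / 2) * z + u))%C.
Definition log_deriv_GammaC (u : C) (z : C) : C := (RtoC (- ln (2 * PI)) + 1 * psi (1 * z + u))%C.

Lemma good_factor_GammaR (mu : C) :
  good_factor (fun z => GammaR (1 / 2 + z + mu)) (log_deriv_GammaR ((1 / 2 + mu) / 2)%C).
Proof.
  eapply good_factor_ext; [|apply good_factor_mult; [apply (good_factor_exp (Cexp (- (1 / 2 + mu) / 2 * ln PI)) (- ln PI / 2)) |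
    apply (good_factor_gamma (1 / 2) ((1 / 2 + mu) / 2)%C)]]; [|apply Cexp_neq_0|lra].
  intros z. cbv beta. unfold GammaR, Rcpow.
  rewrite <- Cexp_plus. f_equal.
  - f_equal. rewrite RtoC_div, RtoC_opp by lra. field.
  - f_equal. rewrite RtoC_div by lra. field.
Qed.

Lemma good_factor_GammaC (eta : C) :
  good_factor (fun z => GammaC (1 / 2 + z + eta)) (log_deriv_GammaC (1 / 2 + eta)%C).
Proof.
  eapply good_factor_ext; [|apply good_factor_mult; [apply (good_factor_exp (2 * Cexp (- (1 / 2 + eta) * ln (2 * PI))) (- ln (2 * PI))) |
    apply (good_factor_gamma 1 (1 / 2 + eta)%C)]]; [| |lra].
  - intros z. cbv beta. unfold GammaC, Rcpow.
    rewrite <- !Cmult_assoc. f_equal. rewrite Cmult_assoc, <- Cexp_plus. f_equal.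
    + f_equal. rewrite RtoC_opp. ring.
    + f_equal. ring.
  - apply Cmult_neq_0; [apply RtoC_neq_0; lra | apply Cexp_neq_0].
Qed.

Lemma eventually_above_logGR (u : C) (B : R) : eventually_above (log_deriv_GammaR u) B.
Proof.
  destruct (eventually_above_gamma (1 / 2) u (B + ln PI / 2) ltac:(lra)) as [X h]. exists X. intros x hx.
  specialize (h x hx). unfold log_deriv_GammaR. rewrite Re_plus, Re_RtoC. lra.
Qed.

Lemma eventually_above_logGC (u : C) (B : R) : eventually_above (log_deriv_GammaC u) B.
Proof.
  destruct (eventually_above_gamma 1 u (B + ln (2 * PI)) ltac:(lra)) as [X h]. exists X. intros x hx.
  specialize (h x hx). unfold log_deriv_GammaC. rewrite Re_plus, Re_RtoC. lra.
Qed.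

Lemma good_factor_Cprod (G : nat -> C -> C) (lg : nat -> C -> C) (n : nat) :
  (forall j, good_factor (G j) (lg j)) ->
  good_factor (fun z => Cprod (fun j => G j z) n) (fun z => Csum (fun j => lg j z) n).
Proof.
  intros h. induction n as [|n IH].
  - eapply good_factor_ext; [|apply (good_factor_exp 1 0); apply RtoC_neq_0; lra].
    intros z. simpl. rewrite Cmult_0_l, Cexp_0. ring.
  - simpl. apply (good_factor_mult _ _ _ _ IH (h n)).
Qed.

Lemma eventually_above_Csum (lg : nat -> C -> C) (n : nat) (B : R) :
  (forall j E, eventually_above (lg j) E) -> (0 < n)%nat -> eventually_above (fun z => Csum (fun j => lg j z) n) B.
Proof.
  intros h hn. revert B. induction n as [|n IH]; intros B; [lia|].
  destruct n as [|n].
  - simpl. destruct (h O B) as [X k]. exists X. intros x hx. rewrite Re_plus, Re_RtoC, Rplus_0_l. now apply k.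
  - change (eventually_above (fun z => Csum (fun j => lg j z) (S n) + lg (S n) z)%C B).
    replace B with (B + 0) by ring. apply eventually_above_plus; [apply IH; lia | apply h].
Qed.

(** * Dirichlet series far to the right *)

Lemma Ccv_bounded (u : nat -> C) (l : C) : Ccv u l -> exists B : R, forall n, Cmod (u n) <= B.
Proof.
  intros h. destruct (h 1 Rlt_0_1) as [N k].
  assert (fin : forall m, exists B : R, forall n, (n < m)%nat -> Cmod (u n) <= B).
  { induction m as [|m [B hB]].
    - exists 0. intros; lia.
    - exists (Rmax B (Cmod (u m))). intros n hn. destruct (Nat.eq_dec n m) as [->|hne]; [apply Rmax_r|].
      eapply Rle_trans; [apply hB; lia | apply Rmax_l]. }
  destruct (fin N) as [B hB]. exists (Rmax B (Cmod l + 1)). intros n.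
  destruct (Nat.lt_ge_cases n N) as [hn|hn].
  - eapply Rle_trans; [now apply hB | apply Rmax_l].
  - eapply Rle_trans; [|apply Rmax_r]. specialize (k n hn). assert (t := Cmod_sub_ge (u n) l). lra.
Qed.

Lemma is_series_Ccv (t : nat -> C) (l : C) : is_series t l ->
  Ccv (fun n => sum_n (G := C_AbelianMonoid) t n) l.
Proof.
  intros h e he. specialize (h (fun y => Cmod (y - l) < e)).
  destruct h as [N hN].
  { apply locally_C_AbsRing || apply locally_C. exists e. tauto. }
  exists N. intros m hm. exact (hN m hm).
Qed.

Lemma sum_n_C_S (t : nat -> C) (n : nat) :
  sum_n (G := C_AbelianMonoid) t (S n) = (sum_n (G := C_AbelianMonoid) t n + t (S n))%C.
Proof. rewrite sum_Sn. reflexivity. Qed.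

Lemma sum_n_C_zero (t : nat -> C) (n : nat) : (forall k, (k <= n)%nat -> t k = 0%C) ->
  sum_n (G := C_AbelianMonoid) t n = RtoC 0.
Proof.
  induction n as [|n IH]; intros h.
  - rewrite sum_O. now apply h.
  - rewrite sum_n_C_S, IH, h by (intros; try apply h; lia). ceq. ring.
Qed.

Lemma exp_decay (A th e : R) : 0 < th -> 0 < e -> exists X : R, forall x, X <= x -> A * exp (- (x * th)) <= e.
Proof.
  intros hth he. exists (Rabs A / (e * th)). intros x hx.
  assert (hA := Rabs_pos A).
  assert (hx0 : Rabs A / e <= x * th).
  { apply Rmult_le_compat_r with (r := th) in hx; [|lra].
    replace (Rabs A / (e * th) * th) with (Rabs A / e) in hx by (field; lra). exact hx. }
  assert (q := exp_ineq1_le (x * th)). assert (hp := exp_pos (x * th)).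
  rewrite exp_Ropp. apply Rmult_le_reg_r with (exp (x * th)); [exact hp|].
  rewrite Rmult_assoc, Rinv_l, Rmult_1_r by lra.
  assert (h1 : e * (Rabs A / e) <= e * exp (x * th)) by (apply Rmult_le_compat_l; lra).
  replace (e * (Rabs A / e)) with (Rabs A) in h1 by (field; lra). generalize (Rle_abs A). lra.
Qed.

(** The first nonzero coefficient dominates as Re z grows, uniformly in Im z, because all other
    terms are smaller by a power of (m + 1) / m at least. *)
Lemma dirichlet_asym (a : nat -> R) (L : C -> C) : dirichlet_series a L ->
  (exists X : R, forall z, X <= Re z -> L z = 0%C) \/
  (exists (m : nat) (al : R), (1 <= m)%nat /\ al <> 0 /\
    forall e : R, 0 < e -> exists X : R, forall z, X <= Re z -> Cmod (L z * Rcpow (INR m) z - al) <= e).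
Proof.
  intros [sg hL].
  destruct (classic (exists k, a (S k) <> 0)) as [hne|hz].
  2: { left. exists (sg + 1). intros z hzr. symmetry.
       assert (h := is_series_Ccv _ _ (hL z ltac:(lra))).
       apply (Ccv_unique _ _ _ (Ccv_const 0)). eapply (Ccv_ext _ _ _ 0); [|exact h].
       intros m _. apply sum_n_C_zero. intros k _.
       destruct (Req_dec (a (S k)) 0) as [e|e]; [rewrite e; ring|]. exfalso. apply hz. now exists k. }
  right.
  assert (hmin : exists k0, a (S k0) <> 0 /\ forall k, (k < k0)%nat -> a (S k) = 0).
  { destruct (dec_inh_nat_subset_has_unique_least_element (fun k => a (S k) <> 0)) as [k0 [[h1 h2] _]].
    - intros k. destruct (Req_dec (a (S k)) 0); tauto.
    - exact hne.
    - exists k0. split; [exact h1|]. intros k hk. apply NNPP. intros hk'. specialize (h2 k hk'). lia. }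
  destruct hmin as (k0 & hk0 & hlow).
  exists (S k0), (a (S k0)). split; [lia|]. split; [exact hk0|].
  set (s0 := sg + 1).
  destruct (Ccv_bounded _ _ (is_series_Ccv _ _ (hL (RtoC s0) ltac:(rewrite Re_RtoC; unfold s0; lra)))) as [B hB].
  assert (hB0 : 0 <= B) by (eapply Rle_trans; [apply Cmod_ge_0 | apply (hB O)]).
  (* Convergence at the single point [s0] bounds the partial sums by [B]; a term is a difference of
     two of them, so the coefficients grow at most like a power. *)
  set (A := 2 * B).
  assert (coef : forall k, Rabs (a (S k)) <= A * exp (s0 * ln (INR (S k)))).
  { intros k. assert (ht : Cmod (a (S k) * Rcpow (INR (S k)) (- s0)) <= A).
    { destruct k as [|k].
      - specialize (hB O). rewrite sum_O in hB. unfold A. eapply Rle_trans; [exact hB|]. lra.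
      - assert (h1 := hB k). assert (h2 := hB (S k)). rewrite sum_n_C_S in h2.
        set (S1 := sum_n _ k) in *. set (t := (a (S (S k)) * Rcpow (INR (S (S k))) (- s0))%C) in *.
        replace t with ((S1 + t) - S1)%C by ring. eapply Rle_trans; [apply Cmod_sub_le|]. unfold A.
        apply Rle_trans with (B + B); [|lra]. apply Rplus_le_compat; assumption. }
    rewrite Cmod_mult, Cmod_R, Cmod_Rcpow, Re_opp, Re_RtoC in ht.
    assert (hp := exp_pos (s0 * ln (INR (S k)))).
    replace (- s0 * ln (INR (S k))) with (- (s0 * ln (INR (S k)))) in ht by ring. rewrite exp_Ropp in ht.
    apply Rmult_le_compat_r with (r := exp (s0 * ln (INR (S k)))) in ht; [|lra].
    rewrite Rmult_assoc, Rinv_l in ht by lra. lra. }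
  set (lm := ln (INR (S k0))). set (th := ln (INR (S k0) + 1) - lm).
  assert (hIm : 1 <= INR (S k0)) by (replace 1 with (INR 1) by reflexivity; apply le_INR; lia).
  assert (hth : 0 < th). { unfold th, lm. assert (ln (INR (S k0)) < ln (INR (S k0) + 1)) by (apply ln_increasing; lra). lra. }
  (* The exponent s0 + 2 instead of s0 reserves a factor k^(-2) in each term, which makes the tail
     summable by telescoping. The rest of the decay is exp (- (x - s0 - 2) th), with [th] the
     logarithmic gap to the next integer. *)
  set (A' := A * exp ((s0 + 2) * lm)).
  assert (hA' : 0 <= A') by (apply Rmult_le_pos; [unfold A; lra | left; apply exp_pos]).
  assert (main : forall z, s0 + 2 <= Re z ->
    Cmod (L z * Rcpow (INR (S k0)) z - a (S k0)) <= 2 * A' * exp (- ((Re z - (s0 + 2)) * th))).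
  { intros z hz. set (x := Re z) in *. set (E := exp (- ((x - (s0 + 2)) * th))).
    assert (hE : 0 < E) by apply exp_pos.
    set (R0 := Rcpow (INR (S k0)) z).
    assert (h := is_series_Ccv _ _ (hL z ltac:(fold x; unfold s0 in hz; lra))).
    set (t := fun k : nat => (a (S k) * Rcpow (INR (S k)) (- z))%C) in *.
    assert (rinv : (Rcpow (INR (S k0)) (- z) * R0 = 1)%C).
    { unfold R0, Rcpow. rewrite <- Cexp_plus, <- Cexp_0. f_equal. ring. }
    assert (ps : forall j, Cmod (sum_n (G := C_AbelianMonoid) t (k0 + j) * R0 - a (S k0)) <=
       2 * A' * E * (/ INR (k0 + 2) - / INR (k0 + j + 2))).
    { induction j as [|j IH].
      - rewrite !Nat.add_0_r.
        replace (sum_n (G := C_AbelianMonoid) t k0) with (t k0).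
        + unfold t. rewrite <- Cmult_assoc, rinv. replace (a (S k0) * 1 - a (S k0))%C with (RtoC 0) by ring.
          rewrite Cmod_0. lra.
        + destruct k0 as [|k1]; [now rewrite sum_O|]. rewrite sum_n_C_S, sum_n_C_zero; [ring|].
          intros k hk. unfold t. rewrite hlow by lia. ring.
      - replace (k0 + S j)%nat with (S (k0 + j)) by lia. rewrite sum_n_C_S.
        replace ((sum_n (G := C_AbelianMonoid) t (k0 + j) + t (S (k0 + j))) * R0 - a (S k0))%C with
          ((sum_n (G := C_AbelianMonoid) t (k0 + j) * R0 - a (S k0)) + t (S (k0 + j)) * R0)%C by ring.
        eapply Rle_trans; [apply Cmod_triangle|].
        set (k := S (k0 + j)). set (y := INR (S k)).
        assert (hy : 1 <= y) by (unfold y; replace 1 with (INR 1) by reflexivity; apply le_INR; lia).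
        assert (ey : INR (k0 + j + 2) = y) by (unfold y, k; f_equal; lia).
        assert (ey1 : INR (k + 2) = y + 1) by (unfold y, k; rewrite <- S_INR; f_equal; lia).
        rewrite ey in IH. rewrite ey1.
        assert (tel := inv_sqr_telescope y hy).
        assert (bt : Cmod (t k * R0) <= A' * E * / y ^ 2).
        { unfold t, R0. rewrite !Cmod_mult, Cmod_R, !Cmod_Rcpow, Re_opp. fold y x lm.
          assert (c := coef k). fold y in c.
          assert (hly : th <= ln y - lm).
          { unfold th. assert (ln (INR (S k0) + 1) <= ln y); [|lra]. apply Rcomplements.ln_le; [lra|].
            unfold y. rewrite <- S_INR. apply le_INR. unfold k. lia. }
          apply Rle_trans with (A * exp (s0 * ln y) * exp (- x * ln y) * exp (x * lm)).
          - apply Rmult_le_compat_r; [left; apply exp_pos|]. apply Rmult_le_compat_r; [left; apply exp_pos | exact c].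
          - replace (/ y ^ 2) with (exp (- 2 * ln y)).
            2: { replace (- 2 * ln y) with (- (ln y + ln y)) by ring. rewrite exp_Ropp, exp_plus, exp_ln by lra.
                 f_equal. ring. }
            unfold A', E. rewrite !Rmult_assoc, <- !exp_plus. apply Rmult_le_compat_l; [unfold A; lra|].
            apply Rle_exp. assert (0 <= (x - (s0 + 2)) * (ln y - lm - th)) by (apply Rmult_le_pos; lra). lra. }
        assert (A' * E * / y ^ 2 <= A' * E * (2 * (/ y - / (y + 1)))).
        { apply Rmult_le_compat_l; [apply Rmult_le_pos; lra | exact tel]. }
        lra. }
    apply (Ccv_Cmod_le (fun n => sum_n (G := C_AbelianMonoid) t n * R0 - a (S k0))%C _ _ k0).
    - intros n hn. specialize (ps (n - k0)%nat). replace (k0 + (n - k0))%nat with n in ps by lia.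
      eapply Rle_trans; [exact ps|].
      assert (i1 : / INR (k0 + 2) <= 1).
      { rewrite <- Rinv_1. apply Rinv_le_contravar; [lra|]. replace 1 with (INR 1) by reflexivity. apply le_INR; lia. }
      assert (i2 : 0 < / INR (n + 2)) by (apply Rinv_0_lt_compat, lt_0_INR; lia).
      assert (0 <= A' * E) by (apply Rmult_le_pos; lra). nra.
    - apply Ccv_minus; [apply Ccv_mult; [exact h | apply Ccv_const] | apply Ccv_const]. }
  intros e he. destruct (exp_decay (2 * A') th e hth he) as [X hX].
  exists (Rabs X + s0 + 2). intros z hz.
  assert (hXa := Rle_abs X). assert (hX0 := Rabs_pos X).
  eapply Rle_trans; [apply main; lra|]. apply hX. lra.
Qed.

Lemma hol_entire_rect (f : C -> C) (x1 x2 y1 y2 : R) : entire f -> hol_rect f x1 x2 y1 y2.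
Proof. intros h z _. now apply h. Qed.

(** Cauchy's estimate on unit squares applied to f - al shows that the derivative tends to 0, so the
    logarithmic derivative does too. It is one function [l] for every [e]. *)
Lemma slow_log_deriv_near_const (f : C -> C) (al : C) : entire f -> al <> 0%C ->
  (forall e, 0 < e -> exists X, forall z, X <= Re z -> Cmod (f z - al) <= e) ->
  exists l : C -> C, forall e, 0 < e -> slow_log_deriv f l e /\ eventually_above l (- e).
Proof.
  intros hf hal h. exists (fun z => C_derive f z / f z)%C. intros e he.
  set (m := Cmod al). assert (hm : 0 < m) by now apply Cmod_gt_0.
  (* The first bound keeps |f| >= m / 2; with the second, Cauchy's estimate 4 e1 divided by m / 2 is
     at most e / 2. *)
  set (e1 := Rmin (m / 2) (e * m / 16)).
  assert (he1 : 0 < e1) by (apply Rmin_pos; [lra|]; assert (0 < e * m) by (now apply Rmult_lt_0_compat); lra).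
  assert (q1 : e1 <= m / 2) by apply Rmin_l. assert (q2 : e1 <= e * m / 16) by apply Rmin_r.
  destruct (h e1 he1) as [X hX].
  set (X1 := Rmax 1 (2 * (Rabs X + 1))).
  assert (x1 : 1 <= X1) by apply Rmax_l. assert (x2 : 2 * (Rabs X + 1) <= X1) by apply Rmax_r.
  assert (x3 := Rle_abs X). assert (x4 := Rabs_pos X).
  assert (low : forall z, X <= Re z -> m / 2 <= Cmod (f z)).
  { intros z hz. specialize (hX z hz). assert (t := Cmod_sub_ge al (f z)). rewrite Cmod_sub_sym in t. fold m in t. lra. }
  assert (lb : forall z, X + 1 <= Re z -> Cmod (C_derive f z / f z) <= e / 2).
  { intros z hz.
    assert (n0 : f z <> 0%C) by (apply Cmod_pos_neq; specialize (low z ltac:(lra)); lra).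
    assert (d : C_derive (fun s => f s - al)%C z = C_derive f z).
    { apply is_C_derive_unique. eapply is_derive_ext_val.
      - apply is_derive_minus_C; [apply C_derive_is, hf; exact I | apply is_derive_const_C].
      - ceq. ring. }
    assert (c := cauchy_estimate (fun s => f s - al)%C z 1 e1 1 Rlt_0_1).
    simpl C_derive_n in c. rewrite d in c.
    assert (c' : Cmod (C_derive f z) <= 4 * INR (fact 1) * e1 / 1 ^ 1).
    { apply c.
      - intros s _. apply ex_derive_minus_C; [apply hf; exact I | apply ex_derive_const_C].
      - intros s [[hs _] _]. apply hX. lra. }
    simpl in c'. rewrite Cmod_div by exact n0. specialize (low z ltac:(lra)).
    apply Rmult_le_reg_r with (Cmod (f z)); [lra|]. unfold Rdiv at 1. rewrite Rmult_assoc, Rinv_l, Rmult_1_r by lra.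
    assert (e / 2 * (m / 2) <= e / 2 * Cmod (f z)) by (apply Rmult_le_compat_l; lra). lra. }
  split.
  - exists X1, 3. split; [exact x1|]. split; [lra|]. split.
    + intros z hz. assert (hl := low z ltac:(lra)).
      assert (n0 : f z <> 0%C) by (apply Cmod_pos_neq; lra).
      split; [exact n0|]. split.
      * eapply is_derive_ext_val; [apply C_derive_is, hf; exact I|]. field. exact n0.
      * assert (hl2 := low (RtoC (Re z)) ltac:(rewrite Re_RtoC; lra)).
        specialize (hX z ltac:(lra)). assert (t := Cmod_sub_ge (f z) al). fold m in t. lra.
    + intros x z hx hz.
      assert (hre : x / 2 <= Re z).
      { assert (q := re_le_Cmod (z - x)). rewrite Re_minus, Re_RtoC in q.
        assert (q' := Rle_trans _ _ _ q hz). apply Rabs_le_between in q'. lra. }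
      eapply Rle_trans; [apply Cmod_sub_le|].
      assert (b1 := lb z ltac:(lra)). assert (b2 := lb (RtoC x) ltac:(rewrite Re_RtoC; lra)). lra.
  - exists X1. intros x hx. assert (b := lb (RtoC x) ltac:(rewrite Re_RtoC; lra)).
    assert (r := re_le_Cmod (C_derive f (RtoC x) / f (RtoC x))).
    assert (r2 := Rle_trans _ _ _ r b). apply Rabs_le_between in r2. lra.
Qed.

(** * A Liouville theorem for even functions bounded in a half-plane *)

Definition strip_poly (F : C -> C) : Prop :=
  forall X : R, exists (M Y : R) (k : nat), 0 <= M /\ 1 <= Y /\
    forall z, Rabs (Re z) <= X -> Y <= Rabs (Im z) -> Cmod (F z) <= M * Rabs (Im z) ^ k.

Lemma taylor_growth (F : C -> C) (m : nat) : exists G : R, 0 <= G /\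
  forall x : R, 1 <= x -> Cmod (taylor_at F 0 m x) <= G * x ^ m.
Proof.
  induction m as [|m (G & hG & h)].
  - exists (Cmod (C_derive_n F 0 0 / INR (fact 0))). split; [apply Cmod_ge_0|]. intros x _.
    unfold taylor_at. rewrite sum_O. change (Cmod (C_derive_n F 0 0 / INR (fact 0) * 1) <= Cmod (C_derive_n F 0 0 / INR (fact 0)) * 1).
    rewrite Cmult_1_r. lra.
  - exists (G + Cmod (C_derive_n F (S m) 0 / INR (fact (S m)))).
    assert (hc := Cmod_ge_0 (C_derive_n F (S m) 0 / INR (fact (S m)))). split; [lra|].
    intros x hx. unfold taylor_at. rewrite sum_n_C_S. eapply Rle_trans; [apply Cmod_triangle|].
    rewrite Cmod_mult, Cmod_pow. replace (x - 0)%C with (RtoC x) by ring. rewrite Cmod_RtoC_pos by lra.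
    specialize (h x hx). unfold taylor_at in h. replace (x - 0)%C with (RtoC x) in h by ring.
    assert (x ^ m <= x ^ S m). { simpl. assert (0 < x ^ m) by (apply pow_lt; lra). nra. }
    assert (G * x ^ m <= G * x ^ S m) by (apply Rmult_le_compat_l; assumption).
    rewrite Rmult_plus_distr_r. lra.
Qed.

(** Induction on the degree: a nonzero leading coefficient would outgrow the lower terms along the
    positive axis, so it vanishes. *)
Lemma taylor_bounded_const (F : C -> C) (m : nat) (K X : R) :
  (forall x : R, X <= x -> Cmod (taylor_at F 0 m x) <= K) ->
  forall z, taylor_at F 0 m z = taylor_at F 0 0 z.
Proof.
  induction m as [|m IH]; intros h z; [reflexivity|].
  set (c := (C_derive_n F (S m) 0 / INR (fact (S m)))%C).
  assert (e : forall z, taylor_at F 0 (S m) z = (taylor_at F 0 m z + c * (z - 0) ^ (S m))%C).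
  { intros w. unfold taylor_at. rewrite sum_n_C_S. reflexivity. }
  assert (hc : c = 0%C).
  { apply Cmod_eq_0. apply Rle_antisym; [|apply Cmod_ge_0]. apply Rnot_lt_le. intros hlt.
    destruct (taylor_growth F m) as (G & hG & g).
    assert (hK : 0 <= K) by (eapply Rle_trans; [apply Cmod_ge_0 | apply (h X); lra]).
    set (x := Rmax (Rmax 1 X) ((K + G) / Cmod c + 1)).
    assert (x1 : 1 <= x) by (unfold x; eapply Rle_trans; [apply Rmax_l | apply Rmax_l]).
    assert (x2 : X <= x) by (unfold x; eapply Rle_trans; [apply Rmax_r | apply Rmax_l]).
    assert (x3 : (K + G) / Cmod c + 1 <= x) by apply Rmax_r.
    specialize (h x x2). specialize (g x x1). rewrite e in h.
    assert (t := Cmod_sub_ge (c * (x - 0) ^ S m) (- taylor_at F 0 m x)).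
    replace (c * (x - 0) ^ S m - - taylor_at F 0 m x)%C with (taylor_at F 0 m x + c * (x - 0) ^ S m)%C in t by ring.
    rewrite Cmod_opp, Cmod_mult, Cmod_pow in t. replace (x - 0)%C with (RtoC x) in t by ring.
    rewrite Cmod_RtoC_pos in t by lra.
    replace (x - 0)%C with (RtoC x) in h by ring.
    assert (hxm : 1 <= x ^ m) by (now apply pow_R1_Rle).
    assert (K <= K * x ^ m) by nra.
    simpl in t, h.
    assert (h1 : Cmod c * x <= K + G).
    { apply Rmult_le_reg_r with (x ^ m); [lra|]. lra. }
    apply Rmult_le_compat_l with (r := Cmod c) in x3; [|lra].
    replace (Cmod c * ((K + G) / Cmod c + 1)) with (K + G + Cmod c) in x3 by (field; lra). lra. }
  rewrite e, hc, IH.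
  - ring.
  - intros x hx. specialize (h x hx). rewrite e, hc in h.
    replace (taylor_at F 0 m x + 0 * (x - 0) ^ S m)%C with (taylor_at F 0 m x) in h by ring. exact h.
Qed.

(** Evenness carries the bound to the left half-plane, and the growth in the remaining strip is
    polynomial. The Taylor remainder on large squares then vanishes, [F] is a polynomial, and
    boundedness on the axis makes it constant. *)
Lemma liouville_half_plane (F : C -> C) (X K : R) : entire F -> (forall z, F (- z)%C = F z) ->
  strip_poly F -> (forall z, X <= Re z -> Cmod (F z) <= K) -> exists c : C, forall z, F z = c.
Proof.
  intros hF hev hs hK.
  destruct (hs (Rabs X)) as (M & Y & k & hM & hY & b).
  assert (hx := Rle_abs X). assert (hx0 := Rabs_pos X).
  assert (hK0 : 0 <= K).
  { eapply Rle_trans; [apply Cmod_ge_0 | apply (hK (RtoC X)); rewrite Re_RtoC; lra]. }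
  assert (side : forall z, Rabs X <= Rabs (Re z) -> Cmod (F z) <= K).
  { intros z hz. destruct (Rle_lt_dec 0 (Re z)) as [h|h].
    - rewrite (Rabs_pos_eq (Re z)) in hz by exact h. apply hK. lra.
    - rewrite <- hev. apply hK. rewrite Re_opp. rewrite (Rabs_left (Re z)) in hz by exact h. lra. }
  assert (eqT : forall z, F z = taylor_at F 0 k z).
  { intros z. apply Csub_eq_0, Cmod_eq_0. apply Rle_antisym; [|apply Cmod_ge_0]. apply Rnot_lt_le. intros hlt.
    set (d := Cmod (F z - taylor_at F 0 k z)) in *.
    set (Q := 4 * (K + M) * Cmod z ^ S k).
    assert (hQ : 0 <= Q). { unfold Q. apply Rmult_le_pos; [lra|]. apply pow_le, Cmod_ge_0. }
    (* The remainder of order k + 1 on the square of half-side r is at most Q / r; the summand Q / d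
       makes this smaller than the supposed positive value [d]. *)
    set (r := 1 + Rabs X + Y + 2 * Cmod z + Q / d).
    assert (hz0 := Cmod_ge_0 z). assert (hQd : 0 <= Q / d) by (now apply Rdiv_le_0_compat).
    assert (hr : 1 <= r) by (unfold r; lra).
    assert (t := taylor_remainder_bound F 0 r ((K + M) * r ^ k) k z ltac:(lra)).
    replace (z - 0)%C with z in t by ring. fold d in t.
    assert (hrk : 1 <= r ^ k) by (now apply pow_R1_Rle).
    assert (t' : d <= 4 * ((K + M) * r ^ k) * (Cmod z / r) ^ S k).
    { apply t.
      - apply hol_entire_rect, hF.
      - intros s [[sx sy] hb]. revert sx sy hb. rewrite Re_RtoC, Im_RtoC, !Rminus_0_l, !Rplus_0_l. intros sx sy hb.
        assert (KM : K <= (K + M) * r ^ k) by nra.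
        destruct (Rle_lt_dec (Rabs X) (Rabs (Re s))) as [h|h]; [eapply Rle_trans; [now apply side | exact KM]|].
        assert (him : Rabs (Im s) = r).
        { destruct hb as [h'|[h'|[h'|h']]].
          - rewrite h', Rabs_Ropp, Rabs_pos_eq in h by lra. unfold r in h. lra.
          - rewrite h', Rabs_pos_eq in h by lra. unfold r in h. lra.
          - rewrite h', Rabs_Ropp, Rabs_pos_eq; lra.
          - rewrite h', Rabs_pos_eq; lra. }
        eapply Rle_trans; [apply b; [lra | rewrite him; unfold r; lra]|]. rewrite him. nra.
      - unfold r. lra. }
    unfold Rdiv in t'. rewrite Rpow_mult_distr, pow_inv in t'.
    replace (4 * ((K + M) * r ^ k) * (Cmod z ^ S k * / r ^ S k)) with (Q / r) in t'.
    2: { unfold Q. simpl. field. split; [apply pow_nonzero; lra | lra]. }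
    apply Rmult_le_compat_r with (r := r) in t'; [|lra].
    replace (Q / r * r) with Q in t' by (field; lra).
    assert (d * (Q / d) = Q) by (field; lra).
    assert (d * r >= d * (1 + Q / d)) by (apply Rmult_ge_compat_l; unfold r; lra). lra. }
  exists (taylor_at F 0 0 0). intros z. rewrite eqT.
  rewrite (taylor_bounded_const F k K X).
  - unfold taylor_at. rewrite !sum_O. reflexivity.
  - intros x hxx. rewrite <- eqT. apply hK. now rewrite Re_RtoC.
Qed.

Lemma finite_bound (mu : nat -> C) (J : nat) : exists P : R, 0 <= P /\
  forall j, (j < J)%nat -> Cmod (mu j) <= P.
Proof.
  induction J as [|J (P & hP & h)].
  - exists 0. split; [lra|]. intros; lia.
  - exists (Rmax P (Cmod (mu J))). split; [eapply Rle_trans; [exact hP | apply Rmax_l]|].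
    intros j hj. destruct (Nat.eq_dec j J) as [->|hne]; [apply Rmax_r|].
    eapply Rle_trans; [apply h; lia | apply Rmax_l].
Qed.

(** * Growth of the completed function *)

Section Asymptotics.
Variables (a : nat -> R) (L : C -> C) (N : R) (J K : nat) (mu eta : nat -> C) (Lam F : C -> C).
Hypotheses (hN : 0 < N) (hL : dirichlet_series a L) (hA : entire L)
  (hB : completed N J K mu eta L Lam) (hFE : forall z : C, Lam z = Lam (1 - z)%C)
  (hC : polynomially_bounded L) (hF : forall z : C, F z = Lam (1 / 2 + z)%C).

Lemma completed_even (z : C) : F (- z)%C = F z.
Proof. rewrite !hF, hFE. f_equal. field. Qed.

Lemma completed_entire : entire F.
Proof.
  intros z _. apply (ex_derive_locally_ext (fun z => Lam (1 / 2 + z)%C) F z 1 Rlt_0_1).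
  - intros s _. now rewrite hF.
  - apply ex_derive_comp_C; [apply (proj1 hB); exact I|].
    apply ex_derive_plus_C; [apply ex_derive_const_C | apply ex_derive_id_C].
Qed.

(** Beyond all the parameters, to the right or upwards, no gamma factor meets a pole, and the
    defining product is available. *)
Lemma completed_formula : exists P : R, 0 <= P /\ forall z, P <= Re z \/ P <= Im z ->
  F z = (Rcpow N ((1 / 2 + z) / 2) * Cprod (fun j => GammaR (1 / 2 + z + mu j)) J
        * Cprod (fun k => GammaC (1 / 2 + z + eta k)) K * L (1 / 2 + z))%C.
Proof.
  destruct (finite_bound mu J) as (P1 & hP1 & b1). destruct (finite_bound eta K) as (P2 & hP2 & b2).
  exists (P1 + P2 + 1). split; [lra|]. intros z hz. rewrite hF. apply (proj2 hB).
  - intros j hj. specialize (b1 j hj). assert (r := re_le_Cmod (mu j)). assert (i := im_le_Cmod (mu j)).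
    assert (r' := Rle_trans _ _ _ r b1). assert (i' := Rle_trans _ _ _ i b1).
    apply Rabs_le_between in r', i'.
    replace ((1 / 2 + z + mu j) / 2)%C with (RtoC (1 / 2) * (RtoC (1 / 2) + z + mu j))%C
      by (rewrite RtoC_div by lra; field).
    destruct hz as [hz|hz]; [apply not_pole_Re | apply not_pole_Im]; reim; lra.
  - intros j hj. specialize (b2 j hj). assert (r := re_le_Cmod (eta j)). assert (i := im_le_Cmod (eta j)).
    assert (r' := Rle_trans _ _ _ r b2). assert (i' := Rle_trans _ _ _ i b2).
    apply Rabs_le_between in r', i'.
    replace (1 / 2 + z + eta j)%C with (RtoC (1 / 2) + z + eta j)%C by (rewrite RtoC_div by lra; field).
    destruct hz as [hz|hz]; [apply not_pole_Re | apply not_pole_Im]; reim; lra.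
Qed.

Let PR (z : C) : C := Cprod (fun j => GammaR (1 / 2 + z + mu j)) J.
Let PC (z : C) : C := Cprod (fun k => GammaC (1 / 2 + z + eta k)) K.
Let lR (z : C) : C := Csum (fun j => log_deriv_GammaR ((1 / 2 + mu j) / 2)%C z) J.
Let lC (z : C) : C := Csum (fun k => log_deriv_GammaC (1 / 2 + eta k)%C z) K.

Let good_PR : good_factor PR lR.
Proof. apply (good_factor_Cprod (fun j z => GammaR (1 / 2 + z + mu j)) (fun j => log_deriv_GammaR ((1 / 2 + mu j) / 2)%C)). intros j. apply good_factor_GammaR. Qed.
Let good_PC : good_factor PC lC.
Proof. apply (good_factor_Cprod (fun j z => GammaC (1 / 2 + z + eta j)) (fun j => log_deriv_GammaC (1 / 2 + eta j)%C)). intros j. apply good_factor_GammaC. Qed.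

(** The gamma and exponential factors are bounded high in the strip, and [L] grows polynomially
    there; the exponent is rounded up to an integer. The lower half follows from F (- z) = F z. *)
Lemma completed_strip_poly : strip_poly F.
Proof.
  intros X. destruct completed_formula as (P & hP & hform).
  destruct (hC (1 / 2 - X) (1 / 2 + X)) as (M & b & Y & hM & hb & hY & bL).
  assert (gA : good_factor (fun z => Cexp (RtoC (ln N / 4)) * Cexp (RtoC (ln N / 2) * z) * PR z * PC z)%C
     (fun z => RtoC (ln N / 2) + lR z + lC z)%C).
  { apply good_factor_mult; [apply good_factor_mult|]; trivial. apply good_factor_exp, Cexp_neq_0. }
  destruct (proj2 gA X) as (M' & Y' & hM' & bA).
  destruct (nat_above b) as (k & _ & hk).
  set (Y1 := 1 + P + Y + Rabs Y').
  assert (hY' := Rle_abs Y'). assert (hY0 := Rabs_pos Y').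
  assert (up : forall z, Rabs (Re z) <= X -> Y1 <= Im z -> Cmod (F z) <= M' * M * Rabs (Im z) ^ k).
  { intros z hz hy. unfold Y1 in hy.
    apply Rabs_le_between in hz.
    rewrite hform by (right; lra).
    replace (Rcpow N ((1 / 2 + z) / 2)) with (Cexp (RtoC (ln N / 4)) * Cexp (RtoC (ln N / 2) * z))%C.
    2: { unfold Rcpow. rewrite <- Cexp_plus. f_equal. rewrite !RtoC_div by lra. field. }
    rewrite Cmod_mult, Rmult_assoc.
    apply Rmult_le_compat; try apply Cmod_ge_0.
    - apply bA; lra.
    - replace (1 / 2 + z)%C with ((1 / 2 + Re z, Im z) : C).
      2: { replace (1 / 2)%C with (RtoC (1 / 2)) by (now rewrite RtoC_div by lra). apply C_ext; reim; ring. }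
      eapply Rle_trans; [apply bL; lra|]. apply Rmult_le_compat_l; [lra|].
      rewrite Rabs_pos_eq by lra. rewrite <- Rpower_pow by lra. apply Rle_Rpower; lra. }
  exists (M' * M), Y1, k. split; [apply Rmult_le_pos; lra|]. split; [unfold Y1; lra|].
  intros z hz hy. destruct (Rle_lt_dec 0 (Im z)) as [h|h].
  - rewrite (Rabs_pos_eq (Im z)) in hy by exact h. now apply up.
  - rewrite (Rabs_left (Im z)) in hy by exact h. rewrite <- completed_even.
    rewrite <- (Rabs_Ropp (Im z)). change (- Im z) with (Im (- z)%C). apply up.
    + rewrite Re_opp, Rabs_Ropp. exact hz.
    + rewrite Im_opp. lra.
Qed.

Hypothesis hnc : ~ exists c : C, forall z, F z = c.

(** Write F = A L1, where L1 z = L (1/2 + z) m^(1/2 + z) tends to its nonzero leading coefficient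
    and [A] collects the exponential and gamma factors. The oscillation of [l] is then compared with
    its size: either the size is unbounded, or there are no gamma factors and the oscillation tends
    to 0. *)
Lemma completed_log_derivative : exists l : C -> C,
  (exists X0 K0 : R, 1 <= X0 /\ 0 <= K0 /\ forall z, X0 <= Re z ->
     F z <> 0%C /\ is_derive F z (F z * l z)%C /\ Cmod (F z) <= K0 * Cmod (F (RtoC (Re z)))) /\
  (forall e, 0 < e -> exists X : R, forall (x : R) (z : C), X <= x -> Cmod (z - x) <= x / 2 ->
     Cmod (l z - l (RtoC x)) <= e * Re (l (RtoC x))) /\
  (exists X1 r0 : R, 0 < r0 /\ forall x : R, X1 <= x -> r0 <= Re (l (RtoC x))).
Proof.
  destruct completed_formula as (P & hP & hform).
  assert (nobound : forall X K0, ~ forall z, X <= Re z -> Cmod (F z) <= K0).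
  { intros X K0 h. apply hnc.
    exact (liouville_half_plane F X K0 completed_entire completed_even completed_strip_poly h). }
  destruct (dirichlet_asym a L hL) as [[X hz]|(m & al & hm & hal & has)].
  - exfalso. apply (nobound (Rabs X + P) 0). intros z hzz.
    assert (hx := Rle_abs X). assert (hx0 := Rabs_pos X).
    rewrite hform by (left; lra). rewrite hz, Cmult_0_r, Cmod_0; [lra|].
    replace (1 / 2 + z)%C with (RtoC (1 / 2) + z)%C by (now rewrite RtoC_div by lra). reim. lra.
  - set (L1 := fun z : C => (L (1 / 2 + z) * Rcpow (INR m) (1 / 2 + z))%C).
    assert (eL1 : entire L1).
    { intros z _. unfold L1. apply ex_derive_mult_C.
      - apply ex_derive_comp_C; [apply hA; exact I|].
        apply ex_derive_plus_C; [apply ex_derive_const_C | apply ex_derive_id_C].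
      - unfold Rcpow. apply ex_derive_comp_C; [apply ex_derive_Cexp|].
        apply ex_derive_mult_C; [|apply ex_derive_const_C].
        apply ex_derive_plus_C; [apply ex_derive_const_C | apply ex_derive_id_C]. }
    assert (limL1 : forall e, 0 < e -> exists X, forall z, X <= Re z -> Cmod (L1 z - al) <= e).
    { intros e he. destruct (has e he) as [X hX]. exists X. intros z hz. apply hX.
      replace (1 / 2 + z)%C with (RtoC (1 / 2) + z)%C by (now rewrite RtoC_div by lra). reim. lra. }
    destruct (slow_log_deriv_near_const L1 al eL1 (RtoC_neq_0 _ hal) limL1) as [lL hlL].
    set (r := ln N / 2 - ln (INR m)).
    set (c0 := Cexp (RtoC (ln N / 4 - ln (INR m) / 2))).
    set (A := fun z : C => (c0 * Cexp (RtoC r * z) * PR z * PC z)%C).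
    set (lA := fun z : C => (RtoC r + lR z + lC z)%C).
    assert (FA : forall z, P <= Re z -> (A z * L1 z)%C = F z).
    { intros z hz. rewrite hform by now left. unfold A, L1, PR, PC.
      assert (e : (Rcpow N ((1 / 2 + z) / 2) = c0 * Cexp (RtoC r * z) * Rcpow (INR m) (1 / 2 + z))%C).
      { unfold c0, Rcpow. rewrite <- !Cexp_plus. f_equal. unfold r.
        rewrite !RtoC_minus, !RtoC_div by lra. field. }
      rewrite e. ring. }
    (* The dichotomy: with gamma factors the oscillation is bounded and Re lA exceeds every [B];
       without them lA is the constant [r], with oscillation 0, and [r] has to be shown positive. *)
    assert (key : exists DA, 0 <= DA /\ slow_log_deriv A lA DA /\
       ((forall B, eventually_above lA B) \/ (DA = 0 /\ exists r0, 0 < r0 /\ eventually_above lA r0))).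
    { destruct (Nat.eq_dec (J + K) 0) as [h0|h0].
      - assert (hJ : J = O) by lia. assert (hK : K = O) by lia.
        exists 0. split; [lra|].
        assert (eA : forall z, A z = (c0 * Cexp (RtoC r * z))%C).
        { intros z. unfold A, PR, PC. rewrite hJ, hK. simpl. ring. }
        assert (el : forall z, lA z = RtoC r).
        { intros z. unfold lA, lR, lC. rewrite hJ, hK. simpl. ring. }
        split.
        + destruct (slow_log_deriv_exp c0 r (Cexp_neq_0 _)) as (X & K1 & h1 & h2 & h3 & h4).
          exists X, K1. split; [exact h1|]. split; [exact h2|]. split.
          * intros z hz. rewrite !eA, el. destruct (h3 z hz) as (n1 & d1 & b1).
            split; [exact n1|]. split; [|exact b1].
            apply (is_derive_locally_ext (fun z => c0 * Cexp (RtoC r * z))%C _ _ _ 1 Rlt_0_1); [|exact d1].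
            intros s _. now rewrite eA.
          * intros x z hx hz. rewrite !el. now apply (h4 x z).
        + right. split; [reflexivity|]. destruct (Rle_lt_dec r 0) as [hr|hr].
          (* If r <= 0, then F = A L1 is bounded in a right half-plane, which the Liouville theorem
             forbids for a nonconstant [F]. *)
          * exfalso. destruct (limL1 1 Rlt_0_1) as [X hX].
            apply (nobound (Rabs X + P) (Cmod c0 * (1 + Cmod al))).
            intros z hz. assert (hx := Rle_abs X). assert (hx0 := Rabs_pos X).
            rewrite <- FA by lra. rewrite eA, !Cmod_mult, Cmod_Cexp.
            assert (hL1 : Cmod (L1 z) <= 1 + Cmod al).
            { specialize (hX z ltac:(lra)). assert (t := Cmod_sub_ge (L1 z) al). lra. }
            assert (he : exp (Re (RtoC r * z)%C) <= 1).
            { rewrite <- exp_0. apply Rle_exp. reim. nra. }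
            assert (hp := exp_pos (Re (RtoC r * z)%C)).
            apply Rmult_le_compat; [apply Rmult_le_pos; [apply Cmod_ge_0 | lra] | apply Cmod_ge_0 | | exact hL1].
            assert (hc := Cmod_ge_0 c0). nra.
          * exists r. split; [exact hr|]. exists 0. intros x _. rewrite el, Re_RtoC. lra.
      - assert (gA : good_factor A lA).
        { apply good_factor_mult; [apply good_factor_mult|]; trivial. apply good_factor_exp, Cexp_neq_0. }
        destruct gA as [(D & hD & s) _]. exists D. split; [exact hD|]. split; [exact s|]. left. intros B.
        assert (evR : forall B, (0 < J)%nat -> eventually_above lR B).
        { intros B' hJ. apply (eventually_above_Csum (fun j => log_deriv_GammaR ((1 / 2 + mu j) / 2)%C)); [|exact hJ]. intros; apply eventually_above_logGR. }
        assert (evC : forall B, (0 < K)%nat -> eventually_above lC B).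
        { intros B' hK. apply (eventually_above_Csum (fun j => log_deriv_GammaC (1 / 2 + eta j)%C)); [|exact hK]. intros; apply eventually_above_logGC. }
        assert (evR0 : exists B, eventually_above lR B).
        { destruct (Nat.eq_dec J 0) as [e|e]; [|exists 0; apply evR; lia].
          exists 0. exists 0. intros x _. unfold lR. rewrite e. simpl. lra. }
        assert (evC0 : exists B, eventually_above lC B).
        { destruct (Nat.eq_dec K 0) as [e|e]; [|exists 0; apply evC; lia].
          exists 0. exists 0. intros x _. unfold lC. rewrite e. simpl. lra. }
        assert (evr : eventually_above (fun _ => RtoC r) r) by (exists 0; intros x _; rewrite Re_RtoC; lra).
        destruct (Nat.eq_dec J 0) as [e|e].
        + destruct evR0 as [B0 hB0]. replace B with (r + B0 + (B - r - B0)) by ring.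
          apply (eventually_above_plus (fun z => RtoC r + lR z)%C lC); [now apply eventually_above_plus | apply evC; lia].
        + destruct evC0 as [B0 hB0]. replace B with (r + (B - r - B0) + B0) by ring.
          apply (eventually_above_plus (fun z => RtoC r + lR z)%C lC); [apply eventually_above_plus; [exact evr | apply evR; lia] | exact hB0]. }
    destruct key as (DA & hDA & sA & ev).
    exists (fun z => lA z + lL z)%C. split; [|split].
    + destruct (slow_log_deriv_ext _ F _ _ P FA (slow_log_deriv_mult _ _ _ _ _ _ sA (proj1 (hlL 1 Rlt_0_1)))) as (X & K1 & h1 & h2 & h3 & _).
      exists X, K1. tauto.
    + intros e he.
      assert (both : exists B e1, 0 < e1 /\ eventually_above lA B /\ 0 < B - e1 /\ DA + e1 <= e * (B - e1)).
      { destruct ev as [ev|(e0 & r0 & hr0 & ev)].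
        - exists ((DA + 1) / e + 1), 1. split; [lra|]. split; [apply ev|]. split.
          + assert (0 < (DA + 1) / e) by (apply Rdiv_lt_0_compat; lra). lra.
          + right. field. lra.
        (* Solves e1 (1 + e) = r0 e / 2, so that the oscillation [e1] of the Dirichlet part is at
           most e times the lower bound r0 - e1 of the whole. *)
        - set (e1 := r0 * e / (2 * (1 + e))). exists r0, e1.
          assert (h1 : 0 < e1). { apply Rdiv_lt_0_compat; [now apply Rmult_lt_0_compat | lra]. }
          assert (h2 : e1 * (1 + e) = r0 * e / 2) by (unfold e1; field; lra).
          assert (0 < r0 * e) by (now apply Rmult_lt_0_compat).
          split; [exact h1|]. split; [exact ev|]. split; [nra|]. rewrite e0. lra. }
      destruct both as (B & e1 & he1 & evA & hBe & hDe).
      destruct (hlL e1 he1) as [sL evL].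
      destruct (slow_log_deriv_mult _ _ _ _ _ _ sA sL) as (X & K1 & h1 & h2 & _ & h4).
      destruct (eventually_above_plus _ _ _ _ evA evL) as [X2 h5].
      exists (Rmax X X2). intros x z hx hz.
      specialize (h4 x z (Rle_trans _ _ _ (Rmax_l _ _) hx) hz). specialize (h5 x (Rle_trans _ _ _ (Rmax_r _ _) hx)).
      eapply Rle_trans; [exact h4|]. eapply Rle_trans; [exact hDe|].
      apply Rmult_le_compat_l; lra.
    + assert (both : exists B, 0 < B /\ eventually_above lA B).
      { destruct ev as [ev|(e0 & r0 & hr0 & ev)]; [exists 1; split; [lra | apply ev] | now exists r0]. }
      destruct both as (B & hB0 & evB).
      destruct (eventually_above_plus _ _ _ _ evB (proj2 (hlL (B / 2) ltac:(lra)))) as [X h].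
      exists X, (B / 2). split; [lra|]. intros x hx. specialize (h x hx). lra.
Qed.
End Asymptotics.

Lemma derive_real (f : C -> C) (x : R) (d : C) : is_derive f (RtoC x) d ->
  (exists t0 : R, 0 < t0 /\ forall t, 0 < t < t0 -> Im (f (RtoC (x + t))) = 0) -> Im (f (RtoC x)) = 0 -> Im d = 0.
Proof.
  intros hd (t0 & ht0 & h) h0.
  destruct (Req_dec (Im d) 0) as [e|hne]; [exact e|]. exfalso.
  assert (hp : 0 < Rabs (Im d)) by now apply Rabs_pos_lt.
  destruct (proj1 (is_derive_C _ _ _) hd (Rabs (Im d) / 2) ltac:(lra)) as (r & hr & k).
  set (t := Rmin (t0 / 2) (r / 2)).
  assert (ht : 0 < t) by (apply Rmin_pos; lra).
  assert (t1 : t <= t0 / 2) by apply Rmin_l. assert (t2 : t <= r / 2) by apply Rmin_r.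
  specialize (k (RtoC (x + t))). replace (RtoC (x + t) - RtoC x)%C with (RtoC t) in k by (rewrite RtoC_plus; ring).
  rewrite Cmod_RtoC_pos in k by lra. specialize (k ltac:(lra)).
  assert (i := Rle_trans _ _ _ (im_le_Cmod _) k). revert i. reim. rewrite h, h0 by lra.
  replace (0 - 0 - (t * Im d + 0 * Re d)) with (- (t * Im d)) by ring.
  rewrite Rabs_Ropp, Rabs_mult, (Rabs_pos_eq t) by lra. nra.
Qed.

(** The phase is known to be real only on the open half-line beyond 1; this carries the reality to
    the point 1 itself. *)
Lemma Im_limit_right (f : C -> C) (x t0 : R) : 0 < t0 -> continuous f (RtoC x) ->
  (forall y, x < y < x + t0 -> Im (f (RtoC y)) = 0) -> Im (f (RtoC x)) = 0.
Proof.
  intros ht0 hc h. apply NNPP. intros hne.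
  assert (hp : 0 < Rabs (Im (f (RtoC x)))) by now apply Rabs_pos_lt.
  destruct (proj1 (continuous_C _ _) hc _ hp) as (r & hr & k).
  set (t := Rmin (r / 2) (t0 / 2)). assert (ht : 0 < t) by (apply Rmin_pos; lra).
  assert (t1 : t <= r / 2) by apply Rmin_l. assert (t2 : t <= t0 / 2) by apply Rmin_r.
  specialize (k (RtoC (x + t))).
  replace (RtoC (x + t) - RtoC x)%C with (RtoC t) in k by (rewrite RtoC_plus; ring).
  rewrite Cmod_RtoC_pos in k by lra. specialize (k ltac:(lra)).
  assert (i := Rle_lt_trans _ _ _ (im_le_Cmod _) k). revert i. rewrite Im_minus, h by lra.
  rewrite Rminus_0_l, Rabs_Ropp. lra.
Qed.

Lemma entire_derive (f : C -> C) (z : C) : entire f -> ex_derive (C_derive f) z.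
Proof.
  intros hf.
  exact (proj2 (cauchy_derivatives f (Re z - 1) (Re z + 1) (Im z - 1) (Im z + 1) 1
    (hol_entire_rect f _ _ _ _ hf) z (center_in_square z 1 Rlt_0_1))).
Qed.

(** * The scaling and the phase *)

Section Scaling.
Variables (F l : C -> C) (lam : nat -> R) (phi : nat -> C -> C) (X0 : R).
Hypotheses (hent : entire F) (hX0 : 1 <= X0)
  (hlog : forall z, X0 <= Re z -> F z <> 0%C /\ is_derive F z (F z * l z)%C)
  (hslow : forall e, 0 < e -> exists X : R, forall (x : R) (z : C), X <= x -> Cmod (z - x) <= x / 2 ->
     Cmod (l z - l (RtoC x)) <= e * Re (l (RtoC x)))
  (hpos : exists X1 r0 : R, 0 < r0 /\ forall x : R, X1 <= x -> r0 <= Re (l (RtoC x)))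
  (hlam : exists n0 : nat, forall n : nat, (n0 <= n)%nat -> is_scaling F n (lam n))
  (hphi : exists n0 : nat, forall n : nat, (n0 <= n)%nat -> is_phase F n (lam n) (phi n)).

Lemma log_derivative_eq (z : C) : X0 <= Re z -> (C_derive F z / F z)%C = l z.
Proof.
  intros hz. destruct (hlog z hz) as [h0 hd]. rewrite (is_C_derive_unique _ _ _ hd). field. exact h0.
Qed.

Lemma log_derivative_continuous (z : C) : X0 < Re z -> continuous l z.
Proof.
  intros hz.
  assert (h : ex_derive (fun z => C_derive F z / F z)%C z).
  { apply ex_derive_div_C; [apply hlog; lra | now apply entire_derive | apply hent; exact I]. }
  apply ex_derive_continuous_C.
  apply (ex_derive_locally_ext (fun z => C_derive F z / F z)%C l z (Re z - X0)); [lra| |exact h].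
  intros s hs. apply log_derivative_eq.
  assert (q := re_le_Cmod (s - z)). rewrite Re_minus in q.
  assert (q' := Rle_lt_trans _ _ _ q hs). apply Rabs_lt_between in q'. lra.
Qed.

(** The reality of [F] on the axis, up to a constant factor, is extracted from the branch of the
    phase: exp (n phi x) is positive for x > 1 and equals x^(2n) F (lam) / F (lam x). *)
Lemma phase_real_ratio (n : nat) : is_phase F n (lam n) (phi n) -> F (lam n) <> 0%C -> 0 < lam n ->
  forall y, lam n < y -> F (RtoC y) <> 0%C -> Im (F (RtoC y) / F (lam n))%C = 0.
Proof.
  intros (_ & he & him & _) h0 hl y hy hFy.
  assert (hx : 1 < y / lam n). { apply Rmult_lt_reg_r with (lam n); [exact hl|]. replace (y / lam n * lam n) with y by (field; lra). lra. }
  assert (e := he (RtoC (y / lam n))).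
  assert (ey : (lam n * RtoC (y / lam n))%C = RtoC y) by (rewrite <- RtoC_mult; f_equal; field; lra).
  rewrite ey in e. specialize (e (RtoC_neq_0 (y / lam n) ltac:(lra)) hFy).
  assert (real : (INR n * phi n (RtoC (y / lam n)))%C = RtoC (INR n * Re (phi n (RtoC (y / lam n))))).
  { apply C_ext; reim; rewrite ?him by exact hx; ring. }
  rewrite real, Cexp_RtoC in e. set (q := exp _) in *.
  assert (hq : 0 < q) by apply exp_pos.
  rewrite <- RtoC_pow in e.
  assert (e2 : (F (RtoC y) / F (lam n))%C = RtoC ((y / lam n) ^ (2 * n) / q)).
  { rewrite RtoC_div by lra. rewrite e. field. split; [exact hFy|]. split; [exact h0|].
    apply RtoC_neq_0, pow_nonzero. lra. }
  rewrite e2. reflexivity.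
Qed.

(** One admissible index [n] is enough: [l] does not depend on [n], and the constant factor F (lam
    n) drops out of the logarithmic derivative. *)
Lemma log_derivative_real : exists X : R, forall y, X <= y -> Im (l (RtoC y)) = 0.
Proof.
  destruct hlam as [n1 h1]. destruct hphi as [n2 h2].
  set (n := (n1 + n2)%nat). destruct (h1 n ltac:(unfold n; lia)) as [[hl hs] _].
  specialize (h2 n ltac:(unfold n; lia)).
  assert (hF0 : F (lam n) <> 0%C).
  { intros e. unfold scaling_eq in hs. rewrite e in hs.
    (* Division by 0 yields 0, so a zero of [F] at lam n would turn the scaling equation into 2 =
       0. *)
    assert (i0 : (/ 0)%C = RtoC 0) by (unfold Cinv; simpl; apply C_ext; simpl; unfold Rdiv; ring).
    unfold Cdiv in hs. rewrite i0, !Cmult_0_r in hs.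
    apply (f_equal Re) in hs. revert hs. reim. lra. }
  exists (Rabs (lam n) + X0 + 1). intros y hy.
  assert (ha := Rle_abs (lam n)). assert (ha0 := Rabs_pos (lam n)).
  assert (R1 : forall u, Rabs (lam n) + X0 + 1 <= u -> Im (F (RtoC u) / F (lam n))%C = 0).
  { intros u hu. apply phase_real_ratio; trivial; try lra. apply hlog. rewrite Re_RtoC; lra. }
  destruct (hlog (RtoC y)) as [hFy hd]; [rewrite Re_RtoC; lra|].
  set (q := (F (RtoC y) / F (lam n))%C).
  assert (hq0 : q <> 0%C).
  { unfold q. intros e. apply hFy. replace (F (RtoC y)) with (q * F (lam n))%C by (unfold q; field; exact hF0).
    unfold q. rewrite e. ring. }
  assert (dq : is_derive (fun z => F z / F (lam n))%C (RtoC y) (q * l (RtoC y))%C).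
  { eapply is_derive_ext_val; [apply is_derive_div_C; [exact hF0 | exact hd | apply is_derive_const_C]|].
    unfold q. ceq. field. exact hF0. }
  assert (i1 : Im (q * l (RtoC y))%C = 0).
  { apply (derive_real _ _ _ dq).
    - exists 1. split; [lra|]. intros t ht. apply R1. lra.
    - apply R1. lra. }
  assert (i2 : Im q = 0) by (apply R1; lra).
  rewrite Im_mult, i2, Rmult_0_l, Rplus_0_r in i1. apply Rmult_integral in i1.
  destruct i1 as [i1|i1]; [|exact i1]. exfalso. apply hq0. apply C_ext; [exact i1 | exact i2].
Qed.

(** The scaling equation reads x l(x) = 2 n. The left side is continuous and unbounded far out, so
    for large [n] the intermediate value theorem gives a solution beyond any prescribed [B']; by
    uniqueness that solution is lam n. *)
Lemma scaling_tends_to_infinity (B : R) : exists n0 : nat, forall n, (n0 <= n)%nat -> B <= lam n.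
Proof.
  destruct hpos as (X1 & r0 & hr0 & hp). destruct log_derivative_real as [X2 hre]. destruct hlam as [n1 h1].
  set (B' := 1 + X0 + Rabs X1 + Rabs X2 + Rabs B).
  assert (a1 := Rle_abs X1). assert (a1' := Rabs_pos X1). assert (a2 := Rle_abs X2). assert (a2' := Rabs_pos X2).
  assert (a3 := Rle_abs B). assert (a3' := Rabs_pos B).
  set (g := fun x : R => x * Re (l (RtoC x))).
  destruct (nat_above (Rabs (g B') + 1)) as (n2 & hn2 & hgn).
  exists (n1 + n2)%nat. intros n hn.
  assert (hI : INR n2 <= INR n) by (apply le_INR; lia).
  assert (ag := Rle_abs (g B')). assert (ag0 := Rabs_pos (g B')).
  set (T := B' + 2 * INR n / r0 + 1).
  assert (hTn : 0 <= 2 * INR n / r0) by (apply Rdiv_le_0_compat; lra).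
  assert (hgT : 2 * INR n < g T).
  { unfold g. assert (hT := hp T ltac:(unfold T, B'; lra)).
    assert (T * r0 <= T * Re (l (RtoC T))) by (apply Rmult_le_compat_l; [unfold T, B'; lra | exact hT]).
    assert (2 * INR n < T * r0); [|lra].
    replace (2 * INR n) with (2 * INR n / r0 * r0) by (field; lra). apply Rmult_lt_compat_r; [lra|]. unfold T, B'; lra. }
  destruct (IVT_interv (fun x => g x - 2 * INR n) B' T) as (y & hy & he).
  - intros x hx. apply continuity_pt_filterlim.
    apply (continuous_minus (V := R_NormedModule) g (fun _ => 2 * INR n)); [|apply continuous_const].
    apply (continuous_mult (K := R_AbsRing) (fun x => x) (fun x => Re (l (RtoC x)))); [apply continuous_id|].
    assert (hc := log_derivative_continuous (RtoC x) ltac:(rewrite Re_RtoC; unfold B' in hx; lra)).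
    intros P hP. destruct hP as [e hP].
    destruct (proj1 (continuous_C _ _) hc e (cond_pos e)) as (d & hd & k).
    exists (mkposreal d hd). intros t ht. apply hP. change (Rabs (Re (l (RtoC t)) - Re (l (RtoC x))) < e).
    rewrite <- Re_minus. eapply Rle_lt_trans; [apply re_le_Cmod|]. apply k.
    rewrite <- RtoC_minus, Cmod_R. exact ht.
  - unfold T. lra.
  - lra.
  - lra.
  - assert (heq : scaling_eq F n y).
    { unfold scaling_eq. rewrite log_derivative_eq by (rewrite Re_RtoC; unfold B' in hy; lra).
      assert (hn0 : 0 < INR n) by lra.
      assert (i0 := hre y ltac:(unfold B' in hy; lra)).
      rewrite <- RtoC_div by lra. unfold g in he. apply C_ext; reim; rewrite ?i0; [|ring].
      rewrite Rmult_0_l, Rminus_0_r. replace (y / INR n * Re (l (RtoC y))) with ((y * Re (l (RtoC y))) / INR n) by (field; lra).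
      replace (y * Re (l (RtoC y))) with (2 * INR n) by lra. field. lra. }
    destruct (h1 n ltac:(lia)) as [_ hu]. rewrite <- (hu y ltac:(unfold B' in hy; lra) heq).
    unfold B' in hy. lra.
Qed.

(** One has n phi' z = 2 n / z - lam l (lam z), and slow variation replaces l (lam z) by l (lam) = 2
    n / lam with relative error e / 2. Hence phi' is close to 2 / z - 2 uniformly on the disc of
    radius 1 / 2. *)
Lemma phase_local (e : R) : 0 < e -> exists n0 : nat, forall n, (n0 <= n)%nat ->
  (1 <= n)%nat /\ 4 * X0 <= lam n /\
  (forall z : C, 1 / 2 <= Re z -> right_of_zeros F (lam n) z) /\
  phi n 1 = 0%C /\ C_derive (phi n) 1 = 0%C /\
  (forall z : C, 1 / 2 <= Re z -> ex_derive (phi n) z) /\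
  (forall z : C, Cmod (z - 1) < 1 / 2 -> Cmod (C_derive (phi n) z - (2 / z - 2)) <= e) /\
  (forall x, 1 < x -> Im (phi n (RtoC x)) = 0) /\
  (forall z : C, z <> 0%C -> F (lam n * z)%C <> 0%C ->
     Cexp (INR n * phi n z) = (z ^ (2 * n) * F (lam n) / F (lam n * z))%C).
Proof.
  intros he. destruct (hslow (e / 2) ltac:(lra)) as [X hX].
  destruct log_derivative_real as [X2 hre]. destruct hlam as [n1 h1]. destruct hphi as [n2 h2].
  destruct (scaling_tends_to_infinity (4 * X0 + Rabs X + Rabs X2)) as [n3 h3].
  exists (n1 + n2 + n3 + 1)%nat. intros n hn.
  destruct (h1 n ltac:(lia)) as [[_ hs] _]. specialize (h3 n ltac:(lia)).
  destruct (h2 n ltac:(lia)) as (hol & hexp & him & _).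
  set (la := lam n) in *.
  assert (a1 := Rle_abs X). assert (a1' := Rabs_pos X). assert (a2 := Rle_abs X2). assert (a2' := Rabs_pos X2).
  assert (hla : 4 * X0 <= la) by lra.
  assert (rz : forall z, 1 / 2 <= Re z -> right_of_zeros F la z).
  (* The abscissa 1 / 4 is scaled to lam / 4 >= X0, beyond which [F] has no zeros; this is why lam n
     >= 4 X0 is required. *)
  { intros z hz. split; [lra|]. exists (1 / 4). split; [lra|]. intros s hsr. apply hlog.
    reim. rewrite Rmult_0_l, Rminus_0_r. nra. }
  assert (nz : forall z, 1 / 2 <= Re z -> F (la * z)%C <> 0%C).
  { intros z hz. apply hlog. reim. rewrite Rmult_0_l, Rminus_0_r. nra. }
  assert (dphi : forall z, 1 / 2 <= Re z -> ex_derive (phi n) z) by (intros z hz; apply hol, rz, hz).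
  assert (hn0 : 0 < INR n) by (apply lt_0_INR; lia).
  assert (nC : RtoC (INR n) <> 0%C) by (apply RtoC_neq_0; lra).
  assert (hl1 : (RtoC la * l (RtoC la) = 2 * INR n)%C).
  { unfold scaling_eq in hs. rewrite log_derivative_eq in hs by (rewrite Re_RtoC; lra).
    apply Csub_eq_0. replace (la * l la - 2 * INR n)%C with (- INR n * (2 - la / INR n * l la))%C by (field; exact nC).
    rewrite hs. ring. }
  assert (hF1 : F (RtoC la) <> 0%C) by (apply hlog; rewrite Re_RtoC; lra).
  (* The derivative is found by differentiating exp (n phi) in two ways, since only the exponential
     of the phase has a formula. *)
  assert (der : forall z, 1 / 2 < Re z -> (INR n * C_derive (phi n) z = 2 * INR n / z - la * l (la * z))%C).
  { intros z hz. assert (z0 : z <> 0%C) by (intros e0; rewrite e0 in hz; revert hz; reim; lra).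
    assert (hFz := nz z ltac:(lra)).
    assert (d1 : is_derive (fun z => Cexp (INR n * phi n z)) z (INR n * C_derive (phi n) z * Cexp (INR n * phi n z))%C).
    { eapply is_derive_ext_val.
      - apply (is_derive_comp_C Cexp (fun z => INR n * phi n z)%C); [apply is_derive_Cexp|].
        apply is_derive_mult_C; [apply is_derive_const_C | apply C_derive_is, dphi; lra].
      - ceq. ring. }
    destruct (hlog (la * z)%C) as [_ dF]; [reim; rewrite Rmult_0_l, Rminus_0_r; nra|].
    assert (d2 : is_derive (fun z => z ^ (2 * n) * F la / F (la * z))%C z
      ((2 * INR n / z - la * l (la * z)) * (z ^ (2 * n) * F la / F (la * z)))%C).
    { eapply is_derive_ext_val.
      - apply is_derive_div_C; [exact hFz| |].
        + apply is_derive_mult_C; [apply is_derive_pow_C, is_derive_id_C | apply is_derive_const_C].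
        + apply (is_derive_comp_C F (fun z => la * z)%C); [exact dF|].
          apply is_derive_mult_C; [apply is_derive_const_C | apply is_derive_id_C].
      - ceq. destruct n as [|k]; [lia|].
        replace (2 * S k - 1)%nat with (S (2 * k)) by lia. replace (2 * S k)%nat with (S (S (2 * k))) by lia.
        rewrite !Cpow_S. replace (INR (S (S (2 * k)))) with (2 * INR (S k)).
        + rewrite RtoC_mult. field. split; assumption.
        + replace (S (S (2 * k))) with (2 * S k)%nat by lia. rewrite mult_INR. reflexivity. }
    assert (d3 : is_derive (fun z => Cexp (INR n * phi n z)) z
      ((2 * INR n / z - la * l (la * z)) * (z ^ (2 * n) * F la / F (la * z)))%C).
    { apply (is_derive_locally_ext (fun z => z ^ (2 * n) * F la / F (la * z))%C _ z _ (Re z - 1 / 2)); [lra| |exact d2].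
      intros s hsd. symmetry. assert (q := re_le_Cmod (s - z)). rewrite Re_minus in q.
      assert (q' := Rle_lt_trans _ _ _ q hsd). apply Rabs_lt_between in q'.
      apply hexp; [|apply nz; lra]. intros e0; rewrite e0 in q'; revert q'; rewrite Re_RtoC; lra. }
    assert (u1 := is_C_derive_unique _ _ _ d1). assert (u2 := is_C_derive_unique _ _ _ d3).
    rewrite u1 in u2. rewrite <- (hexp z z0 hFz) in u2.
    assert (c0 := Cexp_neq_0 (INR n * phi n z)).
    set (E := Cexp (INR n * phi n z)) in *.
    replace (INR n * C_derive (phi n) z)%C with (INR n * C_derive (phi n) z * E / E)%C by (field; exact c0).
    rewrite u2. field. split; assumption. }
  split; [lia|]. split; [exact hla|]. split; [exact rz|].
  assert (im1 : Im (phi n 1) = 0).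
  { apply (Im_limit_right _ 1 1 Rlt_0_1); [|intros y hy; apply him; lra].
    apply ex_derive_continuous_C, dphi. rewrite Re_RtoC. lra. }
  split; [|split; [|split; [exact dphi|split; [|split; [exact him | exact hexp]]]]].
  (* The exponential of n phi 1 being 1 fixes only the real part of phi 1; the imaginary part was
     obtained as a limit from the right. *)
  - assert (e1 := hexp 1%C (RtoC_neq_0 1 ltac:(lra))). rewrite Cmult_1_r in e1. specialize (e1 hF1).
    rewrite Cpow_1_l in e1. replace (1 * F la / F la)%C with (RtoC 1) in e1 by (field; exact hF1).
    apply (f_equal Cmod) in e1. rewrite Cmod_Cexp, Cmod_1 in e1.
    rewrite Re_mult, Re_RtoC, Im_RtoC, Rmult_0_l, Rminus_0_r in e1.
    apply (f_equal ln) in e1. rewrite ln_exp, ln_1 in e1.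
    apply C_ext; [|exact im1]. rewrite Re_RtoC. apply Rmult_integral in e1. destruct e1 as [e1|e1]; [lra | exact e1].
  - assert (d := der 1%C ltac:(rewrite Re_RtoC; lra)). rewrite Cmult_1_r, hl1 in d.
    replace (2 * INR n / 1 - 2 * INR n)%C with (RtoC 0) in d by field.
    replace (C_derive (phi n) 1) with (INR n * C_derive (phi n) 1 / INR n)%C by (field; exact nC).
    rewrite d. field. exact nC.
  - intros z hz.
    assert (hre' : 1 / 2 < Re z).
    { assert (q := Rle_lt_trans _ _ _ (re_le_Cmod (z - 1)) hz). rewrite Re_minus, Re_RtoC in q.
      apply Rabs_lt_between in q. lra. }
    assert (z0 : z <> 0%C) by (intros e0; rewrite e0 in hre'; revert hre'; reim; lra).
    assert (d := der z hre').
    replace (C_derive (phi n) z - (2 / z - 2))%C with (- (la / INR n) * (l (la * z) - l la))%C.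
    2: { replace (C_derive (phi n) z) with (INR n * C_derive (phi n) z / INR n)%C by (field; exact nC).
         rewrite d. replace (2 / z - 2)%C with (2 / z - la * l la / INR n)%C.
         - field. split; assumption.
         - rewrite hl1. field. split; assumption. }
    assert (s := hX la (la * z)%C ltac:(lra)).
    replace (la * z - la)%C with (la * (z - 1))%C in s by ring.
    rewrite Cmod_mult, Cmod_RtoC_pos in s by lra. specialize (s ltac:(nra)).
    rewrite Cmod_mult, Cmod_opp, <- RtoC_div, Cmod_RtoC_pos by (try lra; apply Rdiv_le_0_compat; lra).
    apply Rle_trans with (la / INR n * (e / 2 * Re (l la))).
    { apply Rmult_le_compat_l; [apply Rdiv_le_0_compat; lra | exact s]. }
    apply (f_equal Re) in hl1. rewrite !Re_mult, !Re_RtoC, !Im_RtoC in hl1.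
    replace (la / INR n * (e / 2 * Re (l la))) with (e / 2 * ((la * Re (l la)) / INR n)) by (field; lra).
    replace (la * Re (l la)) with (2 * INR n) by lra. right. field. lra.
Qed.
End Scaling.

(** * Divided differences and the square root of the phase *)

Lemma mvt_C (f g : C -> C) (z w : C) (M : R) :
  (forall t : R, 0 <= t <= 1 -> is_derive f (w + t * (z - w))%C (g (w + t * (z - w))%C) /\
     continuous g (w + t * (z - w))%C /\ Cmod (g (w + t * (z - w))%C) <= M) ->
  Cmod (f z - f w) <= M * Cmod (z - w).
Proof.
  intros h.
  assert (i : is_CRInt (fun t : R => g (w + t * (z - w))%C * (z - w))%C 0 1
    (f (w + 1 * (z - w))%C - f (w + 0 * (z - w))%C)%C).
  { apply (is_RInt_C_derive (fun t : R => f (w + t * (z - w))%C)); rewrite Rmin_left, Rmax_right by lra.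
    - intros t ht. apply (is_derive_path f (fun t : R => w + t * (z - w))%C); [apply h, ht | apply is_derive_line].
    - intros t ht.
      apply (continuous_comp (fun t : R => w + t * (z - w))%C (fun s => g s * (z - w))%C); [apply continuous_line|].
      apply continuous_C_mult; [apply h, ht|]. apply ex_derive_continuous_C, ex_derive_const_C. }
  replace (w + 1 * (z - w))%C with z in i by ring. replace (w + 0 * (z - w))%C with w in i by ring.
  rewrite <- (CRInt_unique _ _ _ _ i).
  replace (M * Cmod (z - w)) with (M * Cmod (z - w) * (1 - 0)) by ring.
  apply CRInt_bound_const; [lra | eexists; exact i|].
  intros t ht. rewrite Cmod_mult. apply Rmult_le_compat_r; [apply Cmod_ge_0 | apply h, ht].
Qed.

(** Removes a singularity quantitatively: [g] is the Cauchy integral of f s / (s - p)^(m+1),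
    analytic at p as well, with size and Lipschitz constant controlled by [M] and [r] alone and
    hence uniform in [n]. *)
Lemma divided_difference (f : C -> C) (p : C) (r M : R) (m : nat) : 0 < r -> hol_square f p r ->
  (forall s, on_bd (Re p - r) (Re p + r) (Im p - r) (Im p + r) s -> Cmod (f s) <= M) ->
  exists g : C -> C,
    (forall z, Cmod (z - p) < r -> f z = (taylor_at f p m z + (z - p) ^ (S m) * g z)%C) /\
    (forall z, Cmod (z - p) <= r / 2 -> Cmod (g z) <= 4 * M / r ^ S m) /\
    (forall z w, Cmod (z - p) <= r / 2 -> Cmod (w - p) <= r / 2 ->
       Cmod (g z - g w) <= 8 * M / r ^ S (S m) * Cmod (z - w)) /\
    (forall z, Cmod (z - p) < r -> ex_derive g z) /\
    g p = (C_derive_n f (S m) p / INR (fact (S m)))%C.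
Proof.
  intros hr hol hM.
  set (x1 := Re p - r) in *. set (x2 := Re p + r) in *. set (y1 := Im p - r) in *. set (y2 := Im p + r) in *.
  assert (hx : x1 <= x2) by (unfold x1, x2; lra). assert (hy : y1 <= y2) by (unfold y1, y2; lra).
  assert (per : x2 - x1 + (y2 - y1) = 4 * r) by (unfold x1, x2, y1, y2; ring).
  assert (hp : in_open_rect x1 x2 y1 y2 p) by (now apply center_in_square).
  assert (dp : forall s, on_bd x1 x2 y1 y2 s -> r <= Cmod (s - p)) by (intros s hs; now apply square_dist).
  assert (npow : forall s, on_bd x1 x2 y1 y2 s -> (s - p)%C <> 0%C).
  { intros s hs. apply Cmod_pos_neq. specialize (dp s hs). lra. }
  set (k := fun s : C => (f s * / (s - p) ^ (S m))%C).
  assert (ek : forall s, on_bd x1 x2 y1 y2 s -> ex_derive k s).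
  { intros s hs. apply ex_derive_mult_C; [apply hol, hs|]. apply ex_derive_kernel.
    intros ->. apply (npow p hs). ring. }
  assert (hpi := PI2_3_2). unfold PI2 in hpi.
  assert (hrm : 0 < r ^ S m) by now apply pow_lt.
  assert (hM0 : 0 <= M).
  { eapply Rle_trans; [apply Cmod_ge_0 | apply (hM (x2, Im p))]. split; [split; simpl; unfold x1, x2, y1, y2; lra|]. simpl; tauto. }
  assert (bk : forall s, on_bd x1 x2 y1 y2 s -> Cmod (k s) <= M / r ^ S m).
  { intros s hs. specialize (dp s hs). unfold k. rewrite Cmod_mult.
    rewrite Cmod_inv by (apply Cpow_nz; now apply npow). rewrite Cmod_pow.
    apply Rmult_le_compat; [apply Cmod_ge_0 | | now apply hM |].
    - left. apply Rinv_0_lt_compat, pow_lt. lra.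
    - apply Rinv_le_contravar; [lra|]. apply pow_incr. lra. }
  assert (hMr : 0 <= M / r ^ S m) by (apply Rdiv_le_0_compat; lra).
  assert (far : forall z s, Cmod (z - p) <= r / 2 -> on_bd x1 x2 y1 y2 s -> r / 2 <= Cmod (s - z)).
  { intros z s hz hs. specialize (dp s hs). assert (t := Cmod_sub_triangle s z p). lra. }
  exists (fun z => / (2 * PI * Ci) * RectInt (fun s => k s * / (s - z) ^ 1)%C x1 x2 y1 y2)%C.
  assert (ninv : forall z : C, z <> 0%C -> Cmod (/ z) = / Cmod z) by (intros z hz; now apply Cmod_inv).
  split; [|split; [|split; [|split]]].
  - intros z hz. assert (hzin := disk_in_square p z r hz).
    assert (e := taylor_remainder_in f x1 x2 y1 y2 p hol hp m z hzin).
    assert (e2 : RectInt (fun s => f s / ((s - p) ^ (S m) * (s - z)))%C x1 x2 y1 y2 = RectInt (fun s => k s * / (s - z) ^ 1)%C x1 x2 y1 y2).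
    { apply RectInt_ext; auto. intros s hs. unfold k. rewrite Cpow_1_r.
      assert (h1 := Cpow_nz _ (S m) (npow s hs)).
      assert (h2 := Csub_neq_0 _ _ (in_open_rect_not_bd _ _ _ _ _ _ hzin hs)). field. split; assumption. }
    rewrite e2 in e. set (I0 := RectInt _ _ _ _ _) in *.
    replace (f z) with (taylor_at f p m z + (2 * PI * Ci * (f z - taylor_at f p m z)) / (2 * PI * Ci))%C
      by (field; repeat split; auto using PIC_neq_0, Ci_neq_0).
    rewrite e. field. repeat split; auto using PIC_neq_0, Ci_neq_0.
  - intros z hz. rewrite Cmod_mult, Cmod_inv, Cmod_two_pi_i by exact two_pi_i_neq_0.
    assert (b : Cmod (RectInt (fun s => k s * / (s - z) ^ 1)%C x1 x2 y1 y2) <= 2 * (M / r ^ S m * (2 / r)) * (x2 - x1 + (y2 - y1))).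
    { apply RectInt_bound; auto.
      - intros s hs. specialize (far z s hz hs). apply ex_derive_continuous_C, ex_derive_mult_C; [now apply ek|].
        apply ex_derive_kernel. intros ->. unfold Cminus in far. rewrite Cplus_opp_r, Cmod_0 in far. lra.
      - intros s hs. specialize (far z s hz hs). rewrite Cpow_1_r, Cmod_mult.
        rewrite ninv by (apply Cmod_pos_neq; lra).
        apply Rmult_le_compat; [apply Cmod_ge_0 | left; apply Rinv_0_lt_compat; lra | now apply bk |].
        replace (2 / r) with (/ (r / 2)) by (field; lra). apply Rinv_le_contravar; lra. }
    rewrite per in b. set (I0 := Cmod (RectInt _ _ _ _ _)) in *.
    apply Rmult_le_reg_l with (2 * PI); [lra|]. rewrite <- Rmult_assoc, Rinv_r, Rmult_1_l by lra.
    eapply Rle_trans; [exact b|].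
    replace (2 * (M / r ^ S m * (2 / r)) * (4 * r)) with (16 * (M / r ^ S m)) by (field; repeat split; first [lra | apply pow_nonzero; lra]).
    replace (4 * M / r ^ S m) with (4 * (M / r ^ S m)) by (field; apply pow_nonzero; lra). nra.
  - intros z w hz hw.
    assert (cz : forall z, Cmod (z - p) <= r / 2 -> forall s, on_bd x1 x2 y1 y2 s -> continuous (fun s => k s * / (s - z) ^ 1)%C s).
    { intros v hv s hs. specialize (far v s hv hs). apply ex_derive_continuous_C, ex_derive_mult_C; [now apply ek|].
      apply ex_derive_kernel. intros ->. unfold Cminus in far. rewrite Cplus_opp_r, Cmod_0 in far. lra. }
    replace (/ (2 * PI * Ci) * RectInt (fun s => k s * / (s - z) ^ 1) x1 x2 y1 y2 -
      / (2 * PI * Ci) * RectInt (fun s => k s * / (s - w) ^ 1) x1 x2 y1 y2)%C with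
      (/ (2 * PI * Ci) * RectInt (fun s => k s * / (s - z) ^ 1 - k s * / (s - w) ^ 1) x1 x2 y1 y2)%C.
    2: { rewrite RectInt_minus; auto. ring. }
    rewrite Cmod_mult, Cmod_inv, Cmod_two_pi_i by exact two_pi_i_neq_0.
    assert (b : Cmod (RectInt (fun s => k s * / (s - z) ^ 1 - k s * / (s - w) ^ 1)%C x1 x2 y1 y2) <=
       2 * (M / r ^ S m * (Cmod (z - w) * (2 / r * (2 / r)))) * (x2 - x1 + (y2 - y1))).
    { apply RectInt_bound; auto.
      - intros s hs. apply (continuous_minus (V := C_R_NormedModule) (U := C_UniformSpace)); apply cz; auto.
      - intros s hs. assert (f1 := far z s hz hs). assert (f2 := far w s hw hs).
        assert (n1 : (s - z)%C <> 0%C) by (apply Cmod_pos_neq; lra).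
        assert (n2 : (s - w)%C <> 0%C) by (apply Cmod_pos_neq; lra).
        rewrite !Cpow_1_r. replace (k s * / (s - z) - k s * / (s - w))%C with (k s * ((z - w) * (/ (s - z) * / (s - w))))%C
          by (field; split; assumption).
        rewrite !Cmod_mult, !ninv by assumption.
        assert (i1 : / Cmod (s - z) <= 2 / r). { replace (2 / r) with (/ (r / 2)) by (field; lra). apply Rinv_le_contravar; lra. }
        assert (i2 : / Cmod (s - w) <= 2 / r). { replace (2 / r) with (/ (r / 2)) by (field; lra). apply Rinv_le_contravar; lra. }
        assert (j1 : 0 < / Cmod (s - z)) by (apply Rinv_0_lt_compat; lra).
        assert (j2 : 0 < / Cmod (s - w)) by (apply Rinv_0_lt_compat; lra).
        apply Rmult_le_compat; [apply Cmod_ge_0 | | now apply bk |].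
        + apply Rmult_le_pos; [apply Cmod_ge_0|]. apply Rmult_le_pos; lra.
        + apply Rmult_le_compat_l; [apply Cmod_ge_0|]. apply Rmult_le_compat; lra. }
    rewrite per in b. set (I0 := Cmod (RectInt _ _ _ _ _)) in *.
    apply Rmult_le_reg_l with (2 * PI); [lra|]. rewrite <- Rmult_assoc, Rinv_r, Rmult_1_l by lra.
    eapply Rle_trans; [exact b|].
    assert (hc := Cmod_ge_0 (z - w)).
    replace (2 * (M / r ^ S m * (Cmod (z - w) * (2 / r * (2 / r)))) * (4 * r)) with (32 * (M / r ^ S (S m) * Cmod (z - w)))
      by (simpl; field; repeat split; first [lra | apply pow_nonzero; lra]).
    replace (8 * M / r ^ S (S m) * Cmod (z - w)) with (8 * (M / r ^ S (S m) * Cmod (z - w)))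
      by (simpl; field; repeat split; first [lra | apply pow_nonzero; lra]).
    assert (0 <= M / r ^ S (S m) * Cmod (z - w)).
    { apply Rmult_le_pos; [|exact hc]. apply Rdiv_le_0_compat; [exact hM0 | now apply pow_lt]. }
    nra.
  - intros z hz. apply ex_derive_mult_C; [apply ex_derive_const_C|].
    eexists. apply is_derive_RectInt_kernel; [now apply disk_in_square|].
    intros s hs. now apply ex_derive_continuous_C, ek.
  - destruct (cauchy_derivatives f x1 x2 y1 y2 (S m) hol p hp) as [e _].
    assert (hf : RtoC (INR (fact (S m))) <> 0%C) by apply RtoC_neq_0, INR_fact_neq_0.
    assert (e2 : RectInt (fun s => f s * / (s - p) ^ (S (S m)))%C x1 x2 y1 y2 = RectInt (fun s => k s * / (s - p) ^ 1)%C x1 x2 y1 y2).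
    { apply RectInt_ext; auto. intros s hs. unfold k. rewrite Cpow_1_r, (Cpow_S _ (S m)).
      assert (h1 := Cpow_nz _ (S m) (npow s hs)). assert (h2 := npow s hs). field. split; assumption. }
    rewrite e2 in e. set (I0 := RectInt _ _ _ _ _) in *.
    replace (C_derive_n f (S m) p / INR (fact (S m)))%C with
      ((2 * PI * Ci * C_derive_n f (S m) p) / (2 * PI * Ci * INR (fact (S m))))%C
      by (field; repeat split; auto using PIC_neq_0, Ci_neq_0).
    rewrite e. field. repeat split; auto using PIC_neq_0, Ci_neq_0.
Qed.

(* The principal branch, meaningful for [0 < Re z] only. *)
Definition Csqrt (z : C) : C :=
  (sqrt ((Cmod z + Re z) / 2), Im z / (2 * sqrt ((Cmod z + Re z) / 2))).

Lemma Csqrt_Re_pos (z : C) : 0 < Re z -> 0 < Re (Csqrt z).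
Proof. intros h. simpl. apply sqrt_lt_R0. generalize (Cmod_ge_0 z). lra. Qed.

Lemma Csqrt_sqr (z : C) : 0 < Re z -> (Csqrt z * Csqrt z)%C = z.
Proof.
  intros h. assert (hp := Csqrt_Re_pos z h). simpl in hp. unfold Csqrt.
  set (p := sqrt ((Cmod z + Re z) / 2)) in *.
  assert (hp2 : p * p = (Cmod z + Re z) / 2).
  { apply sqrt_sqrt. generalize (Cmod_ge_0 z). lra. }
  assert (hm := Cmod2_alt z).
  apply C_ext; reim.
  - assert (e : Im z / (2 * p) * (Im z / (2 * p)) = (Cmod z - Re z) / 2).
    { replace (Im z / (2 * p) * (Im z / (2 * p))) with (Im z ^ 2 / (4 * (p * p))) by (field; lra).
      rewrite hp2. replace (Im z ^ 2) with ((Cmod z - Re z) * (Cmod z + Re z)) by (replace (Im z ^ 2) with (Cmod z ^ 2 - Re z ^ 2) by lra; ring).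
      field. generalize (Cmod_ge_0 z). lra. }
    rewrite e, hp2. lra.
  - field. lra.
Qed.

Lemma Csqrt_unique (z u : C) : 0 < Re z -> 0 < Re u -> (u * u = z)%C -> Csqrt z = u.
Proof.
  intros hz hu e. assert (h1 := Csqrt_Re_pos z hz). assert (h2 := Csqrt_sqr z hz).
  assert (h3 : ((Csqrt z - u) * (Csqrt z + u) = 0)%C).
  { transitivity (Csqrt z * Csqrt z - u * u)%C; [ring|]. rewrite h2, e. ring. }
  apply Csub_eq_0. apply NNPP. intros hne.
  assert (hne2 : (Csqrt z + u)%C <> 0%C).
  { intros e0. apply (f_equal Re) in e0. rewrite Re_plus, Re_RtoC in e0. lra. }
  now apply (Cmult_neq_0 _ _ hne hne2).
Qed.

Lemma Csqrt_sub (z w : C) : 0 < Re z -> 0 < Re w ->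
  (Csqrt z - Csqrt w = (z - w) / (Csqrt z + Csqrt w))%C.
Proof.
  intros hz hw. assert (h1 := Csqrt_Re_pos z hz). assert (h2 := Csqrt_Re_pos w hw).
  assert (hne : (Csqrt z + Csqrt w)%C <> 0%C).
  { intros e0. apply (f_equal Re) in e0. rewrite Re_plus, Re_RtoC in e0. lra. }
  rewrite <- (Csqrt_sqr z hz) at 2. rewrite <- (Csqrt_sqr w hw) at 2. field. exact hne.
Qed.

Lemma ex_derive_Csqrt (z : C) : 0 < Re z -> ex_derive Csqrt z.
Proof.
  intros hz. set (s := Csqrt z). assert (hs := Csqrt_Re_pos z hz). fold s in hs.
  set (c := Re s) in *.
  assert (s0 : s <> 0%C). { intros e. apply (f_equal Re) in e. fold c in e. rewrite Re_RtoC in e. lra. }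
  exists (/ (2 * s))%C.
  apply (is_derive_quadratic _ _ _ (/ (2 * c ^ 3)) (Re z / 2)); [lra| |].
  { left. apply Rinv_0_lt_compat. assert (0 < c ^ 3) by now apply pow_lt. lra. }
  intros w hw.
  assert (hwr : 0 < Re w).
  { assert (q := Rle_trans _ _ _ (re_le_Cmod (w - z)) hw). rewrite Re_minus in q.
    apply Rabs_le_between in q. lra. }
  assert (ht := Csqrt_Re_pos w hwr).
  assert (e := Csqrt_sub w z hwr hz). fold s in e. fold s.
  set (t := Csqrt w) in *.
  assert (hts : c <= Cmod (t + s)). { eapply Rle_trans; [|apply Re_le_Cmod]. rewrite Re_plus. unfold c. lra. }
  assert (ts0 : (t + s)%C <> 0%C) by (apply Cmod_pos_neq; lra).
  assert (hsc : c <= Cmod s) by apply Re_le_Cmod.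
  replace (t - s - (w - z) * / (2 * s))%C with (- ((w - z) * (w - z)) / (2 * s * ((t + s) * (t + s))))%C.
  2: { assert (eD : (w - z = (t - s) * (t + s))%C) by (rewrite e; field; exact ts0).
       rewrite eD. field. split; assumption. }
  rewrite Cmod_div.
  2: { repeat apply Cmult_neq_0; trivial. apply RtoC_neq_0; lra. }
  rewrite Cmod_opp, !Cmod_mult, Cmod_RtoC_pos by lra.
  replace (Cmod (w - z) * Cmod (w - z)) with (Cmod (w - z) ^ 2) by ring.
  unfold Rdiv. rewrite Rmult_comm. apply Rmult_le_compat_r; [apply pow2_ge_0|].
  assert (0 < c ^ 3) by now apply pow_lt.
  apply Rinv_le_contravar; [lra|]. simpl.
  assert (c * c <= Cmod (t + s) * Cmod (t + s)) by (apply Rmult_le_compat; lra).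
  assert (c * (c * c) <= Cmod s * (Cmod (t + s) * Cmod (t + s))) by (apply Rmult_le_compat; nra).
  lra.
Qed.

(** A radius around 1 that serves all [n]. It is small enough that 2 (s - 1)^2 / s, the deviation of
    2 / s - 2 from - 2 (s - 1), stays below rho / 128 within distance 2 rho of 1. *)
Definition rho : R := / 2048.

Lemma rho_pos : 0 < rho. Proof. unfold rho. lra. Qed.

Lemma half_plane_near_1 (z : C) (r : R) : Cmod (z - 1) < r -> 1 - r < Re z.
Proof.
  intros h. assert (q := Rle_lt_trans _ _ _ (re_le_Cmod (z - 1)) h). rewrite Re_minus, Re_RtoC in q.
  apply Rabs_lt_between in q. lra.
Qed.

Section PhaseSqrt.
Variable phi : C -> C.
Hypotheses (hol : forall z : C, 1 / 2 <= Re z -> ex_derive phi z)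
  (h0 : phi 1 = 0%C) (h1 : C_derive phi 1 = 0%C)
  (hder : forall z : C, Cmod (z - 1) < 1 / 2 -> Cmod (C_derive phi z - (2 / z - 2)) <= rho / 128)
  (him : forall x, 1 < x -> Im (phi (RtoC x)) = 0).

(** The deviation of the phase from its model - (z - 1)^2. It vanishes to second order at 1 and will
    be divided by (z - 1)^2. *)
Let q (z : C) : C := (phi z + (z - 1) ^ 2)%C.

Let dq (z : C) : 1 / 2 <= Re z -> is_derive q z (C_derive phi z + 2 * (z - 1))%C.
Proof.
  intros hz. unfold q. eapply is_derive_ext_val.
  - apply is_derive_plus_C; [now apply C_derive_is, hol|].
    apply is_derive_pow_C, is_derive_minus_C; [apply is_derive_id_C | apply is_derive_const_C].
  - ceq. simpl. replace (RtoC (1 + 1)) with (RtoC 2) by (f_equal; ring). ring.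
Qed.

Let square_near (z : C) : in_rect (Re 1 - rho) (Re 1 + rho) (Im 1 - rho) (Im 1 + rho) z -> Cmod (z - 1) <= 2 * rho.
Proof.
  intros [hx hy]. rewrite Re_RtoC in hx. rewrite Im_RtoC in hy.
  eapply Rle_trans; [apply Cmod_le_re_im|]. reim.
  replace (2 * rho) with (rho + rho) by ring. apply Rplus_le_compat; apply Rabs_le; lra.
Qed.

Let ddphi (z : C) : Cmod (z - 1) < 1 / 2 -> ex_derive (C_derive phi) z.
Proof.
  intros hz. set (e := (1 / 2 - Cmod (z - 1)) / 2). assert (he : 0 < e) by (unfold e; lra).
  exact (proj2 (cauchy_derivatives phi (Re z - e) (Re z + e) (Im z - e) (Im z + e) 1
    (fun s hs => hol s ltac:(
      assert (k := re_le_Cmod (z - 1)); rewrite Re_minus, Re_RtoC in k;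
      apply (fun k' => Rle_trans _ _ _ (Rle_abs _) k') in k as k1;
      rewrite <- Rabs_Ropp in k; apply (fun k' => Rle_trans _ _ _ (Rle_abs _) k') in k;
      destruct hs as [hs _]; unfold e in hs; lra)) z (center_in_square z e he))).
Qed.

Let hol_q : hol_square q 1 rho.
Proof.
  intros z hz. eexists. apply dq. destruct hz as [hx _]. rewrite Re_RtoC in hx. unfold rho in hx. lra.
Qed.

(** The derivative of [q] is the error allowed by [hder] plus 2 (s - 1)^2 / s, each at most rho /
    128; integrating over a segment of length at most 2 rho gives rho^2 / 32. *)
Let bound_q (z : C) : in_rect (Re 1 - rho) (Re 1 + rho) (Im 1 - rho) (Im 1 + rho) z -> Cmod (q z) <= rho ^ 2 / 32.
Proof.
  intros hz. apply square_near in hz.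
  assert (q1 : q 1 = 0%C) by (unfold q; rewrite h0; simpl; ring).
  replace (q z) with (q z - q 1)%C by (rewrite q1; ring).
  apply Rle_trans with (rho / 64 * Cmod (z - 1)); [|unfold rho in *; lra].
  apply mvt_C with (g := fun z => (C_derive phi z + 2 * (z - 1))%C).
  intros t ht. set (s := (1 + t * (z - 1))%C).
  assert (hs : Cmod (s - 1) <= 2 * rho).
  { unfold s. replace (1 + t * (z - 1) - 1)%C with (t * (z - 1))%C by ring.
    rewrite Cmod_mult, Cmod_RtoC_pos by lra. generalize (Cmod_ge_0 (z - 1)). nra. }
  assert (hsr : 1 - 1 / 4 < Re s) by (apply half_plane_near_1; unfold rho in hs; lra).
  assert (s0 : s <> 0%C). { intros e. rewrite e, Re_RtoC in hsr. lra. }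
  split; [apply dq; lra|]. split.
  - apply ex_derive_continuous_C, ex_derive_plus_C; [apply ddphi; unfold rho in hs; lra|].
    apply ex_derive_mult_C; [apply ex_derive_const_C|].
    apply ex_derive_minus_C; [apply ex_derive_id_C | apply ex_derive_const_C].
  - replace (C_derive phi s + 2 * (s - 1))%C with ((C_derive phi s - (2 / s - 2)) + 2 * (s - 1) ^ 2 / s)%C.
    2: { simpl. field. exact s0. }
    eapply Rle_trans; [apply Cmod_triangle|].
    assert (b := hder s ltac:(unfold rho in hs; lra)).
    rewrite Cmod_div, Cmod_mult, Cmod_pow, Cmod_RtoC_pos by (try exact s0; lra).
    assert (hs2 : 3 / 4 <= Cmod s) by (eapply Rle_trans; [|apply Re_le_Cmod]; lra).
    assert (hsq : Cmod (s - 1) ^ 2 <= (2 * rho) ^ 2) by (apply pow_incr; split; [apply Cmod_ge_0 | exact hs]).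
    assert (2 * Cmod (s - 1) ^ 2 / Cmod s <= rho / 128); [|lra].
    apply Rmult_le_reg_r with (Cmod s); [lra|]. unfold Rdiv at 1. rewrite Rmult_assoc, Rinv_l, Rmult_1_r by lra.
    unfold rho in *. lra.
Qed.

(** Dividing [q] by (z - 1)^2 gives phi = - (z - 1)^2 Psi with Psi within 4 (rho^2 / 32) / rho^2 = 1
    / 8 of 1, so the principal root [sg] of Psi is analytic. The Lipschitz constant 1 / (4 rho) is 8
    (rho^2 / 32) / rho^3; the root does not increase it, because the sum of two roots has modulus at
    least 1. *)
Lemma phase_sqrt : exists (sg : C -> C) (c : R),
  (forall z, Cmod (z - 1) < rho / 2 -> phi z = (- ((z - 1) * sg z) ^ 2)%C) /\
  (forall z, Cmod (z - 1) <= rho / 2 -> Cmod (sg z - 1) <= / 8) /\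
  (forall z w, Cmod (z - 1) <= rho / 2 -> Cmod (w - 1) <= rho / 2 ->
     Cmod (sg z - sg w) <= / (4 * rho) * Cmod (z - w)) /\
  (forall z, Cmod (z - 1) < rho / 2 -> ex_derive sg z) /\
  sg 1 = RtoC c /\ 7 / 8 <= c <= 9 / 8 /\ phi2 phi = RtoC (- (2 * c ^ 2)).
Proof.
  assert (hr := rho_pos).
  destruct (divided_difference q 1 rho (rho ^ 2 / 32) 1 hr hol_q) as (g & g1 & g2 & g3 & g4 & g5).
  { intros s [hs _]. now apply bound_q. }
  assert (q1 : q 1 = 0%C) by (unfold q; rewrite h0; simpl; ring).
  assert (dq1 : C_derive q 1 = 0%C).
  { rewrite (is_C_derive_unique _ _ _ (dq 1%C ltac:(rewrite Re_RtoC; lra))), h1. ring. }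
  set (Psi := fun z => (1 - g z)%C).
  assert (P1 : forall z, Cmod (z - 1) < rho / 2 -> phi z = (- ((z - 1) ^ 2 * Psi z))%C).
  { intros z hz. assert (e := g1 z ltac:(lra)). rewrite taylor_at_1, q1, dq1 in e.
    unfold q in e. unfold Psi. apply Csub_eq_0.
    transitivity (phi z + (z - 1) ^ 2 - (z - 1) ^ 2 * g z)%C; [ring|]. rewrite e. ring. }
  assert (P2 : forall z, Cmod (z - 1) <= rho / 2 -> Cmod (Psi z - 1) <= / 8).
  { intros z hz. unfold Psi. replace (1 - g z - 1)%C with (- g z)%C by ring. rewrite Cmod_opp.
    eapply Rle_trans; [now apply g2|]. right. simpl. field. lra. }
  assert (PR : forall z, Cmod (z - 1) <= rho / 2 -> 7 / 8 <= Re (Psi z)).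
  { intros z hz. assert (b := Rle_trans _ _ _ (re_le_Cmod _) (P2 z hz)). rewrite Re_minus, Re_RtoC in b.
    apply Rabs_le_between in b. lra. }
  assert (c1 : Cmod (1 - 1) = 0) by (unfold Cminus; rewrite Cplus_opp_r; apply Cmod_0).
  assert (P5 : Psi 1 = (- phi2 phi / 2)%C).
  { unfold Psi. rewrite g5. simpl C_derive_n.
    assert (d2 : C_derive (C_derive q) 1 = (C_derive (C_derive phi) 1 + 2)%C).
    { apply is_C_derive_unique.
      apply (is_derive_locally_ext (fun z => C_derive phi z + 2 * (z - 1))%C _ _ _ (1 / 4)); [lra| |].
      - intros s hs. symmetry. apply is_C_derive_unique, dq. apply half_plane_near_1 in hs. lra.
      - eapply is_derive_ext_val.
        + apply is_derive_plus_C; [apply C_derive_is, ddphi; lra|].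
          apply is_derive_mult_C; [apply is_derive_const_C|].
          apply is_derive_minus_C; [apply is_derive_id_C | apply is_derive_const_C].
        + ceq. ring. }
    rewrite d2. unfold phi2. simpl (INR _). replace (RtoC (1 + 1)) with (RtoC 2) by (f_equal; ring). field. }
  assert (cPsi : forall z, Cmod (z - 1) < rho / 2 -> ex_derive Psi z).
  { intros z hz. apply ex_derive_minus_C; [apply ex_derive_const_C | apply g4; lra]. }
  (* Psi 1 is real as a limit of real values on x > 1; hence [c] is a real number and phi''(1) = - 2
     c^2 is negative. *)
  assert (im1 : Im (Psi 1) = 0).
  { apply (Im_limit_right Psi 1 (rho / 2)); [lra | apply ex_derive_continuous_C, cPsi; lra|].
    intros y hy.
    assert (hz : Cmod (y - 1) < rho / 2) by (rewrite <- RtoC_minus, Cmod_RtoC_pos by lra; lra).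
    assert (e := P1 y hz).
    assert (e2 : Psi y = (RtoC (- / (y - 1) ^ 2) * phi y)%C).
    { rewrite e, RtoC_opp, RtoC_inv by (apply pow_nonzero; lra).
      rewrite RtoC_pow, <- RtoC_minus. assert (hn : RtoC (y - 1) <> 0%C) by (apply RtoC_neq_0; lra).
      set (t := RtoC (y - 1)) in *. set (P := Psi y). field. exact hn. }
    rewrite e2, Im_mult, Im_RtoC, him by lra. ring. }
  set (a := Re (Psi 1)).
  assert (eP : Psi 1 = RtoC a) by (apply C_ext; [reflexivity | rewrite im1; reflexivity]).
  assert (ha := PR 1%C ltac:(lra)). fold a in ha.
  exists (fun z => Csqrt (Psi z)), (sqrt a).
  assert (near : forall z, Cmod (z - 1) <= rho / 2 -> Cmod (Csqrt (Psi z) - 1) <= / 8).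
  { intros z hz. assert (hp := PR z hz). assert (hs := Csqrt_Re_pos (Psi z) ltac:(lra)).
    assert (e := Csqrt_sqr (Psi z) ltac:(lra)). set (s := Csqrt (Psi z)) in *.
    assert (hs1 : 1 <= Cmod (s + 1)). { eapply Rle_trans; [|apply Re_le_Cmod]. rewrite Re_plus, Re_RtoC. lra. }
    assert (b := P2 z hz). replace (Psi z - 1)%C with ((s - 1) * (s + 1))%C in b by (rewrite <- e; ring).
    rewrite Cmod_mult in b. generalize (Cmod_ge_0 (s - 1)). nra. }
  assert (nearR : forall z, Cmod (z - 1) <= rho / 2 -> 7 / 8 <= Re (Csqrt (Psi z))).
  { intros z hz. assert (b := Rle_trans _ _ _ (re_le_Cmod _) (near z hz)). rewrite Re_minus, Re_RtoC in b.
    apply Rabs_le_between in b. lra. }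
  assert (hsq : sqrt a * sqrt a = a) by (apply sqrt_sqrt; lra).
  assert (hsp : 0 < sqrt a) by (apply sqrt_lt_R0; lra).
  assert (e1 : Csqrt (Psi 1) = RtoC (sqrt a)).
  { apply Csqrt_unique; [fold a; lra | rewrite Re_RtoC; exact hsp|]. rewrite <- RtoC_mult, hsq. now rewrite eP. }
  split; [|split; [exact near|split; [|split; [|split; [exact e1|split]]]]].
  - intros z hz. rewrite P1 by exact hz. assert (e := Csqrt_sqr (Psi z) ltac:(specialize (PR z ltac:(lra)); lra)).
    rewrite <- e at 1. simpl. ring.
  - intros z w hz hw. rewrite Csqrt_sub by (first [specialize (PR z hz); lra | specialize (PR w hw); lra]).
    assert (r1 := nearR z hz). assert (r2 := nearR w hw).
    assert (hs1 : 1 <= Cmod (Csqrt (Psi z) + Csqrt (Psi w))).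
    { eapply Rle_trans; [|apply Re_le_Cmod]. rewrite Re_plus. lra. }
    rewrite Cmod_div by (apply Cmod_pos_neq; lra).
    apply Rle_trans with (Cmod (Psi z - Psi w)).
    + apply Rmult_le_reg_r with (Cmod (Csqrt (Psi z) + Csqrt (Psi w))); [lra|].
      unfold Rdiv. rewrite Rmult_assoc, Rinv_l by lra. generalize (Cmod_ge_0 (Psi z - Psi w)). nra.
    + unfold Psi. replace (1 - g z - (1 - g w))%C with (- (g z - g w))%C by ring. rewrite Cmod_opp.
      eapply Rle_trans; [now apply g3|]. right. simpl. field. lra.
  - intros z hz. apply (ex_derive_comp_C Csqrt Psi); [|now apply cPsi].
    apply ex_derive_Csqrt. specialize (PR z ltac:(lra)). lra.
  - assert (b := near 1%C ltac:(lra)). rewrite e1, <- RtoC_minus, Cmod_R in b. apply Rabs_le_between in b. lra.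
  - replace (sqrt a ^ 2) with a by (rewrite <- hsq at 1; ring).
    rewrite RtoC_opp, RtoC_mult, <- eP, P5. field.
Qed.
End PhaseSqrt.

(** * The local map *)

Section LocalMap.
Variables (F phi sg : C -> C) (lam c delta : R).
Hypotheses (hright : forall z : C, 1 / 2 <= Re z -> right_of_zeros F lam z)
  (S1 : forall z, Cmod (z - 1) < rho / 2 -> phi z = (- ((z - 1) * sg z) ^ 2)%C)
  (S2 : forall z, Cmod (z - 1) <= rho / 2 -> Cmod (sg z - 1) <= / 8)
  (S3 : forall z w, Cmod (z - 1) <= rho / 2 -> Cmod (w - 1) <= rho / 2 ->
     Cmod (sg z - sg w) <= / (4 * rho) * Cmod (z - w))
  (S4 : forall z, Cmod (z - 1) < rho / 2 -> ex_derive sg z)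
  (S5 : sg 1 = RtoC c) (S6 : 7 / 8 <= c <= 9 / 8) (S7 : phi2 phi = RtoC (- (2 * c ^ 2)))
  (hdelta : 0 < delta <= rho / 16).

(** Of the two square roots of the phase, the factor - i selects the one whose leading term is
    prescribed for w. *)
Definition local_w0 (z : C) : C := (- Ci * ((z - 1) * sg z))%C.
Definition local_w (z : C) : C := if Rlt_dec (Re z) 0 then local_w0 (- z) else local_w0 z.
Definition local_B (z : C) : Prop := Cmod (z - 1) < rho / 2 /\ Cmod (local_w0 z) < delta.

Lemma sg_bounds (z : C) : Cmod (z - 1) <= rho / 2 -> 7 / 8 <= Cmod (sg z) <= 9 / 8.
Proof.
  intros hz. specialize (S2 z hz). assert (a := Cmod_sub_ge 1 (1 - sg z)%C).
  replace (1 - (1 - sg z))%C with (sg z) in a by ring.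
  assert (b := Cmod_triangle 1 (sg z - 1)). replace (1 + (sg z - 1))%C with (sg z) in b by ring.
  rewrite Cmod_1 in a, b. rewrite Cmod_sub_sym in S2.
  assert (t := Cmod_sub_ge 1 (sg z)). rewrite Cmod_1 in t. rewrite (Cmod_sub_sym (sg z) 1) in b. lra.
Qed.

Lemma Cmod_local_w0 (z : C) : Cmod (local_w0 z) = Cmod (z - 1) * Cmod (sg z).
Proof. unfold local_w0. rewrite !Cmod_mult, Cmod_opp, Cmod_Ci. ring. Qed.

Lemma local_B_contains (z : C) : Cmod (z - 1) < delta / 2 -> local_B z.
Proof.
  intros h. assert (hr := rho_pos). split; [lra|]. rewrite Cmod_local_w0.
  assert (b := sg_bounds z ltac:(lra)). generalize (Cmod_ge_0 (z - 1)). nra.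
Qed.

Lemma local_B_near (z : C) : local_B z -> Cmod (z - 1) < 2 * delta.
Proof.
  intros [h1 h2]. rewrite Cmod_local_w0 in h2. assert (b := sg_bounds z ltac:(lra)).
  generalize (Cmod_ge_0 (z - 1)). nra.
Qed.

Lemma local_B_Re (z : C) : local_B z -> 1 / 2 <= Re z.
Proof.
  intros h. apply local_B_near in h. apply half_plane_near_1 in h. unfold rho in hdelta. lra.
Qed.

Lemma local_w_right (z : C) : 0 <= Re z -> local_w z = local_w0 z.
Proof. intros h. unfold local_w. destruct (Rlt_dec (Re z) 0); [lra | reflexivity]. Qed.

Lemma ex_derive_local_w0 (z : C) : Cmod (z - 1) < rho / 2 -> ex_derive local_w0 z.
Proof.
  intros hz. apply ex_derive_mult_C; [apply ex_derive_const_C|]. apply ex_derive_mult_C; [|now apply S4].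
  apply ex_derive_minus_C; [apply ex_derive_id_C | apply ex_derive_const_C].
Qed.

(** Comparing the two values leaves (z - z') sg z = (z' - 1) (sg z' - sg z). The left side has
    modulus at least 7/8 |z - z'|, the right side at most 1/8 |z - z'|. *)
Lemma local_w0_inj (z z' : C) : Cmod (z - 1) <= rho / 2 -> Cmod (z' - 1) <= rho / 2 ->
  local_w0 z = local_w0 z' -> z = z'.
Proof.
  intros hz hz' e. assert (hr := rho_pos).
  assert (e2 : ((z - 1) * sg z = (z' - 1) * sg z')%C).
  { unfold local_w0 in e. replace ((z - 1) * sg z)%C with (Ci * (- Ci * ((z - 1) * sg z)))%C.
    - rewrite e. apply C_ext; reim; ring.
    - apply C_ext; reim; ring. }
  assert (e3 : ((z - z') * sg z = (z' - 1) * (sg z' - sg z))%C).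
  { apply Csub_eq_0. transitivity ((z - 1) * sg z - (z' - 1) * sg z')%C; [ring|]. rewrite e2. ring. }
  apply (f_equal Cmod) in e3. rewrite !Cmod_mult in e3.
  assert (b := sg_bounds z hz). assert (s := S3 z' z hz' hz). rewrite (Cmod_sub_sym z' z) in s.
  assert (h0 := Cmod_ge_0 (z - z')).
  assert (h1 : Cmod (z' - 1) * Cmod (sg z' - sg z) <= rho / 2 * (/ (4 * rho) * Cmod (z - z'))).
  { apply Rmult_le_compat; trivial; apply Cmod_ge_0. }
  replace (rho / 2 * (/ (4 * rho) * Cmod (z - z'))) with (Cmod (z - z') / 8) in h1 by (field; lra).
  apply Csub_eq_0, Cmod_eq_0. nra.
Qed.

Lemma sqr_le_pow2 (m : nat) : INR m ^ 2 <= 4 * 2 ^ m.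
Proof.
  assert (h : forall k, INR (k + 3) ^ 2 <= 2 * 2 ^ (k + 3)).
  { induction k as [|k IH].
    - simpl. lra.
    - replace (S k + 3)%nat with (S (k + 3)) by lia. rewrite S_INR, <- (tech_pow_Rmult 2).
      assert (3 <= INR (k + 3)) by (replace 3 with (INR 3) by (simpl; ring); apply le_INR; lia).
      set (x := INR (k + 3)) in *. assert (0 <= (x - 3) * (x + 1)) by (apply Rmult_le_pos; lra).
      assert ((x + 1) ^ 2 <= 2 * x ^ 2) by lra. lra. }
  destruct m as [|[|[|m]]]; [simpl; lra | simpl; lra | simpl; lra|].
  specialize (h m). replace (m + 3)%nat with (S (S (S m))) in h by lia.
  assert (0 < 2 ^ S (S (S m))) by (apply pow_lt; lra). lra.
Qed.

(** The equation local_w0 (1 + v) = u is the fixed point problem v = i u / sg (1 + v). The Lipschitz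
    bound on [sg] makes this map contract by at least 1 / 2 on the disc of radius rho / 2. *)
Lemma local_w0_surj (u : C) : Cmod u < delta -> exists z, local_B z /\ local_w0 z = u.
Proof.
  intros hu. assert (hr := rho_pos).
  set (om := (Ci * u)%C). assert (hom : Cmod om < delta) by (unfold om; rewrite Cmod_mult, Cmod_Ci; lra).
  assert (hom0 := Cmod_ge_0 om).
  set (T := fun v : C => (om / sg (1 + v))%C).
  assert (sub1 : forall v : C, (1 + v - 1 = v)%C) by (intros; ring).
  assert (T1 : forall v, Cmod v <= rho / 2 -> Cmod (T v) <= rho / 2 /\ Cmod (T v) <= 8 / 7 * Cmod om).
  { intros v hv. assert (b := sg_bounds (1 + v)%C ltac:(rewrite sub1; exact hv)).
    assert (h : Cmod (T v) <= 8 / 7 * Cmod om).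
    { unfold T. rewrite Cmod_div by (apply Cmod_pos_neq; lra).
      apply Rmult_le_reg_r with (Cmod (sg (1 + v))); [lra|]. unfold Rdiv at 1. rewrite Rmult_assoc, Rinv_l by lra. nra. }
    split; [lra | exact h]. }
  assert (T2 : forall v v', Cmod v <= rho / 2 -> Cmod v' <= rho / 2 -> Cmod (T v - T v') <= / 2 * Cmod (v - v')).
  { intros v v' hv hv'.
    assert (b := sg_bounds (1 + v)%C ltac:(rewrite sub1; exact hv)).
    assert (b' := sg_bounds (1 + v')%C ltac:(rewrite sub1; exact hv')).
    assert (s := S3 (1 + v)%C (1 + v')%C ltac:(rewrite sub1; exact hv) ltac:(rewrite sub1; exact hv')).
    replace (1 + v - (1 + v'))%C with (v - v')%C in s by ring.
    unfold T. set (a := sg (1 + v)%C) in *. set (a' := sg (1 + v')%C) in *.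
    assert (na : a <> 0%C) by (apply Cmod_pos_neq; lra). assert (na' : a' <> 0%C) by (apply Cmod_pos_neq; lra).
    replace (om / a - om / a')%C with (- (om * (a - a')) / (a * a'))%C by (field; split; assumption).
    rewrite Cmod_div, Cmod_opp, !Cmod_mult by (now apply Cmult_neq_0).
    assert (hp : 7 / 8 * (7 / 8) <= Cmod a * Cmod a') by (apply Rmult_le_compat; lra).
    apply Rmult_le_reg_r with (Cmod a * Cmod a'); [lra|]. unfold Rdiv. rewrite Rmult_assoc, Rinv_l, Rmult_1_r by lra.
    assert (h : Cmod om * Cmod (a - a') <= rho / 16 * (/ (4 * rho) * Cmod (v - v'))).
    { apply Rmult_le_compat; try apply Cmod_ge_0; trivial. lra. }
    replace (rho / 16 * (/ (4 * rho) * Cmod (v - v'))) with (Cmod (v - v') / 64) in h by (field; lra).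
    assert (hv0 := Cmod_ge_0 (v - v')). nra. }
  set (v := fun k : nat => Nat.iter k T (RtoC 0)).
  assert (vb : forall k, Cmod (v k) <= rho / 2).
  { induction k as [|k IH]; [simpl; rewrite Cmod_0; lra|]. apply (T1 (v k) IH). }
  assert (vd : forall k, Cmod (v (S k) - v k) <= rho / 2 ^ k).
  { induction k as [|k IH].
    - simpl. rewrite Rdiv_1_r. replace (T 0 - 0)%C with (T 0) by ring.
      destruct (T1 0%C) as [h _]; [rewrite Cmod_0; lra | lra].
    - change (v (S (S k))) with (T (v (S k))). change (v (S k)) with (T (v k)) at 2.
      eapply Rle_trans; [apply T2; apply vb|].
      replace (rho / 2 ^ S k) with (/ 2 * (rho / 2 ^ k)) by (simpl; field; apply pow_nonzero; lra). lra. }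
  (* The geometric increments rho / 2^m are weakened to 4 rho / m^2 in order to use the convergence
     criterion for inverse squares. *)
  destruct (Ccv_increments v (4 * rho) 1 (le_n 1)) as [l hl]; [lra| |].
  { intros m hm. eapply Rle_trans; [apply vd|].
    assert (h2 : 0 < 2 ^ m) by (apply pow_lt; lra). assert (hm2 : 0 < INR m ^ 2) by (apply pow_lt, lt_0_INR; lia).
    assert (hs := sqr_le_pow2 m).
    apply Rmult_le_reg_r with (2 ^ m * INR m ^ 2); [now apply Rmult_lt_0_compat|].
    replace (rho / 2 ^ m * (2 ^ m * INR m ^ 2)) with (rho * INR m ^ 2) by (field; lra).
    assert (hm3 : INR m <> 0) by (apply not_0_INR; lia).
    replace (4 * rho / INR m ^ 2 * (2 ^ m * INR m ^ 2)) with (rho * (4 * 2 ^ m)) by (field; exact hm3).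
    apply Rmult_le_compat_l; lra. }
  assert (lb : Cmod l <= rho / 2) by (apply (Ccv_Cmod_le v l _ 0); auto).
  assert (fix1 : Cmod (l - T l) = 0).
  { apply Rle_antisym; [|apply Cmod_ge_0]. apply Rnot_lt_le. intros hlt.
    destruct (hl (Cmod (l - T l) / 4) ltac:(lra)) as [n0 k].
    assert (k1 := k n0 (le_n _)). assert (k2 := k (S n0) ltac:(lia)).
    assert (t2 := T2 (v n0) l (vb n0) lb). change (T (v n0)) with (v (S n0)) in t2.
    assert (t := Cmod_sub_triangle l (v (S n0)) (T l)). rewrite (Cmod_sub_sym l (v (S n0))) in t.
    assert (h0 := Cmod_ge_0 (v n0 - l)). lra. }
  apply Cmod_eq_0, Csub_eq_0 in fix1.
  destruct (T1 l lb) as [_ h8]. rewrite <- fix1 in h8.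
  assert (b := sg_bounds (1 + l)%C ltac:(rewrite sub1; exact lb)).
  assert (ew : local_w0 (1 + l)%C = u).
  { unfold local_w0. rewrite sub1. rewrite fix1 at 1. unfold T.
    replace (- Ci * (om / sg (1 + l) * sg (1 + l)))%C with (- Ci * om)%C by (field; apply Cmod_pos_neq; lra).
    unfold om. apply C_ext; reim; ring. }
  exists (1 + l)%C. split; [|exact ew]. split; [rewrite sub1; lra | rewrite ew; exact hu].
Qed.

Lemma local_w_is_local_map : is_local_map F lam phi delta local_w local_B.
Proof.
  assert (hr := rho_pos).
  assert (c1 : Cmod (1 - 1) = 0) by (unfold Cminus; rewrite Cplus_opp_r; apply Cmod_0).
  assert (hopen : forall z, local_B z -> exists d, 0 < d /\ forall s, Cmod (s - z) < d -> local_B s).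
  { intros z [hz1 hz2].
    destruct (proj1 (continuous_C _ _) (ex_derive_continuous_C _ _ (ex_derive_local_w0 z hz1)) (delta - Cmod (local_w0 z)) ltac:(lra))
      as (d & hd & k).
    exists (Rmin d (rho / 2 - Cmod (z - 1))). split; [apply Rmin_pos; lra|]. intros s hs.
    specialize (k s (Rlt_le_trans _ _ _ hs (Rmin_l _ _))). assert (h2 := Rlt_le_trans _ _ _ hs (Rmin_r _ _)).
    split.
    - assert (t := Cmod_sub_triangle s z 1). lra.
    - assert (t := Cmod_sub_ge (local_w0 s) (local_w0 z)). lra. }
  split; [|split; [|split; [|split; [|split; [|split; [|split; [|split]]]]]]].
  - intros z hz. apply locally_C. now apply hopen.
  - apply local_B_contains. lra.
  - intros z hz. now apply hright, local_B_Re.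
  - intros z hz. destruct (hopen z hz) as (d & hd & k).
    apply (ex_derive_locally_ext local_w0 local_w z d hd).
    + intros s hs. rewrite local_w_right; [reflexivity|]. specialize (local_B_Re s (k s hs)). lra.
    + apply ex_derive_local_w0, hz.
  - intros z z' hz hz'. assert (r1 := local_B_Re z hz). assert (r2 := local_B_Re z' hz').
    rewrite !local_w_right by lra. destruct hz, hz'. apply local_w0_inj; lra.
  - intros u. split.
    + intros hu. destruct (local_w0_surj u hu) as (z & hz & e). exists z. split; [exact hz|].
      rewrite local_w_right; [exact e|]. specialize (local_B_Re z hz). lra.
    + intros (z & hz & <-). rewrite local_w_right; [apply hz|]. specialize (local_B_Re z hz). lra.
  - intros z hz. rewrite local_w_right by (specialize (local_B_Re z hz); lra). rewrite S1 by apply hz.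
    unfold local_w0. simpl. replace (- Ci * ((z - 1) * sg z) * (- Ci * ((z - 1) * sg z) * 1))%C with
      ((Ci * Ci) * (((z - 1) * sg z) * ((z - 1) * sg z)))%C by ring.
    replace (Ci * Ci)%C with (- (1))%C by (apply C_ext; reim; ring). ring.
  (* The relative correction is r = sg z / c - 1; dividing the Lipschitz constant 1 / (4 rho) by c
     >= 3/4 gives 1 / (3 rho). *)
  - exists (/ (rho * 3)), (rho / 2). split; [lra|]. intros z hz.
    assert (cn : RtoC c <> 0%C) by (apply RtoC_neq_0; lra).
    exists (sg z / c - 1)%C. split.
    + replace (sg z / c - 1)%C with ((sg z - sg 1) / c)%C by (rewrite S5; field; exact cn).
      rewrite Cmod_div, Cmod_RtoC_pos by (try exact cn; lra).
      assert (s := S3 z 1%C ltac:(lra) ltac:(lra)).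
      apply Rmult_le_reg_r with c; [lra|]. unfold Rdiv. rewrite Rmult_assoc, Rinv_l, Rmult_1_r by lra.
      eapply Rle_trans; [exact s|].
      replace (/ (4 * rho) * Cmod (z - 1)) with (/ (rho * 3) * Cmod (z - 1) * (3 / 4)) by (field; lra).
      apply Rmult_le_compat_l; [|lra].
      apply Rmult_le_pos; [left; apply Rinv_0_lt_compat; lra | apply Cmod_ge_0].
    + apply half_plane_near_1 in hz as hz'. rewrite local_w_right by (unfold rho in hz'; lra).
      rewrite S7, Re_RtoC. replace (- - (2 * c ^ 2) / 2) with (c ^ 2) by field.
      rewrite sqrt_pow2 by lra. unfold local_w0. field. exact cn.
  - intros z hz. assert (r := local_B_Re _ hz). rewrite Re_opp in r.
    rewrite (local_w_right (- z)%C) by (rewrite Re_opp; lra).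
    unfold local_w. destruct (Rlt_dec (Re z) 0); [reflexivity | lra].
Qed.
End LocalMap.

(** * The integrand *)

(* [sg] is an analytic square root of [- phi z / (z - 1)^2] near 1, so that [w z = - i (z - 1) sg z]. *)
Definition near_sigma (F phi sg : C -> C) (lam c : R) (n : nat) : Prop :=
  (1 <= n)%nat /\ 0 < lam /\
  (forall z : C, 1 / 2 <= Re z -> F (lam * z)%C <> 0%C) /\
  (forall z : C, z <> 0%C -> F (lam * z)%C <> 0%C ->
     Cexp (INR n * phi z) = (z ^ (2 * n) * F lam / F (lam * z))%C) /\
  (forall z, Cmod (z - 1) < rho / 2 -> phi z = (- ((z - 1) * sg z) ^ 2)%C) /\
  (forall z, Cmod (z - 1) <= rho / 2 -> Cmod (sg z - 1) <= / 8) /\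
  (forall z w, Cmod (z - 1) <= rho / 2 -> Cmod (w - 1) <= rho / 2 ->
     Cmod (sg z - sg w) <= / (4 * rho) * Cmod (z - w)) /\
  (forall z, Cmod (z - 1) < rho / 2 -> ex_derive sg z) /\
  sg 1 = RtoC c /\ 7 / 8 <= c <= 9 / 8.

(* [exp (- n phi s)], defined for all nonzero [s]. *)
Definition amplitude (F : C -> C) (lam : R) (n : nat) (s : C) : C := (F (lam * s) / (F lam * s ^ (2 * n)))%C.

Lemma C_derive_n_scale (F : C -> C) (lam : R) (k : nat) : entire F ->
  forall z, C_derive_n (fun s => F (lam * s))%C k z = (lam ^ k * C_derive_n F k (lam * z))%C.
Proof.
  intros hF. induction k as [|k IH]; intros z.
  - simpl. ring.
  - simpl C_derive_n.
    assert (hk : ex_derive (C_derive_n F k) (lam * z)%C).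
    { exact (proj2 (cauchy_derivatives F (Re (lam * z)%C - 1) (Re (lam * z)%C + 1) (Im (lam * z)%C - 1) (Im (lam * z)%C + 1) k
       (hol_entire_rect F _ _ _ _ hF) (lam * z)%C (center_in_square _ 1 Rlt_0_1))). }
    apply is_C_derive_unique.
    apply (is_derive_locally_ext (fun z => lam ^ k * C_derive_n F k (lam * z))%C _ z _ 1 Rlt_0_1).
    { intros s _. now rewrite IH. }
    eapply is_derive_ext_val.
    + apply is_derive_mult_C; [apply is_derive_const_C|].
      apply (is_derive_comp_C (C_derive_n F k) (fun z => lam * z)%C); [apply C_derive_is, hk|].
      apply is_derive_mult_C; [apply is_derive_const_C | apply is_derive_id_C].
    + ceq. rewrite Cpow_S. ring.
Qed.

(** The polynomial of [F] evaluated at lam z is the polynomial of the rescaled function at z, to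
    which the remainder formulas on fixed rectangles apply. *)
Lemma taylor_poly_scale (F : C -> C) (lam : R) (m : nat) (z : C) : entire F ->
  taylor_poly m F (lam * z) = taylor_at (fun s => F (lam * s))%C 0 m z.
Proof.
  intros hF. unfold taylor_poly, taylor_at. apply sum_n_ext. intros k.
  rewrite (C_derive_n_scale F lam k hF), Cmult_0_r.
  replace (z - 0)%C with z by ring. rewrite Cpow_mult_l. ceq. field. apply RtoC_neq_0, INR_fact_neq_0.
Qed.

Lemma C_derive_n_even (F : C -> C) (k : nat) : entire F -> (forall z, F (- z)%C = F z) ->
  forall z, C_derive_n F k (- z) = ((- (1)) ^ k * C_derive_n F k z)%C.
Proof.
  intros hF hev. induction k as [|k IH]; intros z.
  - simpl. rewrite hev. ring.
  - simpl C_derive_n.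
    assert (hk : forall w, ex_derive (C_derive_n F k) w).
    { intros w. exact (proj2 (cauchy_derivatives F (Re w - 1) (Re w + 1) (Im w - 1) (Im w + 1) k
       (hol_entire_rect F _ _ _ _ hF) w (center_in_square _ 1 Rlt_0_1))). }
    assert (d1 : is_derive (fun w => C_derive_n F k (- w)) z (- C_derive (C_derive_n F k) (- z))%C).
    { eapply is_derive_ext_val.
      - apply (is_derive_comp_C (C_derive_n F k) (fun w => - w)%C); [apply C_derive_is, hk|].
        apply is_derive_opp_C, is_derive_id_C.
      - ceq. ring. }
    assert (d2 : is_derive (fun w => C_derive_n F k (- w)) z ((- (1)) ^ k * C_derive (C_derive_n F k) z)%C).
    { apply (is_derive_locally_ext (fun w => (- (1)) ^ k * C_derive_n F k w)%C _ z _ 1 Rlt_0_1).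
      - intros s _. now rewrite IH.
      - eapply is_derive_ext_val.
        + apply is_derive_mult_C; [apply is_derive_const_C | apply C_derive_is, hk].
        + ceq. ring. }
    assert (e := eq_trans (eq_sym (is_C_derive_unique _ _ _ d1)) (is_C_derive_unique _ _ _ d2)).
    rewrite Cpow_S. replace (C_derive (C_derive_n F k) (- z)) with (- (- C_derive (C_derive_n F k) (- z)))%C by ring.
    rewrite e. ring.
Qed.

Lemma odd_coefficient_zero (F : C -> C) (k : nat) : entire F -> (forall z, F (- z)%C = F z) ->
  C_derive_n F (2 * k + 1) 0 = 0%C.
Proof.
  intros hF hev. assert (e := C_derive_n_even F (2 * k + 1) hF hev 0%C).
  replace (- 0)%C with (RtoC 0) in e by ring.
  rewrite Cpow_add_r, Cpow_mult_r, Cpow_1_r in e.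
  replace ((- (1)) ^ 2)%C with (RtoC 1) in e by (simpl; ring). rewrite Cpow_1_l in e.
  set (x := C_derive_n F (2 * k + 1) 0) in *.
  assert (h : (2 * x = 0)%C). { transitivity (x - (1 * - (1) * x))%C; [ring|]. rewrite <- e. ring. }
  replace x with (/ 2 * (2 * x))%C by field. rewrite h. ring.
Qed.

Lemma taylor_poly_drop_odd (F : C -> C) (n : nat) (z : C) : (1 <= n)%nat ->
  entire F -> (forall z, F (- z)%C = F z) -> taylor_poly (2 * n - 2) F z = taylor_poly (2 * n - 1) F z.
Proof.
  intros hn hF hev. destruct n as [|k]; [lia|].
  replace (2 * S k - 1)%nat with (S (2 * k)) by lia. replace (2 * S k - 2)%nat with (2 * k)%nat by lia.
  unfold taylor_poly. rewrite sum_n_C_S.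
  replace (C_derive_n F (S (2 * k)) 0) with (RtoC 0).
  - assert (q : forall s0 v w : C, s0 = (s0 + 0 * v * w)%C) by (intros; ring). apply q.
  - symmetry. replace (S (2 * k)) with (2 * k + 1)%nat by lia. now apply odd_coefficient_zero.
Qed.

Lemma taylor_poly_even (F : C -> C) (m : nat) (z : C) : entire F -> (forall z, F (- z)%C = F z) ->
  taylor_poly m F (- z) = taylor_poly m F z.
Proof.
  intros hF hev. apply sum_n_ext. intros k.
  destruct (Nat.Even_or_Odd k) as [[j ->]|[j ->]].
  - rewrite !Cpow_mult_r. replace ((- z) ^ 2)%C with (z ^ 2)%C by (simpl; ring). reflexivity.
  - rewrite odd_coefficient_zero by assumption. unfold Cdiv. rewrite !Cmult_0_l. reflexivity.
Qed.

Section Amplitude.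
Variables (F phi sg : C -> C) (lam c X0 K0 : R) (n : nat).
Hypotheses (hent : entire F) (hev : forall z, F (- z)%C = F z) (hX0 : 1 <= X0) (hK0 : 0 <= K0)
  (hmod : forall z, X0 <= Re z -> Cmod (F z) <= K0 * Cmod (F (RtoC (Re z))))
  (hlam4 : 4 * X0 <= lam) (good : near_sigma F phi sg lam c n).

Let h := amplitude F lam n.

Lemma F_lam_neq_0 : F (RtoC lam) <> 0%C.
Proof.
  destruct good as (_ & _ & h1 & _). specialize (h1 1%C). rewrite Cmult_1_r in h1. apply h1. rewrite Re_RtoC. lra.
Qed.

Lemma amplitude_even (s : C) : h (- s)%C = h s.
Proof.
  unfold h, amplitude. replace (lam * - s)%C with (- (lam * s))%C by ring. rewrite hev.
  rewrite !Cpow_mult_r. replace ((- s) ^ 2)%C with (s ^ 2)%C by (simpl; ring). reflexivity.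
Qed.

Lemma ex_derive_amplitude (s : C) : s <> 0%C -> ex_derive h s.
Proof.
  intros hs. unfold h, amplitude. apply ex_derive_div_C.
  - apply Cmult_neq_0; [exact F_lam_neq_0 | now apply Cpow_nz].
  - apply (ex_derive_comp_C F (fun s => lam * s)%C); [apply hent; exact I|].
    apply ex_derive_mult_C; [apply ex_derive_const_C | apply ex_derive_id_C].
  - apply ex_derive_mult_C; [apply ex_derive_const_C | apply ex_derive_pow_C, ex_derive_id_C].
Qed.

Lemma amplitude_exp (s : C) : 1 / 2 <= Re s -> h s = Cexp (- (INR n * phi s)).
Proof.
  intros hs. destruct good as (_ & _ & h1 & h2 & _).
  assert (s0 : s <> 0%C) by (intros e; rewrite e, Re_RtoC in hs; lra).
  rewrite Cexp_opp, h2 by auto. unfold h, amplitude.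
  assert (n1 := F_lam_neq_0). assert (n2 := h1 s hs). assert (n3 := Cpow_nz s (2 * n) s0).
  field. repeat split; assumption.
Qed.

Lemma Cmod_sg_le (s : C) : Cmod (s - 1) <= rho / 2 -> Cmod (sg s) <= 9 / 8.
Proof.
  intros hs. destruct good as (_ & _ & _ & _ & _ & S2 & _). specialize (S2 s hs).
  replace (sg s) with (1 + (sg s - 1))%C by ring. eapply Rle_trans; [apply Cmod_triangle|]. rewrite Cmod_1. lra.
Qed.

(** At the real point x the local form of the phase gives |h| <= exp (n (9 eta / 8)^2). Moving up,
    |F (lam s)| grows by at most [K0], while |s|^(2n) gains (1 + y^2 / x^2)^n with x <= 2. *)
Lemma amplitude_bound (s : C) (eta : R) : 0 <= eta <= rho / 4 -> Rabs (Re s - 1) <= eta ->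
  Cmod (h s) <= K0 * (exp (2 * eta ^ 2) / (1 + (Im s) ^ 2 / 4)) ^ n.
Proof.
  intros heta hs. assert (hr := rho_pos). set (x := Re s) in *. set (y := Im s).
  assert (hx : 1 / 2 <= x <= 2). { apply Rabs_le_between in hs. unfold rho in heta. lra. }
  assert (dx : Cmod (RtoC x - 1) <= eta) by (rewrite <- RtoC_minus, Cmod_R; exact hs).
  assert (hx1 : Cmod (h (RtoC x)) <= exp (2 * eta ^ 2) ^ n).
  { rewrite amplitude_exp by (rewrite Re_RtoC; lra). rewrite Cmod_Cexp.
    assert (ep : exp (2 * eta ^ 2) ^ n = exp (INR n * (2 * eta ^ 2))).
    { rewrite <- Rpower_pow by apply exp_pos. unfold Rpower. rewrite ln_exp. reflexivity. }
    rewrite ep. apply Rle_exp. rewrite Re_opp, Re_mult, Re_RtoC, Im_RtoC, Rmult_0_l, Rminus_0_r, Ropp_mult_distr_r.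
    apply Rmult_le_compat_l; [apply pos_INR|].
    destruct good as (_ & _ & _ & _ & S1 & _). rewrite S1 by lra.
    rewrite Re_opp, Ropp_involutive. eapply Rle_trans; [apply Re_le_Cmod|].
    rewrite Cmod_pow, Cmod_mult. assert (b := Cmod_sg_le (RtoC x) ltac:(lra)).
    assert (h0 := Cmod_ge_0 (x - 1)). assert (h1 := Cmod_ge_0 (sg x)).
    apply Rle_trans with ((eta * (9 / 8)) ^ 2).
    - apply pow_incr. split; [now apply Rmult_le_pos|]. apply Rmult_le_compat; assumption.
    - generalize (pow2_ge_0 eta). simpl. lra. }
  assert (n1 : 0 < Cmod (F (RtoC lam))) by (apply Cmod_gt_0, F_lam_neq_0).
  assert (hlx : X0 <= lam * x) by nra.
  assert (b := hmod (lam * s)%C). revert b. reim. rewrite Rmult_0_l, Rminus_0_r. fold x. intros b. specialize (b hlx).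
  assert (s0 : s <> 0%C) by (intros e; unfold x in hx; rewrite e, Re_RtoC in hx; lra).
  assert (ms : Cmod s ^ 2 = x ^ 2 + y ^ 2) by apply Cmod2_alt.
  assert (hden : 0 < x ^ 2 + y ^ 2) by (generalize (pow2_ge_0 y); nra).
  assert (hs2 : Cmod (h s) = Cmod (F (lam * s)) / (Cmod (F (RtoC lam)) * (x ^ 2 + y ^ 2) ^ n)).
  { unfold h, amplitude. rewrite Cmod_div by (apply Cmult_neq_0; [exact F_lam_neq_0 | now apply Cpow_nz]).
    now rewrite Cmod_mult, Cmod_pow, pow_mult, ms. }
  assert (hxx : Cmod (h (RtoC x)) = Cmod (F (RtoC (lam * x))) / (Cmod (F (RtoC lam)) * (x ^ 2) ^ n)).
  { unfold h, amplitude. rewrite Cmod_div by (apply Cmult_neq_0; [exact F_lam_neq_0 | apply Cpow_nz, RtoC_neq_0; lra]).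
    rewrite Cmod_mult, Cmod_pow, pow_mult, Cmod_RtoC_pos by lra. now rewrite RtoC_mult. }
  rewrite hs2. rewrite hxx in hx1.
  assert (px : 0 < (x ^ 2) ^ n) by (apply pow_lt; nra).
  assert (pd : 0 < (x ^ 2 + y ^ 2) ^ n) by (now apply pow_lt).
  apply Rle_trans with (K0 * (exp (2 * eta ^ 2) ^ n * (x ^ 2) ^ n / (x ^ 2 + y ^ 2) ^ n)).
  - apply Rmult_le_reg_r with (Cmod (F (RtoC lam)) * (x ^ 2 + y ^ 2) ^ n); [now apply Rmult_lt_0_compat|].
    replace (Cmod (F (lam * s)) / (Cmod (F (RtoC lam)) * (x ^ 2 + y ^ 2) ^ n) * (Cmod (F (RtoC lam)) * (x ^ 2 + y ^ 2) ^ n))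
      with (Cmod (F (lam * s))) by (field; lra).
    replace (K0 * (exp (2 * eta ^ 2) ^ n * (x ^ 2) ^ n / (x ^ 2 + y ^ 2) ^ n) * (Cmod (F (RtoC lam)) * (x ^ 2 + y ^ 2) ^ n))
      with (K0 * (exp (2 * eta ^ 2) ^ n * (Cmod (F (RtoC lam)) * (x ^ 2) ^ n))) by (field; lra).
    eapply Rle_trans; [exact b|]. apply Rmult_le_compat_l; [exact hK0|].
    apply Rmult_le_compat_r with (r := Cmod (F (RtoC lam)) * (x ^ 2) ^ n) in hx1; [|left; now apply Rmult_lt_0_compat].
    replace (Cmod (F (RtoC (lam * x))) / (Cmod (F (RtoC lam)) * (x ^ 2) ^ n) * (Cmod (F (RtoC lam)) * (x ^ 2) ^ n))
      with (Cmod (F (RtoC (lam * x)))) in hx1 by (field; lra). exact hx1.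
  - apply Rmult_le_compat_l; [exact hK0|].
    rewrite <- Rpow_mult_distr. unfold Rdiv at 1. rewrite <- pow_inv, <- Rpow_mult_distr.
    apply pow_incr. assert (he := exp_pos (2 * eta ^ 2)). split.
    + apply Rmult_le_pos; [apply Rmult_le_pos; nra | left; now apply Rinv_0_lt_compat].
    + unfold Rdiv. rewrite Rmult_assoc. apply Rmult_le_compat_l; [lra|].
      assert (hy2 := pow2_ge_0 y).
      apply Rmult_le_reg_r with ((x ^ 2 + y ^ 2) * (1 + y ^ 2 / 4)); [apply Rmult_lt_0_compat; lra|].
      replace (x ^ 2 * / (x ^ 2 + y ^ 2) * ((x ^ 2 + y ^ 2) * (1 + y ^ 2 / 4))) with (x ^ 2 * (1 + y ^ 2 / 4)) by (field; lra).
      replace (/ (1 + y ^ 2 * / 4) * ((x ^ 2 + y ^ 2) * (1 + y ^ 2 / 4))) with (x ^ 2 + y ^ 2) by (field; lra).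
      assert (x ^ 2 <= 4) by nra. nra.
Qed.

(** The strip near the zeros grows like a power k < 2 n of the height, and s^(2n) beats it. The rest
    is bounded through the maximum of |F| on the real segment from X0 to 2 lam. The height [H1] may
    depend on [n], since it only serves to discard the horizontal sides. *)
Lemma amplitude_horizontal (M Y : R) (k : nat) : 0 <= M -> 1 <= Y -> (k < 2 * n)%nat ->
  (forall z, Rabs (Re z) <= X0 -> Y <= Rabs (Im z) -> Cmod (F z) <= M * Rabs (Im z) ^ k) ->
  forall e, 0 < e -> exists H1 : R, 1 <= H1 /\ forall H x, H1 <= H -> Rabs x <= 2 ->
    Cmod (h (x, H)) <= e /\ Cmod (h (x, - H)) <= e.
Proof.
  intros hM hY hk hs e he.
  destruct (bounded_H F 0 X0 (2 * lam)) as [M2 b2].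
  { intros x _. apply ex_derive_continuous_C, hent. exact I. }
  set (A := Cmod (F (RtoC lam))). assert (hA : 0 < A) by (apply Cmod_gt_0, F_lam_neq_0).
  assert (hM2 : 0 <= M2). { eapply Rle_trans; [apply Cmod_ge_0 | apply (b2 X0); lra]. }
  set (Kt := K0 * M2 + M * lam ^ k).
  assert (hl1 : 4 <= lam) by lra.
  assert (hKt : 0 <= Kt).
  { unfold Kt. assert (0 <= lam ^ k) by (apply pow_le; lra).
    assert (0 <= K0 * M2) by now apply Rmult_le_pos. assert (0 <= M * lam ^ k) by now apply Rmult_le_pos. lra. }
  exists (1 + Y + Kt / (A * e)).
  assert (hKe : 0 <= Kt / (A * e)) by (apply Rdiv_le_0_compat; [exact hKt | now apply Rmult_lt_0_compat]).
  split; [lra|].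
  assert (main : forall s, 1 + Y + Kt / (A * e) <= Rabs (Im s) -> Rabs (Re s) <= 2 -> Cmod (h s) <= e).
  { intros s hi hre. set (H := Rabs (Im s)) in *.
    assert (hsH : H <= Cmod s) by apply im_le_Cmod.
    assert (s0 : s <> 0%C) by (apply Cmod_pos_neq; lra).
    assert (hH1 : 1 <= H) by lra.
    assert (hHk : 1 <= H ^ k) by (now apply pow_R1_Rle).
    assert (bF : Cmod (F (lam * s)) <= Kt * H ^ k).
    { assert (ims : Rabs (Im (lam * s)%C) = lam * H).
      { reim. rewrite Rmult_0_l, Rplus_0_r, Rabs_mult, (Rabs_pos_eq lam) by lra. reflexivity. }
      assert (side : forall w, X0 <= Re w <= 2 * lam -> Cmod (F w) <= K0 * M2).
      { intros w hw. eapply Rle_trans; [apply hmod; lra|]. apply Rmult_le_compat_l; [exact hK0|].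
        replace (RtoC (Re w)) with ((Re w, 0) : C) by reflexivity. apply b2. exact hw. }
      assert (t1 : K0 * M2 <= Kt * H ^ k).
      { unfold Kt. assert (0 <= K0 * M2) by now apply Rmult_le_pos.
        assert (0 <= lam ^ k) by (apply pow_le; lra). assert (0 <= M * lam ^ k) by now apply Rmult_le_pos. nra. }
      destruct (Rle_lt_dec (Rabs (Re (lam * s)%C)) X0) as [hin|hout].
      - eapply Rle_trans; [apply hs; [exact hin|]|].
        + rewrite ims. nra.
        + rewrite ims, Rpow_mult_distr. unfold Kt.
          assert (0 <= K0 * M2) by now apply Rmult_le_pos. nra.
      - eapply Rle_trans; [|exact t1].
        assert (hre2 : Rabs (Re (lam * s)%C) <= 2 * lam).
        { reim. rewrite Rmult_0_l, Rminus_0_r, Rabs_mult, (Rabs_pos_eq lam) by lra. nra. }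
        destruct (Rle_lt_dec 0 (Re (lam * s)%C)) as [hp|hn].
        + rewrite Rabs_pos_eq in hout, hre2 by exact hp. apply side. lra.
        + rewrite Rabs_left in hout, hre2 by exact hn. rewrite <- hev. apply side. rewrite Re_opp. lra. }
    unfold h, amplitude. rewrite Cmod_div by (apply Cmult_neq_0; [exact F_lam_neq_0 | now apply Cpow_nz]).
    rewrite Cmod_mult, Cmod_pow. fold A.
    assert (hpow : H ^ k * H <= Cmod s ^ (2 * n)).
    { apply Rle_trans with (H ^ (2 * n)); [|apply pow_incr; lra].
      replace (H ^ k * H) with (H ^ (S k)) by (simpl; ring). apply Rle_pow; [exact hH1 | lia]. }
    assert (hq : 0 < Cmod s ^ (2 * n)) by (apply pow_lt; lra).
    apply Rmult_le_reg_r with (A * Cmod s ^ (2 * n)); [now apply Rmult_lt_0_compat|].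
    replace (Cmod (F (lam * s)) / (A * Cmod s ^ (2 * n)) * (A * Cmod s ^ (2 * n))) with (Cmod (F (lam * s))) by (field; lra).
    eapply Rle_trans; [exact bF|].
    apply Rle_trans with (e * (A * (H ^ k * H))).
    - assert (hh : Kt <= e * A * H).
      { assert (q : Kt / (A * e) <= H) by lra. apply Rmult_le_compat_l with (r := A * e) in q; [|left; now apply Rmult_lt_0_compat].
        replace (A * e * (Kt / (A * e))) with Kt in q by (field; lra). lra. }
      replace (e * (A * (H ^ k * H))) with (e * A * H * H ^ k) by ring. apply Rmult_le_compat_r; lra.
    - apply Rmult_le_compat_l; [lra|]. apply Rmult_le_compat_l; lra. }
  intros H x hH hx. split; apply main; simpl; try exact hx.
  - rewrite Rabs_pos_eq; lra.
  - rewrite Rabs_Ropp, Rabs_pos_eq; lra.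
Qed.
End Amplitude.

(** * The saddle point *)

Lemma exp_le_one_plus (x : R) : 0 <= x <= 1 / 2 -> exp x <= 1 + 2 * x.
Proof.
  intros hx. assert (h := exp_ineq1_le (- x)). rewrite exp_Ropp in h. assert (hp := exp_pos x).
  apply Rmult_le_compat_r with (r := exp x) in h; [|lra]. rewrite Rinv_l in h by lra. nra.
Qed.

Lemma exp_ge_cube (t : R) : 0 <= t -> (t / 3) ^ 3 <= exp t.
Proof.
  intros ht. replace (exp t) with (exp (t / 3) ^ 3).
  - apply pow_incr. split; [lra|]. generalize (exp_ineq1_le (t / 3)). lra.
  - simpl. rewrite Rmult_1_r, <- !exp_plus. f_equal. field.
Qed.

(** The quadratic bound without restriction on [u]: for |u| > 1 / 2 the three terms are estimated
    separately and absorbed in |u|^2 >= 1 / 4. *)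
Lemma Cexp_quad_exp (u : C) : Cmod (Cexp u - 1 - u) <= 8 * Cmod u ^ 2 * exp (Cmod u).
Proof.
  assert (h0 := Cmod_ge_0 u). assert (he := exp_ineq1_le (Cmod u)).
  destruct (Rle_lt_dec (Cmod u) (1 / 2)) as [h|h].
  - eapply Rle_trans; [now apply Cexp_quad|]. assert (0 <= Cmod u ^ 2) by nra. nra.
  - eapply Rle_trans; [apply Cmod_sub_le|].
    eapply Rle_trans; [apply Rplus_le_compat_r, Cmod_sub_le|]. rewrite Cmod_1, Cmod_Cexp.
    assert (exp (Re u) <= exp (Cmod u)) by (apply Rle_exp, Re_le_Cmod).
    assert (1 / 4 <= Cmod u ^ 2) by nra. nra.
Qed.

Lemma gauss_int_odd (x : R) : gauss_int (- x) = - gauss_int x.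
Proof.
  unfold gauss_int. apply (is_RInt_unique (V := R_CompleteNormedModule)).
  assert (h : is_RInt (fun t => exp (- t ^ 2)) (- 0) (- - x) (gauss_int x)).
  { rewrite Ropp_0, Ropp_involutive. apply (RInt_correct (V := R_CompleteNormedModule)), ex_gauss. }
  apply is_RInt_comp_opp in h. apply (is_RInt_opp (V := R_NormedModule)) in h.
  eapply is_RInt_ext; [|exact h]. intros t _. unfold opp. simpl. rewrite Ropp_involutive. do 2 f_equal. ring.
Qed.

Lemma is_RInt_gauss_scaled (b x : R) : b <> 0 ->
  is_RInt (fun y => exp (- (b * y) ^ 2)) (- x) x (2 * gauss_int (b * x) / b).
Proof.
  intros hb.
  replace (2 * gauss_int (b * x) / b) with (minus (gauss_int (b * x) / b) (gauss_int (b * - x) / b)).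
  2: { rewrite <- Ropp_mult_distr_r, gauss_int_odd. unfold minus, plus, opp. simpl. field. exact hb. }
  apply (is_RInt_derive (fun y => gauss_int (b * y) / b)).
  - intros y _. auto_derive.
    + eexists. apply is_derive_gauss_int.
    + match goal with |- context [Derive ?f ?x] => replace (Derive f x) with (exp (- (b * y) ^ 2)) by (symmetry; apply is_derive_unique, is_derive_gauss_int) end. field. exact hb.
  - intros y _. apply (ex_derive_continuous (fun y => exp (- (b * y) ^ 2))). auto_derive. trivial.
Qed.

Lemma is_RInt_gauss_odd1 (b x : R) : b <> 0 -> is_RInt (fun y => y * exp (- (b * y) ^ 2)) (- x) x 0.
Proof.
  intros hb. set (P := fun y => - exp (- (b * y) ^ 2) / (2 * b ^ 2)).
  replace 0 with (minus (P x) (P (- x))).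
  2: { unfold P, minus, plus, opp. simpl. replace (b * - x * (b * - x * 1)) with (b * x * (b * x * 1)) by ring. ring. }
  apply (is_RInt_derive P).
  - intros y _. unfold P. auto_derive; [trivial|]. simpl. field. exact hb.
  - intros y _. apply (ex_derive_continuous (fun y => y * exp (- (b * y) ^ 2))). auto_derive. trivial.
Qed.

Lemma is_RInt_gauss_odd3 (b x : R) : b <> 0 -> is_RInt (fun y => y ^ 3 * exp (- (b * y) ^ 2)) (- x) x 0.
Proof.
  intros hb. set (P := fun y => - (y ^ 2 / (2 * b ^ 2) + 1 / (2 * b ^ 4)) * exp (- (b * y) ^ 2)).
  replace 0 with (minus (P x) (P (- x))).
  2: { unfold P, minus, plus, opp. simpl. replace (b * - x * (b * - x * 1)) with (b * x * (b * x * 1)) by ring.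
       replace (- x * (- x * 1)) with (x * (x * 1)) by ring. ring. }
  apply (is_RInt_derive P).
  - intros y _. unfold P. auto_derive; [trivial|]. simpl. field. exact hb.
  - intros y _. apply (ex_derive_continuous (fun y => y ^ 3 * exp (- (b * y) ^ 2))). auto_derive. trivial.
Qed.

Lemma is_RInt_RtoC (f : R -> R) (a b l : R) : is_RInt f a b l ->
  is_CRInt (fun t => RtoC (f t)) a b (RtoC l).
Proof.
  intros h. apply is_RInt_C_pair. split; [exact h|].
  replace (Im (RtoC l)) with (scal (b - a) 0) by (unfold scal; simpl; unfold mult; simpl; ring).
  apply (is_RInt_const (V := R_NormedModule) a b 0).
Qed.

(** From (t / 12)^3 <= exp (t / 4) one gets t^3 <= 1728 exp (t / 4), and t^2 + t <= 2 t^3 + 3; thus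
    5187 = 3 * 1728 + 3. *)
Lemma poly_exp_bound (t : R) : 0 <= t -> (t ^ 3 + t ^ 2 + t) * exp (- (t / 2)) <= 5187 * exp (- (t / 4)).
Proof.
  intros ht. assert (h := exp_ge_cube (t / 4) ltac:(lra)).
  assert (h1 := exp_ineq1_le (t / 4)).
  replace (- (t / 4)) with (- (t / 2) + t / 4) by field. rewrite exp_plus.
  assert (hp := exp_pos (- (t / 2))). set (e := exp (t / 4)) in *. set (g := exp (- (t / 2))) in *.
  assert (t ^ 3 + t ^ 2 + t <= 5187 * e); [|nra].
  assert (h3 : t ^ 3 <= 1728 * e) by (simpl in *; lra).
  assert (t ^ 2 + t <= 2 * t ^ 3 + 3).
  { destruct (Rle_lt_dec t 1) as [k|k].
    - assert (0 <= t ^ 3) by (now apply pow_le). nra.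
    - assert (t ^ 2 <= t ^ 3) by (simpl; nra). nra. }
  lra.
Qed.

Section Laplace.
Variables (y0 C1 : R).
Hypotheses (hy0 : 0 < y0 <= 1) (hC1 : 1 <= C1).

(** Expand exponent and kernel to first order in y and keep the correction to the exponent outside
    the exponential. With t = n y^2 the remainder is 1 / n times a polynomial in t, absorbed by part
    of the Gaussian decay. *)
Lemma laplace_pointwise (A k A1 k0 k1 : C) (a y : R) (n : nat) : (1 <= n)%nat -> Rabs y <= y0 ->
  2 / 3 <= a -> Cmod (A - a - y * A1) <= C1 * y ^ 2 -> Cmod (k - k0 - y * k1) <= C1 * y ^ 2 ->
  Cmod A1 <= C1 -> Cmod k0 <= C1 -> Cmod k1 <= C1 -> Cmod (A - a) <= a / 4 ->
  Cmod (Cexp (- (INR n * y ^ 2 * A)) * k - exp (- (INR n * a * y ^ 2)) * (k0 + y * k1 - INR n * y ^ 3 * A1 * k0))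
   <= 518700 * C1 ^ 3 / INR n * exp (- (INR n * y ^ 2 / 4)).
Proof.
  intros hn hy ha hA hk hA1 hk0 hk1 hAa.
  assert (hN : 1 <= INR n) by (change 1 with (INR 1); now apply le_INR).
  set (N := INR n) in *. set (v := Rabs y). assert (hv : 0 <= v) by apply Rabs_pos.
  assert (hv1 : v <= 1) by (unfold v; lra).
  assert (ev : y ^ 2 = v ^ 2) by (unfold v; now rewrite pow2_abs).
  assert (hvv : C1 * v ^ 2 <= C1 * v) by (apply Rmult_le_compat_l; nra).
  assert (hAl : Cmod (A - a) <= 2 * C1 * v).
  { replace (A - a)%C with ((A - a - y * A1) + y * A1)%C by ring.
    eapply Rle_trans; [apply Cmod_triangle|]. rewrite Cmod_mult, Cmod_R. fold v. rewrite ev in hA.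
    assert (q := Rmult_le_compat_l v _ _ hv hA1). lra. }
  assert (hkl : Cmod (k - k0) <= 2 * C1 * v).
  { replace (k - k0)%C with ((k - k0 - y * k1) + y * k1)%C by ring.
    eapply Rle_trans; [apply Cmod_triangle|]. rewrite Cmod_mult, Cmod_R. fold v. rewrite ev in hk.
    assert (q := Rmult_le_compat_l v _ _ hv hk1). lra. }
  assert (hkk : Cmod k <= 3 * C1).
  { replace k with ((k - k0) + k0)%C by ring. eapply Rle_trans; [apply Cmod_triangle|].
    assert (q := Rmult_le_compat_l C1 _ _ ltac:(lra) hv1). lra. }
  (* [u] is the part of the exponent beyond the pure Gaussian. It is at most t a / 4, so the
     exponential of |u| costs only a quarter of the Gaussian exponent. *)
  set (u := (- (N * y ^ 2 * (A - a)))%C).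
  assert (hu1 : Cmod u = N * v ^ 2 * Cmod (A - a)).
  { unfold u. rewrite Cmod_opp, !Cmod_mult, Cmod_pow, (Cmod_RtoC_pos N), Cmod_R by lra. reflexivity. }
  assert (hv2 : 0 <= v ^ 2) by nra. assert (hv3 : 0 <= v ^ 3) by (now apply pow_le).
  assert (hu2 : Cmod u <= 2 * C1 * N * v ^ 3).
  { rewrite hu1. apply Rle_trans with (N * v ^ 2 * (2 * C1 * v)); [|right; ring].
    apply Rmult_le_compat_l; [nra | exact hAl]. }
  assert (hu3 : Cmod u <= N * v ^ 2 * a / 4).
  { rewrite hu1. apply Rle_trans with (N * v ^ 2 * (a / 4)); [|right; field].
    apply Rmult_le_compat_l; [nra | exact hAa]. }
  replace (Cexp (- (N * y ^ 2 * A)))%C with (exp (- (N * a * y ^ 2)) * Cexp u)%C.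
  2: { rewrite <- Cexp_RtoC, <- Cexp_plus. f_equal. unfold u. rewrite RtoC_opp, !RtoC_mult, RtoC_pow. ring. }
  set (g := exp (- (N * a * y ^ 2))).
  replace (g * Cexp u * k - g * (k0 + y * k1 - N * y ^ 3 * A1 * k0))%C
    with (g * ((Cexp u - 1 - u) * k + u * (k - k0) + (- (N * y ^ 2 * (A - a - y * A1))) * k0 + (k - k0 - y * k1)))%C
    by (unfold u; simpl; ring).
  assert (hg : 0 < g) by apply exp_pos.
  rewrite Cmod_mult, Cmod_RtoC_pos by lra.
  set (e := exp (Cmod u)). assert (he : 1 <= e).
  { unfold e. generalize (exp_ineq1_le (Cmod u)) (Cmod_ge_0 u). lra. }
  assert (hC3 : 0 <= C1 ^ 3) by (apply pow_le; lra).
  assert (hC2 : C1 ^ 2 <= C1 ^ 3) by (simpl; nra). assert (hC1' : C1 <= C1 ^ 2) by (simpl; nra).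
  assert (hu0 := Cmod_ge_0 u).
  assert (b1 : Cmod ((Cexp u - 1 - u) * k) <= 96 * C1 ^ 3 * N ^ 2 * v ^ 6 * e).
  { rewrite Cmod_mult.
    apply Rle_trans with ((8 * (2 * C1 * N * v ^ 3) ^ 2 * e) * (3 * C1)); [|right; ring].
    apply Rmult_le_compat; try apply Cmod_ge_0; [|exact hkk].
    eapply Rle_trans; [apply Cexp_quad_exp|]. fold e. apply Rmult_le_compat_r; [lra|].
    apply Rmult_le_compat_l; [lra|]. now apply pow_incr. }
  assert (b2 : Cmod (u * (k - k0)) <= 4 * C1 ^ 3 * N * v ^ 4 * e).
  { rewrite Cmod_mult. apply Rle_trans with ((2 * C1 * N * v ^ 3) * (2 * C1 * v)).
    - apply Rmult_le_compat; try apply Cmod_ge_0; assumption.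
    - replace (2 * C1 * N * v ^ 3 * (2 * C1 * v)) with (C1 ^ 2 * (4 * N * v ^ 4)) by ring.
      replace (4 * C1 ^ 3 * N * v ^ 4 * e) with ((C1 ^ 3 * e) * (4 * N * v ^ 4)) by ring.
      assert (0 <= v ^ 4) by (now apply pow_le). apply Rmult_le_compat_r; [nra|]. nra. }
  assert (b3 : Cmod (- (N * y ^ 2 * (A - a - y * A1)) * k0) <= C1 ^ 3 * N * v ^ 4 * e).
  { rewrite Cmod_mult, Cmod_opp, !Cmod_mult, Cmod_pow, (Cmod_RtoC_pos N), Cmod_R by lra. fold v.
    apply Rle_trans with (N * v ^ 2 * (C1 * v ^ 2) * C1).
    - apply Rmult_le_compat; [|apply Cmod_ge_0| |exact hk0].
      + apply Rmult_le_pos; [nra | apply Cmod_ge_0].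
      + apply Rmult_le_compat_l; [nra|]. now rewrite <- ev at 1.
    - replace (N * v ^ 2 * (C1 * v ^ 2) * C1) with (C1 ^ 2 * (N * v ^ 4)) by ring.
      replace (C1 ^ 3 * N * v ^ 4 * e) with ((C1 ^ 3 * e) * (N * v ^ 4)) by ring.
      assert (0 <= v ^ 4) by (now apply pow_le). apply Rmult_le_compat_r; [nra|]. nra. }
  assert (b4 : Cmod (k - k0 - y * k1) <= C1 ^ 3 * v ^ 2 * e).
  { rewrite ev in hk. eapply Rle_trans; [exact hk|].
    replace (C1 ^ 3 * v ^ 2 * e) with ((C1 ^ 3 * e) * v ^ 2) by ring. apply Rmult_le_compat_r; nra. }
  set (t := N * v ^ 2). assert (ht : 0 <= t) by (unfold t; nra).
  assert (tot : Cmod ((Cexp u - 1 - u) * k + u * (k - k0) + - (N * y ^ 2 * (A - a - y * A1)) * k0 + (k - k0 - y * k1))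
     <= 50 * C1 ^ 3 / N * (t ^ 3 + t ^ 2 + t) * 2 * e).
  { eapply Rle_trans; [apply Cmod_triangle|]. eapply Rle_trans; [apply Rplus_le_compat_r, Cmod_triangle|].
    eapply Rle_trans; [apply Rplus_le_compat_r, Rplus_le_compat_r, Cmod_triangle|].
    replace (50 * C1 ^ 3 / N * (t ^ 3 + t ^ 2 + t) * 2 * e) with
      (C1 ^ 3 * e * (100 * (N ^ 2 * v ^ 6) + 100 * (N * v ^ 4) + 100 * v ^ 2)) by (unfold t; field; lra).
    assert (0 <= C1 ^ 3 * e) by (apply Rmult_le_pos; lra).
    assert (0 <= v ^ 4) by (now apply pow_le). assert (0 <= v ^ 6) by (now apply pow_le).
    assert (0 <= N ^ 2 * v ^ 6) by (apply Rmult_le_pos; [nra|assumption]). assert (0 <= N * v ^ 4) by nra.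
    replace (96 * C1 ^ 3 * N ^ 2 * v ^ 6 * e) with (96 * (C1 ^ 3 * e) * (N ^ 2 * v ^ 6)) in b1 by ring.
    replace (4 * C1 ^ 3 * N * v ^ 4 * e) with (4 * (C1 ^ 3 * e) * (N * v ^ 4)) in b2 by ring.
    replace (C1 ^ 3 * N * v ^ 4 * e) with ((C1 ^ 3 * e) * (N * v ^ 4)) in b3 by ring.
    replace (C1 ^ 3 * v ^ 2 * e) with ((C1 ^ 3 * e) * v ^ 2) in b4 by ring.
    nra. }
  (* The remaining exponent is 3 a t / 4, at least t / 2 because a >= 2 / 3. *)
  assert (hge : g * e <= exp (- (t / 2))).
  { unfold g, e. rewrite <- exp_plus. apply Rle_exp. rewrite ev. unfold t. nra. }
  apply Rle_trans with (100 * C1 ^ 3 / N * ((t ^ 3 + t ^ 2 + t) * exp (- (t / 2)))).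
  - apply Rle_trans with (100 * C1 ^ 3 / N * ((t ^ 3 + t ^ 2 + t) * (g * e))).
    + apply Rle_trans with (g * (50 * C1 ^ 3 / N * (t ^ 3 + t ^ 2 + t) * 2 * e)); [|right; field; lra].
      apply Rmult_le_compat_l; [lra | exact tot].
    + apply Rmult_le_compat_l; [apply Rdiv_le_0_compat; lra|]. apply Rmult_le_compat_l; [|exact hge].
      assert (0 <= t ^ 3) by (now apply pow_le). nra.
  - replace (N * y ^ 2 / 4) with (t / 4) by (unfold t; rewrite ev; reflexivity).
    assert (p := poly_exp_bound t ht).
    apply Rle_trans with (100 * C1 ^ 3 / N * (5187 * exp (- (t / 4)))).
    + apply Rmult_le_compat_l; [apply Rdiv_le_0_compat; lra | exact p].
    + right. field. lra.
Qed.

(** The corrections linear and cubic in y are odd and integrate to 0, so the leading term of order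
    n^(-1/2) is followed directly by order n^(-3/2). The term 8 C1 / y0^2 pays for completing the
    truncated Gaussian to the whole line. *)
Lemma laplace_integral (A k G : R -> C) (A1 k0 k1 : C) (c : R) (n : nat) : (1 <= n)%nat -> 7 / 8 <= c ->
  (forall y, - y0 <= y <= y0 ->
     G y = (Cexp (- (INR n * y ^ 2 * A y)) * k y)%C /\ Cmod (A y - RtoC (c ^ 2) - y * A1) <= C1 * y ^ 2 /\ Cmod (k y - k0 - y * k1) <= C1 * y ^ 2 /\ Cmod (A y - RtoC (c ^ 2)) <= c ^ 2 / 4) ->
  ex_CRInt G (- y0) y0 ->
  Cmod A1 <= C1 -> Cmod k0 <= C1 -> Cmod k1 <= C1 ->
  Cmod (CRInt G (- y0) y0 - k0 * RtoC (sqrt PI / (sqrt (INR n) * c))) <=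
    (8300000 * C1 ^ 3 + 8 * C1 / y0 ^ 2) / (INR n * sqrt (INR n)).
Proof.
  intros hn hc hG exG hA1 hk0 hk1.
  assert (hN : 1 <= INR n) by (change 1 with (INR 1); now apply le_INR).
  set (N := INR n) in *. set (s := sqrt N).
  assert (hs : s * s = N) by (apply sqrt_sqrt; lra).
  assert (hs1 : 1 <= s) by (unfold s; rewrite <- sqrt_1; apply sqrt_le_1_alt; exact hN).
  assert (hsN : s <= N) by nra.
  set (b := s * c). assert (hb : 0 < b) by (unfold b; nra).
  assert (hb2 : b ^ 2 = N * c ^ 2) by (unfold b; rewrite <- hs; ring).
  set (m := (k0 * RtoC (2 * gauss_int (b * y0) / b))%C).
  set (g := fun y : R => (RtoC (exp (- (N * c ^ 2 * y ^ 2))) * (k0 + y * k1 - N * y ^ 3 * A1 * k0))%C).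
  assert (Ig : is_CRInt g (- y0) y0 m).
  { assert (h1 := is_RInt_C_scal k0 _ _ _ _ (is_RInt_RtoC _ _ _ _ (is_RInt_gauss_scaled b y0 ltac:(lra)))).
    assert (h2 := is_RInt_C_scal k1 _ _ _ _ (is_RInt_RtoC _ _ _ _ (is_RInt_gauss_odd1 b y0 ltac:(lra)))).
    assert (h3 := is_RInt_C_scal (- (N * A1 * k0)) _ _ _ _ (is_RInt_RtoC _ _ _ _ (is_RInt_gauss_odd3 b y0 ltac:(lra)))).
    assert (h := is_RInt_plus (V := C_R_NormedModule) _ _ _ _ _ _ (is_RInt_plus (V := C_R_NormedModule) _ _ _ _ _ _ h1 h2) h3).
    evar_last; [eapply is_RInt_ext; [|exact h]|].
    - intros y _. unfold g. replace (N * c ^ 2 * y ^ 2) with ((b * y) ^ 2) by (rewrite <- hb2; ring).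
      set (e := exp _). unfold plus. simpl. change (@eq C (k0 * e + k1 * RtoC (y * e) + - (N * A1 * k0) * RtoC (y ^ 3 * e))%C
        (RtoC e * (k0 + y * k1 - N * y ^ 3 * A1 * k0))%C).
      rewrite !RtoC_mult, RtoC_pow. ring.
    - unfold m. change (@eq C (k0 * RtoC (2 * gauss_int (b * y0) / b) + k1 * RtoC 0 + - (N * A1 * k0) * RtoC 0)%C
        (k0 * RtoC (2 * gauss_int (b * y0) / b))%C). ring. }
  assert (eg : CRInt g (- y0) y0 = m) by now apply CRInt_unique.
  assert (d1 : Cmod (CRInt G (- y0) y0 - m) <= 8300000 * C1 ^ 3 / (N * s)).
  { rewrite <- eg, <- CRInt_minus by (trivial; now exists m).
    set (b' := s / 2). assert (hb' : 0 < b') by (unfold b'; lra).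
    assert (Ie := is_RInt_scal _ _ _ (518700 * C1 ^ 3 / N) _ (is_RInt_gauss_scaled b' y0 ltac:(lra))).
    eapply Rle_trans; [apply CRInt_bound with (g := fun y => scal (518700 * C1 ^ 3 / N) (exp (- (b' * y) ^ 2)))|].
    - lra.
    - apply (ex_RInt_minus (V := C_R_NormedModule)); [exact exG | now exists m].
    - eexists. exact Ie.
    - intros y hy. destruct (hG y hy) as (e & q1 & q2 & q3). rewrite e. unfold g, scal. simpl. unfold mult. simpl.
      assert (p := laplace_pointwise (A y) (k y) A1 k0 k1 (c ^ 2) y n hn ltac:(apply Rabs_le; lra) ltac:(nra) q1 q2 hA1 hk0 hk1 q3).
      fold N in p. replace (b' * y * (b' * y * 1)) with (N * y ^ 2 / 4) by (unfold b'; rewrite <- hs; field). exact p.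
    - eapply Rle_trans; [right; apply (is_RInt_unique (V := R_CompleteNormedModule)); exact Ie|]. unfold scal. simpl. unfold mult. simpl.
      assert (hgi : gauss_int (b' * y0) <= 4).
      { assert (q := gauss_int_bound (b' * y0) ltac:(apply Rmult_le_pos; lra)). apply Rabs_le_between in q.
        assert (exp (- (b' * y0) ^ 2) <= 1).
        { rewrite <- exp_0. apply Rle_exp. generalize (pow2_ge_0 (b' * y0)). lra. }
        assert (sqrt PI <= 2). { rewrite <- (sqrt_pow2 2) by lra. apply sqrt_le_1_alt. generalize PI_4. simpl. lra. }
        lra. }
      assert (hC3 : 0 <= C1 ^ 3) by (apply pow_le; lra).
      (* A Gaussian with half the width parameter, b' = s / 2, dominates the pointwise error; its
         integral is at most 16 / s, and 16 * 518700 is below 8300000. *)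
      apply Rle_trans with (518700 * C1 ^ 3 / N * (2 * 4 / b')).
      + apply Rmult_le_compat_l; [apply Rdiv_le_0_compat; lra|]. unfold Rdiv.
        apply Rmult_le_compat_r; [left; now apply Rinv_0_lt_compat | lra].
      + unfold b'. apply Rle_trans with (8299200 * C1 ^ 3 / (N * s)); [right; field; lra|].
        unfold Rdiv. apply Rmult_le_compat_r; [left; apply Rinv_0_lt_compat; nra | lra]. }
  assert (d2 : Cmod (m - k0 * RtoC (sqrt PI / b)) <= 8 * C1 / y0 ^ 2 / (N * s)).
  { unfold m. replace (k0 * RtoC (2 * gauss_int (b * y0) / b) - k0 * RtoC (sqrt PI / b))%C
      with (k0 * RtoC (2 / b * (gauss_int (b * y0) - sqrt PI / 2)))%C.
    2: { replace (2 / b * (gauss_int (b * y0) - sqrt PI / 2)) with (2 * gauss_int (b * y0) / b - sqrt PI / b) by (field; lra).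
         rewrite RtoC_minus. ring. }
    rewrite Cmod_mult, Cmod_R, Rabs_mult, (Rabs_pos_eq (2 / b)) by (apply Rdiv_le_0_compat; lra).
    assert (hby : 0 < b * y0) by (apply Rmult_lt_0_compat; lra).
    assert (q := gauss_int_bound (b * y0) ltac:(lra)).
    assert (hx2 : 0 < (b * y0) ^ 2) by (now apply pow_lt).
    assert (he : exp (- (b * y0) ^ 2) <= / (b * y0) ^ 2).
    { rewrite exp_Ropp. apply Rinv_le_contravar; [exact hx2|]. generalize (exp_ineq1_le ((b * y0) ^ 2)). lra. }
    apply Rle_trans with (C1 * (2 / b * (2 * / (b * y0) ^ 2))).
    - apply Rmult_le_compat; [apply Cmod_ge_0 | | exact hk0|].
      + apply Rmult_le_pos; [apply Rdiv_le_0_compat; lra | apply Rabs_pos].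
      + apply Rmult_le_compat_l; [apply Rdiv_le_0_compat; lra | lra].
    - apply Rle_trans with (4 * C1 / y0 ^ 2 * / (b ^ 2 * b)); [right; field; lra|].
      assert (hy2 : 0 < y0 ^ 2) by (apply pow_lt; lra).
      assert (hi : / (b ^ 2 * b) <= 2 * / (N * s)).
      { rewrite hb2. unfold b. assert (hc3 : 1 / 2 <= c ^ 2 * c) by nra.
        assert (hNs : 0 < N * s) by nra.
        replace (2 * / (N * s)) with (/ (N * s / 2)) by (field; nra).
        apply Rinv_le_contravar; [lra|]. nra. }
      apply Rle_trans with (4 * C1 / y0 ^ 2 * (2 * / (N * s))); [|right; field; nra].
      apply Rmult_le_compat_l; [apply Rdiv_le_0_compat; lra | exact hi]. }
  replace (CRInt G (- y0) y0 - k0 * RtoC (sqrt PI / b))%C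
    with ((CRInt G (- y0) y0 - m) + (m - k0 * RtoC (sqrt PI / b)))%C by ring.
  eapply Rle_trans; [apply Cmod_triangle|].
  apply Rle_trans with (8300000 * C1 ^ 3 / (N * s) + 8 * C1 / y0 ^ 2 / (N * s)); [lra|].
  right. unfold Rdiv. ring.
Qed.
End Laplace.

(** * The integral along a vertical line *)

(** Exponentially small tails are recorded as O(1 / n^2), the form in which they are added to the
    saddle error. The exponent is n - 1 because one factor of the integrand is kept for
    integrability in y. *)
Lemma geometric_decay (r : R) : 0 < r < 1 -> exists K : R, 0 <= K /\
  forall n : nat, (1 <= n)%nat -> r ^ (n - 1) <= K / (INR n * INR n).
Proof.
  intros hr. set (L := - ln r).
  assert (hL : 0 < L). { unfold L. assert (ln r < ln 1) by (apply ln_increasing; lra). rewrite ln_1 in H. lra. }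
  exists (27 / L ^ 3 / r). assert (hL3 : 0 < L ^ 3) by (now apply pow_lt).
  split; [apply Rdiv_le_0_compat; [apply Rdiv_le_0_compat; lra | lra]|].
  intros n hn. assert (hN : 1 <= INR n) by (change 1 with (INR 1); now apply le_INR).
  set (N := INR n) in *.
  assert (e : r ^ (n - 1) = r ^ n / r). { replace n with (S (n - 1)) at 2 by lia. simpl. field. lra. }
  assert (e2 : r ^ n = / exp (N * L)).
  { rewrite <- Rpower_pow by lra. unfold Rpower, L. fold N. rewrite <- exp_Ropp. f_equal. ring. }
  assert (b := exp_ge_cube (N * L) ltac:(nra)).
  rewrite e, e2.
  assert (hc : 0 < (N * L / 3) ^ 3) by (apply pow_lt; nra).
  assert (b2 : / exp (N * L) <= / (N * L / 3) ^ 3) by (now apply Rinv_le_contravar).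
  apply Rle_trans with (/ (N * L / 3) ^ 3 / r).
  - unfold Rdiv at 1 3. apply Rmult_le_compat_r; [left; apply Rinv_0_lt_compat; lra | exact b2].
  - replace (/ (N * L / 3) ^ 3 / r) with (27 / L ^ 3 / r / (N * N) * / N) by (field; lra).
    rewrite <- Rmult_1_r. apply Rmult_le_compat_l.
    + repeat (apply Rdiv_le_0_compat; [|nra]). lra.
    + rewrite <- Rinv_1. apply Rinv_le_contravar; lra.
Qed.

Lemma is_RInt_inv_one_plus_sqr (a b : R) : is_RInt (fun y => / (1 + y ^ 2 / 4)) a b (2 * atan (b / 2) - 2 * atan (a / 2)).
Proof.
  apply (is_RInt_derive (fun y => 2 * atan (y / 2))).
  - intros y _. auto_derive; [trivial|]. generalize (pow2_ge_0 y). simpl. intros. field. nra.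
  - intros y _. apply (ex_derive_continuous (fun y => / (1 + y ^ 2 / 4))). auto_derive.
    generalize (pow2_ge_0 y). simpl. intros. nra.
Qed.

Lemma CRInt_reflect (f : R -> C) (a : R) : ex_CRInt f (- a) a ->
  CRInt (fun y => f (- y)) (- a) a = CRInt f (- a) a.
Proof.
  intros hf.
  assert (h : is_CRInt f (- - a) (- a) (- CRInt f (- a) a)%C).
  { rewrite Ropp_involutive. apply (is_RInt_swap (V := C_R_NormedModule)), CRInt_correct, hf. }
  apply (is_RInt_comp_opp (V := C_R_NormedModule)) in h. apply (is_RInt_opp (V := C_R_NormedModule)) in h.
  apply CRInt_unique. evar_last; [eapply is_RInt_ext; [|exact h]|].
  - intros y _. apply (opp_opp (G := C_R_NormedModule)).
  - apply (opp_opp (G := C_R_NormedModule)).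
Qed.

Lemma IntV_shift (f : C -> C) (xa xb y1 y2 M : R) : xa <= xb -> y1 <= y2 -> hol_rect f xa xb y1 y2 ->
  (forall x, xa <= x <= xb -> Cmod (f (x, y1)) <= M /\ Cmod (f (x, y2)) <= M) ->
  Cmod (IntV f xa y1 y2 - IntV f xb y1 y2) <= 2 * M * (xb - xa).
Proof.
  intros hx hy hol hM. assert (g := goursat_rect f xa xb y1 y2 hx hy hol). unfold RectInt in g.
  assert (hc := hol_rect_cont _ _ _ _ _ hol).
  replace (IntV f xa y1 y2 - IntV f xb y1 y2)%C with (- Ci * (IntH f y1 xa xb - IntH f y2 xa xb))%C.
  - rewrite Cmod_mult, Cmod_opp, Cmod_Ci, Rmult_1_l.
    eapply Rle_trans; [apply Cmod_sub_le|].
    replace (2 * M * (xb - xa)) with (M * (xb - xa) + M * (xb - xa)) by ring.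
    apply Rplus_le_compat; apply IntH_bound; auto; intros x h; try (apply hc; lra); now apply hM.
  - assert (i2 : (Ci * Ci = - (1))%C) by (apply C_ext; reim; ring).
    replace (IntH f y1 xa xb - IntH f y2 xa xb)%C with (Ci * (IntV f xa y1 y2 - IntV f xb y1 y2))%C.
    + rewrite Cmult_assoc. replace (- Ci * Ci)%C with (- (Ci * Ci))%C by ring. rewrite i2. ring.
    + apply Csub_eq_0.
      transitivity (- (IntH f y1 xa xb + Ci * IntV f xb y1 y2 - IntH f y2 xa xb - Ci * IntV f xa y1 y2))%C; [ring|].
      rewrite g. ring.
Qed.

(** Reflection through 0 moves the left side of the rectangle onto the right one; as the amplitude
    is even, this adds the kernel 1 / (s + z). The sum is left split so that each pole is bounded
    separately. *)
Definition cauchy_pair (z s : C) : C := (/ (s - z) + / (s + z))%C.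

Lemma ex_derive_cauchy_pair (z s : C) : s <> z -> s <> (- z)%C -> ex_derive (cauchy_pair z) s.
Proof.
  intros h1 h2. unfold cauchy_pair. apply ex_derive_plus_C.
  - eexists. apply is_derive_inv_C; [now apply Csub_neq_0|].
    apply is_derive_minus_C; [apply is_derive_id_C | apply is_derive_const_C].
  - eexists. apply is_derive_inv_C.
    + intros e. apply h2. replace s with (s + z - z)%C by ring. rewrite e. ring.
    + apply is_derive_plus_C; [apply is_derive_id_C | apply is_derive_const_C].
Qed.

Lemma cauchy_pair_bound (z s : C) (d : R) : 0 < d -> d <= Cmod (s - z) -> d <= Cmod (s + z) ->
  Cmod (cauchy_pair z s) <= 2 / d.
Proof.
  intros hd h1 h2. unfold cauchy_pair. eapply Rle_trans; [apply Cmod_triangle|].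
  rewrite !Cmod_inv by (apply Cmod_pos_neq; lra).
  replace (2 / d) with (/ d + / d) by (field; lra).
  apply Rplus_le_compat; now apply Rinv_le_contravar.
Qed.

Section Vertical.
Variables (F phi sg : C -> C) (lam c X0 K0 : R) (n : nat).
Hypotheses (hent : entire F) (hev : forall z, F (- z)%C = F z) (hX0 : 1 <= X0) (hK0 : 0 <= K0)
  (hmod : forall z, X0 <= Re z -> Cmod (F z) <= K0 * Cmod (F (RtoC (Re z))))
  (hlam4 : 4 * X0 <= lam) (good : near_sigma F phi sg lam c n).
Variables (z : C).

Let h := amplitude F lam n.
Let g (s : C) : C := (h s / (s - z))%C.
Let G (s : C) : C := (h s * cauchy_pair z s)%C.

Let cont_g (s : C) : s <> 0%C -> s <> z -> continuous g s.
Proof.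
  intros h1 h2. apply ex_derive_continuous_C. unfold g. apply ex_derive_div_C; [now apply Csub_neq_0| |].
  - eapply ex_derive_amplitude; eassumption.
  - apply ex_derive_minus_C; [apply ex_derive_id_C | apply ex_derive_const_C].
Qed.

Let hol_G (s : C) : s <> 0%C -> s <> z -> s <> (- z)%C -> ex_derive G s.
Proof.
  intros h1 h2 h3. unfold G. apply ex_derive_mult_C.
  - eapply ex_derive_amplitude; eassumption.
  - now apply ex_derive_cauchy_pair.
Qed.

Lemma RectInt_vertical (x H : R) : 0 < x -> 0 < H -> Rabs (Re z) <> x ->
  RectInt g (- x) x (- H) H = (IntH g (- H) (- x) x - IntH g H (- x) x + Ci * IntV G x (- H) H)%C.
Proof.
  intros hx hH hz.
  assert (zr : Re z <> x) by (intros e; apply hz; rewrite e; apply Rabs_pos_eq; lra).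
  assert (zl : Re z <> - x) by (intros e; apply hz; rewrite e, Rabs_Ropp; apply Rabs_pos_eq; lra).
  assert (nz : forall a y, a <> 0 -> (a, y) <> RtoC 0) by (intros a y ha e; apply ha; now apply (f_equal Re) in e).
  assert (nr : forall y, (x, y) <> z) by (intros y e; apply zr; now rewrite <- e).
  assert (nl : forall y, (- x, y) <> z) by (intros y e; apply zl; now rewrite <- e).
  assert (e1 : IntV g (- x) (- H) H = CRInt (fun y => g ((- x)%R, (- y)%R)) (- H) H).
  { unfold IntV. symmetry. apply (CRInt_reflect (fun y => g ((- x)%R, y))). apply ex_IntV. intros y _.
    apply cont_g; [apply nz; lra | apply nl]. }
  unfold RectInt. rewrite e1.
  assert (e2 : (IntV g x (- H) H - CRInt (fun y => g ((- x)%R, (- y)%R)) (- H) H)%C = IntV G x (- H) H).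
  { unfold IntV. rewrite <- CRInt_minus.
    - apply CRInt_ext. intros y _. unfold G, cauchy_pair.
      change (g ((- x)%R, (- y)%R)) with (g (- ((x, y) : C))%C). unfold g.
      unfold h. rewrite (amplitude_even F lam n hev).
      assert (n1 : ((x, y) - z)%C <> 0%C) by apply Csub_neq_0, nr.
      assert (n2 : (- (x, y) - z)%C <> 0%C) by (apply (Csub_neq_0 (- (x, y))), (nl (- y))).
      assert (n3 : ((x, y) + z)%C <> 0%C).
      { intros e. apply n2. replace (- (x, y) - z)%C with (- ((x, y) + z))%C by ring. rewrite e. ring. }
      set (s := (x, y) : C) in *. ceq. field. repeat split; assumption.
    - apply ex_IntV. intros y _. apply cont_g; [apply nz; lra | apply nr].
    - apply ex_RInt_C. intros y _. apply (continuous_comp Ropp (fun t => g ((- x)%R, t))).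
      + apply (ex_derive_continuous Ropp). auto_derive. trivial.
      + apply continuous_V, cont_g; [apply nz; lra | apply nl]. }
  rewrite <- e2. ring.
Qed.

Variables (c0 Cr : R).
Hypotheses (hc0 : 0 < c0 <= rho) (hCr0 : 0 <= Cr).
(** [c0] bounds from below the distance of [z] to 1 and - 1. The saddle window |y| <= y0 then stays
    far from the poles, and eta = y0 / 8 gives exp (2 eta^2) <= 1 + y0^2 / 16, so beyond the window
    each power of the amplitude bound contributes at most r < 1. *)
Let y0 := c0 / 16.
Let eta := y0 / 8.
Let r := (1 + y0 ^ 2 / 16) / (1 + y0 ^ 2 / 4).
Hypothesis (hCr : r ^ (n - 1) <= Cr / (INR n * INR n)).
Hypotheses (z1 : c0 <= Cmod (z - 1)) (z2 : c0 <= Cmod (z + 1)).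

Let hN : 1 <= INR n.
Proof. destruct good as (hn & _). change 1 with (INR 1). now apply le_INR. Qed.

Let hy0 : 0 < y0 <= 1.
Proof. unfold y0, rho in *. lra. Qed.

Let r01 : 0 < r < 1.
Proof.
  assert (h1 := pow2_ge_0 y0). unfold r. split; [apply Rdiv_lt_0_compat; lra|].
  assert (0 < y0 ^ 2) by (apply pow_lt; lra).
  apply Rmult_lt_reg_r with (1 + y0 ^ 2 / 4); [lra|]. unfold Rdiv at 1. rewrite Rmult_assoc, Rinv_l by lra. lra.
Qed.

(** Of the n equal factors one is kept as 2 / (1 + y^2 / 4), which is integrable along the line, and
    the other n - 1 give the decay r^(n-1). *)
Let h_tail (s : C) : Rabs (Re s - 1) <= eta -> y0 <= Rabs (Im s) ->
  Cmod (h s) <= 2 * K0 * (Cr / (INR n * INR n)) / (1 + (Im s) ^ 2 / 4).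
Proof.
  intros hs hi. assert (b := amplitude_bound F phi sg lam c X0 K0 n hX0 hK0 hmod hlam4 good s eta
    ltac:(unfold eta, y0, rho in *; lra) hs). fold h in b.
  eapply Rle_trans; [exact b|]. set (y := Im s) in *.
  assert (hy2 : y0 ^ 2 <= y ^ 2). { rewrite <- (pow2_abs y). apply pow_incr. lra. }
  assert (he : exp (2 * eta ^ 2) <= 1 + y0 ^ 2 / 16).
  { eapply Rle_trans; [apply exp_le_one_plus|]; unfold eta; nra. }
  assert (hp := exp_pos (2 * eta ^ 2)). assert (h02 := pow2_ge_0 y0).
  set (q := exp (2 * eta ^ 2) / (1 + y ^ 2 / 4)).
  assert (hq0 : 0 <= q) by (apply Rdiv_le_0_compat; lra).
  assert (hi1 : 0 < / (1 + y ^ 2 / 4)) by (apply Rinv_0_lt_compat; lra).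
  assert (hqr : q <= r).
  { unfold q, r, Rdiv. apply Rmult_le_compat; [lra | lra | exact he|]. apply Rinv_le_contravar; lra. }
  assert (hq2 : q <= 2 * / (1 + y ^ 2 / 4)).
  { unfold q, Rdiv. apply Rmult_le_compat_r; [lra|]. nra. }
  destruct good as (hn & _).
  assert (en : q ^ n = q * q ^ (n - 1)) by (replace n with (S (n - 1)) at 1 by lia; reflexivity).
  fold q. rewrite en.
  assert (hqn : q ^ (n - 1) <= Cr / (INR n * INR n)).
  { eapply Rle_trans; [apply pow_incr; split; [exact hq0 | exact hqr] | exact hCr]. }
  assert (hqn0 : 0 <= q ^ (n - 1)) by now apply pow_le.
  replace (2 * K0 * (Cr / (INR n * INR n)) / (1 + y ^ 2 / 4)) with (K0 * ((2 * / (1 + y ^ 2 / 4)) * (Cr / (INR n * INR n))))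
    by (unfold Rdiv; ring).
  apply Rmult_le_compat_l; [exact hK0|]. apply Rmult_le_compat; assumption.
Qed.

(** The line is placed on the side of Re s = 1 away from [z]: at 1 + eta when |Re z| <= 1 and at 1 -
    eta when |Re z| >= 1. In both cases the poles z and - z stay at distance at least eta. *)
Variable (x : R).
Hypothesis (hx : x = 1 - eta /\ 1 <= Rabs (Re z) \/ x = 1 + eta /\ Rabs (Re z) <= 1).

Let heta : 0 < eta. Proof. unfold eta. lra. Qed.

Let line_dist (y : R) : eta <= Cmod ((x, y) - z) /\ eta <= Cmod ((x, y) + z).
Proof.
  assert (a1 : eta <= Rabs (Rabs (Re z) - x)).
  { destruct hx as [[-> k]|[-> k]]; [rewrite Rabs_pos_eq by lra | rewrite Rabs_left by lra]; lra. }
  assert (xp : Rabs x = x).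
  { apply Rabs_pos_eq. destruct hx as [[-> _]|[-> _]]; unfold eta; lra. }
  rewrite <- xp in a1.
  split; (eapply Rle_trans; [exact a1|]).
  - rewrite Cmod_sub_sym. eapply Rle_trans; [|apply re_le_Cmod]. rewrite Re_minus, Re_pair. apply Rabs_triang_inv2.
  - eapply Rle_trans; [|apply re_le_Cmod]. rewrite Re_plus, Re_pair.
    replace (x + Re z) with (Re z - - x) by ring. rewrite <- (Rabs_Ropp x). apply Rabs_triang_inv2.
Qed.

Let hx1 : Rabs (x - 1) = eta.
Proof. destruct hx as [[-> _]|[-> _]]; [rewrite Rabs_left by lra | rewrite Rabs_pos_eq by lra]; ring. Qed.

Let x_pos : 1 / 2 < x.
Proof. destruct hx as [[-> _]|[-> _]]; unfold eta; lra. Qed.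

Let G_line (y : R) : ex_derive G (x, y).
Proof.
  destruct (line_dist y) as [d1 d2]. apply hol_G.
  - intros e. apply (f_equal Re) in e. simpl in e. lra.
  - intros e. rewrite e in d1. unfold Cminus in d1. rewrite Cplus_opp_r, Cmod_0 in d1. lra.
  - intros e. rewrite e in d2. rewrite Cplus_comm, Cplus_opp_r, Cmod_0 in d2. lra.
Qed.

Lemma vertical_tail_bound (p q : R) : p <= q -> (forall y, p <= y <= q -> y0 <= Rabs y) ->
  Cmod (IntV G x p q) <= 32 * K0 * Cr / eta / (INR n * INR n).
Proof.
  intros hpq hy. set (T := 2 * K0 * (Cr / (INR n * INR n)) * (2 / eta)).
  assert (hNN : 0 < INR n * INR n) by nra.
  assert (hT : 0 <= T).
  { unfold T. apply Rmult_le_pos; [apply Rmult_le_pos; [lra | apply Rdiv_le_0_compat; lra] | apply Rdiv_le_0_compat; lra]. }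
  assert (I := is_RInt_scal _ _ _ T _ (is_RInt_inv_one_plus_sqr p q)).
  unfold IntV. eapply Rle_trans; [apply CRInt_bound with (g := fun y => scal T (/ (1 + y ^ 2 / 4)))|].
  - exact hpq.
  - apply ex_IntV. intros y _. apply ex_derive_continuous_C, G_line.
  - eexists. exact I.
  - intros y hpy. unfold G. rewrite Cmod_mult. unfold scal. simpl. unfold mult. simpl.
    destruct (line_dist y) as [d1 d2].
    assert (b1 := h_tail (x, y) ltac:(rewrite Re_pair; lra) (hy y hpy)).
    assert (b2 := cauchy_pair_bound z (x, y) eta heta d1 d2).
    apply Rle_trans with (2 * K0 * (Cr / (INR n * INR n)) / (1 + y ^ 2 / 4) * (2 / eta)).
    + apply Rmult_le_compat; try apply Cmod_ge_0; assumption.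
    + unfold T. right. simpl. unfold Rdiv. ring.
  - eapply Rle_trans; [right; apply (is_RInt_unique (V := R_CompleteNormedModule)); exact I|].
    unfold scal. simpl. unfold mult. simpl.
    assert (b1 := atan_bound (q / 2)). assert (b2 := atan_bound (p / 2)). assert (b3 := PI_4).
    apply Rle_trans with (T * 8); [apply Rmult_le_compat_l; lra|].
    unfold T. right. field. lra.
Qed.

Let near_dist (s : C) : Cmod (s - 1) <= c0 / 4 -> c0 / 2 <= Cmod (s - z) /\ c0 / 2 <= Cmod (s + z) /\ 1 / 2 <= Re s.
Proof.
  intros hs. split; [|split].
  - assert (k := Cmod_sub_triangle z s 1). rewrite (Cmod_sub_sym z s) in k. lra.
  - assert (k := Cmod_sub_triangle (- z) s 1).
    replace (- z - s)%C with (- (s + z))%C in k by ring. replace (- z - 1)%C with (- (z + 1))%C in k by ring.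
    rewrite !Cmod_opp in k. lra.
  - assert (k := Rle_trans _ _ _ (re_le_Cmod _) hs). rewrite Re_minus, Re_RtoC in k. apply Rabs_le_between in k.
    unfold rho in hc0. lra.
Qed.

Let near_facts (s : C) : Cmod (s - 1) <= c0 / 4 -> Cmod (cauchy_pair z s) <= 4 / c0 /\ ex_derive (cauchy_pair z) s /\ ex_derive G s.
Proof.
  intros hs. destruct (near_dist s hs) as (d1 & d2 & d3).
  assert (n1 : s <> z). { intros e. rewrite e in d1. unfold Cminus in d1. rewrite Cplus_opp_r, Cmod_0 in d1. lra. }
  assert (n2 : s <> (- z)%C). { intros e. rewrite e in d2. rewrite Cplus_comm, Cplus_opp_r, Cmod_0 in d2. lra. }
  split; [|split].
  - replace (4 / c0) with (2 / (c0 / 2)) by (field; lra). apply cauchy_pair_bound; [lra | exact d1 | exact d2].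
  - now apply ex_derive_cauchy_pair.
  - apply hol_G; trivial. intros e. rewrite e, Re_RtoC in d3. lra.
Qed.

Let rect_near (s : C) : Rabs (Re s - 1) <= eta -> Rabs (Im s) <= y0 -> Cmod (s - 1) <= c0 / 4.
Proof.
  intros h1 h2. eapply Rle_trans; [apply Cmod_le_re_im|]. rewrite Re_minus, Im_minus, Re_RtoC, Im_RtoC, Rminus_0_r.
  unfold eta, y0 in *. lra.
Qed.

(** Inside the window the line can be moved back to Re s = 1: the thin rectangle lies within c0 / 4
    of 1 and contains no pole, and on its short sides the amplitude is already exponentially
    small. *)
Lemma vertical_middle_shift : Cmod (IntV G x (- y0) y0 - IntV G 1 (- y0) y0) <= 32 * K0 * Cr / eta / (INR n * INR n).
Proof.
  assert (hNN : 0 < INR n * INR n) by nra.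
  set (M := 2 * K0 * (Cr / (INR n * INR n)) * (4 / c0)).
  assert (hCN : 0 <= Cr / (INR n * INR n)) by (apply Rdiv_le_0_compat; lra).
  assert (hM0 : 0 <= M) by (apply Rmult_le_pos; [nra | apply Rdiv_le_0_compat; lra]).
  assert (ends : forall u y, Rabs (u - 1) <= eta -> Rabs y = y0 -> Cmod (G (u, y)) <= M).
  { intros u y hu hy. unfold G. rewrite Cmod_mult.
    destruct (near_facts (u, y)) as (b2 & _); [apply rect_near; simpl; lra|].
    assert (b1 := h_tail (u, y) hu ltac:(simpl; lra)). unfold M.
    apply Rmult_le_compat; try apply Cmod_ge_0; [|exact b2].
    eapply Rle_trans; [exact b1|]. unfold Rdiv at 1. rewrite <- Rmult_1_r. apply Rmult_le_compat_l; [nra|].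
    rewrite <- Rinv_1. apply Rinv_le_contravar; [lra|]. generalize (pow2_ge_0 (Im (u, y))). lra. }
  assert (hb : 2 * M * eta <= 32 * K0 * Cr / eta / (INR n * INR n)).
  { unfold M. apply Rle_trans with (K0 * Cr / (INR n * INR n) * 16 * (eta / c0)); [right; field; lra|].
    apply Rle_trans with (K0 * Cr / (INR n * INR n) * 16 * (2 / eta)); [|right; field; lra].
    apply Rmult_le_compat_l.
    - apply Rmult_le_pos; [apply Rdiv_le_0_compat; [now apply Rmult_le_pos | lra] | lra].
    - apply Rle_trans with 1.
      + apply Rmult_le_reg_r with c0; [lra|]. unfold Rdiv. rewrite Rmult_assoc, Rinv_l by lra. unfold eta, y0. lra.
      + apply Rmult_le_reg_r with eta; [lra|]. unfold Rdiv. rewrite Rmult_assoc, Rinv_l by lra. unfold eta. lra. }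
  assert (ay : Rabs (- y0) = y0 /\ Rabs y0 = y0) by (split; [rewrite Rabs_Ropp|]; apply Rabs_pos_eq; lra).
  assert (hol : forall xa xb, (forall u, xa <= u <= xb -> Rabs (u - 1) <= eta) -> hol_rect G xa xb (- y0) y0).
  { intros xa xb hu s [s1 s2]. apply near_facts, rect_near; [now apply hu | now apply Rabs_le]. }
  eapply Rle_trans; [|exact hb].
  destruct hx as [[e _]|[e _]].
  - replace eta with (1 - x) at 1 by lra. apply IntV_shift; [lra | lra | |].
    + apply hol. intros u hu. apply Rabs_le. lra.
    + intros u hu. split; apply ends; try tauto; apply Rabs_le; lra.
  - rewrite Cmod_sub_sym. replace eta with (x - 1) at 1 by lra. apply IntV_shift; [lra | lra | |].
    + apply hol. intros u hu. apply Rabs_le. lra.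
    + intros u hu. split; apply ends; try tauto; apply Rabs_le; lra.
Qed.

(** One constant for all the Laplace hypotheses. The largest demand is the second-order remainder of
    the kernel, 4 (4 / c0) (8 / c0)^2 = 1024 / c0^3. *)
Let C1 := 2048 / c0 ^ 3.

(** On s = 1 + i y the phase is y^2 sg(s)^2, so the exponent function is [sg] squared with value c^2
    at the saddle. Its first-order data and those of the kernel come from Cauchy estimates on a
    square of half-side c0 / 8. *)
Lemma vertical_middle_laplace :
  Cmod (IntV G 1 (- y0) y0 - cauchy_pair z 1 * RtoC (sqrt PI / (sqrt (INR n) * c))) <=
    (8300000 * C1 ^ 3 + 8 * C1 / y0 ^ 2) / (INR n * sqrt (INR n)).
Proof.
  destruct good as (hn & _ & _ & _ & S1 & S2 & S3 & S4 & S5 & hc).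
  assert (hr := rho_pos).
  assert (c01 : 0 < c0 <= 1 / 2) by (unfold rho in hc0; lra).
  assert (i1 : 1 <= / c0) by (rewrite <- Rinv_1; apply Rinv_le_contravar; lra).
  assert (hc3 : / c0 ^ 3 = / c0 * / c0 * / c0) by (field; lra).
  assert (ha1 : / c0 <= / c0 * / c0) by nra. assert (ha2 : / c0 * / c0 <= / c0 * / c0 * / c0) by nra.
  assert (eC : C1 = 2048 * (/ c0 * / c0 * / c0)) by (unfold C1, Rdiv; now rewrite hc3).
  assert (hC1 : 1 <= C1) by (rewrite eC; lra).
  set (R0 := c0 / 8). assert (hR0 : 0 < R0) by (unfold R0; lra).
  assert (sq : forall s, in_rect (Re 1 - R0) (Re 1 + R0) (Im 1 - R0) (Im 1 + R0) s -> Cmod (s - 1) <= c0 / 4).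
  { intros s [p q]. rewrite Re_RtoC in p. rewrite Im_RtoC in q.
    eapply Rle_trans; [apply Cmod_le_re_im|]. rewrite Re_minus, Im_minus, Re_RtoC, Im_RtoC, Rminus_0_r.
    assert (Rabs (Re s - 1) <= R0) by (apply Rabs_le; lra). assert (Rabs (Im s) <= R0) by (apply Rabs_le; lra).
    unfold R0 in *. lra. }
  set (f := fun s => (sg s ^ 2)%C).
  assert (hol_f : hol_square f 1 R0).
  { intros s hs. apply ex_derive_pow_C, S4. apply sq in hs. lra. }
  assert (b_f : forall s, on_bd (Re 1 - R0) (Re 1 + R0) (Im 1 - R0) (Im 1 + R0) s -> Cmod (f s) <= 2).
  { intros s [hs _]. apply sq in hs. unfold f. rewrite Cmod_pow.
    assert (k := S2 s ltac:(lra)). assert (k2 : Cmod (sg s) <= 9 / 8).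
    { replace (sg s) with (1 + (sg s - 1))%C by ring. eapply Rle_trans; [apply Cmod_triangle|]. rewrite Cmod_1. lra. }
    generalize (Cmod_ge_0 (sg s)). simpl. nra. }
  assert (hol_k : hol_square (cauchy_pair z) 1 R0) by (intros s hs; now apply near_facts, sq).
  assert (b_k : forall s, on_bd (Re 1 - R0) (Re 1 + R0) (Im 1 - R0) (Im 1 + R0) s -> Cmod (cauchy_pair z s) <= 4 / c0).
  { intros s [hs _]. now apply near_facts, sq. }
  assert (t_f := fun s hs => taylor_remainder_bound f 1 R0 2 1 s hR0 hol_f b_f hs).
  assert (t_k := fun s hs => taylor_remainder_bound (cauchy_pair z) 1 R0 (4 / c0) 1 s hR0 hol_k b_k hs).
  assert (d_f := cauchy_estimate f 1 R0 2 1 hR0 hol_f b_f).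
  assert (d_k := cauchy_estimate (cauchy_pair z) 1 R0 (4 / c0) 1 hR0 hol_k b_k).
  simpl C_derive_n in d_f, d_k. rewrite pow_1 in d_f, d_k. simpl (INR (fact 1)) in d_f, d_k.
  assert (c11 : Cmod (1 - 1) = 0) by (unfold Cminus; rewrite Cplus_opp_r; apply Cmod_0).
  apply (laplace_integral y0 C1 hy0 hC1 (fun y => f (1, y)) (fun y => cauchy_pair z (1, y)) (fun y => G (1, y))
    (Ci * C_derive f 1) (cauchy_pair z 1) (Ci * C_derive (cauchy_pair z) 1) c n hn); try lra.
  - intros y hy. set (s := (1, y) : C).
    assert (es : (s - 1)%C = (Ci * y)%C) by (apply C_ext; unfold s; reim; ring).
    assert (ms : Cmod (s - 1) = Rabs y) by (rewrite es, Cmod_mult, Cmod_Ci, Cmod_R; ring).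
    assert (hay : Rabs y <= y0) by now apply Rabs_le.
    assert (hs2 : Cmod (s - 1) <= R0 / 2) by (rewrite ms; unfold R0, y0 in *; lra).
    assert (hs3 : Cmod (s - 1) <= rho / 16) by (unfold R0 in hs2; lra).
    assert (pw : (Rabs y / R0) ^ 2 = 64 * (/ c0 * / c0) * y ^ 2).
    { unfold Rdiv. rewrite Rpow_mult_distr, pow2_abs. unfold R0. field. lra. }
    assert (hy2 := pow2_ge_0 y).
    split; [|split; [|split]].
    + unfold G, h. rewrite (amplitude_exp F phi sg lam c n good) by (unfold s; simpl; lra).
      rewrite S1 by lra. rewrite es. unfold f. do 3 f_equal.
      assert (i2 : (Ci * Ci = - (1))%C) by (apply C_ext; reim; ring).
      replace (- (Ci * y * sg s) ^ 2)%C with (- (Ci * Ci) * (y ^ 2 * sg s ^ 2))%C by (simpl; ring).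
      rewrite i2. simpl. ring.
    + specialize (t_f s hs2). rewrite taylor_at_1, ms, es, pw in t_f. unfold f at 2 in t_f. rewrite S5 in t_f.
      replace (f s - RtoC (c ^ 2) - y * (Ci * C_derive f 1))%C with (f s - (RtoC c ^ 2 + Ci * y * C_derive f 1))%C
        by (rewrite RtoC_pow; ring).
      eapply Rle_trans; [exact t_f|]. rewrite eC.
      replace (4 * 2 * (64 * (/ c0 * / c0) * y ^ 2)) with (512 * (/ c0 * / c0) * y ^ 2) by ring.
      apply Rmult_le_compat_r; lra.
    + specialize (t_k s hs2). rewrite taylor_at_1, ms, es, pw in t_k.
      replace (cauchy_pair z s - cauchy_pair z 1 - y * (Ci * C_derive (cauchy_pair z) 1))%C
        with (cauchy_pair z s - (cauchy_pair z 1 + Ci * y * C_derive (cauchy_pair z) 1))%C by ring.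
      eapply Rle_trans; [exact t_k|]. rewrite eC.
      replace (4 * (4 / c0) * (64 * (/ c0 * / c0) * y ^ 2)) with (1024 * (/ c0 * / c0 * / c0) * y ^ 2) by (field; lra).
      apply Rmult_le_compat_r; lra.
    + unfold f. replace (sg s ^ 2 - RtoC (c ^ 2))%C with ((sg s - sg 1) * (sg s + c))%C.
      2: { rewrite S5, RtoC_pow. simpl. ring. }
      rewrite Cmod_mult. assert (k3 := S3 s 1%C ltac:(lra) ltac:(lra)).
      assert (k4 : Cmod (sg s + c) <= 9 / 4).
      { eapply Rle_trans; [apply Cmod_triangle|]. rewrite Cmod_RtoC_pos by lra.
        assert (k5 := Cmod_sg_le F phi sg lam c n good s ltac:(lra)). lra. }
      assert (k6 : Cmod (sg s - sg 1) <= / 64).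
      { eapply Rle_trans; [exact k3|]. apply Rle_trans with (/ (4 * rho) * (rho / 16)).
        - apply Rmult_le_compat_l; [left; apply Rinv_0_lt_compat; lra | exact hs3].
        - right. field. lra. }
      apply Rle_trans with (/ 64 * (9 / 4)); [apply Rmult_le_compat; try apply Cmod_ge_0; assumption | nra].
  - apply ex_IntV. intros y hy. rewrite Rmin_left, Rmax_right in hy by lra. apply ex_derive_continuous_C.
    apply near_facts, rect_near; simpl.
    + unfold Rminus. rewrite Rplus_opp_r, Rabs_R0. lra.
    + now apply Rabs_le.
  - rewrite Cmod_mult, Cmod_Ci, Rmult_1_l. eapply Rle_trans; [exact d_f|]. rewrite eC.
    replace (4 * 1 * 2 / R0) with (64 * / c0) by (unfold R0; field; lra). lra.
  - eapply Rle_trans; [apply near_facts; lra|]. rewrite eC. unfold Rdiv. lra.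
  - rewrite Cmod_mult, Cmod_Ci, Rmult_1_l. eapply Rle_trans; [exact d_k|]. rewrite eC.
    replace (4 * 1 * (4 / c0) / R0) with (128 * (/ c0 * / c0)) by (unfold R0; field; lra). lra.
Qed.

Lemma vertical_estimate (H : R) : 1 <= H ->
  Cmod (IntV G x (- H) H - cauchy_pair z 1 * RtoC (sqrt PI / (sqrt (INR n) * c))) <=
    (96 * K0 * Cr / eta + 8300000 * C1 ^ 3 + 8 * C1 / y0 ^ 2) / (INR n * sqrt (INR n)).
Proof.
  intros hH.
  assert (cl : forall y, continuous G (x, y)) by (intros; apply ex_derive_continuous_C, G_line).
  rewrite (IntV_Chasles G x (- H) (- y0) H) by (auto; lra).
  rewrite (IntV_Chasles G x (- y0) y0 H) by (auto; lra).
  assert (b1 := vertical_tail_bound (- H) (- y0) ltac:(lra)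
    ltac:(intros y hy; rewrite Rabs_left by lra; lra)).
  assert (b2 := vertical_tail_bound y0 H ltac:(lra) ltac:(intros y hy; rewrite Rabs_pos_eq by lra; lra)).
  assert (b3 := vertical_middle_shift). assert (b4 := vertical_middle_laplace).
  set (t1 := IntV G x (- H) (- y0)) in *. set (t2 := IntV G x y0 H) in *. set (m1 := IntV G x (- y0) y0) in *.
  set (m2 := IntV G 1 (- y0) y0) in *. set (T := (cauchy_pair z 1 * _)%C) in *.
  replace (t1 + (m1 + t2) - T)%C with ((t1 + t2) + ((m1 - m2) + (m2 - T)))%C by ring.
  eapply Rle_trans; [apply Cmod_triangle|].
  assert (s1 : 1 <= sqrt (INR n)) by (rewrite <- sqrt_1; apply sqrt_le_1_alt; exact hN).
  assert (ss : sqrt (INR n) * sqrt (INR n) = INR n) by (apply sqrt_sqrt; lra).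
  assert (hle : 32 * K0 * Cr / eta / (INR n * INR n) <= 32 * K0 * Cr / eta / (INR n * sqrt (INR n))).
  { unfold Rdiv at 1 3. apply Rmult_le_compat_l.
    - apply Rdiv_le_0_compat; [|exact heta]. repeat apply Rmult_le_pos; lra.
    - apply Rinv_le_contravar; nra. }
  apply Rle_trans with (32 * K0 * Cr / eta / (INR n * sqrt (INR n)) * 3 +
    (8300000 * C1 ^ 3 + 8 * C1 / y0 ^ 2) / (INR n * sqrt (INR n))).
  - assert (q1 := Cmod_triangle t1 t2). assert (q2 := Cmod_triangle (m1 - m2) (m2 - T)). lra.
  - right. unfold Rdiv. ring.
Qed.
End Vertical.

(** * The outer estimate *)

Definition growth_data (F : C -> C) (X0 K0 M Y : R) (k : nat) : Prop :=
  entire F /\ (forall z, F (- z)%C = F z) /\ 1 <= X0 /\ 0 <= K0 /\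
  (forall z, X0 <= Re z -> Cmod (F z) <= K0 * Cmod (F (RtoC (Re z)))) /\
  0 <= M /\ 1 <= Y /\
  (forall z, Rabs (Re z) <= X0 -> Y <= Rabs (Im z) -> Cmod (F z) <= M * Rabs (Im z) ^ k).

(** [B] is chosen before [F], the phase and [n]: this order of quantifiers is the uniformity in [n].
    [Q] is the Cauchy integral over the rectangle; it remains defined at z = 0, where it cannot be
    recovered from the factor z^(2n) Q. *)
Lemma outside_bound (c0 K0 : R) : 0 < c0 <= rho -> 0 <= K0 -> exists B, 0 <= B /\
  forall (F phi sg : C -> C) (lam c X0 M Y : R) (n k : nat),
  growth_data F X0 K0 M Y k -> 4 * X0 <= lam -> (k < 2 * n)%nat -> near_sigma F phi sg lam c n ->
  forall z, c0 <= Cmod (z - 1) -> c0 <= Cmod (z + 1) ->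
  exists Q : C, (F (lam * z) * chi z - taylor_poly (2 * n - 1) F (lam * z) = z ^ (2 * n) * F lam * Q)%C /\
    Cmod (sqrt (INR n) * Q - RtoC (/ (sqrt PI * c)) / (1 - z ^ 2)) <= B / INR n.
Proof.
  intros hc0 hK0.
  set (y0 := c0 / 16). set (eta := y0 / 8). set (r := (1 + y0 ^ 2 / 16) / (1 + y0 ^ 2 / 4)). set (C1 := 2048 / c0 ^ 3).
  assert (hy0 : 0 < y0 <= 1) by (unfold y0, rho in *; lra).
  assert (heta : 0 < eta <= 1 / 4) by (unfold eta; lra).
  assert (hy2 : 0 < y0 ^ 2) by (apply pow_lt; lra).
  assert (r01 : 0 < r < 1).
  { unfold r. split; [apply Rdiv_lt_0_compat; lra|].
    apply Rmult_lt_reg_r with (1 + y0 ^ 2 / 4); [lra|]. unfold Rdiv at 1. rewrite Rmult_assoc, Rinv_l by lra. lra. }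
  destruct (geometric_decay r r01) as (Cr & hCr0 & hCr).
  set (Cv := 96 * K0 * Cr / eta + 8300000 * C1 ^ 3 + 8 * C1 / y0 ^ 2).
  assert (hC1 : 0 < C1) by (apply Rdiv_lt_0_compat; [lra | apply pow_lt; lra]).
  assert (hCv : 0 <= Cv).
  { assert (0 <= 96 * K0 * Cr / eta) by (apply Rdiv_le_0_compat; [repeat apply Rmult_le_pos; lra | lra]).
    assert (0 <= C1 ^ 3) by (apply pow_le; lra). assert (0 <= 8 * C1 / y0 ^ 2) by (apply Rdiv_le_0_compat; lra).
    unfold Cv. lra. }
  exists (Cv + 8). split; [lra|].
  intros F phi sg lam c X0 M Y n k (hent & hev & hX0 & _ & hmod & hM & hY & hstrip) hlam4 hk good z z1 z2.
  assert (good' := good). destruct good' as (hn & hlam0 & _ & _ & _ & _ & _ & _ & _ & hc).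
  assert (hN : 1 <= INR n) by (change 1 with (INR 1); now apply le_INR).
  set (s := sqrt (INR n)).
  assert (s1 : 1 <= s) by (unfold s; rewrite <- sqrt_1; apply sqrt_le_1_alt; exact hN).
  assert (ss : s * s = INR n) by (apply sqrt_sqrt; lra).
  assert (hns : 0 < INR n * s) by nra.
  destruct (amplitude_horizontal F phi sg lam c X0 K0 n hent hev hX0 hK0 hmod hlam4 good M Y k hM hY hk hstrip
    (/ (INR n * s)) (Rinv_0_lt_compat _ hns)) as (H1 & hH1 & hH).
  set (H := Rmax H1 (Rabs (Im z) + 1)).
  assert (hHa : H1 <= H) by apply Rmax_l. assert (hHb : Rabs (Im z) + 1 <= H) by apply Rmax_r.
  (* The line |Re z| = 1 falls in the case chi z = 0, so there the narrower rectangle is used and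
     [z] lies outside it. *)
  assert (inside : exists x, (x = 1 - eta /\ 1 <= Rabs (Re z) \/ x = 1 + eta /\ Rabs (Re z) <= 1) /\
    (1 <= Rabs (Re z) /\ x < Rabs (Re z) /\ chi z = 0%C \/ Rabs (Re z) < x /\ chi z = 1%C)).
  { unfold chi. destruct (Rlt_dec (Rabs (Re z)) 1) as [hl|hl].
    - exists (1 + eta). split; [right; split; lra|]. right. split; [lra | reflexivity].
    - exists (1 - eta). split; [left; split; lra|]. left. split; [lra|]. split; [lra | reflexivity]. }
  destruct inside as (x & hx & hchi).
  assert (xb : 1 / 2 <= x <= 2) by (destruct hx as [[-> _]|[-> _]]; lra).
  set (g := fun w => (amplitude F lam n w / (w - z))%C).
  set (J := RectInt g (- x) x (- H) H).
  set (V := IntV (fun w => amplitude F lam n w * cauchy_pair z w)%C x (- H) H).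
  assert (hRez : Rabs (Re z) <> x) by (destruct hchi as [[_ [q _]]|[q _]]; lra).
  assert (eJ : J = (IntH g (- H) (- x) x - IntH g H (- x) x + Ci * V)%C).
  { unfold J, g, V. apply (RectInt_vertical F phi sg lam c n hent hev good z x H); lra. }
  assert (bV := vertical_estimate F phi sg lam c X0 K0 n hent hX0 hK0 hmod hlam4 good z c0 Cr hc0 hCr0 (hCr n hn) z1 z2 x hx H ltac:(lra)).
  fold V in bV. fold y0 eta C1 Cv s in bV.
  assert (ch : forall u y, Rabs y = H -> continuous g (u, y)).
  { intros u y hy. apply ex_derive_continuous_C. unfold g. apply ex_derive_div_C.
    - apply Csub_neq_0. intros e. apply (f_equal Im) in e. simpl in e. rewrite e in hy. lra.
    - apply (ex_derive_amplitude F phi sg lam c n hent good). intros e. apply (f_equal Im) in e. simpl in e.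
      rewrite e, Rabs_R0 in hy. generalize (Rabs_pos (Im z)). lra.
    - apply ex_derive_minus_C; [apply ex_derive_id_C | apply ex_derive_const_C]. }
  assert (bh : forall u y, Rabs y = H -> Rabs u <= 2 -> Cmod (amplitude F lam n (u, y)) <= / (INR n * s) ->
    Cmod (g (u, y)) <= / (INR n * s)).
  { intros u y hy hu hb. unfold g.
    assert (d1 : 1 <= Cmod ((u, y) - z)).
    { eapply Rle_trans; [|apply im_le_Cmod]. rewrite Im_minus, Im_pair.
      assert (k1 := Rabs_triang_inv y (Im z)). lra. }
    rewrite Cmod_div by (apply Cmod_pos_neq; lra). unfold Rdiv. rewrite <- (Rmult_1_r (/ (INR n * s))).
    apply Rmult_le_compat; [apply Cmod_ge_0 | left; apply Rinv_0_lt_compat; lra | exact hb|].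
    rewrite <- Rinv_1. apply Rinv_le_contravar; lra. }
  assert (Hp : Rabs H = H /\ Rabs (- H) = H).
  { rewrite Rabs_Ropp. split; apply Rabs_pos_eq; lra. }
  assert (bHor : Cmod (IntH g (- H) (- x) x - IntH g H (- x) x) <= 8 / (INR n * s)).
  { eapply Rle_trans; [apply Cmod_sub_le|].
    assert (side : forall y, (y = H \/ y = - H) -> Cmod (IntH g y (- x) x) <= 4 / (INR n * s)).
    { intros y hy. assert (hy' : Rabs y = H) by (destruct hy as [-> | ->]; tauto).
      apply Rle_trans with (/ (INR n * s) * (x - - x)).
      - apply IntH_bound; [lra | |].
        + intros u _. now apply ch.
        + intros u hu. assert (hu2 : Rabs u <= 2) by (apply Rabs_le; lra). apply bh; trivial.
          destruct (hH H u hHa hu2) as [p q]. now destruct hy as [-> | ->].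
      - unfold Rdiv. rewrite Rmult_comm. apply Rmult_le_compat_r; [left; now apply Rinv_0_lt_compat | lra]. }
    assert (p1 := side (- H) ltac:(tauto)). assert (p2 := side H ltac:(tauto)).
    replace (8 / (INR n * s)) with (4 / (INR n * s) + 4 / (INR n * s)) by (field; lra). lra. }
  set (f := fun w => F (lam * w)%C).
  assert (hf : hol_rect f (- x) x (- H) H).
  { intros w _. apply (ex_derive_comp_C F (fun w => lam * w)%C); [apply hent; exact I|].
    apply ex_derive_mult_C; [apply ex_derive_const_C | apply ex_derive_id_C]. }
  assert (p0 : in_open_rect (- x) x (- H) H 0%C) by (split; simpl; generalize (Rabs_pos (Im z)); lra).
  assert (Fl := F_lam_neq_0 F phi sg lam c n good).
  assert (hdist : forall w, on_bd (- x) x (- H) H w -> w <> 0%C /\ w <> z).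
  { intros w hw. split.
    - now apply (in_open_rect_not_bd _ _ _ _ _ _ p0).
    - intros ->. destruct hw as [[q1 q2] q3]. apply Rabs_le in q1. apply Rabs_le in q2.
      destruct hchi as [[_ [q _]]|[q _]]; [lra|].
      destruct Hp as [k1 k2].
      destruct q3 as [q3|[q3|[q3|q3]]].
      + rewrite q3, Rabs_Ropp, Rabs_pos_eq in q; lra.
      + rewrite q3, Rabs_pos_eq in q; lra.
      + rewrite q3 in hHb. lra.
      + rewrite q3 in hHb. lra. }
  assert (eR : (RectInt (fun w => f w / ((w - 0) ^ (S (2 * n - 1)) * (w - z))) (- x) x (- H) H)%C = (F lam * J)%C).
  { unfold J. rewrite <- RectInt_scal.
    - apply RectInt_ext; try lra. intros w hw. destruct (hdist w hw) as [w0 wz]. unfold g, amplitude, f.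
      replace (S (2 * n - 1)) with (2 * n)%nat by lia. replace (w - 0)%C with w by ring.
      assert (q1 := Csub_neq_0 _ _ wz). assert (q2 := Cpow_nz w (2 * n) w0). field. repeat split; assumption.
    - lra.
    - lra.
    - intros w hw. destruct (hdist w hw) as [w0 wz]. apply ex_derive_continuous_C. unfold g.
      apply ex_derive_div_C; [now apply Csub_neq_0 | now apply (ex_derive_amplitude F phi sg lam c n hent good)|].
      apply ex_derive_minus_C; [apply ex_derive_id_C | apply ex_derive_const_C]. }
  exists (J / (2 * PI * Ci))%C. split.
  - rewrite (taylor_poly_scale F lam (2 * n - 1) z hent). fold f.
    assert (e : (2 * PI * Ci * (F (lam * z) * chi z - taylor_at f 0 (2 * n - 1) z) = z ^ (2 * n) * (F lam * J))%C).
    { rewrite <- eR. replace (z ^ (2 * n))%C with ((z - 0) ^ (S (2 * n - 1)))%C.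
      2: { replace (S (2 * n - 1)) with (2 * n)%nat by lia. f_equal. ring. }
      destruct hchi as [[_ [q ->]]|[q ->]].
      - rewrite <- taylor_remainder_out with (f := f) (x1 := (- x)) (x2 := x) (y1 := (- H)) (y2 := H); trivial.
        + ring.
        + intros [hh _]. apply Rabs_le in hh. lra.
      - rewrite <- taylor_remainder_in with (f := f) (x1 := (- x)) (x2 := x) (y1 := (- H)) (y2 := H); trivial.
        + unfold f. ring.
        + assert (k1 := Rabs_lt_between (Re z) x). assert (k2 := Rabs_lt_between (Im z) H). split; [now apply k1 | apply k2; lra]. }
    assert (n1 := Ci_neq_0). assert (n2 := PIC_neq_0).
    transitivity (2 * PI * Ci * (F (lam * z) * chi z - taylor_at f 0 (2 * n - 1) z) / (2 * PI * Ci))%C; [field; split; assumption|].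
    rewrite e. field. split; assumption.
  - set (cp := cauchy_pair z 1) in *. set (T := (cp * RtoC (sqrt PI / (s * c)))%C) in *.
    assert (sp : 0 < sqrt PI) by apply sqrt_lt_R0, PI_RGT_0.
    assert (spp : sqrt PI * sqrt PI = PI) by (apply sqrt_sqrt; left; apply PI_RGT_0).
    assert (n1 : (1 - z)%C <> 0%C).
    { intros e. apply Csub_eq_0 in e. rewrite <- e in z1. unfold Cminus in z1. rewrite Cplus_opp_r, Cmod_0 in z1. lra. }
    assert (n2 : (1 + z)%C <> 0%C).
    { intros e. replace (z + 1)%C with (1 + z)%C in z2 by ring. rewrite e, Cmod_0 in z2. lra. }
    assert (n4 := Ci_neq_0).
    (* At s = 1 the folded kernel is 2 / (1 - z^2); with the Gaussian factor sqrt PI / (sqrt n c)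
       this is the explicit leading term [H0]. *)
    assert (ecp : (RtoC (/ (sqrt PI * c)) / (1 - z ^ 2))%C = (s * (Ci * T) / (2 * PI * Ci))%C).
    { unfold T, cp, cauchy_pair. replace (1 - z ^ 2)%C with ((1 - z) * (1 + z))%C by (simpl; ring).
      replace (RtoC PI) with (sqrt PI * sqrt PI)%C by (rewrite <- RtoC_mult, spp; reflexivity).
      assert (m4 : 0 < sqrt PI * c) by (apply Rmult_lt_0_compat; lra).
      assert (m5 : 0 < s * c) by (apply Rmult_lt_0_compat; lra).
      rewrite RtoC_inv, RtoC_div by lra. rewrite !RtoC_mult.
      assert (m1 : RtoC (sqrt PI) <> 0%C) by (apply RtoC_neq_0; lra).
      assert (m2 : RtoC s <> 0%C) by (apply RtoC_neq_0; lra). assert (m3 : RtoC c <> 0%C) by (apply RtoC_neq_0; lra).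
      field. repeat split; assumption. }
    rewrite ecp, eJ. set (Ho := (IntH g (- H) (- x) x - IntH g H (- x) x)%C) in *.
    replace (s * ((Ho + Ci * V) / (2 * PI * Ci)) - s * (Ci * T) / (2 * PI * Ci))%C
      with (s * (Ho + Ci * (V - T)) / (2 * PI * Ci))%C by (field; split; [assumption | apply PIC_neq_0]).
    rewrite Cmod_div by apply two_pi_i_neq_0. rewrite Cmod_two_pi_i, Cmod_mult, Cmod_RtoC_pos by lra.
    assert (b : Cmod (Ho + Ci * (V - T)) <= (Cv + 8) / (INR n * s)).
    { eapply Rle_trans; [apply Cmod_triangle|]. rewrite Cmod_mult, Cmod_Ci, Rmult_1_l.
      replace ((Cv + 8) / (INR n * s)) with (8 / (INR n * s) + Cv / (INR n * s)) by (field; lra). lra. }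
    assert (hpi := PI2_3_2). unfold PI2 in hpi.
    apply Rle_trans with (s * ((Cv + 8) / (INR n * s)) / 1).
    + assert (0 <= s * Cmod (Ho + Ci * (V - T))) by (apply Rmult_le_pos; [lra | apply Cmod_ge_0]).
      unfold Rdiv at 1 2. apply Rmult_le_compat; [assumption | left; apply Rinv_0_lt_compat; lra | |].
      * apply Rmult_le_compat_l; lra.
      * apply Rinv_le_contravar; lra.
    + right. field. lra.
Qed.

(** * The neighbourhood of the saddle point *)

Lemma ex_derive_taylor_poly (F : C -> C) (m : nat) (z : C) : ex_derive (taylor_poly m F) z.
Proof.
  assert (t : forall k, ex_derive (fun z => C_derive_n F k 0 / INR (fact k) * z ^ k)%C z).
  { intros k. apply ex_derive_mult_C; [apply ex_derive_const_C | apply ex_derive_pow_C, ex_derive_id_C]. }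
  induction m as [|m IH].
  - apply (ex_derive_locally_ext (fun z => C_derive_n F 0 0 / INR (fact 0) * z ^ 0)%C _ z 1 Rlt_0_1); [|apply t].
    intros s _. unfold taylor_poly. now rewrite sum_O.
  - apply (ex_derive_locally_ext (fun z => taylor_poly m F z + C_derive_n F (S m) 0 / INR (fact (S m)) * z ^ (S m))%C
      _ z 1 Rlt_0_1).
    + intros s _. unfold taylor_poly. now rewrite sum_n_C_S.
    + now apply ex_derive_plus_C.
Qed.

(** The expansion of erfc at infinity changes by the constant 2 between the half-planes, which
    matches the jump of [chi]. Where the sign of Re zeta and the value x disagree, the discrepancy
    is multiplied by exp (zeta^2), assumed to be at most [m] there. *)
Lemma erfc_switch (zeta x : C) (m : R) : zeta <> 0%C -> 0 <= m ->
  (x = 1%C /\ (Re zeta < 0 \/ Cmod (Cexp (zeta ^ 2)) <= m)) \/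
  (x = 0%C /\ (0 <= Re zeta \/ Cmod (Cexp (zeta ^ 2)) <= m)) ->
  Cmod (Cexp (zeta ^ 2) * (1 / 2 * Cerfc zeta - x) - 1 / (2 * sqrt PI * zeta)) <= / Cmod zeta ^ 3 + m.
Proof.
  intros h0 hm hx.
  assert (sp : RtoC (sqrt PI) <> 0%C). { apply RtoC_neq_0. generalize (sqrt_lt_R0 PI PI_RGT_0). lra. }
  assert (hpz : 0 < Cmod zeta) by (now apply Cmod_gt_0).
  assert (half : forall A : C, Cmod A <= 2 / Cmod zeta ^ 3 -> Cmod (1 / 2 * A) <= / Cmod zeta ^ 3).
  { intros A hA. rewrite Cmod_mult. replace (Cmod (1 / 2)) with (1 / 2).
    - assert (hc3 : 0 < Cmod zeta ^ 3) by (now apply pow_lt). unfold Rdiv in *. lra.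
    - rewrite <- RtoC_div by lra. rewrite Cmod_RtoC_pos; lra. }
  set (q := Cexp (zeta ^ 2)) in *.
  destruct (Rle_lt_dec 0 (Re zeta)) as [hr|hr].
  - assert (b := half _ (erfc_asym zeta hr h0)). fold q in b.
    replace (q * (1 / 2 * Cerfc zeta - x) - 1 / (2 * sqrt PI * zeta))%C
      with (1 / 2 * (q * Cerfc zeta - 1 / (sqrt PI * zeta)) + - (q * x))%C by (field; split; assumption).
    eapply Rle_trans; [apply Cmod_triangle|]. apply Rplus_le_compat; [exact b|].
    rewrite Cmod_opp, Cmod_mult. destruct hx as [[-> [k|k]]|[-> _]].
    + lra.
    + rewrite Cmod_1. lra.
    + rewrite Cmod_0. lra.
  - assert (h0' : (- zeta)%C <> 0%C). { intros e. apply h0. replace zeta with (- - zeta)%C by ring. rewrite e. ring. }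
    assert (b := erfc_asym (- zeta) ltac:(rewrite Re_opp; lra) h0'). rewrite (Cmod_opp zeta) in b. apply half in b.
    replace ((- zeta) ^ 2)%C with (zeta ^ 2)%C in b by (simpl; ring). rewrite Cerfc_opp in b. fold q in b.
    replace (q * (1 / 2 * Cerfc zeta - x) - 1 / (2 * sqrt PI * zeta))%C
      with (- (1 / 2 * (q * (2 - Cerfc zeta) - 1 / (sqrt PI * - zeta))) + q * (1 - x))%C by (field; repeat split; assumption).
    eapply Rle_trans; [apply Cmod_triangle|]. rewrite Cmod_opp. apply Rplus_le_compat; [exact b|].
    rewrite Cmod_mult. destruct hx as [[-> _]|[-> [k|k]]].
    + replace (1 - 1)%C with (RtoC 0) by ring. rewrite Cmod_0. lra.
    + lra.
    + replace (1 - 0)%C with (RtoC 1) by ring. rewrite Cmod_1. lra.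
Qed.

(** The inner formula solved for the error. It does not contain [chi], so it is analytic across the
    line Re z = 1 and beyond the disc where it is finally used. *)
Definition inner_error (F sg : C -> C) (lam : R) (n : nat) (z : C) : C :=
  (sqrt (INR n) * (amplitude F lam n z * (1 / 2 * Cerfc (Ci * sqrt (INR n) * local_w0 sg z))
     - taylor_poly (2 * n - 1) F (lam * z) / (F lam * z ^ (2 * n))))%C.

(** A weak maximum principle straight from Cauchy's formula. The constant 6 has no importance;
    restricting to half the side is enough here. *)
Lemma maximum_square (f : C -> C) (p z : C) (R0 B : R) : 0 < R0 -> hol_square f p R0 ->
  (forall s, on_bd (Re p - R0) (Re p + R0) (Im p - R0) (Im p + R0) s -> Cmod (f s) <= B) ->
  Cmod (z - p) <= R0 / 2 -> Cmod (f z) <= 6 * B.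
Proof.
  intros hR hol hB hz.
  assert (hin := disk_in_square p z R0 ltac:(lra)).
  assert (e := cauchy_formula f _ _ _ _ z hin hol).
  assert (hB0 : 0 <= B).
  { eapply Rle_trans; [apply Cmod_ge_0 | apply (hB (Re p - R0, Im p))]. apply bd_l; lra. }
  assert (hd : forall s, on_bd (Re p - R0) (Re p + R0) (Im p - R0) (Im p + R0) s -> R0 / 2 <= Cmod (s - z)).
  { intros s hs. assert (k := square_dist p s R0 hR hs). assert (t := Cmod_sub_triangle s z p). lra. }
  assert (b : Cmod (RectInt (fun s => f s / (s - z))%C (Re p - R0) (Re p + R0) (Im p - R0) (Im p + R0)) <=
    2 * (B / (R0 / 2)) * ((Re p + R0 - (Re p - R0)) + (Im p + R0 - (Im p - R0)))).
  { apply RectInt_bound; try lra.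
    - intros s hs. apply ex_derive_continuous_C, ex_derive_div_C.
      + apply Cmod_pos_neq. specialize (hd s hs). lra.
      + apply hol, hs.
      + apply ex_derive_minus_C; [apply ex_derive_id_C | apply ex_derive_const_C].
    - intros s hs. specialize (hd s hs). rewrite Cmod_div by (apply Cmod_pos_neq; lra).
      unfold Rdiv. apply Rmult_le_compat; [apply Cmod_ge_0 | left; apply Rinv_0_lt_compat; lra | now apply hB |].
      apply Rinv_le_contravar; lra. }
  rewrite e, Cmod_mult, Cmod_two_pi_i in b.
  replace (2 * (B / (R0 / 2)) * ((Re p + R0 - (Re p - R0)) + (Im p + R0 - (Im p - R0)))) with (16 * B) in b by (field; lra).
  assert (hpi := PI2_3_2). unfold PI2 in hpi. generalize (Cmod_ge_0 (f z)). nra.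
Qed.

(* Where [chi] and the side of the imaginary axis on which [zeta] lies disagree, [v] is close to the
   imaginary axis, so [v sg] squared has a large negative real part. *)
Lemma switch_gap (v s : C) : Cmod (s - 1) <= / 8 ->
  (Re v <= 0 /\ 0 <= Re (v * s) \/ 0 <= Re v /\ Re (v * s) <= 0) -> Re ((v * s) ^ 2) <= - (Cmod v ^ 2 / 2).
Proof.
  intros hs hv.
  assert (d : Rabs (Re (v * s) - Re v) <= Cmod v / 8).
  { replace (Re (v * s) - Re v) with (Re (v * (s - 1))%C) by (reim; ring).
    eapply Rle_trans; [apply re_le_Cmod|]. rewrite Cmod_mult. generalize (Cmod_ge_0 v). nra. }
  assert (m1 : 7 / 8 <= Cmod s).
  { assert (k := Cmod_sub_ge 1 (1 - s)). replace (1 - (1 - s))%C with s in k by ring.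
    rewrite Cmod_1, Cmod_sub_sym in k. lra. }
  assert (m2 : 7 / 8 * Cmod v <= Cmod (v * s)) by (rewrite Cmod_mult; generalize (Cmod_ge_0 v); nra).
  assert (r1 : Rabs (Re (v * s)) <= Cmod v / 8).
  { apply Rabs_le_between in d. apply Rabs_le. lra. }
  set (u := (v * s)%C) in *.
  assert (e : Re (u ^ 2)%C = 2 * Re u ^ 2 - Cmod u ^ 2).
  { rewrite Cmod2_alt. simpl. reim. ring. }
  rewrite e. assert (q1 : Re u ^ 2 <= (Cmod v / 8) ^ 2) by (rewrite <- (pow2_abs (Re u)); apply pow_incr; split; [apply Rabs_pos | exact r1]).
  assert (q2 : (7 / 8 * Cmod v) ^ 2 <= Cmod u ^ 2) by (apply pow_incr; split; [generalize (Cmod_ge_0 v); lra | exact m2]).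
  generalize (pow2_ge_0 (Cmod v)). nra.
Qed.

Lemma ex_derive_inner_error (F phi sg : C -> C) (lam c : R) (n : nat) (z : C) : entire F ->
  near_sigma F phi sg lam c n -> Cmod (z - 1) < rho / 2 -> ex_derive (inner_error F sg lam n) z.
Proof.
  intros hent good hz. assert (good' := good). destruct good' as (_ & _ & _ & _ & _ & _ & _ & S4 & _).
  assert (z0 : z <> 0%C).
  { intros e. apply half_plane_near_1 in hz. rewrite e, Re_RtoC in hz. unfold rho in hz. lra. }
  assert (Fl := F_lam_neq_0 F phi sg lam c n good).
  unfold inner_error. apply ex_derive_mult_C; [apply ex_derive_const_C|]. apply ex_derive_minus_C.
  - apply ex_derive_mult_C; [now apply (ex_derive_amplitude F phi sg lam c n hent good)|].
    apply ex_derive_mult_C; [apply ex_derive_const_C|].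
    apply (ex_derive_comp_C Cerfc (fun z => Ci * sqrt (INR n) * local_w0 sg z)%C); [apply ex_derive_Cerfc|].
    apply ex_derive_mult_C; [apply ex_derive_const_C | now apply ex_derive_local_w0].
  - apply ex_derive_div_C.
    + apply Cmult_neq_0; [exact Fl | now apply Cpow_nz].
    + apply (ex_derive_comp_C (taylor_poly (2 * n - 1) F) (fun z => lam * z)%C); [apply ex_derive_taylor_poly|].
      apply ex_derive_mult_C; [apply ex_derive_const_C | apply ex_derive_id_C].
    + apply ex_derive_mult_C; [apply ex_derive_const_C | apply ex_derive_pow_C, ex_derive_id_C].
Qed.

(** This is z - 1 times H0 + 1 / (2 i sqrt PI w). It vanishes at 1 because sg 1 = c, which is the
    cancellation of the two poles. *)
Definition regular_part (sg : C -> C) (c : R) (z : C) : C :=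
  (RtoC (/ (2 * sqrt PI)) * (/ sg z - 2 / (c * (1 + z))))%C.

Lemma sqrt_PI_ge_1 : 1 <= sqrt PI.
Proof. rewrite <- sqrt_1. apply sqrt_le_1_alt. assert (h := PI2_3_2). unfold PI2 in h. lra. Qed.

(** The divided difference of [regular_part] at 1 extends H0 + 1 / (2 i sqrt PI w) analytically over
    the pole, with a bound independent of [n]. *)
Lemma regular_quotient (F phi sg : C -> C) (lam c : R) (n : nat) : near_sigma F phi sg lam c n ->
  exists g : C -> C, (forall z, Cmod (z - 1) < rho / 8 -> ex_derive g z) /\
    (forall z, Cmod (z - 1) <= rho / 16 -> Cmod (g z) <= 64 / rho) /\
    (forall z, Cmod (z - 1) < rho / 8 -> z <> 1%C ->
       g z = (RtoC (/ (sqrt PI * c)) / (1 - z ^ 2) + 1 / (2 * Ci * sqrt PI * local_w0 sg z))%C).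
Proof.
  intros (_ & _ & _ & _ & _ & S2 & S3 & S4 & S5 & hc). assert (hr := rho_pos). assert (hp := sqrt_PI_ge_1).
  assert (sq : forall s, in_rect (Re 1 - rho / 8) (Re 1 + rho / 8) (Im 1 - rho / 8) (Im 1 + rho / 8) s -> Cmod (s - 1) <= rho / 4).
  { intros s [p q]. rewrite Re_RtoC in p. rewrite Im_RtoC in q.
    eapply Rle_trans; [apply Cmod_le_re_im|]. rewrite Re_minus, Im_minus, Re_RtoC, Im_RtoC, Rminus_0_r.
    assert (Rabs (Re s - 1) <= rho / 8) by (apply Rabs_le; lra). assert (Rabs (Im s) <= rho / 8) by (apply Rabs_le; lra). lra. }
  assert (sgb : forall s, Cmod (s - 1) <= rho / 4 -> 7 / 8 <= Cmod (sg s)).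
  { intros s hs. specialize (S2 s ltac:(lra)). assert (a := Cmod_sub_ge 1 (1 - sg s)).
    replace (1 - (1 - sg s))%C with (sg s) in a by ring. rewrite Cmod_1, Cmod_sub_sym in a. lra. }
  assert (onb : forall s, Cmod (s - 1) <= rho / 4 -> 7 / 4 <= Cmod (1 + s)).
  { intros s hs. eapply Rle_trans; [|apply Re_le_Cmod]. rewrite Re_plus, Re_RtoC.
    assert (k := half_plane_near_1 s (rho / 2) ltac:(lra)). unfold rho in k. lra. }
  assert (cn : RtoC c <> 0%C) by (apply RtoC_neq_0; lra).
  assert (spn : RtoC (sqrt PI) <> 0%C) by (apply RtoC_neq_0; lra).
  destruct (divided_difference (regular_part sg c) 1 (rho / 8) 2 0) as (g & g1 & g2 & _ & g4 & _).
  - lra.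
  - intros s hs. apply sq in hs. specialize (sgb s hs). specialize (onb s hs). unfold regular_part.
    apply ex_derive_mult_C; [apply ex_derive_const_C|]. apply ex_derive_minus_C.
    + destruct (S4 s ltac:(lra)) as [l hl]. eexists. apply is_derive_inv_C; [apply Cmod_pos_neq; lra | exact hl].
    + apply ex_derive_div_C; [apply Cmult_neq_0; [exact cn | apply Cmod_pos_neq; lra] | apply ex_derive_const_C|].
      apply ex_derive_mult_C; [apply ex_derive_const_C|]. apply ex_derive_plus_C; [apply ex_derive_const_C | apply ex_derive_id_C].
  - intros s [hs _]. apply sq in hs. specialize (sgb s hs). specialize (onb s hs). unfold regular_part.
    rewrite Cmod_mult, Cmod_RtoC_pos by (left; apply Rinv_0_lt_compat; lra).
    assert (b1 : / (2 * sqrt PI) <= / 2) by (apply Rinv_le_contravar; lra).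
    assert (b0 : 0 < / (2 * sqrt PI)) by (apply Rinv_0_lt_compat; lra).
    assert (b2 : Cmod (/ sg s - 2 / (c * (1 + s))) <= 4).
    { eapply Rle_trans; [apply Cmod_sub_le|]. rewrite Cmod_inv by (apply Cmod_pos_neq; lra).
      rewrite Cmod_div by (apply Cmult_neq_0; [exact cn | apply Cmod_pos_neq; lra]).
      rewrite Cmod_mult, !Cmod_RtoC_pos by lra.
      assert (q1 : / Cmod (sg s) <= / (7 / 8)) by (apply Rinv_le_contravar; lra).
      assert (q2 : / (c * Cmod (1 + s)) <= / 1) by (apply Rinv_le_contravar; nra).
      rewrite Rinv_1 in q2. unfold Rdiv at 1. lra. }
    generalize (Cmod_ge_0 (/ sg s - 2 / (c * (1 + s)))). nra.
  - exists g. split; [exact g4|]. split.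
    + intros z hz. eapply Rle_trans; [apply g2; lra|]. right. simpl. field. lra.
    + intros z hz hne. assert (e := g1 z hz).
      assert (r1 : regular_part sg c 1 = 0%C). { unfold regular_part. rewrite S5. field; assumption. }
      unfold taylor_at in e. rewrite sum_O in e. simpl (C_derive_n _ 0 _) in e. rewrite r1 in e.
      assert (vn := Csub_neq_0 _ _ hne).
      assert (sn : sg z <> 0%C) by (apply Cmod_pos_neq; specialize (sgb z ltac:(lra)); lra).
      assert (on : (1 + z)%C <> 0%C) by (apply Cmod_pos_neq; specialize (onb z ltac:(lra)); lra).
      assert (in0 := Ci_neq_0).
      assert (e2 : g z = (regular_part sg c z / (z - 1))%C).
      { rewrite e. simpl. field. exact vn. }
      rewrite e2. unfold regular_part, local_w0.
      replace (1 - z ^ 2)%C with (- (z - 1) * (1 + z))%C by (simpl; ring).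
      rewrite !RtoC_inv by nra. rewrite !RtoC_mult.
      assert (i2 : (Ci * Ci = - (1))%C) by (apply C_ext; reim; ring).
      replace (2 * Ci * sqrt PI * (- Ci * ((z - 1) * sg z)))%C with (- (Ci * Ci) * (2 * sqrt PI * ((z - 1) * sg z)))%C by ring.
      rewrite i2. field. repeat split; assumption.
Qed.

(** On the boundary of the square of half-side 4 delta the outer formula and the expansion of erfc
    are both valid, so the error differs there from the regular function [g] by O(1 / n). The
    neighbourhood of 1 lies within 2 delta, half of that side, and the maximum principle applies. *)
Lemma inside_bound (delta K0 : R) : 0 < delta < rho / 64 -> 0 <= K0 -> exists B, 0 <= B /\
  forall (F phi sg : C -> C) (lam c X0 M Y : R) (n k : nat),
  growth_data F X0 K0 M Y k -> 4 * X0 <= lam -> (k < 2 * n)%nat -> near_sigma F phi sg lam c n ->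
  forall z, local_B sg delta z ->
  Cmod (inner_error F sg lam n z) <= B /\
  (z <> 1%C -> Cmod (inner_error F sg lam n z -
     (RtoC (/ (sqrt PI * c)) / (1 - z ^ 2) + 1 / (2 * Ci * sqrt PI * local_w0 sg z))) <= B / INR n).
Proof.
  intros hd hK0. assert (hr := rho_pos).
  destruct (outside_bound (delta / 2) K0 ltac:(lra) hK0) as (Bo & hBo & out).
  assert (hd3 : 0 < / delta ^ 3) by (apply Rinv_0_lt_compat, pow_lt; lra).
  assert (hd6 : 0 < / delta ^ 6) by (apply Rinv_0_lt_compat, pow_lt; lra).
  (* Three contributions: the outer estimate, the cubic remainder of erfc at |zeta| >= sqrt n delta,
     and the exponentially small mismatch between [chi] and the half-plane of zeta. *)
  set (S := Bo + / delta ^ 3 + / delta ^ 6).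
  assert (h64 : 0 < 64 / rho) by (apply Rdiv_lt_0_compat; lra).
  exists (6 * S + 64 / rho). split; [unfold S; lra|].
  intros F phi sg lam c X0 M Y n k gd hlam4 hk good z hz.
  specialize (out F phi sg lam c X0 M Y n k gd hlam4 hk good).
  destruct gd as (hent & _).
  destruct (regular_quotient F phi sg lam c n good) as (g & g1 & g2 & g3).
  assert (good' := good). destruct good' as (hn & _ & _ & _ & S1 & S2 & S3 & S4 & S5 & hc).
  assert (hN : 1 <= INR n) by (change 1 with (INR 1); now apply le_INR).
  set (s := sqrt (INR n)).
  assert (s1 : 1 <= s) by (unfold s; rewrite <- sqrt_1; apply sqrt_le_1_alt; exact hN).
  assert (ss : s * s = INR n) by (apply sqrt_sqrt; lra).
  assert (Fl := F_lam_neq_0 F phi sg lam c n good).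
  (* On that boundary |z - 1| >= 4 delta, and [switch_gap] gives the exponent - n (4 delta)^2 /
     2. *)
  set (m := exp (- (8 * INR n * delta ^ 2))).
  assert (hm : s * m <= / delta ^ 6 / INR n).
  { assert (q := exp_ge_cube (8 * INR n * delta ^ 2) ltac:(apply Rmult_le_pos; [lra | apply pow2_ge_0])).
    assert (hp : 0 < (8 * INR n * delta ^ 2 / 3) ^ 3).
    { apply pow_lt, Rdiv_lt_0_compat; [|lra]. apply Rmult_lt_0_compat; [lra | apply pow_lt; lra]. }
    assert (q2 : m <= / (8 * INR n * delta ^ 2 / 3) ^ 3).
    { unfold m. rewrite exp_Ropp. now apply Rinv_le_contravar. }
    apply Rle_trans with (INR n * / (8 * INR n * delta ^ 2 / 3) ^ 3).
    - apply Rmult_le_compat; [lra | left; apply exp_pos | nra | exact q2].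
    - replace (INR n * / (8 * INR n * delta ^ 2 / 3) ^ 3) with (/ delta ^ 6 / INR n * (27 / 512 * / INR n)) by (field; lra).
      rewrite <- Rmult_1_r. apply Rmult_le_compat_l; [apply Rdiv_le_0_compat; lra|].
      assert (/ INR n <= 1) by (rewrite <- Rinv_1; apply Rinv_le_contravar; lra). lra. }
  assert (sq : forall p, in_rect (Re 1 - 4 * delta) (Re 1 + 4 * delta) (Im 1 - 4 * delta) (Im 1 + 4 * delta) p ->
    Cmod (p - 1) <= 8 * delta).
  { intros p [a b]. rewrite Re_RtoC in a. rewrite Im_RtoC in b.
    eapply Rle_trans; [apply Cmod_le_re_im|]. rewrite Re_minus, Im_minus, Re_RtoC, Im_RtoC, Rminus_0_r.
    assert (Rabs (Re p - 1) <= 4 * delta) by (apply Rabs_le; lra). assert (Rabs (Im p) <= 4 * delta) by (apply Rabs_le; lra). lra. }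
  set (D := fun p => (inner_error F sg lam n p - g p)%C).
  assert (bD : Cmod (D z) <= 6 * (S / INR n)).
  { apply (maximum_square D 1 z (4 * delta)); [lra | | |].
    - intros p hp. apply sq in hp. apply ex_derive_minus_C; [|apply g1; lra].
      apply (ex_derive_inner_error F phi sg lam c); trivial. lra.
    - intros p hp. assert (p1 := square_dist 1 p (4 * delta) ltac:(lra) hp). destruct hp as [hp _]. apply sq in hp.
      assert (rp := half_plane_near_1 p (1 / 2) ltac:(unfold rho in hd; lra)).
      destruct (out p ltac:(lra)) as (Q & eQ & bQ).
      { eapply Rle_trans; [|apply Re_le_Cmod]. rewrite Re_plus, Re_RtoC. unfold rho in hd. lra. }
      set (v := (p - 1)%C) in *.
      assert (vn : v <> 0%C) by (apply Cmod_pos_neq; lra).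
      assert (p0 : p <> 0%C) by (intros e; rewrite e, Re_RtoC in rp; lra).
      assert (sb := S2 p ltac:(fold v; lra)).
      assert (m1 : 7 / 8 <= Cmod (sg p)).
      { assert (q := Cmod_sub_ge 1 (1 - sg p)). replace (1 - (1 - sg p))%C with (sg p) in q by ring.
        rewrite Cmod_1, Cmod_sub_sym in q. lra. }
      set (zeta := (Ci * s * local_w0 sg p)%C).
      assert (i2 : (Ci * Ci = - (1))%C) by (apply C_ext; reim; ring).
      assert (ez : zeta = (s * (v * sg p))%C).
      { unfold zeta, local_w0. fold v.
        replace (Ci * s * (- Ci * (v * sg p)))%C with (- (Ci * Ci) * (s * (v * sg p)))%C by ring. rewrite i2. ring. }
      assert (sgn : sg p <> 0%C) by (apply Cmod_pos_neq; lra).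
      assert (sn : RtoC s <> 0%C) by (apply RtoC_neq_0; lra).
      assert (zn : zeta <> 0%C) by (rewrite ez; repeat apply Cmult_neq_0; assumption).
      assert (mz : s * delta <= Cmod zeta).
      { rewrite ez, !Cmod_mult, Cmod_RtoC_pos by lra. apply Rmult_le_compat_l; [lra|]. nra. }
      assert (ez2 : (zeta ^ 2 = INR n * (v * sg p) ^ 2)%C) by (rewrite ez, <- ss, RtoC_mult; simpl; ring).
      assert (eh : amplitude F lam n p = Cexp (zeta ^ 2)).
      { rewrite (amplitude_exp F phi sg lam c n good) by lra. rewrite S1 by (fold v; lra). fold v. rewrite ez2.
        f_equal. simpl. ring. }
      assert (gap : (Re v <= 0 /\ 0 <= Re (v * sg p) \/ 0 <= Re v /\ Re (v * sg p) <= 0) -> Cmod (Cexp (zeta ^ 2)) <= m).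
      { intros hh. rewrite Cmod_Cexp. apply Rle_exp. rewrite ez2, Re_mult, Re_RtoC, Im_RtoC, Rmult_0_l, Rminus_0_r.
        assert (q := switch_gap v (sg p) sb hh). assert (q2 : (4 * delta) ^ 2 <= Cmod v ^ 2) by (apply pow_incr; lra). nra. }
      assert (erz : Re zeta = s * Re (v * sg p)) by (rewrite ez, Re_mult, Re_RtoC, Im_RtoC; ring).
      assert (sw := erfc_switch zeta (chi p) m zn (Rlt_le _ _ (exp_pos _))).
      assert (hsw : Cmod (Cexp (zeta ^ 2) * (1 / 2 * Cerfc zeta - chi p) - 1 / (2 * sqrt PI * zeta)) <= / Cmod zeta ^ 3 + m).
      { apply sw. assert (rv : Re v = Re p - 1) by (unfold v; now rewrite Re_minus, Re_RtoC).
        unfold chi. destruct (Rlt_dec (Rabs (Re p)) 1) as [hl|hl]; rewrite Rabs_pos_eq in hl by lra.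
        - left. split; [reflexivity|]. destruct (Rlt_le_dec (Re zeta) 0) as [hz0|hz0]; [now left|]. right. apply gap.
          left. split; [lra|]. rewrite erz in hz0. apply Rmult_le_reg_l with s; lra.
        - right. split; [reflexivity|]. destruct (Rle_lt_dec 0 (Re zeta)) as [hz0|hz0]; [now left|]. right. apply gap.
          right. split; [lra|]. rewrite erz in hz0. apply Rmult_le_reg_l with s; lra. }
      assert (pn : p <> 1%C) by (intros e; apply vn; unfold v; rewrite e; ring).
      assert (spn : RtoC (sqrt PI) <> 0%C) by (apply RtoC_neq_0; generalize sqrt_PI_ge_1; lra).
      assert (in0 := Ci_neq_0).
      assert (wn : local_w0 sg p <> 0%C).
      { intros e. apply zn. unfold zeta. rewrite e. ring. }
      assert (eT : (taylor_poly (2 * n - 1) F (lam * p) / (F lam * p ^ (2 * n)))%C = (amplitude F lam n p * chi p - Q)%C).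
      { replace (taylor_poly (2 * n - 1) F (lam * p)) with
          (F (lam * p) * chi p - (F (lam * p) * chi p - taylor_poly (2 * n - 1) F (lam * p)))%C by ring.
        rewrite eQ. unfold amplitude. assert (pp := Cpow_nz p (2 * n) p0). field. split; assumption. }
      (* The pole terms cancel: [H0] meets the main term of the outer estimate and 1 / (2 i sqrt PI
         w) that of erfc, leaving two small errors. *)
      assert (eD : D p = ((s * Q - RtoC (/ (sqrt PI * c)) / (1 - p ^ 2)) +
         s * (Cexp (zeta ^ 2) * (1 / 2 * Cerfc zeta - chi p) - 1 / (2 * sqrt PI * zeta)))%C).
      { unfold D. rewrite g3 by (trivial; fold v; lra). unfold inner_error. fold s zeta. rewrite eT, eh.
        assert (e1 : (1 / (2 * Ci * sqrt PI * local_w0 sg p) = s * (1 / (2 * sqrt PI * zeta)))%C).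
        { unfold zeta. field. repeat split; assumption. }
        rewrite e1. ring. }
      rewrite eD. eapply Rle_trans; [apply Cmod_triangle|]. rewrite Cmod_mult, (Cmod_RtoC_pos s) by lra.
      apply Rle_trans with (Bo / INR n + s * (/ Cmod zeta ^ 3 + m)).
      + apply Rplus_le_compat; [exact bQ|]. apply Rmult_le_compat_l; [lra | exact hsw].
      + assert (hz3 : s * / Cmod zeta ^ 3 <= / delta ^ 3 / INR n).
        { apply Rle_trans with (s * / (s * delta) ^ 3).
          - apply Rmult_le_compat_l; [lra|]. apply Rinv_le_contravar; [apply pow_lt; nra|]. apply pow_incr. nra.
          - rewrite <- ss. right. field. lra. }
        unfold S. replace ((Bo + / delta ^ 3 + / delta ^ 6) / INR n)
          with (Bo / INR n + / delta ^ 3 / INR n + / delta ^ 6 / INR n) by (field; lra). lra.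
    - left. replace (4 * delta / 2) with (2 * delta) by field. apply (local_B_near sg delta S2 ltac:(lra) z hz). }
  assert (hz2 : Cmod (z - 1) < 2 * delta).
  { apply (local_B_near sg delta S2 ltac:(lra) z hz). }
  assert (hS : 0 <= S) by (unfold S; lra).
  assert (hSn : S / INR n <= S).
  { unfold Rdiv. rewrite <- (Rmult_1_r S) at 2. apply Rmult_le_compat_l; [exact hS|].
    rewrite <- Rinv_1. apply Rinv_le_contravar; lra. }
  split.
  - replace (inner_error F sg lam n z) with (D z + g z)%C by (unfold D; ring).
    eapply Rle_trans; [apply Cmod_triangle|]. assert (q := g2 z ltac:(lra)). lra.
  - intros hne. rewrite <- g3 by (trivial; lra). eapply Rle_trans; [exact bD|].
    unfold Rdiv. assert (hi : 0 < / INR n) by (apply Rinv_0_lt_compat; lra).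
    rewrite Rmult_plus_distr_r, <- Rmult_assoc. assert (0 <= 64 * / rho * / INR n); [|lra].
    apply Rmult_le_pos; [unfold Rdiv in h64|]; lra.
Qed.

(** * The error term *)

Lemma chi_locally_constant (z : C) : ~ frontier S1 z ->
  exists d, 0 < d /\ forall s, Cmod (s - z) < d -> chi s = chi z.
Proof.
  intros h. apply not_all_ex_not in h. destruct h as [d h]. apply imply_to_and in h. destruct h as [hd h].
  exists d. split; [exact hd|]. intros s hs. unfold chi.
  assert (z0 : Cmod (z - z) < d) by (unfold Cminus; rewrite Cplus_opp_r, Cmod_0; exact hd).
  destruct (Rlt_dec (Rabs (Re s)) 1) as [a|a]; destruct (Rlt_dec (Rabs (Re z)) 1) as [b|b]; trivial; exfalso; apply h;
    split; solve [exists s; tauto | exists z; tauto].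
Qed.

Lemma frontier_outside (B : C -> Prop) (z : C) : ~ B z -> ~ frontier B z ->
  exists d, 0 < d /\ forall s, Cmod (s - z) < d -> ~ B s.
Proof.
  intros hz h. apply not_all_ex_not in h. destruct h as [d h]. apply imply_to_and in h. destruct h as [hd h].
  exists d. split; [exact hd|]. intros s hs hB. apply h. split; [now exists s|].
  exists z. split; [exact hz|]. unfold Cminus. now rewrite Cplus_opp_r, Cmod_0.
Qed.

(** Extends a bound over an isolated exceptional point, namely 0, where the error is defined by
    continuation. *)
Lemma Cmod_le_continuous (f : C -> C) (z : C) (d b : R) : 0 < d -> continuous f z ->
  (forall s, Cmod (s - z) < d -> s <> z -> Cmod (f s) <= b) -> Cmod (f z) <= b.
Proof.
  intros hd hc h. apply Rnot_lt_le. intros hlt.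
  destruct (proj1 (continuous_C _ _) hc (Cmod (f z) - b) ltac:(lra)) as (r & hr & k).
  set (t := Rmin (r / 2) (d / 2)). assert (ht : 0 < t) by (apply Rmin_pos; lra).
  assert (t1 : t <= r / 2) by apply Rmin_l. assert (t2 : t <= d / 2) by apply Rmin_r.
  set (s := (z + t)%C). assert (es : (s - z)%C = RtoC t) by (unfold s; ring).
  assert (ms : Cmod (s - z) = t) by (rewrite es, Cmod_RtoC_pos; lra).
  assert (k1 := k s ltac:(lra)). assert (k2 := h s ltac:(lra)).
  assert (hne : s <> z). { intros e. rewrite e in ms. unfold Cminus in ms. rewrite Cplus_opp_r, Cmod_0 in ms. lra. }
  specialize (k2 hne). assert (k3 := Cmod_sub_ge (f z) (f s)). rewrite (Cmod_sub_sym (f z) (f s)) in k3. lra.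
Qed.

Section Fixed.
Variables (F phi sg : C -> C) (lam c delta Bo Bi : R) (n : nat).
Hypotheses (hent : entire F) (hev : forall z, F (- z)%C = F z)
  (good : near_sigma F phi sg lam c n)
  (hright : forall z : C, 1 / 2 <= Re z -> right_of_zeros F lam z)
  (hphi2 : phi2 phi = RtoC (- (2 * c ^ 2)))
  (hdelta : 0 < delta < rho / 64)
  (out : forall z, delta / 2 <= Cmod (z - 1) -> delta / 2 <= Cmod (z + 1) ->
    exists Q : C, (F (lam * z) * chi z - taylor_poly (2 * n - 1) F (lam * z) = z ^ (2 * n) * F lam * Q)%C /\
    Cmod (sqrt (INR n) * Q - RtoC (/ (sqrt PI * c)) / (1 - z ^ 2)) <= Bo / INR n)
  (ins : forall z, local_B sg delta z ->
    Cmod (inner_error F sg lam n z) <= Bi /\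
    (z <> 1%C -> Cmod (inner_error F sg lam n z -
     (RtoC (/ (sqrt PI * c)) / (1 - z ^ 2) + 1 / (2 * Ci * sqrt PI * local_w0 sg z))) <= Bi / INR n)).

Let T (z : C) : C := taylor_poly (2 * n - 1) F (lam * z).
Let B1 := local_B sg delta.
Let B := B_both B1.
Let hr := rho_pos.

Let S2 (z : C) : Cmod (z - 1) <= rho / 2 -> Cmod (sg z - 1) <= / 8.
Proof. apply good. Qed.

Let hd16 : 0 < delta <= rho / 16. Proof. lra. Qed.

Let hN : 1 <= INR n.
Proof. destruct good as (hn & _). change 1 with (INR 1). now apply le_INR. Qed.

Let sN : RtoC (sqrt (INR n)) <> 0%C.
Proof. apply RtoC_neq_0. assert (h := sqrt_lt_R0 (INR n) ltac:(lra)). lra. Qed.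

Let Fl : F (RtoC lam) <> 0%C.
Proof. exact (F_lam_neq_0 F phi sg lam c n good). Qed.

(** Since phi''(1) = - 2 c^2, the prefactor 2 / sqrt (2 PI |phi''(1)|) is 1 / (sqrt PI c). *)
Lemma H0_near_sigma (z : C) : H0 phi z = (RtoC (/ (sqrt PI * c)) / (1 - z ^ 2))%C.
Proof.
  assert (hc : 7 / 8 <= c <= 9 / 8) by apply good. assert (hp := sqrt_PI_ge_1).
  unfold H0. rewrite hphi2, Cmod_R, Rabs_left by nra.
  replace (2 * PI * - - (2 * c ^ 2)) with ((2 * c) ^ 2 * PI) by ring.
  rewrite sqrt_mult, sqrt_pow2 by (try apply pow2_ge_0; generalize PI_RGT_0; nra).
  rewrite RtoC_inv by nra. rewrite !RtoC_mult. unfold Cdiv.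
  assert (cn : RtoC c <> 0%C) by (apply RtoC_neq_0; lra). assert (spn : RtoC (sqrt PI) <> 0%C) by (apply RtoC_neq_0; lra).
  set (i := (/ (1 - z ^ 2))%C). field. split; assumption.
Qed.

Lemma H0_even (z : C) : H0 phi (- z) = H0 phi z.
Proof. unfold H0. replace ((- z) ^ 2)%C with (z ^ 2)%C by (simpl; ring). reflexivity. Qed.

Let T_even (z : C) : T (- z) = T z.
Proof. unfold T. replace (lam * - z)%C with (- (lam * z))%C by ring. now apply taylor_poly_even. Qed.

Let pow_even (z : C) : ((- z) ^ (2 * n))%C = (z ^ (2 * n))%C.
Proof. rewrite !Cpow_mult_r. replace ((- z) ^ 2)%C with (z ^ 2)%C by (simpl; ring). reflexivity. Qed.

(** Near 0 the outer error divides by z^(2n). The Taylor remainder has exactly this factor, and the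
    remaining Cauchy integral over a fixed small square is analytic at 0 as well. *)
Let q (z : C) : C :=
  (sqrt (INR n) * (RectInt (fun s => amplitude F lam n s * / (s - z) ^ 1) (- (1 / 2)) (1 / 2) (- (1 / 2)) (1 / 2) / (2 * PI * Ci))
    - H0 phi z)%C.

(** The outer formula solved for the error. *)
Let outer (z : C) : C :=
  (sqrt (INR n) * (F (lam * z) * chi z - T z) / (z ^ (2 * n) * F lam) - H0 phi z)%C.

Let small (z : C) : Cmod z < 1 / 2 -> Rabs (Re z) < 1 / 2 /\ in_open_rect (- (1 / 2)) (1 / 2) (- (1 / 2)) (1 / 2) z.
Proof.
  intros h. assert (a := Rle_lt_trans _ _ _ (re_le_Cmod z) h). assert (b := Rle_lt_trans _ _ _ (im_le_Cmod z) h).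
  split; [exact a|]. apply Rabs_lt_between in a, b. split; lra.
Qed.

Let square_nonzero (s : C) : on_bd (- (1 / 2)) (1 / 2) (- (1 / 2)) (1 / 2) s -> s <> 0%C.
Proof. intros h. apply (in_open_rect_not_bd (- (1 / 2)) (1 / 2) (- (1 / 2)) (1 / 2)); [split; simpl; lra | exact h]. Qed.

Let q_outer (z : C) : Cmod z < 1 / 2 -> z <> 0%C -> outer z = q z.
Proof.
  intros hz z0. destruct (small z hz) as [hre hin]. unfold outer, q.
  set (f := fun w => F (lam * w)%C).
  assert (hf : hol_rect f (- (1 / 2)) (1 / 2) (- (1 / 2)) (1 / 2)).
  { intros w _. apply (ex_derive_comp_C F (fun w => lam * w)%C); [apply hent; exact I|].
    apply ex_derive_mult_C; [apply ex_derive_const_C | apply ex_derive_id_C]. }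
  assert (p0 : in_open_rect (- (1 / 2)) (1 / 2) (- (1 / 2)) (1 / 2) 0%C) by (split; simpl; lra).
  assert (e := taylor_remainder_in f _ _ _ _ 0%C hf p0 (2 * n - 1) z hin).
  unfold T. rewrite (taylor_poly_scale F lam (2 * n - 1) z hent). fold f.
  assert (hn : (1 <= n)%nat) by apply good.
  assert (eR : (RectInt (fun w => f w / ((w - 0) ^ (S (2 * n - 1)) * (w - z))) (- (1 / 2)) (1 / 2) (- (1 / 2)) (1 / 2))%C
    = (F lam * RectInt (fun s => amplitude F lam n s * / (s - z) ^ 1) (- (1 / 2)) (1 / 2) (- (1 / 2)) (1 / 2))%C).
  { rewrite <- RectInt_scal; try lra.
    - apply RectInt_ext; try lra. intros w hw. assert (w0 := square_nonzero w hw).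
      assert (wz := Csub_neq_0 _ _ (in_open_rect_not_bd _ _ _ _ _ _ hin hw)).
      replace (S (2 * n - 1)) with (2 * n)%nat by lia. replace (w - 0)%C with w by ring.
      unfold amplitude, f. assert (q2 := Cpow_nz w (2 * n) w0). simpl (_ ^ 1)%C. field. repeat split; assumption.
    - intros w hw. apply ex_derive_continuous_C, ex_derive_mult_C.
      + apply (ex_derive_amplitude F phi sg lam c n hent good), square_nonzero, hw.
      + apply ex_derive_kernel, (in_open_rect_not_bd _ _ _ _ _ _ hin hw). }
  rewrite eR in e. set (J := RectInt _ _ _ _ _) in *.
  replace (S (2 * n - 1)) with (2 * n)%nat in e by lia. replace (z - 0)%C with z in e by ring.
  assert (ec : chi z = 1%C) by (unfold chi; destruct (Rlt_dec (Rabs (Re z)) 1); [reflexivity | lra]).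
  assert (n1 := Ci_neq_0). assert (n2 := PIC_neq_0). assert (n3 := Cpow_nz z (2 * n) z0).
  rewrite ec. change (F (lam * z)%C) with (f z).
  replace (f z * 1 - taylor_at f 0 (2 * n - 1) z)%C with (z ^ (2 * n) * (F lam * J) / (2 * PI * Ci))%C.
  - f_equal. field. repeat split; assumption.
  - rewrite <- e. field. split; assumption.
Qed.

Let ex_derive_H0 (z : C) : z <> 1%C -> z <> (- (1))%C -> ex_derive (H0 phi) z.
Proof.
  intros h1 h2. unfold H0. apply ex_derive_mult_C; [apply ex_derive_const_C|]. apply ex_derive_div_C.
  - replace (1 - z ^ 2)%C with ((1 - z) * (z - - (1)))%C by (simpl; ring).
    apply Cmult_neq_0; apply Csub_neq_0; [intros e; now apply h1 | exact h2].
  - apply ex_derive_const_C.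
  - apply ex_derive_minus_C; [apply ex_derive_const_C | apply ex_derive_pow_C, ex_derive_id_C].
Qed.

Let ex_derive_q : ex_derive q (RtoC 0).
Proof.
  unfold q. apply ex_derive_minus_C.
  - apply ex_derive_mult_C; [apply ex_derive_const_C|].
    apply ex_derive_div_C; [apply two_pi_i_neq_0 | | apply ex_derive_const_C].
    eexists. apply is_derive_RectInt_kernel; [split; simpl; lra|].
    intros s hs. apply ex_derive_continuous_C, (ex_derive_amplitude F phi sg lam c n hent good), square_nonzero, hs.
  - apply ex_derive_H0; intros e; apply (f_equal Re) in e; revert e; reim; lra.
Qed.

(** Each branch is its formula solved for the error, reflected near - 1. The value at 0, where the
    outer expression divides by 0, is the analytic continuation [q 0]. *)
Definition error_term (z : C) : C :=
  if excluded_middle_informative (B1 z) then inner_error F sg lam n z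
  else if excluded_middle_informative (B1 (- z)) then inner_error F sg lam n (- z)
  else if excluded_middle_informative (z = 0%C) then q 0%C else outer z.

Let E_in (z : C) : B1 z -> error_term z = inner_error F sg lam n z.
Proof. intros h. unfold error_term. destruct (excluded_middle_informative (B1 z)); [reflexivity | contradiction]. Qed.

Let B1_disjoint (z : C) : B1 (- z) -> ~ B1 z.
Proof.
  intros h1 h2. assert (a := local_B_Re sg delta S2 hd16 _ h1). assert (b := local_B_Re sg delta S2 hd16 _ h2).
  rewrite Re_opp in a. lra.
Qed.

Let E_in_opp (z : C) : B1 (- z) -> error_term z = inner_error F sg lam n (- z).
Proof.
  intros h. unfold error_term. destruct (excluded_middle_informative (B1 z)) as [k|_]; [destruct (B1_disjoint z h k)|].
  destruct (excluded_middle_informative (B1 (- z))); [reflexivity | contradiction].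
Qed.

Let E_out (z : C) : ~ B z -> z <> 0%C -> error_term z = outer z.
Proof.
  intros h z0. unfold error_term. destruct (excluded_middle_informative (B1 z)) as [k|_]; [destruct h; now left|].
  destruct (excluded_middle_informative (B1 (- z))) as [k|_]; [destruct h; now right|].
  destruct (excluded_middle_informative (z = 0%C)); [contradiction | reflexivity].
Qed.

Let small_not_B (z : C) : Cmod z < 1 / 2 -> ~ B z.
Proof.
  intros h. destruct (small z h) as [a _]. apply Rabs_lt_between in a.
  intros [k|k]; apply (local_B_Re sg delta S2 hd16) in k; rewrite ?Re_opp in k; lra.
Qed.

Let E_small (z : C) : Cmod z < 1 / 2 -> error_term z = q z.
Proof.
  intros h. destruct (classic (z = 0%C)) as [->|z0].
  - unfold error_term. assert (k := small_not_B 0%C h).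
    destruct (excluded_middle_informative (B1 0)) as [k1|_]; [destruct k; now left|].
    destruct (excluded_middle_informative (B1 (- 0))) as [k1|_]; [destruct k; now right|].
    destruct (excluded_middle_informative (RtoC 0 = 0%C)) as [_|k1]; [reflexivity | now destruct k1].
  - rewrite E_out; auto.
Qed.

Let outside_dist (z : C) : ~ B z -> delta / 2 <= Cmod (z - 1) /\ delta / 2 <= Cmod (z + 1).
Proof.
  intros h. split; apply Rnot_lt_le; intros k; apply h.
  - left. now apply (local_B_contains sg delta S2 hd16).
  - right. apply (local_B_contains sg delta S2 hd16).
    replace (- z - 1)%C with (- (z + 1))%C by ring. now rewrite Cmod_opp.
Qed.

Lemma error_outside (z : C) : ~ B z -> Cmod (error_term z) <= Bo / INR n.
Proof.
  assert (nz : forall z, ~ B z -> z <> 0%C -> Cmod (error_term z) <= Bo / INR n).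
  { intros s hs s0. rewrite E_out by trivial. destruct (outside_dist s hs) as [d1 d2].
    destruct (out s d1 d2) as (Q & e & b). unfold outer. fold (T s) in e. rewrite e, H0_near_sigma.
    assert (n3 := Cpow_nz s (2 * n) s0).
    replace (sqrt (INR n) * (s ^ (2 * n) * F lam * Q) / (s ^ (2 * n) * F lam))%C with (sqrt (INR n) * Q)%C
      by (field; split; assumption). exact b. }
  intros hz. destruct (classic (z = 0%C)) as [->|z0]; [|now apply nz].
  assert (s0 : forall s, Cmod (s - 0) < 1 / 2 -> Cmod s < 1 / 2) by (intros s; now replace (s - 0)%C with s by ring).
  rewrite E_small by (rewrite Cmod_0; lra).
  apply (Cmod_le_continuous q 0%C (1 / 2)); [lra | apply ex_derive_continuous_C, ex_derive_q|].
  intros s hs hne. apply s0 in hs. rewrite <- E_small by exact hs. apply nz; auto.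
Qed.

Lemma error_inside (z : C) : B z -> Cmod (error_term z) <= Bi.
Proof.
  intros [h|h].
  - rewrite E_in by exact h. now apply ins.
  - rewrite E_in_opp by exact h. now apply ins.
Qed.

Lemma formula_outside (z : C) : ~ B z ->
  T z = (F (lam * z) * chi z - F_exp_phase F n lam z / sqrt (INR n) * (H0 phi z + error_term z))%C.
Proof.
  intros hz. unfold F_exp_phase. destruct (classic (z = 0%C)) as [->|z0].
  - destruct (outside_dist _ hz) as [d1 d2]. destruct (out 0%C d1 d2) as (Q & e & _). fold (T 0) in e.
    assert (hn : (1 <= n)%nat) by apply good.
    (* At 0 the Taylor remainder and the correction both carry the factor 0^(2n), which vanishes
       because n >= 1. *)
    assert (p0 : (0 ^ (2 * n))%C = 0%C) by (replace (2 * n)%nat with (S (2 * n - 1)) by lia; rewrite Cpow_S; ring).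
    rewrite p0 in *. transitivity (F (lam * 0) * chi 0 - (F (lam * 0) * chi 0 - T 0))%C; [ring|].
    rewrite e. unfold Cdiv. ring.
  - rewrite E_out by trivial. unfold outer. assert (n3 := Cpow_nz z (2 * n) z0). field. repeat split; assumption.
Qed.

Let formula_B1 (z : C) : B1 z ->
  T z = (F (lam * z) * (1 / 2 * Cerfc (Ci * sqrt (INR n) * local_w0 sg z))
         - F_exp_phase F n lam z / sqrt (INR n) * inner_error F sg lam n z)%C.
Proof.
  intros h. unfold F_exp_phase, inner_error, amplitude. fold (T z). assert (a := local_B_Re sg delta S2 hd16 _ h).
  assert (z0 : z <> 0%C) by (intros e; rewrite e, Re_RtoC in a; lra).
  assert (n3 := Cpow_nz z (2 * n) z0). set (x := Cerfc _). field. repeat split; assumption.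
Qed.

Let w_opp (z : C) : B1 (- z) -> local_w sg z = local_w0 sg (- z).
Proof.
  intros h. assert (a := local_B_Re sg delta S2 hd16 _ h). rewrite Re_opp in a.
  unfold local_w. destruct (Rlt_dec (Re z) 0); [reflexivity | lra].
Qed.

Let w_in (z : C) : B1 z -> local_w sg z = local_w0 sg z.
Proof. intros h. apply local_w_right. assert (a := local_B_Re sg delta S2 hd16 _ h). lra. Qed.

Lemma formula_inside (z : C) : B z ->
  T z = (F (lam * z) * (1 / 2 * Cerfc (Ci * sqrt (INR n) * local_w sg z))
         - F_exp_phase F n lam z / sqrt (INR n) * error_term z)%C.
Proof.
  intros [h|h].
  - rewrite w_in, E_in by exact h. now apply formula_B1.
  - rewrite w_opp, E_in_opp by exact h. assert (e := formula_B1 (- z)%C h).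
    unfold F_exp_phase in *. rewrite T_even, pow_even in e. replace (lam * - z)%C with (- (lam * z))%C in e by ring.
    now rewrite hev in e.
Qed.

Lemma error_expansion_inside (z : C) : B z -> z <> 1%C -> z <> (- (1))%C ->
  Cmod (error_term z - (H0 phi z + 1 / (2 * Ci * sqrt PI * local_w sg z))) <= Bi / INR n.
Proof.
  intros [h|h] z1 z2.
  - rewrite w_in, E_in, H0_near_sigma by exact h. now apply ins.
  - rewrite w_opp, E_in_opp, <- H0_even, H0_near_sigma by exact h. apply ins; [exact h|].
    intros e. apply z2. rewrite <- e. ring.
Qed.

(** Away from the excluded curves [z] has a neighbourhood on which a single branch of [error_term]
    is in force; outside the discs [chi] is moreover constant there, and 0 is covered by [q]. *)
Lemma error_holomorphic (z : C) : ~ (frontier S1 z /\ ~ B z \/ frontier B z) -> ex_derive error_term z.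
Proof.
  intros hz.
  assert (map := local_w_is_local_map F phi sg lam c delta hright).
  destruct good as (_ & _ & _ & _ & g1 & g2 & g3 & g4 & g5 & g6).
  specialize (map g1 g2 g3 g4 g5 g6 hphi2 hd16). destruct map as (hopen & hB1 & _).
  assert (hop : forall u, B1 u -> exists d, 0 < d /\ forall s, Cmod (s - u) < d -> B1 s).
  { intros u hu. apply locally_C. now apply hopen. }
  destruct (classic (B z)) as [[h|h]|h].
  - destruct (hop z h) as (d & hd & k).
    apply (ex_derive_locally_ext (inner_error F sg lam n) _ z d hd).
    + intros s hs. symmetry. apply E_in, k, hs.
    + apply (ex_derive_inner_error F phi sg lam c n z hent good), h.
  - destruct (hop _ h) as (d & hd & k).
    apply (ex_derive_locally_ext (fun s => inner_error F sg lam n (- s)) _ z d hd).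
    + intros s hs. symmetry. apply E_in_opp, k. replace (- s - - z)%C with (- (s - z))%C by ring. now rewrite Cmod_opp.
    + apply (ex_derive_comp_C (inner_error F sg lam n) Copp).
      * apply (ex_derive_inner_error F phi sg lam c n _ hent good), h.
      * apply (ex_derive_opp_C (fun s => s)), ex_derive_id_C.
  - destruct (frontier_outside B z h ltac:(tauto)) as (d1 & hd1 & k1).
    destruct (chi_locally_constant z ltac:(tauto)) as (d2 & hd2 & k2).
    destruct (classic (z = 0%C)) as [->|z0].
    + apply (ex_derive_locally_ext q _ 0%C (1 / 2)); [lra | | exact ex_derive_q].
      intros s hs. replace (s - 0)%C with s in hs by ring. symmetry. now apply E_small.
    + assert (hm : 0 < Cmod z) by now apply Cmod_gt_0.
      set (d := Rmin (Rmin d1 d2) (Cmod z)).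
      assert (hd : 0 < d) by (repeat apply Rmin_pos; assumption).
      assert (l1 : d <= d1) by (eapply Rle_trans; [apply Rmin_l | apply Rmin_l]).
      assert (l2 : d <= d2) by (eapply Rle_trans; [apply Rmin_l | apply Rmin_r]).
      assert (l3 : d <= Cmod z) by apply Rmin_r.
      apply (ex_derive_locally_ext (fun s => sqrt (INR n) * (F (lam * s) * chi z - T s) / (s ^ (2 * n) * F lam) - H0 phi s)%C
        _ z d hd).
      * intros s hs. rewrite E_out.
        -- unfold outer. now rewrite (k2 s ltac:(lra)).
        -- apply k1. lra.
        -- intros e. rewrite e in hs. replace (0 - z)%C with (- z)%C in hs by ring. rewrite Cmod_opp in hs. lra.
      * assert (lin : ex_derive (fun s => lam * s)%C z).
        { apply ex_derive_mult_C; [apply ex_derive_const_C | apply ex_derive_id_C]. }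
        apply ex_derive_minus_C.
        -- apply ex_derive_div_C.
           ++ apply Cmult_neq_0; [now apply Cpow_nz | exact Fl].
           ++ apply ex_derive_mult_C; [apply ex_derive_const_C|]. apply ex_derive_minus_C.
              ** apply ex_derive_mult_C; [|apply ex_derive_const_C].
                 apply (ex_derive_comp_C F (fun s => lam * s)%C); [apply hent; exact I | exact lin].
              ** apply (ex_derive_comp_C (taylor_poly (2 * n - 1) F) (fun s => lam * s)%C);
                   [apply ex_derive_taylor_poly | exact lin].
           ++ apply ex_derive_mult_C; [apply ex_derive_pow_C, ex_derive_id_C | apply ex_derive_const_C].
        -- apply ex_derive_H0; intros e; apply h; rewrite e.
           ++ now left.
           ++ right. replace (- - (1))%C with (RtoC 1) by ring. exact hB1.
Qed.

Lemma local_map_near_sigma : is_local_map F lam phi delta (local_w sg) B1.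
Proof.
  destruct good as (_ & _ & _ & _ & g1 & g2 & g3 & g4 & g5 & g6).
  now apply (local_w_is_local_map F phi sg lam c delta hright).
Qed.
End Fixed.

Lemma choose_sequence {A : Type} {P : nat -> A -> Prop} : (forall n, exists x, P n x) ->
  exists f : nat -> A, forall n, P n (f n).
Proof.
  intros h. exists (fun n => proj1_sig (constructive_indefinite_description _ (h n))).
  intros n. apply proj2_sig.
Qed.

(** For a constant [F] the numerator F' vanishes and the scaling equation reads 2 = 0, whatever the
    value of the quotient's denominator. *)
Lemma scaling_not_constant (F : C -> C) (n : nat) (lam : R) : scaling_eq F n lam ->
  ~ exists c : C, forall z, F z = c.
Proof.
  intros hs [c h]. unfold scaling_eq in hs.
  assert (d : C_derive F lam = RtoC 0).
  { apply is_C_derive_unique. apply (is_derive_locally_ext (fun _ => c) F lam (RtoC 0) 1 Rlt_0_1).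
    - intros s _. now rewrite h.
    - apply is_derive_const_C. }
  rewrite d in hs. unfold Cdiv in hs. rewrite Cmult_0_l, Cmult_0_r in hs.
  apply (f_equal Re) in hs. revert hs. reim. lra.
Qed.

Local Open Scope C_scope.

Theorem theorem6p4
    (a : nat -> R) (L : C -> C) (N : R) (J K : nat) (mu eta : nat -> C)
    (Lam F : C -> C) (lam : nat -> R) (phi : nat -> C -> C)
    (hN : (0 < N)%R)
    (hL : dirichlet_series a L)
    (hA : entire L)
    (hB : completed N J K mu eta L Lam)
    (hFE : forall z : C, Lam z = Lam (1 - z))
    (hC : polynomially_bounded L)
    (hF : forall z : C, F z = Lam (1 / 2 + z))
    (hlam : exists n0 : nat, forall n : nat, (n0 <= n)%nat ->
       is_scaling F n (lam n))
    (hphi : exists n0 : nat, forall n : nat, (n0 <= n)%nat ->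
       is_phase F n (lam n) (phi n)) :
  exists delta0 : R, (0 < delta0)%R /\
  forall delta : R, (0 < delta < delta0)%R ->
  exists (n0 : nat) (M : R) (w : nat -> C -> C) (B1 : nat -> C -> Prop)
         (E : nat -> C -> C),
  forall n : nat, (n0 <= n)%nat ->
    let B := B_both (B1 n) in
    is_local_map F (lam n) (phi n) delta (w n) (B1 n) /\
    (forall z : C,
       taylor_poly (2 * n - 2) F (lam n * z)
       = taylor_poly (2 * n - 1) F (lam n * z)) /\
    (forall z : C, ~ B z ->
       taylor_poly (2 * n - 1) F (lam n * z)
       = F (lam n * z) * chi z
         - F_exp_phase F n (lam n) z / sqrt (INR n)
           * (H0 (phi n) z + E n z)) /\
    (forall z : C, B z ->
       taylor_poly (2 * n - 1) F (lam n * z)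
       = F (lam n * z) * (1 / 2 * Cerfc (Ci * sqrt (INR n) * w n z))
         - F_exp_phase F n (lam n) z / sqrt (INR n) * E n z) /\
    (forall z : C, (Cmod (E n z) <= M)%R) /\
    holomorphic_on
      (fun z => ~ ((frontier S1 z /\ ~ B z) \/ frontier B z)) (E n) /\
    (forall z : C, ~ B z -> (Cmod (E n z) <= M / INR n)%R) /\
    (* H0 and 1 / w have poles at 1 and -1 which cancel *)
    (forall z : C, B z -> z <> 1 -> z <> - 1 ->
       (Cmod (E n z
              - (H0 (phi n) z + 1 / (2 * Ci * sqrt PI * w n z)))
        <= M / INR n)%R).
Proof.
  assert (hr := rho_pos).
  assert (hnc : ~ exists c : C, forall z, F z = c).
  { destruct hlam as [n h]. destruct (h n (le_n n)) as [[_ hs] _]. exact (scaling_not_constant F n (lam n) hs). }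
  assert (hev := completed_even Lam F hFE hF). assert (hent := completed_entire L N J K mu eta Lam F hB hF).
  destruct (completed_log_derivative a L N J K mu eta Lam F hL hA hB hFE hC hF hnc)
    as (l & (X0 & K0 & hX0 & hK0 & hlog) & hslow & hpos).
  destruct (completed_strip_poly L N J K mu eta Lam F hB hFE hC hF X0) as (M & Y & k & hM & hY & hstrip).
  assert (gd : growth_data F X0 K0 M Y k).
  { repeat split; trivial. intros z hz. now apply hlog. }
  (* The tolerance rho / 128 for phi' is the one required by [phase_sqrt]. *)
  destruct (phase_local F l lam phi X0 hent hX0 (fun z hz => conj (proj1 (hlog z hz)) (proj1 (proj2 (hlog z hz))))
    hslow hpos hlam hphi (rho / 128)%R ltac:(lra)) as (n1 & hn1).
  (* Adding [k] ensures k < 2 n, so that z^(2n) outgrows the polynomial bound for [F] in the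
     strip. *)
  set (n0 := (n1 + k + 1)%nat).
  assert (sig : forall n, (n0 <= n)%nat -> exists (sg : C -> C) (c : R),
    near_sigma F (phi n) sg (lam n) c n /\ phi2 (phi n) = RtoC (- (2 * c ^ 2))%R).
  { intros n hn. destruct (hn1 n ltac:(unfold n0 in hn; lia)) as (p1 & p2 & p3 & p4 & p5 & p6 & p7 & p8 & p9).
    destruct (phase_sqrt (phi n) p6 p4 p5 p7 p8) as (sg & c & s1 & s2 & s3 & s4 & s5 & s6 & s7).
    exists sg, c. split; [|exact s7]. repeat split; trivial; try lra.
    intros z hz. destruct (p3 z hz) as (_ & r & hrz & hz2). now apply hz2. }
  (* The square of half-side 4 delta lies within 8 delta of 1 and has to stay in the disc of radius
     rho / 8 where the regular function is analytic. *)
  exists (rho / 64)%R. split; [lra|]. intros delta hdelta.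
  destruct (outside_bound (delta / 2)%R K0 ltac:(lra) hK0) as (Bo & hBo & out).
  destruct (inside_bound delta K0 hdelta hK0) as (Bi & hBi & ins).
  exists n0, (Bo + Bi)%R.
  (* The local root and the error depend on [n] and are picked by choice as a pair; an arbitrary
     pair serves for n < n0, where nothing is claimed. *)
  assert (per_n : forall n, exists p : (C -> C) * (C -> C), (n0 <= n)%nat ->
    let B1 := local_B (fst p) delta in let B := B_both B1 in let w := local_w (fst p) in let E := snd p in
    is_local_map F (lam n) (phi n) delta w B1 /\
    (forall z : C, ~ B z -> taylor_poly (2 * n - 1) F (lam n * z)
       = F (lam n * z) * chi z - F_exp_phase F n (lam n) z / sqrt (INR n) * (H0 (phi n) z + E z)) /\
    (forall z : C, B z -> taylor_poly (2 * n - 1) F (lam n * z)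
       = F (lam n * z) * (1 / 2 * Cerfc (Ci * sqrt (INR n) * w z)) - F_exp_phase F n (lam n) z / sqrt (INR n) * E z) /\
    (forall z : C, ~ B z -> (Cmod (E z) <= Bo / INR n)%R) /\
    (forall z : C, B z -> (Cmod (E z) <= Bi)%R) /\
    holomorphic_on (fun z => ~ ((frontier S1 z /\ ~ B z) \/ frontier B z)) E /\
    (forall z : C, B z -> z <> 1 -> z <> - (1) ->
       (Cmod (E z - (H0 (phi n) z + 1 / (2 * Ci * sqrt PI * w z))) <= Bi / INR n)%R)).
  { intros n. destruct (le_lt_dec n0 n) as [hn|hn].
    2: { exists (fun z => z, fun z => z). intros hn'. lia. }
    destruct (sig n hn) as (sg & c & good & h2).
    destruct (hn1 n ltac:(unfold n0 in hn; lia)) as (p1 & p2 & p3 & _).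
    assert (hk : (k < 2 * n)%nat) by (unfold n0 in hn; lia).
    specialize (out F (phi n) sg (lam n) c X0 M Y n k gd p2 hk good).
    specialize (ins F (phi n) sg (lam n) c X0 M Y n k gd p2 hk good).
    exists (sg, error_term F (phi n) sg (lam n) delta n). intros _. simpl fst. simpl snd.
    split; [|split; [|split; [|split; [|split; [|split]]]]].
    - eapply local_map_near_sigma with (c := c); eassumption.
    - intros z hz. eapply formula_outside with (c := c); eassumption.
    - intros z hz. eapply formula_inside with (c := c); eassumption.
    - intros z hz. eapply error_outside with (c := c); eassumption.
    - intros z hz. eapply error_inside with (c := c); eassumption.
    - intros z hz. eapply error_holomorphic with (c := c); eassumption.
    - intros z hz. eapply error_expansion_inside with (c := c); eassumption. }
  destruct (choose_sequence per_n) as [p hp].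
  exists (fun n => local_w (fst (p n))), (fun n => local_B (fst (p n)) delta), (fun n => snd (p n)).
  intros n hn B. destruct (hp n hn) as (q1 & q2 & q3 & q4 & q5 & q6 & q7).
  destruct (hn1 n ltac:(unfold n0 in hn; lia)) as (p1 & _).
  assert (hN1 : (1 <= INR n)%R) by (change 1%R with (INR 1); now apply le_INR).
  assert (hi : (0 < / INR n <= 1)%R).
  { split; [apply Rinv_0_lt_compat; lra|]. rewrite <- Rinv_1. apply Rinv_le_contravar; lra. }
  split; [exact q1|]. split; [|split; [exact q2|]; split; [exact q3|]; split; [|split; [exact q6|]; split]].
  - intros z. now apply taylor_poly_drop_odd.
  - intros z. destruct (classic (B z)) as [hz|hz].
    + specialize (q5 z hz). lra.
    + specialize (q4 z hz). unfold Rdiv in q4. nra.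
  - intros z hz. specialize (q4 z hz). unfold Rdiv in *. nra.
  - intros z hz z1 z2. eapply Rle_trans; [apply q7; trivial|].
    + intros e. apply z2. rewrite e. apply C_ext; reim; ring.
    + unfold Rdiv. nra.
Qed.
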